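(* Let $q$ be a power of a prime, $G=\mathrm{U}(3)_{\mathbb{F}_q}$ with signature $(r,s)=(2,1)$ and $\mu,T,B$ as in the context, and $(S,\zeta)$ satisfying conditions (a), (b), (c) of the context. Let $\lambda=(a_1,a_2,a_3)\in\mathbb{Z}^3$ with $a_1-a_3>0$ and $f\in H^0(\mathrm{Flag}(S),\mathcal{V}_{\mathrm{flag}}(\lambda))$. Then $f$ is divisible by the partial Hasse invariant $\mathrm{Ha}_{\alpha_1}$, $\alpha_1=e_1-e_2$.
   Context: Notation: $k=\overline{\mathbb{F}}_q$, $\sigma$ the $q$-power Frobenius. For a connected reductive group $G$ over $\mathbb{F}_q$ and a cocharacter $\mu\colon\mathbb{G}_{m,k}\to G_k$: let $P=P_-(\mu)$ (resp. $P_+(\mu)$) be the parabolic subgroup of $G_k$ consisting of $g$ such that $t\mapsto\mu(t)^{-1}g\mu(t)$ (resp. $t\mapsto\mu(t)g\mu(t)^{-1}$) extends to a morphism $\mathbb{A}^1_k\to G_k$; $L$ the centralizer of $\mu$; $Q=(P_+(\mu))^{(q)}$, $M=L^{(q)}$, $\varphi\colon L\to M$ the $q$-Frobenius. The zip group is $E=\{(x,y)\in P\times Q:\varphi(\bar x)=\bar y\}$ ($\bar x$, $\bar y$ the Levi components), acting on $G_k$ by $(x,y)\cdot g=xgy^{-1}$; $G\text{-}\mathtt{Zip}^\mu:=[E\backslash G_k]$. Fix a Borel pair $(B,T)$ over $\mathbb{F}_q$ with $B\subset P$; positive roots are those with root groups in the opposite Borel $B^+$; $\Delta$ the simple roots,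 $I$ the simple roots of $L$, $W$ the Weyl group, $s_\alpha$ reflections, $w_0$ the longest element, $w_{0,I}$ the longest element of $W_I$, $\le$ the Bruhat order, $z=\sigma(w_{0,I})w_0$. For $\lambda\in X^*(T)$, $V_I(\lambda)=\mathrm{Ind}_B^P(\lambda)$ and $\mathcal{V}_I(\lambda)$ its vector bundle on $G\text{-}\mathtt{Zip}^\mu$. The zip flag stack $G\text{-}\mathtt{ZipFlag}^\mu=[E'\backslash G_k]$, $E'=E\cap(B\times G_k)$, carries the line bundle $\mathcal{V}_{\mathrm{flag}}(\lambda)$ attached to the character $(x,y)\mapsto\lambda(x)$ of $E'$; its pushforward to $G\text{-}\mathtt{Zip}^\mu$ is $\mathcal{V}_I(\lambda)$. Flag strata: $\mathcal{F}_w=[E'\backslash BwBz^{-1}]$, with closure $\bigcup_{w'\le w}\mathcal{F}_{w'}$. For $\alpha\in\Delta$, a partial Hasse invariant $\mathrm{Ha}_\alpha$ is a global section over $G\text{-}\mathtt{ZipFlag}^\mu$ of some $\mathcal{V}_{\mathrm{flag}}(\lambda_\alpha)$ whose divisor is exactly $\overline{\mathcal{F}}_{w_0s_\alpha}$ with multiplicity one (such sections exist). Condition on $(S,\zeta)$, $\zeta\colon S\to G\text{-}\mathtt{Zip}^\mu$ a morphism from a $k$-scheme: (a) $\zeta$ smooth; (b) $\zeta$ surjective on each connected component; (c) for each $w$ of length 1, $\overline{\mathrm{Flag}(S)}_w$ is pseudo-complete, where $\mathrm{Flag}(S)=S\times_{G\text{-}\mathtt{Zip}^\mu}G\text{-}\mathtt{ZipFlag}^\mu$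 with projection $\zeta_{\mathrm{flag}}$, $\mathrm{Flag}(S)_w=\zeta_{\mathrm{flag}}^{-1}(\mathcal{F}_w)$ (reduced). Line bundles and $\mathrm{Ha}_\alpha$ on $\mathrm{Flag}(S)$ denote pullbacks via $\zeta_{\mathrm{flag}}$. Specifics: $V$ is a 3-dimensional $\mathbb{F}_{q^2}$-space with hermitian form of matrix the antidiagonal matrix $J$ of ones, $G=\mathrm{U}(V,\psi)$, $G_k\simeq\mathrm{GL}_{3,k}$ with Frobenius $A\mapsto J\sigma({}^tA)^{-1}J$; $T$ diagonal, $B$ lower-triangular, $X^*(T)=\mathbb{Z}^3$, $e_i$ standard basis, $\mu(x)=\mathrm{diag}(x,x,1)$. The weight of $\mathrm{Ha}_{\alpha_1}$ is $(q+1,1,q)$. *)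

(* Defs.v *)
From HB Require Import structures.
From mathcomp Require Import all_boot all_order all_algebra.
From mathcomp Require Import mpoly.

Set Implicit Arguments.
Unset Strict Implicit.
Unset Printing Implicit Defensive.

Import GRing.Theory.
Local Open Scope ring_scope.

(* Schemes over k are their functors of points on k-algebras (as in Demazure
   and Gabriel).  An algebra is a [comUnitAlgType k]: the unit structure is no
   extra datum, since it is determined by the ring.  MathComp rings are nonzero;
   omitting the zero algebra loses nothing, as a sheaf has exactly one point
   there.

   The points of the topological space |X| are represented by the K-points of X
   for all extension fields K of k.  Two such points that agree over a common
   extension lie in the same open sets, so the repetitions are harmless. *)

Section FunctorOfPoints.

Variable k : fieldType.
Notation alg := (comUnitAlgType k).

Record kfunctor := KFunctor {
  points :> alg -> Type;
  pull : forall A B : alg, {lrmorphism A -> B} -> points A -> points B;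
  pull_id : forall (A : alg) (h : {lrmorphism A -> A}) (x : points A),
    h =1 id -> pull h x = x;
  pull_comp : forall (A B C : alg) (f : {lrmorphism A -> B})
      (g : {lrmorphism B -> C}) (h : {lrmorphism A -> C}) (x : points A),
    h =1 g \o f -> pull h x = pull g (pull f x) }.

Record kmorphism (X Y : kfunctor) := KMorphism {
  kfun :> forall A : alg, X A -> Y A;
  kfun_nat : forall (A B : alg) (f : {lrmorphism A -> B}) (x : X A),
    kfun (pull f x) = pull f (kfun x) }.

Definition is_field (A : alg) : Prop := GRing.field_axiom A.

(* Used both for subfunctors and, when only its values on fields matter, for
   subsets of |X|. *)
Definition subset_of (X : kfunctor) := forall A : alg, X A -> Prop.

Definition unit_ideal (A : alg) (D : A -> Prop) : Prop :=
  exists n (c d : 'I_n -> A), (forall i, D (d i)) /\ \sum_i c i * d i = 1.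

Definition open_sub (X : kfunctor) (U : subset_of X) : Prop :=
  forall (A : alg) (x : X A), exists D : A -> Prop,
  forall (B : alg) (f : {lrmorphism A -> B}),
    U B (pull f x) <-> unit_ideal (fun b => exists2 a, D a & b = f a).

Definition closed_sub (X : kfunctor) (Z : subset_of X) : Prop :=
  forall (A : alg) (x : X A), exists D : A -> Prop,
  forall (B : alg) (f : {lrmorphism A -> B}),
    Z B (pull f x) <-> (forall a, D a -> f a = 0).

Definition represented_by (X : kfunctor) (U : subset_of X) (R : alg) (r : X R)
    : Prop :=
  U R r /\ forall (A : alg) (x : X A), U A x ->
    (exists f : {lrmorphism R -> A}, pull f r = x) /\
    (forall f g : {lrmorphism R -> A}, pull f r = x -> pull g r = x -> f =1 g).

Definition affine_open (X : kfunctor) (U : subset_of X) (R : alg) (r : X R)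
    : Prop :=
  open_sub U /\ represented_by U r.

Definition is_localization (A B : alg) (f : {lrmorphism A -> B}) (a : A)
    : Prop :=
  [/\ f a \is a GRing.unit,
      forall b, exists n c, b * f a ^+ n = f c
    & forall c, f c = 0 -> exists n, a ^+ n * c = 0].

(* The compatibility condition ranges over all C under B i and B j, which
   amounts to compatibility over their tensor product over A. *)
Definition zariski_sheaf (X : kfunctor) : Prop :=
  forall (A : alg) n (a : 'I_n -> A) (B : 'I_n -> alg)
    (f : forall i, {lrmorphism A -> B i}) (x : forall i, X (B i)),
    (exists c : 'I_n -> A, \sum_i c i * a i = 1) ->
    (forall i, is_localization (f i) (a i)) ->
    (forall i j (C : alg) (g : {lrmorphism B i -> C}) (h : {lrmorphism B j -> C}),
       g \o f i =1 h \o f j -> pull g (x i) = pull h (x j)) ->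
  exists! y : X A, forall i, pull (f i) y = x i.

Definition is_scheme (X : kfunctor) : Prop :=
  zariski_sheaf X /\
  forall (K : alg) (x : X K), is_field K ->
    exists (U : subset_of X) (R : alg) (r : X R), affine_open U r /\ U K x.

Definition finitely_presented (A B : alg) (f : {lrmorphism A -> B}) : Prop :=
  exists n (b : 'I_n -> B) m (r : 'I_m -> {mpoly A[n]}),
    (forall y, exists p, mmap f b p = y) /\
    (forall p, mmap f b p = 0 <->
       exists c : 'I_m -> {mpoly A[n]}, p = \sum_i c i * r i).

Definition locally_finitely_presented (X Y : kfunctor) (u : kmorphism X Y)
    : Prop :=
  forall (K : alg) (x : X K), is_field K ->
  exists (U : subset_of X) (R : alg) (r : X R)
         (V : subset_of Y) (T : alg) (t : Y T),
    [/\ affine_open U r, affine_open V t, U K x,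
        forall (A : alg) (y : X A), U A y -> V A (u A y)
      & exists2 f : {lrmorphism T -> R}, pull f t = u R r & finitely_presented f].

Definition square_zero_thickening (C D : alg) (h : {lrmorphism C -> D}) : Prop :=
  (forall d, exists c, h c = d) /\
  (forall c c', h c = 0 -> h c' = 0 -> c * c' = 0).

Definition formally_smooth (X Y : kfunctor) (u : kmorphism X Y) : Prop :=
  forall (C D : alg) (h : {lrmorphism C -> D}) (x : X D) (y : Y C),
    square_zero_thickening h -> u D x = pull h y ->
  exists2 x' : X C, u C x' = y & pull h x' = x.

Definition smooth (X Y : kfunctor) (u : kmorphism X Y) : Prop :=
  formally_smooth u /\ locally_finitely_presented u.

Definition formally_etale_alg (A B : alg) (f : {lrmorphism A -> B}) : Prop :=
  forall (C D : alg) (h : {lrmorphism C -> D})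
    (a : {lrmorphism A -> C}) (b : {lrmorphism B -> D}),
    square_zero_thickening h -> h \o a =1 b \o f ->
  (exists g : {lrmorphism B -> C}, g \o f =1 a /\ h \o g =1 b) /\
  (forall g g' : {lrmorphism B -> C},
     g \o f =1 a -> h \o g =1 b -> g' \o f =1 a -> h \o g' =1 b -> g =1 g').

Definition etale_cover (A B : alg) (f : {lrmorphism A -> B}) : Prop :=
  [/\ finitely_presented f, formally_etale_alg f
    & forall (K : alg) (x : {lrmorphism A -> K}), is_field K ->
        exists (L : alg) (i : {lrmorphism K -> L}) (y : {lrmorphism B -> L}),
          is_field L /\ y \o f =1 i \o x].

Definition closure_of (X : kfunctor) (C : subset_of X) : subset_of X :=
  fun K x => forall U : subset_of X, open_sub U -> U K x ->
    exists (L : alg) (y : X L), [/\ is_field L, U L y & C L y].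

Definition connected_set (X : kfunctor) (C : subset_of X) : Prop :=
  forall U V : subset_of X, open_sub U -> open_sub V ->
    (forall (K : alg) (x : X K), is_field K -> C K x -> U K x \/ V K x) ->
    (exists (K : alg) (x : X K), [/\ is_field K, C K x & U K x]) ->
    (exists (K : alg) (x : X K), [/\ is_field K, C K x & V K x]) ->
  exists (K : alg) (x : X K), [/\ is_field K, C K x, U K x & V K x].

Definition connected_component (X : kfunctor) (K : alg) (x : X K) : subset_of X :=
  fun L y => exists C : subset_of X, [/\ connected_set C, C K x & C L y].

(* The smallest closed subscheme containing the points of C; for C closed it is
   C with its reduced structure. *)
Definition reduced_sub (X : kfunctor) (C : subset_of X) : subset_of X :=
  fun A x => forall Z : subset_of X, closed_sub Z ->
    (forall (K : alg) (y : X K), is_field K -> C K y -> Z K y) -> Z A x.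

(* Only the values of h on Z matter. *)
Definition function_on (X : kfunctor) (Z : subset_of X)
    (h : forall A : alg, X A -> A) : Prop :=
  forall (A B : alg) (f : {lrmorphism A -> B}) (x : X A),
    Z A x -> h B (pull f x) = f (h A x).

(* Every global function on Z is Zariski-locally equal to a constant of k. *)
Definition pseudo_complete (X : kfunctor) (Z : subset_of X) : Prop :=
  forall h : forall A : alg, X A -> A, function_on Z h ->
  forall (K : alg) (x : X K), is_field K -> Z K x ->
  exists (U : subset_of X) (c : k), [/\ open_sub U, U K x &
    forall (A : alg) (y : X A), Z A y -> U A y -> h A y = c%:A].

End FunctorOfPoints.

Section UnitaryZip.

Variables (k : fieldType) (q : nat).
Notation alg := (comUnitAlgType k).

Section MatrixGroups.

Variable A : comUnitRingType.
Implicit Types x y g : 'M[A]_3.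

Definition J3 : 'M[A]_3 := \matrix_(i, j) (j == rev_ord i)%:R.

Definition frobG g : 'M[A]_3 := J3 *m invmx (map_mx (fun a => a ^+ q) g)^T *m J3.

(* Cocharacters t |-> diag (t ^ m 0, t ^ m 1, t ^ m 2) are given by their
   exponents m; the (i, j) entry of m(t)^-1 g m(t) is t ^ (m j - m i) * g i j. *)
Definition Pminus (m : 'I_3 -> int) g : Prop :=
  g \in unitmx /\ forall i j, m j < m i -> g i j = 0.
Definition Pplus (m : 'I_3 -> int) g : Prop :=
  g \in unitmx /\ forall i j, m i < m j -> g i j = 0.
Definition levi (m : 'I_3 -> int) g : 'M[A]_3 :=
  \matrix_(i, j) (if m i == m j then g i j else 0).

Definition mu (i : 'I_3) : int := (i < 2)%N%:Z.

(* Frobenius twist of mu: J diag(t ^ m)^-1 J has exponents - m (rev_ord i).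
   Thus Pplus mu_sigma is the q-twist of Pplus mu. *)
Definition mu_sigma (i : 'I_3) : int := - mu (rev_ord i).

Definition zip_group x y : Prop :=
  [/\ Pminus mu x, Pplus mu_sigma y & frobG (levi mu x) = levi mu_sigma y].

Definition borel x : Prop := x \in unitmx /\ is_trig_mx x.

Definition zip_borel x y : Prop := zip_group x y /\ borel x.

Definition torus_char (lam : 'rV[int]_3) x : A := \prod_i x i i ^ lam 0 i.

Definition s_alpha1 : 'M[A]_3 := tperm_mx (inord 0) (inord 1).
Definition s_alpha2 : 'M[A]_3 := tperm_mx (inord 1) (inord 2).
Definition w_0 : 'M[A]_3 := J3.

(* The longest element of W_I is s_alpha1. *)
Definition z_twist : 'M[A]_3 := frobG s_alpha1 *m w_0.

Definition bruhat_cell (w g : 'M[A]_3) : Prop :=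
  exists b b' : 'M[A]_3, [/\ borel b, borel b' & g *m z_twist = b *m w *m b'].

End MatrixGroups.

Definition subgroup_pred := forall A : alg, 'M[A]_3 -> 'M[A]_3 -> Prop.
Definition zipE : subgroup_pred := fun A => @zip_group A.
Definition zipE' : subgroup_pred := fun A => @zip_borel A.

(* act is only meaningful on pairs in the zip group. *)
Record zip_space := ZipSpace {
  zspace :> kfunctor k;
  act : forall A : alg, 'M[A]_3 -> 'M[A]_3 -> zspace A -> zspace A;
  act_1 : forall (A : alg) (p : zspace A), act 1%:M 1%:M p = p;
  act_M : forall (A : alg) (x y x' y' : 'M[A]_3) (p : zspace A),
    zipE x y -> zipE x' y' -> act (x *m x') (y *m y') p = act x y (act x' y' p);
  act_pull : forall (A B : alg) (f : {lrmorphism A -> B}) (x y : 'M[A]_3)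
      (p : zspace A),
    zipE x y -> pull f (act x y p) = act (map_mx f x) (map_mx f y) (pull f p) }.

Definition is_torsor (H : subgroup_pred) (Y : zip_space) (X : kfunctor k)
    (pr : kmorphism Y X) : Prop :=
  [/\ forall (A : alg) (x y : 'M[A]_3) (p : Y A),
        H A x y -> pr A (act x y p) = pr A p,
      forall (A : alg) (p p' : Y A), pr A p = pr A p' ->
        exists! xy : 'M[A]_3 * 'M[A]_3,
          H A xy.1 xy.2 /\ p' = act xy.1 xy.2 p
    & forall (A : alg) (s : X A), exists (B : alg) (f : {lrmorphism A -> B}),
        etale_cover f /\ exists p : Y B, pr B p = pull f s].

Definition GL3 (A : comUnitRingType) := {g : 'M[A]_3 | g \in unitmx}.

Lemma map_unitmx_rmorph (A B : comUnitRingType) (f : {rmorphism A -> B})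
  (g : 'M[A]_3) : g \in unitmx -> map_mx f g \in unitmx.
Proof. by rewrite !unitmxE det_map_mx; apply: rmorph_unit. Qed.

Definition GL3_pull (A B : alg) (f : {lrmorphism A -> B}) (g : GL3 A) : GL3 B :=
  exist _ (map_mx f (val g)) (map_unitmx_rmorph f (valP g)).

Lemma GL3_pull_id (A : alg) (h : {lrmorphism A -> A}) (g : GL3 A) :
  h =1 id -> GL3_pull h g = g.
Proof. by move=> hE; apply/val_inj/matrixP => i j; rewrite !mxE hE. Qed.

Lemma GL3_pull_comp (A B C : alg) (f : {lrmorphism A -> B})
    (g : {lrmorphism B -> C}) (h : {lrmorphism A -> C}) (x : GL3 A) :
  h =1 g \o f -> GL3_pull h x = GL3_pull g (GL3_pull f x).
Proof. by move=> hE; apply/val_inj/matrixP => i j; rewrite !mxE hE. Qed.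

Definition GL3_functor : kfunctor k := KFunctor GL3_pull_id GL3_pull_comp.

Definition GL3_act (A : alg) (x y : 'M[A]_3) (g : GL3_functor A) : GL3_functor A :=
  insubd (g : GL3 A) (x *m val g *m invmx y).

Lemma val_GL3_act (A : alg) (x y : 'M[A]_3) (g : GL3 A) :
  x \in unitmx -> y \in unitmx -> val (GL3_act x y g) = x *m val g *m invmx y.
Proof.
move=> ux uy; rewrite /GL3_act insubdK // -topredE /=.
by rewrite !unitmx_mul ux unitmx_inv uy (valP g).
Qed.

Lemma zipE_unit (A : alg) (x y : 'M[A]_3) :
  zipE x y -> x \in unitmx /\ y \in unitmx.
Proof. by case=> [[ux _] [uy _] _]. Qed.

Lemma GL3_act_1 (A : alg) (g : GL3_functor A) : GL3_act 1%:M 1%:M g = g.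
Proof.
by apply: val_inj; rewrite val_GL3_act ?unitmx1 // mul1mx invmx1 mulmx1.
Qed.

Lemma GL3_act_M (A : alg) (x y x' y' : 'M[A]_3) (g : GL3_functor A) :
  zipE x y -> zipE x' y' ->
  GL3_act (x *m x') (y *m y') g = GL3_act x y (GL3_act x' y' g).
Proof.
move=> /zipE_unit[ux uy] /zipE_unit[ux' uy']; apply: val_inj.
rewrite !val_GL3_act ?unitmx_mul ?ux ?uy // !mulmxA.
have -> : invmx (y *m y') = invmx y' *m invmx y.
  apply: (can_inj (mulKmx (_ : y *m y' \in unitmx))).
    by rewrite unitmx_mul uy.
  by rewrite mulmxV ?unitmx_mul ?uy // mulmxA mulmxK // mulmxV.
by rewrite !mulmxA.
Qed.

Lemma GL3_act_pull (A B : alg) (f : {lrmorphism A -> B}) (x y : 'M[A]_3)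
    (g : GL3_functor A) :
  zipE x y ->
  pull f (GL3_act x y g) = GL3_act (map_mx f x) (map_mx f y) (pull f g).
Proof.
move=> /zipE_unit[ux uy]; apply: val_inj.
have fu := map_unitmx_rmorph f.
rewrite val_GL3_act ?fu //= val_GL3_act // !map_mxM; congr (_ *m _).
apply: (can_inj (mulKmx (fu _ uy))).
by rewrite -map_mxM !mulmxV ?fu // map_mx1.
Qed.

Definition GL3_space : zip_space := ZipSpace GL3_act_1 GL3_act_M GL3_act_pull.

Definition GL3_stratum (w : forall A : alg, 'M[A]_3) : subset_of GL3_space :=
  fun K g => bruhat_cell (w K) (val (g : GL3 K)).

(* A morphism from S to the quotient stack of GL_3 by the zip group: a torsor
   over S with an equivariant map to GL_3.  The torsor is S times GL_3 over the
   stack. *)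
Record stack_map (S : kfunctor k) := StackMap {
  tors : zip_space;
  tors_scheme : is_scheme tors;
  tors_proj : kmorphism tors S;
  tors_proj_torsor : is_torsor zipE tors_proj;
  tors_map : kmorphism tors GL3_space;
  tors_map_act : forall (A : alg) (x y : 'M[A]_3) (p : tors A),
    zipE x y -> tors_map A (act x y p) = act x y (tors_map A p) }.

(* Tested after base change along the atlas GL_3 of the stack. *)
Definition stack_map_smooth (S : kfunctor k) (zeta : stack_map S) : Prop :=
  smooth (tors_map zeta).

Definition stack_map_surjective_on_components (S : kfunctor k) (zeta : stack_map S)
    : Prop :=
  forall (K : alg) (s : S K), is_field K ->
  forall (L : alg) (g : GL3_space L), is_field L ->
  exists (L' : alg) (f : {lrmorphism L -> L'}) (p : tors zeta L'),
    [/\ is_field L', connected_component s (tors_proj zeta L' p)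
      & tors_map zeta L' p = pull f g].

(* Flag(S) is the fibre product of S with the stack quotient of GL_3 by the
   subgroup zipE', hence the quotient of the torsor over S by zipE'. *)
Record flag_space (S : kfunctor k) (zeta : stack_map S) := FlagSpace {
  flag : kfunctor k;
  flag_scheme : is_scheme flag;
  flag_proj : kmorphism (tors zeta) flag;
  flag_proj_torsor : is_torsor zipE' flag_proj }.

Definition flag_stratum (S : kfunctor k) (zeta : stack_map S)
    (X : flag_space zeta) (w : forall A : alg, 'M[A]_3) : subset_of (flag X) :=
  fun K x => exists (L : alg) (f : {lrmorphism K -> L}) (p : tors zeta L),
    [/\ is_field L, flag_proj X L p = pull f x
      & GL3_stratum w (tors_map zeta L p)].
Arguments flag_stratum {S zeta} X w.

Definition pseudo_complete_length1 (S : kfunctor k) (zeta : stack_map S)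
    (X : flag_space zeta) : Prop :=
  pseudo_complete (reduced_sub (closure_of (flag_stratum X (fun A => s_alpha1 A)))) /\
  pseudo_complete (reduced_sub (closure_of (flag_stratum X (fun A => s_alpha2 A)))).

(* Global sections, over the quotient of Y by zipE', of the line bundle attached
   to the character (x, y) |-> lam x. *)
Definition Vflag_section (lam : 'rV[int]_3) (Y : zip_space)
    (f : forall A : alg, Y A -> A) : Prop :=
  (forall (A B : alg) (h : {lrmorphism A -> B}) (p : Y A),
     f B (pull h p) = h (f A p)) /\
  (forall (A : alg) (x y : 'M[A]_3) (p : Y A),
     zipE' x y -> f A (act x y p) = torus_char lam x * f A p).

(* The divisor is read on the atlas GL_3: multiplicity one means that the zero
   scheme is the reduced closure of the stratum of w_0 s_alpha1. *)
Definition partial_hasse_alpha1 (lam : 'rV[int]_3)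
    (Ha : forall A : alg, GL3_space A -> A) : Prop :=
  Vflag_section lam Ha /\
  forall (A : alg) (g : GL3_space A), Ha A g = 0 <->
    reduced_sub (closure_of (GL3_stratum (fun K => w_0 K *m s_alpha1 K))) g.

Definition weight (a1 a2 a3 : int) : 'rV[int]_3 := \row_i [:: a1; a2; a3]`_i.

End UnitaryZip.

(* Main.v *)
Require Import Defs.
From HB Require Import structures.
From mathcomp Require Import all_boot all_order all_algebra.
From mathcomp Require Import mpoly ring_quotient zify ring.
From mathcomp Require Import boolp classical_sets.
From mathcomp Require Import fingroup perm pgroup abelian finfield finalg.

Set Implicit Arguments.
Unset Strict Implicit.
Unset Printing Implicit Defensive.

Import GRing.Theory.
Local Open Scope ring_scope.

(** Let Y be the E-torsor over S and u : Y -> GL3 the smooth equivariant map. Sections over Flag(S)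
    are E'-semi-invariant functions on Y, and the closed strata are pulled back from GL3. Write D
    for [M02 = 0] (the closure for w_0 s_alpha1), Z for [g00 = g02 = 0] (the closure for s_alpha2)
    and X for [g00 = g10 = 0] (the closure for s_alpha1, which is stable under all of E). Inside D,
    the locus X is the divisor [M01 = 0] and Z is the divisor [N02 = 0]; on D these functions have
    weights (1, 1+q, q) and (1+q, 0, 1+q). The heart of the matter is that f vanishes on D
    ([vanishing_on_D]). As D is smooth, f is then locally a multiple of [M02], hence of Ha, and the
    quotients glue ([quotient_exists]).

    Suppose that f does not vanish on D. Generic nonvanishing on D, suitably phrased on whole Levi
    orbits, is E-invariant and locally constant, so an idempotent function on S detects it
    ([generic_idempotent]); since zeta is surjective on components, it holds near some point of X
    ([generic_on_FX]). Let i be the least order of f along X inside D. Then f = M01^i f1 on D, where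
    f1 is semi-invariant and nonzero at some point of X ([divide_M01]). As X is stable under the
    Levi, that point moves in X along a projective line, on which f1 has degree at most n = l0 - l1,
    l being its weight ([line_poly]), while [N02] becomes, up to a constant, a polynomial with q+1
    distinct roots ([theta_simple], [size_theta]). Hence at one of these roots, a point of both X
    and Z, the order j of f1 along Z satisfies (q+1) j <= n ([exact_point]).

    The leading coefficient f2 of f1 along Z is semi-invariant on Z ([divide_N02]). Multiplying
    f2^(1+q^3) g10^m by powers of the units [g01] and [det g] gives a function of weight 0
    ([weight0]); the bound on j and a1 - a3 > 0 make m positive. This function descends to the
    closed stratum of s_alpha2 in Flag(S), where pseudo-completeness makes it locally constant. It
    vanishes at the chosen point because [g10] does, hence on the whole chart of Z around that point
    ([vanishing_propagates]), although neither f2 nor [g10] is zero there: a contradiction.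

    Schemes being functors, everything is done on finitely generated charts of Y ([chart_cover]).
    Local rings at smooth points are domains ([smooth_point_domain]), so charts can be shrunk until
    the ideals of D, Z and X are prime ([refine_chart]); functions are glued from charts
    ([glued_function]), identities are checked on a universal group element over a domain
    ([universal_reduction]), and étale descent rests on a purity statement for linear systems
    ([cover_pure]). *)

Lemma ex_choice (X Y : Type) (P : X -> Y -> Prop) :
  (forall x, exists y, P x y) -> exists f, forall x, P x (f x).
Proof. by move=> /choice[f]; exists f. Qed.

(** * Ideals and quotient algebras *)

Definition ideal (R : comNzRingType) (I : R -> Prop) : Prop :=
  [/\ I 0, forall x y, I x -> I y -> I (x + y) & forall r x, I x -> I (r * x)].

Section Ideals.
Variables (R : comNzRingType) (I : R -> Prop).
Hypothesis idI : ideal I.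

Lemma ideal0 : I 0. Proof. by case: idI. Qed.
Lemma idealD x y : I x -> I y -> I (x + y). Proof. by case: idI => _ h _; apply: h. Qed.
Lemma idealM r x : I x -> I (r * x). Proof. by case: idI => _ _; apply. Qed.
Lemma ideal_mulr r x : I x -> I (x * r). Proof. by rewrite mulrC; apply: idealM. Qed.
Lemma idealN x : I x -> I (- x). Proof. by rewrite -mulN1r; apply: idealM. Qed.
Lemma idealB x y : I x -> I y -> I (x - y).
Proof. by move=> Ix /idealN; apply: idealD. Qed.
Lemma ideal_sum (J : Type) (s : seq J) (P : pred J) (F : J -> R) :
  (forall j, P j -> I (F j)) -> I (\sum_(j <- s | P j) F j).
Proof. by move=> h; elim/big_ind: _ => //; [apply: ideal0 | apply: idealD]. Qed.
Lemma idealBr x y : I x -> I (x + y) -> I y.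
Proof. by move=> Ix Ixy; rewrite -(addKr x y); apply: idealD => //; apply: idealN. Qed.
End Ideals.

Section QuotientAlgebra.
Variables (k : fieldType) (R : comNzRingType) (c : {rmorphism k -> R}) (I : R -> Prop).
Hypotheses (idI : ideal I) (I1 : ~ I 1).

Definition idealb : {pred R} := fun x => `[< I x >].

Let idealb0 : idealb 0. Proof. by apply/asboolP/(ideal0 idI). Qed.
Let idealbP : idealr_closed idealb.
Proof.
split.
- by apply/asboolP/(ideal0 idI).
- by apply/asboolP.
- move=> a x y /asboolP Ix /asboolP Iy; apply/asboolP.
  by apply: idealD => //; apply: idealM.
Qed.
HB.instance Definition _ := isIdealr.Build R idealb idealbP.

Definition qring : Type := {ideal_quot (idealb : idealr R)}.
HB.instance Definition _ := GRing.ComNzRing.on qring.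
Definition qpi : R -> qring := \pi_({ideal_quot (idealb : idealr R)})%qT.

Lemma qpiD : {morph qpi : x y / x + y}. Proof. by move=> x y; rewrite /qpi rmorphD. Qed.
Lemma qpiM : {morph qpi : x y / x * y}. Proof. by move=> x y; rewrite /qpi rmorphM. Qed.
Lemma qpi1 : qpi 1 = 1. Proof. by rewrite /qpi rmorph1. Qed.
Lemma qpi_surj y : exists x, qpi x = y.
Proof. by exists (generic_quotient.repr y); rewrite /qpi generic_quotient.reprK. Qed.
Lemma qpi_eq0 x : qpi x = 0 <-> I x.
Proof.
rewrite -[0](_ : qpi 0 = 0); last by rewrite /qpi rmorph0.
split=> [/eqP|Ix]; last apply/eqP.
  by rewrite -Quotient.idealrBE subr0 => /asboolP.
by rewrite -Quotient.idealrBE subr0; apply/asboolP.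
Qed.

(** Invertibility in a quotient is not decidable in general, so units and inverses are chosen
    classically; this makes every proper quotient an admissible algebra. *)
Definition qunit : {pred qring} := fun x => `[< exists y, y * x = 1 >].
Definition qinv (x : qring) : qring :=
  match pselect (exists y, y * x = 1) with left h => projT1 (cid h) | right _ => x end.
Let qmulV : {in qunit, left_inverse 1 qinv *%R}.
Proof.
move=> x /asboolP h; rewrite /qinv; case: pselect => // h'.
by case: (cid h').
Qed.
Let qunitP : forall x y, y * x = 1 -> qunit x.
Proof. by move=> x y h; apply/asboolP; exists y. Qed.
Let qinvN : {in [predC qunit], qinv =1 id}.
Proof. by move=> x /asboolP h; rewrite /qinv; case: pselect. Qed.
HB.instance Definition _ :=
  GRing.ComNzRing_hasMulInverse.Build qring qmulV qunitP qinvN.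

Definition qscale (a : k) (x : qring) : qring := qpi (c a) * x.
Let qscaleA a b v : qscale a (qscale b v) = qscale (a * b) v.
Proof. by rewrite /qscale rmorphM qpiM mulrA. Qed.
Let qscale1 : left_id 1 qscale.
Proof. by move=> v; rewrite /qscale rmorph1 qpi1 mul1r. Qed.
Let qscaleDr : right_distributive qscale +%R.
Proof. by move=> a x y; rewrite /qscale mulrDr. Qed.
Let qscaleDl v : {morph qscale^~ v : a b / a + b}.
Proof. by move=> a b; rewrite /qscale rmorphD qpiD mulrDl. Qed.
HB.instance Definition _ :=
  GRing.Zmodule_isLmodule.Build k qring qscaleA qscale1 qscaleDr qscaleDl.
Let qscaleAl (a : k) (u v : qring) : a *: (u * v) = (a *: u) * v.
Proof. exact: mulrA. Qed.
HB.instance Definition _ := GRing.Lmodule_isLalgebra.Build k qring qscaleAl.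
Let qscaleAr (a : k) (u v : qring) : a *: (u * v) = u * (a *: v).
Proof. exact: mulrCA. Qed.
HB.instance Definition _ := GRing.Lalgebra_isAlgebra.Build k qring qscaleAr.
Let qpiB : zmod_morphism qpi.
Proof. by move=> x y; rewrite /qpi rmorphB. Qed.
Let qpi_monoid : monoid_morphism qpi.
Proof. by split; [exact: qpi1 | exact: qpiM]. Qed.
HB.instance Definition _ := GRing.isZmodMorphism.Build R qring qpi qpiB.
HB.instance Definition _ := GRing.isMonoidMorphism.Build R qring qpi qpi_monoid.
Definition qalg : comUnitAlgType k := qring.
Definition qmor : {rmorphism R -> qalg} := qpi.
Lemma qmor_alg a : qmor (c a) = a%:A.
Proof. by rewrite /GRing.scale /= /qscale mulr1. Qed.
End QuotientAlgebra.

(** * Algebras over a field: localizations, maximal ideals, field-valued points *)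

Section Algebras.
Variable k : fieldType.
Notation alg := (comUnitAlgType k).

Section MkMorphism.
Variables (A B : alg) (h : A -> B).
Hypotheses (hD : {morph h : x y / x + y}) (hM : {morph h : x y / x * y})
  (h1 : h 1 = 1) (hC : forall a : k, h a%:A = a%:A).
Let hB : zmod_morphism h.
Proof.
have h0 : h 0 = 0 by apply: (addIr (h 0)); rewrite add0r -hD addr0.
by move=> x y; apply/(addIr (h y)); rewrite -hD !subrK.
Qed.
Let hmon : monoid_morphism h. Proof. by split. Qed.
Let hZ : scalable h.
Proof. by move=> a x; rewrite -mulr_algl hM hC mulr_algl. Qed.
HB.instance Definition _ := GRing.isZmodMorphism.Build A B h hB.
HB.instance Definition _ := GRing.isMonoidMorphism.Build A B h hmon.
HB.instance Definition _ := GRing.isScalable.Build k A B *:%R h hZ.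
Definition mk_lrmorphism : {lrmorphism A -> B} := h.
Lemma mk_lrmorphismE : mk_lrmorphism =1 h. Proof. by []. Qed.
End MkMorphism.

Lemma lrmorph_alg (A B : alg) (f : {lrmorphism A -> B}) (a : k) : f a%:A = a%:A.
Proof. by rewrite linearZ /= rmorph1. Qed.

Section LRMorphismTheory.
Variables (A B : alg) (f : {lrmorphism A -> B}).
Lemma lr0 : f 0 = 0. Proof. exact: rmorph0. Qed.
Lemma lr1 : f 1 = 1. Proof. exact: rmorph1. Qed.
Lemma lrN x : f (- x) = - f x. Proof. exact: rmorphN. Qed.
Lemma lrD x y : f (x + y) = f x + f y. Proof. exact: rmorphD. Qed.
Lemma lrB x y : f (x - y) = f x - f y. Proof. exact: rmorphB. Qed.
Lemma lrM x y : f (x * y) = f x * f y. Proof. exact: rmorphM. Qed.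
Lemma lrX x n : f (x ^+ n) = f x ^+ n. Proof. exact: rmorphXn. Qed.
Lemma lr_sum (J : Type) (s : seq J) (P : pred J) (F : J -> A) :
  f (\sum_(j <- s | P j) F j) = \sum_(j <- s | P j) f (F j).
Proof. exact: rmorph_sum. Qed.
Lemma lr_unit x : x \is a GRing.unit -> f x \is a GRing.unit.
Proof. exact: rmorph_unit. Qed.
Lemma lrV x : x \is a GRing.unit -> f x^-1 = (f x)^-1.
Proof. exact: rmorphV. Qed.
End LRMorphismTheory.

Lemma lr_comp (A B C : alg) (f : {lrmorphism A -> B}) (g : {lrmorphism B -> C}) :
  exists h : {lrmorphism A -> C}, h =1 g \o f.
Proof.
suff [h hE] : {h : {lrmorphism A -> C} | h =1 g \o f} by exists h.
by exists [the {lrmorphism A -> C} of g \o f].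
Qed.

Definition lr_id (A : alg) : {lrmorphism A -> A} := [the {lrmorphism A -> A} of idfun].


(** Source of the algebras built below. The ideal must be proper because algebras are nonzero, and
    [c] records the image of the scalars. *)
Lemma quot_exists (R : comNzRingType) (c : {rmorphism k -> R}) (I : R -> Prop) :
  ideal I -> ~ I 1 ->
  exists (A : alg) (p : {rmorphism R -> A}),
    [/\ forall y, exists x, p x = y, forall x, p x = 0 <-> I x
      & forall a, p (c a) = a%:A].
Proof.
move=> idI I1; exists (qalg c idI I1), (qmor c idI I1); split.
- exact: qpi_surj.
- exact: qpi_eq0.
- exact: qmor_alg.
Qed.

Lemma quot_lift (R : comNzRingType) (c : {rmorphism k -> R}) (A : alg)
    (p : {rmorphism R -> A}) (B : alg) (g : {rmorphism R -> B}) :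
  (forall y, exists x, p x = y) -> (forall a, p (c a) = a%:A) ->
  (forall a, g (c a) = a%:A) -> (forall x, p x = 0 -> g x = 0) ->
  exists h : {lrmorphism A -> B}, forall x, h (p x) = g x.
Proof.
move=> ps pc gc pg; have [s sK] := choice ps; pose h y := g (s y).
have hp x : h (p x) = g x.
  by apply/eqP; rewrite -subr_eq0 /h -rmorphB pg // rmorphB sK subrr.
have hD : {morph h : x y / x + y}.
  by move=> x y; rewrite -{1}(sK x) -{1}(sK y) -rmorphD hp rmorphD.
have hM : {morph h : x y / x * y}.
  by move=> x y; rewrite -{1}(sK x) -{1}(sK y) -rmorphM hp rmorphM.
have h1 : h 1 = 1 by rewrite -(rmorph1 p) hp rmorph1.
have hC a : h a%:A = a%:A by rewrite -pc hp gc.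
by exists (mk_lrmorphism hD hM h1 hC).
Qed.

Lemma ring_alg (R : comNzRingType) (c : {rmorphism k -> R}) :
  exists (A : alg) (p : {rmorphism R -> A}),
    [/\ forall y, exists x, p x = y, injective p & forall a, p (c a) = a%:A].
Proof.
have id0 : ideal (fun x : R => x = 0).
  by split=> [|x y -> ->|r x ->]; rewrite ?addr0 ?mulr0.
have [A [p [ps pk pc]]] := quot_exists c id0 (elimN eqP (oner_neq0 R)).
exists A, p; split=> // x y pxy; apply/eqP; rewrite -subr_eq0; apply/eqP/pk.
by rewrite rmorphB pxy subrr.
Qed.

Lemma alg_quot (A : alg) (I : A -> Prop) : ideal I -> ~ I 1 ->
  exists (B : alg) (p : {lrmorphism A -> B}),
    (forall y, exists x, p x = y) /\ forall x, p x = 0 <-> I x.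
Proof.
move=> idI I1; have [B [p [ps pk pc]]] := quot_exists (in_alg A) idI I1.
exists B, (mk_lrmorphism (rmorphD p) (rmorphM p) (rmorph1 p) pc).
by split=> //= x; apply: pk.
Qed.

Lemma alg_quot_lift (A B C : alg) (p : {lrmorphism A -> B}) (g : {lrmorphism A -> C}) :
  (forall y, exists x, p x = y) -> (forall x, p x = 0 -> g x = 0) ->
  exists h : {lrmorphism B -> C}, forall x, h (p x) = g x.
Proof.
move=> ps pg; exact: (@quot_lift _ (in_alg A) _ p _ g ps (lrmorph_alg p) (lrmorph_alg g) pg).
Qed.

(* A comUnitAlgType is built as a quotient of polynomials [{poly A}] by a X - 1. *)
Lemma localization_exists (A : alg) (a : A) : (forall n, a ^+ n <> 0) ->
  exists (L : alg) (l : {lrmorphism A -> L}), is_localization l a.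
Proof.
move=> an0; pose J (P : {poly A}) := exists Q, P = Q * (a%:P * 'X - 1).
have idJ : ideal J.
  split=> [|x y [Q ->] [Q' ->]|r x [Q ->]]; first by exists 0; rewrite mul0r.
    by exists (Q + Q'); rewrite mulrDl.
  by exists (r * Q); rewrite mulrA.
(* The equation [c = Q * (a X - 1)] forces the coefficients of [Q] to be [- a ^+ i * c], and these
   vanish beyond the degree of [Q]. *)
have JC c : J c%:P -> exists n, a ^+ n * c = 0.
  case=> Q E; have co i : Q`_i = - (a ^+ i * c).
    elim: i => [|i IH].
      move/(congr1 (fun P : {poly A} => P`_0)): E.
      rewrite coefC /= mulrBr mulr1 coefB mulrA coefMX /= sub0r expr0 mul1r.
      by move->; rewrite opprK.
    move/(congr1 (fun P : {poly A} => P`_i.+1)): E.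
    rewrite coefC /= mulrBr mulr1 coefB mulrA coefMX /= coefMC IH => /eqP.
    rewrite eq_sym subr_eq0 => /eqP <-.
    by rewrite mulNr mulrAC exprSr.
  exists (size Q); move: (co (size Q)); rewrite nth_default // => /eqP.
  by rewrite eq_sym oppr_eq0 => /eqP.
have J1 : ~ J 1.
  rewrite -[1]polyC1 => /JC[n]; rewrite mulr1; exact: an0.
pose c : {rmorphism k -> {poly A}} := [the {rmorphism k -> {poly A}} of polyC \o in_alg A].
have [L [p [ps pk pc]]] := quot_exists c idJ J1.
pose l0 x := p x%:P.
have lD : {morph l0 : x y / x + y} by move=> x y; rewrite /l0 !rmorphD.
have lM : {morph l0 : x y / x * y} by move=> x y; rewrite /l0 !rmorphM.
have l1 : l0 1 = 1 by rewrite /l0 !rmorph1.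
have lC b : l0 b%:A = b%:A by rewrite -pc.
pose l : {lrmorphism A -> L} := mk_lrmorphism lD lM l1 lC.
have lE x : l x = p x%:P by [].
exists L, l; have aX : l a * p 'X = 1.
  apply/eqP; rewrite lE -rmorphM -subr_eq0 -(rmorph1 p) -rmorphB; apply/eqP/pk.
  by exists 1; rewrite mul1r.
have ua : l a \is a GRing.unit by apply/unitrP; exists (p 'X); rewrite mulrC.
split=> //.
- move=> b; have [P <-] := ps b; elim/poly_ind: P => [|P x [n [d dE]]].
    by exists 0%N, 0; rewrite !rmorph0 mul0r.
  exists n.+1, (d + x * a ^+ n.+1); rewrite rmorphD rmorphM -lE mulrDl.
  have -> : l (d + x * a ^+ n.+1) = l d + l x * l a ^+ n.+1.
    by rewrite rmorphD rmorphM rmorphXn.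
  rewrite -dE; congr (_ + _).
  by rewrite exprS mulrA -(mulrA (p P)) [p 'X * _]mulrC aX mulr1.
- by move=> x; rewrite lE => /pk/JC.
Qed.

Lemma localization_univ (A L B : alg) (a : A) (l : {lrmorphism A -> L})
    (f : {lrmorphism A -> B}) :
  is_localization l a -> f a \is a GRing.unit ->
  exists g : {lrmorphism L -> B}, forall x, g (l x) = f x.
Proof.
case=> la lfrac lker ua.
have fker x : l x = 0 -> f x = 0.
  move/lker=> [n E]; apply: (mulrI (unitrX n ua)).
  by rewrite mulr0 -lrX -lrM E lr0.
have ex b : exists y : B, forall n c, b * l a ^+ n = l c -> y * f a ^+ n = f c.
  have [n [c E]] := lfrac b; exists (f c / f a ^+ n) => m d E'.
  have /fker/eqP : l (c * a ^+ m - d * a ^+ n) = 0.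
    by rewrite lrB !lrM !lrX -E -E' mulrAC subrr.
  rewrite lrB !lrM !lrX subr_eq0 => /eqP E2.
  by rewrite mulrAC E2 mulrK // unitrX.
have [g gE] := choice ex.
have gl x : g (l x) = f x by have := gE (l x) 0%N x; rewrite !expr0 !mulr1 => ->.
have uaX n : f a ^+ n \is a GRing.unit by apply: unitrX.
have gD : {morph g : x y / x + y}.
  move=> x y; have [n [c E]] := lfrac x; have [m [d E']] := lfrac y.
  apply: (mulIr (uaX (n + m)%N)); rewrite (gE _ (n + m)%N (c * a ^+ m + d * a ^+ n)).
    by rewrite lrD !lrM !lrX -(gE _ _ _ E) -(gE _ _ _ E') mulrDl
      exprD !mulrA [g y * _ * _]mulrAC.
  by rewrite lrD !lrM !lrX -E -E' mulrDl exprD !mulrA [y * _ * _]mulrAC.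
have gM : {morph g : x y / x * y}.
  move=> x y; have [n [c E]] := lfrac x; have [m [d E']] := lfrac y.
  apply: (mulIr (uaX (n + m)%N)); rewrite (gE _ (n + m)%N (c * d)).
    by rewrite lrM -(gE _ _ _ E) -(gE _ _ _ E') exprD mulrACA.
  by rewrite lrM -E -E' exprD mulrACA.
have g1 : g 1 = 1 by rewrite -(lr1 l) gl lr1.
have gC b : g b%:A = b%:A by rewrite -(lrmorph_alg l) gl lrmorph_alg.
by exists (mk_lrmorphism gD gM g1 gC).
Qed.

Lemma maximal_ideal (A : alg) (I : A -> Prop) : ideal I -> ~ I 1 ->
  exists M : A -> Prop, [/\ ideal M, ~ M 1, forall x, I x -> M x
    & forall x, ~ M x -> exists y, M (1 - y * x)].
Proof.
move=> idI I1.
pose PP (M : A -> Prop) := (forall x, ~ M x) \/ [/\ ideal M, ~ M 1 & forall x, I x -> M x].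
have [|M [PM Mmax]] := @Zorn_bigcup A PP.
  move=> F FP tot; pose U := (\bigcup_(X in F) X)%classic.
  have [Une|Un] := pselect (exists x, U x); last first.
    by left=> x Ux; case: Un; exists x.
  right; have FX X x : F X -> X x -> [/\ ideal X, ~ X 1 & forall x, I x -> X x].
    by move=> FX Xx; case: (FP X FX) => // /(_ x).
  have [x0 [X0 FX0 Xx0]] := Une; have [id0 _ IX0] := FX _ _ FX0 Xx0.
  split; last by move=> x Ix; exists X0 => //; apply: IX0.
    split; first by exists X0 => //; apply: ideal0.
      move=> x y [X fX Xx] [Y fY Yy].
      have [XY|YX] := tot _ _ fX fY.
        exists Y => //; have [idY _ _] := FX _ _ fY Yy.
        by apply: idealD => //; apply: XY.
      exists X => //; have [idX _ _] := FX _ _ fX Xx.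
      by apply: idealD => //; apply: YX.
    move=> r x [X fX Xx]; exists X => //; have [idX _ _] := FX _ _ fX Xx.
    exact: idealM.
  by move=> [X fX X1]; have [_ ? _] := FX _ _ fX X1.
have {}PM : [/\ ideal M, ~ M 1 & forall x, I x -> M x].
  case: PM => // M0; exfalso; apply: (Mmax I); last by right.
  by split=> [x /M0 //|/(_ 0 (ideal0 idI))/M0].
have [idM M1 IM] := PM; exists M; split=> // x nMx.
(* If [x] is not invertible modulo [M], then [M + (x)] is a larger proper ideal. *)
apply: contrapT => nex; pose M' z := exists r m, M m /\ z = r * x + m.
apply: (Mmax M').
  split=> [z Mz|sub]; first by exists 0, z; rewrite mul0r add0r.
  apply: nMx; apply: sub; exists 1, 0; rewrite mul1r addr0; split=> //; exact: ideal0.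
right; split.
- split; first by exists 0, 0; rewrite mul0r addr0; split=> //; apply: ideal0.
    move=> _ _ [r [m [Mm ->]]] [r' [m' [Mm' ->]]]; exists (r + r'), (m + m').
    by rewrite mulrDl addrACA; split=> //; apply: idealD.
  move=> s _ [r [m [Mm ->]]]; exists (s * r), (s * m).
  by rewrite mulrDr mulrA; split=> //; apply: idealM.
- move=> [r [m [Mm E]]]; apply: nex; exists r.
  by rewrite E addrC addKr.
- by move=> x' Ix; exists 0, x'; rewrite mul0r add0r; split=> //; apply: IM.
Qed.

Lemma field_point (A : alg) (I : A -> Prop) : ideal I -> ~ I 1 ->
  exists (K : alg) (f : {lrmorphism A -> K}), is_field K /\ forall x, I x -> f x = 0.
Proof.
move=> idI I1; have [M [idM M1 IM Mmax]] := maximal_ideal idI I1.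
have [K [p [ps pk]]] := alg_quot idM M1; exists K, p; split; last first.
  by move=> x /IM/pk.
move=> y; have [x <-] := ps y => /eqP px0.
have [|z] := Mmax x; first by move/pk.
move/pk; rewrite lrB lr1 lrM => /eqP; rewrite subr_eq0 => /eqP E.
by apply/unitrP; exists (p z); rewrite [p x * _]mulrC -E.
Qed.

(** A non-nilpotent [a] survives in the localization at [a], and any field point of that
    localization makes [a] invertible. *)
Lemma nilpotent_or_field_point (A : alg) (a : A) :
  (forall (K : alg) (f : {lrmorphism A -> K}), is_field K -> f a = 0) ->
  exists n, a ^+ n = 0.
Proof.
move=> h; apply: contrapT => /forallNP an; have [L [l [la lf lk]]] := localization_exists an.
have [|//|K [f [fK _]]] := @field_point L (fun x => x = 0).
- by split=> [|x y -> ->|r x ->]; rewrite ?addr0 ?mulr0.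
- by move/eqP; rewrite oner_eq0.
have [g gE] := lr_comp l f; have := h _ g fK; rewrite gE /= => E.
by have := lr_unit f la; rewrite E unitr0.
Qed.

(* Replaces multinomial expansions of powers of a partition of unity. *)
Lemma ideal_powers (A : alg) (I : A -> Prop) (J : Type) (s : seq J) (c d : J -> A) :
  ideal I -> \sum_(i <- s) c i * d i = 1 ->
  (forall i, exists n, I (d i ^+ n)) -> I 1.
Proof.
move=> idI s1 dI; apply: contrapT => I1; have [K [f [fK fI]]] := field_point idI I1.
have := oner_neq0 K; rewrite -(lr1 f) -s1 lr_sum big1 ?eqxx // => i _.
have [n /fI] := dI i; rewrite lrM lrX => h.
have [fd|nfd] := eqVneq (f (d i)) 0; first by rewrite fd mulr0.
by have := unitrX n (fK _ nfd); rewrite h unitr0.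
Qed.

Definition idspan (A : comNzRingType) (D : A -> Prop) : A -> Prop :=
  fun x => exists n (c d : 'I_n -> A), (forall i, D (d i)) /\ x = \sum_i c i * d i.

Lemma idspan_ideal (A : comNzRingType) (D : A -> Prop) : ideal (idspan D).
Proof.
split.
- by exists 0%N, (fun=> 0), (fun=> 0); split=> [[]//|]; rewrite big_ord0.
- move=> _ _ [n [c [d [dD ->]]]] [m [c' [d' [dD' ->]]]].
  exists (n + m)%N, (fun i => match split i with inl j => c j | inr j => c' j end),
    (fun i => match split i with inl j => d j | inr j => d' j end).
  split=> [i|]; first by case: (split i).
  rewrite big_split_ord /=; congr (_ + _); apply: eq_bigr => i _.
    by rewrite (unsplitK (inl i)).
  by rewrite (unsplitK (inr i)).
- move=> r _ [n [c [d [dD ->]]]]; exists n, (fun i => r * c i), d; split=> //.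
  by rewrite mulr_sumr; apply: eq_bigr => i _; rewrite mulrA.
Qed.

Lemma idspan_in (A : comNzRingType) (D : A -> Prop) x : D x -> idspan D x.
Proof.
by move=> Dx; exists 1%N, (fun=> 1), (fun=> x); rewrite big_ord1 mul1r.
Qed.

Lemma idspan_sub (A : comNzRingType) (D I : A -> Prop) :
  ideal I -> (forall x, D x -> I x) -> forall x, idspan D x -> I x.
Proof.
move=> idI DI _ [n [c [d [dD ->]]]]; apply: ideal_sum => // i _.
by apply: idealM => //; apply: DI.
Qed.

Lemma unit_idealP (A : alg) (D : A -> Prop) : unit_ideal D <-> idspan D 1.
Proof.
split=> [[n [c [d [dD E]]]]|[n [c [d [dD E]]]]]; exists n, c, d; split=> //.
Qed.

Lemma unit_ideal_field (A : alg) (D : A -> Prop) :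
  (forall (K : alg) (f : {lrmorphism A -> K}), is_field K -> exists2 d, D d & f d <> 0) ->
  unit_ideal D.
Proof.
move=> h; apply/unit_idealP; apply: contrapT => D1.
have [K [f [fK fD]]] := field_point (idspan_ideal D) D1.
by have [d Dd] := h K f fK; case; apply: fD; apply: idspan_in.
Qed.

End Algebras.

(** * Iterated polynomial rings and finitely generated algebras *)

Section IteratedPolynomials.
Variable k : fieldType.

(** Adding one variable at a time keeps univariate degree and division available in the inductions
    for Hilbert's basis theorem and the Nullstellensatz. *)
Fixpoint Pol n : idomainType := if n is m.+1 then {poly (Pol m)} else k.

Fixpoint polc n : {rmorphism k -> Pol n} :=
  match n with
  | 0 => [the {rmorphism k -> k} of idfun]
  | m.+1 => [the {rmorphism k -> {poly (Pol m)}} of polyC \o polc m]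
  end.

Fixpoint polX n (i : nat) : Pol n :=
  match n with
  | 0 => 0
  | m.+1 => (if i == m then 'X else (polX m i)%:P) : {poly (Pol m)}
  end.

Definition ev_step (S R : comNzRingType) (f : {rmorphism S -> R}) (x : R) :
    {rmorphism {poly S} -> R} :=
  [the {rmorphism {poly S} -> R} of horner_morph (fun a => mulrC x (f a))].

Fixpoint ev (R : comNzRingType) (c : {rmorphism k -> R}) (x : nat -> R) n :
    {rmorphism Pol n -> R} :=
  match n with
  | 0 => c
  | m.+1 => ev_step (ev c x m) (x m)
  end.

Lemma ev_stepC (S R : comNzRingType) (f : {rmorphism S -> R}) (x : R) a :
  ev_step f x a%:P = f a.
Proof. exact: horner_morphC. Qed.

Lemma ev_stepX (S R : comNzRingType) (f : {rmorphism S -> R}) (x : R) :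
  ev_step f x 'X = x.
Proof. exact: horner_morphX. Qed.

Lemma ev_stepE (S R : comNzRingType) (f : {rmorphism S -> R}) (x : R) p :
  ev_step f x p = (map_poly f p).[x].
Proof. by []. Qed.

Lemma pol_ind n (P : Pol n -> Prop) :
  (forall a, P (polc n a)) -> (forall i, (i < n)%N -> P (polX n i)) ->
  (forall p q, P p -> P q -> P (p + q)) -> (forall p q, P p -> P q -> P (p * q)) ->
  forall p, P p.
Proof.
elim: n P => [|n IH] P hc hX hD hM p; first exact: (hc p).
have PC (a : Pol n) : P a%:P.
  apply: (IH (fun a => P a%:P)) => [b|i ilt|q r Pq Pr|q r Pq Pr].
  - exact: (hc b).
  - by have := hX i (ltnW ilt); rewrite /= ltn_eqF.
  - by rewrite rmorphD; apply: hD.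
  - by rewrite rmorphM; apply: hM.
have PX : P 'X by have := hX n (leqnn _); rewrite /= eqxx.
elim/poly_ind: (p : {poly (Pol n)}) => [|q a Pq]; first exact: (PC 0).
by apply: hD => //; apply: hM.
Qed.

Lemma ev_polc (R : comNzRingType) (c : {rmorphism k -> R}) x n a :
  ev c x n (polc n a) = c a.
Proof. by elim: n => //= n IH; rewrite ev_stepC IH. Qed.

Lemma ev_polX (R : comNzRingType) (c : {rmorphism k -> R}) x n i :
  (i < n)%N -> ev c x n (polX n i) = x i.
Proof.
elim: n => //= n IH; rewrite ltnS leq_eqVlt; case: eqP => [->|_] /= ilt.
  exact: ev_stepX.
by rewrite ev_stepC IH.
Qed.

Lemma ev_nat (R S : comNzRingType) (c : {rmorphism k -> R}) (d : {rmorphism k -> S})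
    (f : {rmorphism R -> S}) x y n p :
  (forall a, f (c a) = d a) -> (forall i, (i < n)%N -> f (x i) = y i) ->
  f (ev c x n p) = ev d y n p.
Proof.
move=> fc fx; elim/pol_ind: p => [a|i ilt|p q E E'|p q E E'].
- by rewrite !ev_polc.
- by rewrite !ev_polX // fx.
- by rewrite !rmorphD E E'.
- by rewrite !rmorphM E E'.
Qed.

Lemma ev_mem (R : comNzRingType) (c : {rmorphism k -> R}) x n (P : R -> Prop) p :
  (forall a, P (c a)) -> (forall i, (i < n)%N -> P (x i)) ->
  (forall p q, P p -> P q -> P (p + q)) -> (forall p q, P p -> P q -> P (p * q)) ->
  P (ev c x n p).
Proof.
move=> hc hx hD hM; elim/pol_ind: p => [a|i ilt|p q E E'|p q E E'].
- by rewrite ev_polc.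
- by rewrite ev_polX //; apply: hx.
- by rewrite rmorphD; apply: hD.
- by rewrite rmorphM; apply: hM.
Qed.

Lemma ev_self n p : ev (polc n) (polX n) n p = p.
Proof.
elim/pol_ind: p => [a|i ilt|p q E E'|p q E E'].
- by rewrite ev_polc.
- by rewrite ev_polX.
- by rewrite rmorphD E E'.
- by rewrite rmorphM E E'.
Qed.

Definition generates (A : comUnitAlgType k) n (x : nat -> A) :=
  forall a, exists p, ev (in_alg A) x n p = a.

Definition fin_gen (A : comUnitAlgType k) := exists n x, @generates A n x.

End IteratedPolynomials.

(** * Noetherian rings and modules *)

Section Noetherian.

Section Modules.
Variables (R : comNzRingType) (V : lmodType R).

Definition submod (N : V -> Prop) : Prop :=
  [/\ N 0, forall u v, N u -> N v -> N (u + v) & forall a u, N u -> N (a *: u)].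

Definition mspan (D : V -> Prop) : V -> Prop :=
  fun v => exists n (c : 'I_n -> R) (d : 'I_n -> V),
    (forall i, D (d i)) /\ v = \sum_i c i *: d i.

Lemma mspan_submod D : submod (mspan D).
Proof.
split.
- by exists 0%N, (fun=> 0), (fun=> 0); split=> [[]//|]; rewrite big_ord0.
- move=> _ _ [n [c [d [dD ->]]]] [m [c' [d' [dD' ->]]]].
  exists (n + m)%N, (fun i => match split i with inl j => c j | inr j => c' j end),
    (fun i => match split i with inl j => d j | inr j => d' j end).
  split=> [i|]; first by case: (split i).
  rewrite big_split_ord /=; congr (_ + _); apply: eq_bigr => i _.
    by rewrite (unsplitK (inl i)).
  by rewrite (unsplitK (inr i)).
- move=> r _ [n [c [d [dD ->]]]]; exists n, (fun i => r * c i), d; split=> //.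
  by rewrite scaler_sumr; apply: eq_bigr => i _; rewrite scalerA.
Qed.

Lemma mspan_in (D : V -> Prop) v : D v -> mspan D v.
Proof.
by move=> Dx; exists 1%N, (fun=> 1), (fun=> v); rewrite big_ord1 scale1r.
Qed.

Section Sub.
Variable N : V -> Prop.
Hypothesis sN : submod N.
Lemma submod0 : N 0. Proof. by case: sN. Qed.
Lemma submodD u v : N u -> N v -> N (u + v). Proof. by case: sN => _ h _; apply: h. Qed.
Lemma submodZ a u : N u -> N (a *: u). Proof. by case: sN => _ _; apply. Qed.
Lemma submodN u : N u -> N (- u). Proof. by rewrite -scaleN1r; apply: submodZ. Qed.
Lemma submodB u v : N u -> N v -> N (u - v).
Proof. by move=> Nu /submodN; apply: submodD. Qed.
Lemma submod_sum (J : Type) (s : seq J) (P : pred J) (F : J -> V) :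
  (forall j, P j -> N (F j)) -> N (\sum_(j <- s | P j) F j).
Proof. by move=> h; elim/big_ind: _ => //; [apply: submod0 | apply: submodD]. Qed.
Lemma mspan_sub (D : V -> Prop) v : (forall u, D u -> N u) -> mspan D v -> N v.
Proof.
by move=> DN [n [c [d [dD ->]]]]; apply: submod_sum => i _; apply/submodZ/DN.
Qed.
End Sub.

Definition noethM := forall N, submod N ->
  exists s : seq V, (forall v, v \in s -> N v) /\
    forall v, N v -> mspan (fun u => u \in s) v.

Lemma noeth_acc (C : nat -> V -> Prop) : noethM ->
  (forall i, submod (C i)) -> (forall i v, C i v -> C i.+1 v) ->
  exists m, forall i v, C i v -> C m v.
Proof.
move=> nV sC up.
have upn i j v : (i <= j)%N -> C i v -> C j v.
  by move=> /subnK <-; elim: (j - i)%N => //= n IH /IH/up.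
have sU : submod (fun v => exists i, C i v).
  split; first by exists 0%N; apply: submod0.
    move=> u v [i Ci] [j Cj]; exists (maxn i j); apply: submodD => //.
      by apply: upn Ci; apply: leq_maxl.
    by apply: upn Cj; apply: leq_maxr.
  by move=> a u [i Ci]; exists i; apply: submodZ.
have [s [sC' gen]] := nV _ sU.
have [m hm] : exists m, forall v, v \in s -> C m v.
  elim: s sC' {gen} => [|u s IH] h; first by exists 0%N.
  have [|m hm] := IH; first by move=> v vs; apply: h; rewrite inE vs orbT.
  have [i Ci] := h u (mem_head _ _); exists (maxn i m) => v.
  rewrite inE => /orP[/eqP->|/hm]; first by apply: upn Ci; apply: leq_maxl.
  by apply: upn; apply: leq_maxr.
exists m => i v Civ; apply: mspan_sub (gen v _) => //; by exists i.
Qed.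

Lemma noeth_max (Q : (V -> Prop) -> Prop) N0 : noethM -> submod N0 -> Q N0 ->
  exists N, [/\ submod N, Q N, forall v, N0 v -> N v & forall N', submod N' -> Q N' ->
     (forall v, N v -> N' v) -> forall v, N' v -> N v].
Proof.
move=> nV sN0 QN0; apply: contrapT => nomax.
pose T := {N | [/\ submod N, Q N & forall v, N0 v -> N v]}.
have step (N : T) : exists N' : T, (forall v, sval N v -> sval N' v) /\
    exists v, sval N' v /\ ~ sval N v.
  case: N => N [sN QN N0N] /=; apply: contrapT => h; apply: nomax; exists N; split=> //.
  move=> N' sN' QN' NN' v N'v; apply: contrapT => nNv; apply: h.
  have pN' : [/\ submod N', Q N' & forall v, N0 v -> N' v] by split=> // u /N0N/NN'.
  by exists (exist _ N' pN'); split=> //; exists v.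
have [f fP] := choice step.
have p0 : [/\ submod N0, Q N0 & forall v, N0 v -> N0 v] by [].
pose C i := sval (iter i f (exist _ N0 p0)).
have [||m hm] := @noeth_acc C nV.
- by move=> i; rewrite /C; case: (iter _ _ _) => N [].
- by move=> i v; apply: (fP _).1.
have [v [v1 v2]] := (fP (iter m f (exist _ N0 p0))).2.
by apply: v2; apply: (hm m.+1).
Qed.

End Modules.

Definition noeth (R : comNzRingType) := forall I : R -> Prop, ideal I ->
  exists s : seq R, (forall v, v \in s -> I v) /\
    forall v, I v -> idspan (fun u => u \in s) v.

Lemma noeth_field (k : fieldType) : noeth k.
Proof.
move=> N sN; have [[x [Nx x0]]|h] := pselect (exists x, N x /\ x <> 0).
  exists [:: x]; split=> [v|v _]; first by rewrite inE => /eqP->.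
  exists 1%N, (fun=> v / x), (fun=> x); split=> [_|]; first by rewrite mem_head.
  by rewrite big_ord1 divfK //; apply/eqP.
exists [::]; split=> // v Nv; have -> : v = 0 by apply: contrapT => v0; apply: h; exists v.
by exists 0%N, (fun=> 0), (fun=> 0); split=> [[]//|]; rewrite big_ord0.
Qed.

Lemma noeth_image (R S : comNzRingType) (f : {rmorphism R -> S}) :
  (forall y, exists x, f x = y) -> noeth R -> noeth S.
Proof.
move=> fs nR N sN; have [|s [sN' gen]] := nR (fun x => N (f x)).
  split; first by rewrite rmorph0; exact: (ideal0 sN).
    by move=> u v Nu Nv; rewrite rmorphD; exact: (idealD sN).
  by move=> a u Nu; rewrite rmorphM; exact: (idealM sN).
exists (map f s); split=> [v /mapP[x xs ->]|v]; first exact: sN'.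
have [x <-] := fs v => /gen[n [c [d [dD ->]]]].
exists n, (fun i => f (c i)), (fun i => f (d i)); split=> [i|]; first exact: map_f.
by rewrite rmorph_sum; apply: eq_bigr => i _; rewrite rmorphM.
Qed.

(** Hilbert's basis theorem. If [N] is not finitely generated, choose successively elements [f i] of
    least degree outside the span of the earlier ones. The ideal of their leading coefficients is
    finitely generated, so the leading coefficient of some [f m] is a combination of earlier ones,
    and subtracting the matching combination lowers the degree of [f m]. *)
Lemma noeth_poly (R : comNzRingType) : noeth R -> noeth {poly R}.
Proof.
move=> nR N idN; apply: contrapT => nfg.
pose inN (s : seq {poly R}) := forall v, v \in s -> N v.
have nxt (s : seq {poly R}) : exists p, inN s ->
    [/\ N p, ~ idspan (fun u => u \in s) p &
      forall p', N p' -> ~ idspan (fun u => u \in s) p' -> (size p <= size p')%N].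
  have [sin|] := pselect (inN s); last by exists 0.
  have [p [Np np]] : exists p, N p /\ ~ idspan (fun u => u \in s) p.
    apply: contrapT => h; apply: nfg; exists s; split=> // v Nv.
    by apply: contrapT => nv; apply: h; exists v.
  pose Q n := `[< exists p, [/\ N p, ~ idspan (fun u => u \in s) p & size p = n] >].
  have exQ : exists n, Q n by exists (size p); apply/asboolP; exists p.
  case: (ex_minnP exQ) => n /asboolP[p' [Np' np' sz]] mn.
  exists p' => _; split=> // p2 Np2 np2; rewrite sz; apply: mn; apply/asboolP; by exists p2.
have [g gP] := choice nxt.
pose pre := fix pre n := if n is m.+1 then rcons (pre m) (g (pre m)) else [::].
have preN n : inN (pre n).
  elim: n => [|n IH] v //=; rewrite mem_rcons inE => /orP[/eqP->|/IH//].
  by have [] := gP _ IH.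
pose f n := g (pre n); have fP n := gP _ (preN n).
have fpre i n : (i < n)%N -> f i \in pre n.
  elim: n => // n IH; rewrite ltnS leq_eqVlt /= mem_rcons inE.
  by case: eqP => [->|_] /=; rewrite ?eqxx // => /IH ->; rewrite orbT.
have [s [sL gen]] := nR (idspan (fun a => exists i, a = lead_coef (f i))) (idspan_ideal _).
pose Lm m := idspan (fun a => exists2 i, (i < m)%N & a = lead_coef (f i)).
have Lup m m' x : (m <= m')%N -> Lm m x -> Lm m' x.
  move=> mm; apply: idspan_sub; first exact: idspan_ideal.
  by move=> y [i im ->]; apply: idspan_in; exists i => //; apply: leq_trans mm.
have [m hm] : exists m, forall v, v \in s -> Lm m v.
  elim: s sL {gen} => [|u s IH] h; first by exists 0%N.
  have [|m hm] := IH; first by move=> v vs; apply: h; rewrite inE vs orbT.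
  have [m' hm'] : exists m', Lm m' u.
    have [n [c [d [dD ->]]]] := h u (mem_head _ _); have [j jP] := choice dD.
    exists (\max_i (j i)).+1; apply: ideal_sum; first exact: idspan_ideal.
    move=> i _; apply: idealM; first exact: idspan_ideal.
    by apply: idspan_in; exists (j i) => //; rewrite ltnS; apply: leq_bigmax.
  exists (maxn m' m) => v; rewrite inE => /orP[/eqP->|/hm].
    by apply: Lup hm'; apply: leq_maxl.
  by apply: Lup; apply: leq_maxr.
have : Lm m (lead_coef (f m)).
  have /gen : idspan (fun a => exists i, a = lead_coef (f i)) (lead_coef (f m)).
    by apply: idspan_in; exists m.
  by apply: idspan_sub => //; apply: idspan_ideal.
case=> n [c [d [dD E]]]; have [j jP] : exists j : 'I_n -> nat,
   forall i, (j i < m)%N /\ d i = lead_coef (f (j i)).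
  apply: (@ex_choice _ _ (fun i j => (j < m)%N /\ d i = lead_coef (f j))) => i.
  by have [j jm ->] := dD i; exists j.
have [Nf nf minf] := fP m.
have szj i : (size (f (j i)) <= size (f m))%N.
  have [_ _] := fP (j i); apply=> //; apply: contra_not nf.
  apply: idspan_sub; first exact: idspan_ideal.
  have sub a b : (a <= b)%N -> {subset pre a <= pre b}.
    move=> /subnK <-; elim: (b - a)%N => // l IH x xp.
    by rewrite /= mem_rcons inE (IH x xp) orbT.
  by move=> x xp; apply: idspan_in; apply: sub xp; apply: ltnW; case: (jP i).
(* The combination of earlier terms with the same top coefficient as [f m]; the shifts make sense
   because degrees do not decrease along the sequence. *)
pose h := \sum_i ((c i)%:P * 'X^(size (f m) - size (f (j i)))) * f (j i).
have hN : N h.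
  by apply: (ideal_sum idN) => i _; apply: (idealM idN); have [] := fP (j i).
have hs : idspan (fun u => u \in pre m) h.
  apply: ideal_sum; first exact: idspan_ideal.
  move=> i _; apply: idealM; first exact: idspan_ideal.
  by apply/idspan_in/fpre; case: (jP i).
have fm0 : f m <> 0.
  by move=> f0; apply: nf; rewrite -/(f m) f0; apply: ideal0; apply: idspan_ideal.
have {}fm0 : (0 < size (f m))%N by rewrite size_poly_gt0; apply/eqP.
have : (size (f m) <= size (f m - h)%R)%N.
  apply: minf; first exact: (idealB idN).
  apply: contra_not nf => sf; rewrite -/(f m) -(GRing.subrK h (f m)).
  by apply: idealD => //; apply: idspan_ideal.
apply/negP; rewrite -ltnNge.
have ltp : ((size (f m)).-1 < size (f m))%N by rewrite prednK.
apply: leq_ltn_trans ltp; apply/leq_sizeP => l lel.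
have hcoef : h`_l = \sum_i c i * (f (j i))`_(l - (size (f m) - size (f (j i)))).
  rewrite coef_sum; apply: eq_bigr => i _.
  rewrite -mulrA coefCM coefXnM; case: ltnP => // lt.
  have [f0|f0] := eqVneq (f (j i)) 0; first by rewrite f0 coef0.
  exfalso; have : (0 < size (f (j i)))%N by rewrite size_poly_gt0.
  by move: lt lel (szj i) fm0; case: (size (f m)) => // N1; case: (size _) => // N2;
     rewrite subSS /= => ? ? ? _ _; lia.
rewrite coefB hcoef; move: lel; rewrite leq_eqVlt => /orP[/eqP <-|lel].
  apply/eqP; rewrite subr_eq0 -lead_coefE E; apply/eqP; apply: eq_bigr => i _.
  have [_ ->] := jP i; rewrite lead_coefE; congr (_ * _`_ _).
  by move: (szj i) fm0; move: (size (f m)) (size (f (j i))) => N1 N2; lia.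
rewrite nth_default ?sub0r; last first.
  by move: lel fm0; move: (size (f m)) => N1; lia.
rewrite big1 ?oppr0 // => i _; rewrite nth_default ?mulr0 //.
by move: (szj i) lel fm0; move: (size (f m)) (size (f (j i))) => N1 N2; lia.
Qed.

Lemma noeth_Pol (k : fieldType) n : noeth (Pol k n).
Proof. elim: n => [|n IH]; [exact: noeth_field | exact: (noeth_poly IH)]. Qed.

Lemma noeth_fin_gen (k : fieldType) (A : comUnitAlgType k) : fin_gen A -> noeth A.
Proof.
by move=> [n [x gx]]; apply: (noeth_image gx); apply: noeth_Pol.
Qed.

(** Induction on the number of coordinates: lift generators of the ideal of first coordinates, and
    add generators of the part with first coordinate zero. *)
Lemma noeth_rV (R : comNzRingType) s : noeth R -> noethM 'rV[R]_s.
Proof.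
move=> nR; elim: s => [|s IH] N sN.
  exists [::]; split=> // v _; rewrite (_ : v = 0); first exact: submod0 (mspan_submod _).
  by apply/rowP => -[].
have [|s1 [s1N gen1]] := nR (fun a => exists w, N (row_mx (a%:M : 'rV_1) w : 'rV_(1 + s))).
  split.
  - exists 0; rewrite (_ : row_mx _ _ = 0); first exact: submod0.
    by rewrite raddf0 row_mx0.
  - move=> a b [u Nu] [v Nv]; exists (u + v).
    by rewrite raddfD -add_row_mx; apply: submodD.
  - move=> r a [u Nu]; exists (r *: u).
    by rewrite -[X in X%:M]/(r * a) -scale_scalar_mx -scale_row_mx; apply: submodZ.
have [|s2 [s2N gen2]] := IH (fun w => N (row_mx (0 : 'rV_1) w : 'rV_(1 + s))).
  split; first by rewrite row_mx0; apply: submod0.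
    by move=> u v Nu Nv; rewrite -[0]addr0 -add_row_mx; apply: submodD.
  by move=> r u Nu; rewrite -(scaler0 _ r) -scale_row_mx; apply: submodZ.
have [w wP] : exists w : R -> 'rV_s, forall a, a \in s1 ->
    N (row_mx (a%:M : 'rV_1) (w a) : 'rV_(1 + s)).
  apply: (@ex_choice _ _ (fun a w => a \in s1 -> N (row_mx (a%:M : 'rV_1) w : 'rV_(1 + s)))) => a.
  have [/s1N[w Nw]|] := boolP (a \in s1); first by exists w.
  by exists 0.
pose l1 a : 'rV[R]_(1 + s) := row_mx (a%:M : 'rV[R]_1) (w a).
pose l2 (v : 'rV[R]_s) : 'rV[R]_(1 + s) := row_mx (0 : 'rV[R]_1) v.
exists ([seq l1 a | a <- s1] ++ [seq l2 v | v <- s2]); split.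
  by move=> v; rewrite mem_cat => /orP[] /mapP[x xs ->]; [apply: wP | apply: s2N].
move=> v Nv; pose a := v 0 0; pose v' : 'rV_(1 + s) := v.
have vE : v = row_mx ((a%:M : 'rV_1)) (rsubmx v') :> 'rV_(1 + s).
  rewrite -[LHS](@hsubmxK _ 1 1 s); congr row_mx; apply/rowP => i.
  rewrite !mxE ord1 eqxx mulr1n; congr (v _ _); exact/val_inj.
set D := fun u : 'rV_(1 + s) => _; have sD := mspan_submod D.
have [n [c [d [dD aE]]]] : idspan (fun x => x \in s1) a.
  by apply: gen1; exists (rsubmx v'); rewrite -vE.
pose u := \sum_i c i *: l1 (d i).
have uN : N u by apply: (submod_sum sN) => i _; apply: (submodZ sN); apply: wP.
have uD : mspan D u.
  apply: (submod_sum sD) => i _; apply: (submodZ sD); apply: mspan_in.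
  by rewrite /D mem_cat map_f.
have vu : v - u = l2 (rsubmx (v - u : 'rV_(1 + s))).
  apply: (etrans (esym (@hsubmxK _ 1 1 s _))); congr (row_mx _ _); apply/rowP => i.
  rewrite !ord1 linearB /= {1}vE row_mxKl linear_sum /= !mxE eqxx mulr1n summxE aE.
  apply/eqP; rewrite subr_eq0; apply/eqP; apply: eq_bigr => l _.
  by rewrite linearZ /= row_mxKl !mxE eqxx mulr1n.
rewrite -(GRing.subrK u v); apply: (submodD sD) => //.
have : mspan (fun u => u \in s2) (rsubmx (v - u : 'rV_(1 + s))).
  by apply: gen2; rewrite -/(l2 _) -vu; apply: (submodB sN).
case=> m [e [f [fs E]]]; rewrite vu E.
have -> : l2 (\sum_i e i *: f i) = \sum_i e i *: l2 (f i).
  rewrite /l2; elim/big_rec2: _ => [|i x y _ <-]; first by rewrite row_mx0.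
  by rewrite scale_row_mx scaler0 add_row_mx addr0.
apply: (submod_sum sD) => i _; apply: (submodZ sD); apply: mspan_in.
by rewrite /D mem_cat (map_f l2 (fs i)) orbT.
Qed.

End Noetherian.

(** * Powers of an ideal and Krull's intersection theorem *)

Section IdealPowers.
Variables (R : comNzRingType) (I : R -> Prop).

Fixpoint ipow n : R -> Prop :=
  if n is m.+1 then idspan (fun x => exists a b, [/\ I a, ipow m b & x = a * b])
  else fun=> True.

Lemma ipow_ideal n : ideal (ipow n).
Proof. by case: n => [|n]; [split | apply: idspan_ideal]. Qed.

Lemma ipowS n a b : I a -> ipow n b -> ipow n.+1 (a * b).
Proof. by move=> Ia Ib; apply: idspan_in; exists a, b. Qed.

Lemma ipow1 a : I a -> ipow 1 a.
Proof. by move=> Ia; rewrite -(mulr1 a); apply: ipowS. Qed.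

Lemma ipow_ind n (P : R -> Prop) :
  ideal P -> (forall a b, I a -> ipow n b -> P (a * b)) -> forall x, ipow n.+1 x -> P x.
Proof. by move=> iP h; apply: idspan_sub => // _ [a [b [Ia Ib ->]]]; apply: h. Qed.

Lemma ipowM n m a b : ipow n a -> ipow m b -> ipow (n + m) (a * b).
Proof.
move=> + ipb; elim: n a => [|n IH] a pa.
  by rewrite add0n; apply: idealM => //; apply: ipow_ideal.
have idP : ideal (fun x => ipow (n + m).+1 (x * b)).
  split=> [|x y px py|r x px]; first by rewrite mul0r; exact: (ideal0 (ipow_ideal (n + m).+1)).
    by rewrite mulrDl; exact: (idealD (ipow_ideal (n + m).+1)).
  by rewrite -mulrA; exact: (idealM (ipow_ideal (n + m).+1)).
apply: (ipow_ind idP _ pa) => c d Ic pd; rewrite -mulrA; apply: ipowS => //; exact: IH.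
Qed.

Lemma ipow_le n m a : (n <= m)%N -> ipow m a -> ipow n a.
Proof.
move=> /subnK <-; elim: (m - n)%N a => // i IH a.
apply: ipow_ind => [|x y _ py]; first exact: ipow_ideal.
by apply: idealM; [apply: ipow_ideal | apply: IH].
Qed.

Lemma ipow_sub n a : ideal I -> (0 < n)%N -> ipow n a -> I a.
Proof.
move=> idI n0 /(ipow_le n0); apply: (ipow_ind idI) => x y Ix _; exact: (ideal_mulr idI).
Qed.

End IdealPowers.

Lemma ipow_hom (R S : comNzRingType) (f : {rmorphism R -> S}) (I : R -> Prop)
    (J : S -> Prop) n m a :
  (forall x, I x -> ipow J m (f x)) -> ipow I n a -> ipow J (n * m) (f a).
Proof.
move=> IJ; elim: n a => // n IH a.
pose P x := ipow J (n.+1 * m) (f x).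
have idP : ideal P.
  split; rewrite /P.
  - rewrite rmorph0; exact: (ideal0 (ipow_ideal J (n.+1 * m))).
  - by move=> x y px py; rewrite rmorphD; exact: (idealD (ipow_ideal J (n.+1 * m))).
  - by move=> r x px; rewrite rmorphM; exact: (idealM (ipow_ideal J (n.+1 * m))).
apply: (ipow_ind idP) => x y Ix py; rewrite /P rmorphM mulSn.
by apply: ipowM; [apply: IJ | apply: IH].
Qed.

Lemma ipow_mono (R : comNzRingType) (I J : R -> Prop) n a :
  (forall x, I x -> J x) -> ipow I n a -> ipow J n a.
Proof.
move=> IJ; elim: n a => // n IH a; apply: ipow_ind; first exact: ipow_ideal.
by move=> x y /IJ Jx /IH; apply: ipowS.
Qed.

Section Krull.
Variables (R : comNzRingType) (V : lmodType R).
Hypotheses (nR : noeth R) (nV : noethM V).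

(** Krull's intersection theorem without Artin-Rees. Choose [K] maximal among the submodules
    containing [N + m v] whose multiples of [v] all lie in [N + m v]. By maximality each element of
    [m] is nilpotent modulo [K], so a power of [m] sends all of [V] into [K]; hence [v] lies in [K],
    and then in [N + m v]. *)
Lemma krull (m : R -> Prop) (N : V -> Prop) (v : V) : ideal m -> submod N ->
  (forall M, exists n, N n /\
     mspan (fun u => exists a w, ipow m M a /\ u = a *: w) (v - n)) ->
  exists a, m a /\ N ((1 - a) *: v).
Proof.
move=> idm sN vM.
pose N1 u := exists n a, [/\ N n, m a & u = n + a *: v].
have sN1 : submod N1.
  split.
  - exists 0, 0; split; [exact: submod0 sN | exact: ideal0 idm | by rewrite scale0r addr0].
  - move=> _ _ [n [a [Nn ma ->]]] [n' [a' [Nn' ma' ->]]]; exists (n + n'), (a + a').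
    split; [exact: submodD | exact: idealD | by rewrite scalerDl addrACA].
  - move=> r _ [n [a [Nn ma ->]]]; exists (r *: n), (r * a).
    split; [exact: submodZ | exact: idealM | by rewrite scalerDr scalerA].
pose Q (K : V -> Prop) := forall r, K (r *: v) -> N1 (r *: v).
have [K [sK QK N1K Kmax]] := @noeth_max _ _ Q N1 nV sN1 (fun r h => h).
have nilp x : m x -> exists s, forall u, K (x ^+ s *: u).
  move=> mx; have [||s hs] := @noeth_acc _ _ (fun s u => K (x ^+ s *: u)) nV.
  - move=> s; split; first by rewrite scaler0; exact: submod0 sK.
      by move=> u w Ku Kw; rewrite scalerDr; exact: submodD sK _ _ Ku Kw.
    by move=> a u Ku; rewrite scalerA mulrC -scalerA; exact: submodZ sK _ _ Ku.
  - by move=> s u Ku; rewrite exprS -scalerA; exact: submodZ sK _ _ Ku.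
  (* [K + x^s V] has the defining property of [K] as well, so it equals [K]. *)
  pose K' u := exists c w, K c /\ u = c + x ^+ s *: w.
  exists s => u; apply: (Kmax K').
  - split.
    + by exists 0, 0; rewrite scaler0 addr0; split=> //; exact: submod0 sK.
    + move=> _ _ [c [w [Kc ->]]] [c' [w' [Kc' ->]]]; exists (c + c'), (w + w').
      by rewrite scalerDr addrACA; split=> //; exact: submodD sK _ _ Kc Kc'.
    + move=> a _ [c [w [Kc ->]]]; exists (a *: c), (a *: w).
      rewrite scalerDr !scalerA [a * _]mulrC -scalerA; split=> //; exact: submodZ sK _ _ Kc.
  - move=> r [c [w [Kc E]]]; apply: QK; rewrite E; apply: (submodD sK) => //.
    apply: (hs s.+1); have : N1 (x *: (r *: v)).
      exists 0, (x * r); rewrite add0r scalerA.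
      by split=> //; [exact: submod0 sN | apply: ideal_mulr].
    move=> /N1K; rewrite E scalerDr scalerA -exprS => h.
    rewrite -[X in K X](addKr (x *: c)); apply: (submodD sK) => //.
    by apply: (submodN sK); apply: (submodZ sK).
  - by move=> w Kw; exists w, 0; rewrite scaler0 addr0.
  - by exists 0, u; rewrite add0r; split=> //; exact: submod0 sK.
(* [C i] consists of the vectors sent into [K] by the [i]-th power of [m]. The chain stabilizes at
   some [M], and [C M] turns out to be everything. *)
pose C := fix C i : V -> Prop :=
  if i is j.+1 then fun u => forall a, m a -> C j (a *: u) else K.
have sC i : submod (C i).
  elim: i => [//|i IH]; split=> [a ma|u w Cu Cw a ma|r u Cu a ma].
  - by rewrite scaler0; exact: submod0 IH.
  - by rewrite scalerDr; exact: submodD IH _ _ (Cu a ma) (Cw a ma).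
  - rewrite scalerA mulrC -scalerA; exact: submodZ IH _ _ (Cu a ma).
have Cup i u : C i u -> C i.+1 u by move=> Ci a ma; exact: submodZ (sC i) _ _ Ci.
have [M hM] := noeth_acc nV sC Cup.
have CM u : C M u.
  apply: contrapT => nu; have [s [sm gen]] := nR idm.
  (* Multiply a vector outside [C M] by the last power of each generator that keeps it outside. *)
  have [w [nw hw]] : exists w, ~ C M w /\ forall x, x \in s -> C M (x *: w).
    elim: s sm {gen} => [|x s IH] sm; first by exists u.
    have [|w [nw hw]] := IH; first by move=> y ys; apply: sm; rewrite inE ys orbT.
    have [t ht] := nilp x (sm x (mem_head _ _)).
    have ext : exists t, `[< C M (x ^+ t *: w) >].
      exists t; apply/asboolP; apply: hM (0%N) _ _; exact: ht.
    case: (ex_minnP ext) => -[|t'] /asboolP ct mint.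
      by case: nw; rewrite -[w]scale1r -(expr0 x).
    exists (x ^+ t' *: w); split.
      by move=> ct'; have := mint t'; rewrite ltnn => h; have := h (introT (asboolP _) ct').
    move=> y; rewrite inE => /orP[/eqP->|ys]; first by rewrite scalerA -exprS.
    rewrite scalerA mulrC -scalerA; exact: submodZ (sC M) _ _ (hw y ys).
  apply: nw; apply: (hM M.+1) => a /gen[n [c [d [dD ->]]]].
  rewrite scaler_suml; apply: (submod_sum (sC M)) => i _.
  by rewrite -scalerA; apply: (submodZ (sC M)); apply: hw.
have powK i a u : ipow m i a -> C i u -> K (a *: u).
  elim: i a u => [|i IH] a u pa Cu; first exact: submodZ sK _ _ Cu.
  apply: (@ipow_ind _ _ _ (fun a => K (a *: u)) _ _ _ pa).
    split=> [|x y Kx Ky|r x Kx]; first by rewrite scale0r; exact: submod0 sK.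
      by rewrite scalerDl; exact: submodD sK _ _ Kx Ky.
    by rewrite -scalerA; exact: submodZ sK _ _ Kx.
  by move=> x y mx py; rewrite mulrC -scalerA; apply: IH => //; apply: Cu.
have [n [Nn vn]] := vM M.
have Kv : K v.
  rewrite -(GRing.subrK n v); apply: (submodD sK).
    by apply: (mspan_sub sK _ vn) => _ [a [w [pa ->]]]; apply: powK pa (CM w).
  apply: N1K; exists n, 0; split=> //; first exact: ideal0.
  by rewrite scale0r addr0.
have [n' [a [Nn' ma E]]] : N1 v by rewrite -(scale1r v); apply: QK; rewrite scale1r.
by exists a; split=> //; rewrite scalerBl scale1r {1}E addrK.
Qed.

End Krull.

Lemma krull_ideal (R : comNzRingType) (m I : R -> Prop) (v : R) : noeth R -> ideal m ->
  ideal I -> (forall M, exists n, I n /\ ipow m M (v - n)) ->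
  exists a, m a /\ I ((1 - a) * v).
Proof.
move=> nR idm idI h; apply: (@krull R R^o nR nR m I v) => // M.
have [n [In pn]] := h M; exists n; split=> //; apply: mspan_in.
by exists (v - n), 1; rewrite /GRing.scale /= mulr1.
Qed.

(** * The Nullstellensatz *)

Section Nullstellensatz.
Variable k : closedFieldType.
Notation alg := (comUnitAlgType k).

Section Domain.
Variables (R : comNzRingType) (c : {rmorphism k -> R}).
Hypothesis domR : forall x y : R, x * y = 0 -> x = 0 \/ y = 0.

(** Degrees are compared after applying the possibly non-injective [e]; this discards the top
    coefficients that [e] kills. *)
Lemma map_trunc (S : idomainType) (e : {rmorphism S -> R}) (f : {poly S}) :
  exists g : {poly S}, map_poly e g = map_poly e f /\ size g = size (map_poly e f).
Proof.
pose n := size (map_poly e f); exists (\poly_(i < n) f`_i).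
have E : map_poly e (\poly_(i < n) f`_i) = map_poly e f.
  apply/polyP => i; rewrite coef_map coef_poly /=; case: ltnP => [_|ni].
    by rewrite coef_map.
  by rewrite rmorph0 nth_default.
split=> //; apply/eqP; rewrite eqn_leq size_poly /= -/n /n -[in X in (X <= _)%N]E.
exact: size_poly.
Qed.

(** Induction on the variables. If the last value [xi] is transcendental over the others, specialize
    so that a nonzero coefficient of [q] survives and give the last variable any value avoiding the
    roots. Otherwise take a relation [p] of least degree: some combination [u q + w p] is a nonzero
    constant [s], and a specialization keeping [s] and the leading coefficient of [p] nonzero
    extends to a root of [p], at which [q] cannot vanish. *)
Lemma nss_domain n (x : nat -> R) (q : Pol k n) : ev c x n q <> 0 ->
  exists v : nat -> k, (forall p, ev c x n p = 0 -> ev idfun v n p = 0) /\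
    ev idfun v n q <> 0.
Proof.
elim: n q => [|n IH] q.
  move=> q0; exists (fun=> 0); split=> [p /= cp0|/= qq0].
    by apply/eqP; rewrite -(fmorph_eq0 c) cp0.
  by apply: q0; rewrite /= qq0 rmorph0.
set e := ev c x n in IH; set xi := x n => /= q0.
have evE f : ev c x n.+1 f = (map_poly e (f : {poly _})).[xi] by [].
have vE v f : ev idfun v n.+1 f = (map_poly (ev idfun v n) (f : {poly _})).[v n] by [].
have ext v y : exists v', v' n = y /\ forall p, ev idfun v' n p = ev idfun v n p :> k.
  exists (fun i => if (i < n)%N then v i else y); rewrite ltnn; split=> // p.
  apply: (ev_nat (f := [the {rmorphism k -> k} of idfun])) => //= i ilt; by rewrite ilt.
have [[p0 [p0x p00]]|trans] := pselect (exists p : {poly (Pol k n)},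
    (map_poly e p).[xi] = 0 /\ map_poly e p <> 0); last first.
  have [i qi] : exists i, e (q : {poly _})`_i <> 0.
    apply: contrapT => /forallNP h; apply: q0; rewrite ev_stepE.
    suff -> : map_poly e q = 0 by rewrite horner0.
    by apply/polyP => i; rewrite coef_map coef0; apply: contrapT (h i).
  have [v [vker vq]] := IH _ qi.
  have : map_poly (ev idfun v n) q != 0.
    by apply/eqP => /polyP/(_ i); rewrite coef_map coef0.
  move=> /closed_nonrootP[y qy]; have [v' [v'n v'E]] := ext v y.
  have mE f : map_poly (ev idfun v' n) f = map_poly (ev idfun v n) f.
    by apply/polyP => j; rewrite !coef_map; exact: v'E.
  exists v'; split=> [p|]; rewrite vE v'n mE; last exact/eqP.
  rewrite evE => px; suff -> : map_poly (ev idfun v n) p = 0 by rewrite horner0.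
  apply/polyP => j; rewrite coef_map coef0; apply: vker.
  have p0 : map_poly e p = 0 by apply: contrapT => h; apply: trans; exists p.
  by have := congr1 (fun f : {poly R} => f`_j) p0; rewrite coef_map coef0.
pose Q m := `[< exists p : {poly (Pol k n)}, [/\ (map_poly e p).[xi] = 0,
  map_poly e p <> 0 & size (map_poly e p) = m] >].
have exQ : exists m, Q m by exists (size (map_poly e p0)); apply/asboolP; exists p0.
case: (ex_minnP exQ) => d /asboolP[p1 [p1x p10 p1s]] dmin.
have {}dmin f : (map_poly e f).[xi] = 0 -> (size (map_poly e f) < d)%N -> map_poly e f = 0.
  move=> fx fs; apply: contrapT => f0; move: fs; rewrite ltnNge dmin //.
  by apply/asboolP; exists f.
have [p [pE ps]] := map_trunc e p1.
have {p1x} px : (map_poly e p).[xi] = 0 by rewrite pE.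
have {p10} pn0 : map_poly e p <> 0 by rewrite pE.
have {p1s} ped : size (map_poly e p) = d by rewrite pE.
have {ps pE} pd : size p = d by rewrite ps -pE.
have lcE (f : {poly (Pol k n)}) : size (map_poly e f) = size f -> map_poly e f <> 0 ->
    e (lead_coef f) <> 0.
  move=> sf f0; rewrite lead_coefE -sf -coef_map -lead_coefE; apply/eqP.
  by rewrite lead_coef_eq0; apply/eqP.
pose a := lead_coef p; have ea : e a <> 0 by apply: lcE; rewrite ?ped ?pd.
have eX (b : Pol k n) m : e b <> 0 -> e (b ^+ m) <> 0.
  move=> eb; elim: m => [|m IHm]; first by rewrite rmorph1; apply/eqP/oner_neq0.
  by rewrite exprS rmorphM => /domR[].
have d2 : (1 < d)%N.
  rewrite -ped ltnNge; apply/negP => /size1_polyC pC; move: px; rewrite pC hornerC => h.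
  by apply: pn0; rewrite pC h.
have pneq0 : p != 0 by rewrite -size_poly_gt0 pd ltnW.
have pdiv (f g : {poly (Pol k n)}) : g != 0 -> exists m u r,
    lead_coef g ^+ m *: f = u * g + r /\ (size r < size g)%N.
  move=> g0; exists (scalp f g), (f %/ g), (f %% g).
  by rewrite Pdiv.Idomain.divp_eq ltn_modpN0.
have eZ (b : Pol k n) (f : {poly (Pol k n)}) : map_poly e (b *: f) = e b *: map_poly e f.
  exact: map_polyZ.
(* Bezout through a least degree: a nonzero [u q + w p] of least degree has smaller degree than [p],
   so it does not vanish at [xi]; it pseudo-divides [p], and minimality of [p] makes it constant. *)
pose Q2 m := `[< exists u w : {poly (Pol k n)}, map_poly e (u * q + w * p) <> 0 /\
  size (map_poly e (u * q + w * p)) = m >].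
have exQ2 : exists m, Q2 m.
  exists d; apply/asboolP; exists 0, 1; by rewrite mul0r mul1r add0r.
case: (ex_minnP exQ2) => m /asboolP[u [w [g0 gm]]] mmin.
have {}mmin u' w' : (size (map_poly e (u' * q + w' * p)) < m)%N ->
    map_poly e (u' * q + w' * p) = 0.
  move=> fs; apply: contrapT => f0; move: fs; rewrite ltnNge mmin //.
  by apply/asboolP; exists u', w'.
have [g [gE gs]] := map_trunc e (u * q + w * p); rewrite -gE in g0 gm.
have {}gs : size g = m by rewrite gs -gE.
have md : (m < d)%N.
  have [l [u' [r [rE rd]]]] := pdiv q p pneq0; rewrite ltnNge; apply/negP => dm.
  have r0 : map_poly e r = 0.
    have -> : r = (a ^+ l)%:P * q + (- u') * p.
      by rewrite mul_polyC rE mulNr addrAC subrr add0r.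
    apply: mmin; have -> : (a ^+ l)%:P * q + (- u') * p = r.
      by rewrite mul_polyC rE mulNr addrAC subrr add0r.
    apply: leq_ltn_trans (size_poly _ _) _; apply: leq_trans dm; by rewrite -pd.
  have := congr1 (fun f => (map_poly e f).[xi]) rE.
  rewrite eZ hornerZ rmorphD rmorphM /= r0 addr0 hornerM px mulr0 => /domR[]//.
  exact: eX.
have gx : (map_poly e g).[xi] <> 0.
  by move=> gx; apply: g0; apply: dmin => //; rewrite gm.
have gneq0 : g != 0 by apply/eqP => g00; apply: g0; rewrite g00 rmorph0.
have elg : e (lead_coef g) <> 0 by apply: lcE; rewrite ?gm ?gs.
have m1 : m = 1%N.
  have [l [u1 [r [rE rd]]]] := pdiv p g gneq0.
  have r0 : map_poly e r = 0.
    have E : map_poly e r = map_poly e ((- (u1 * u)) * q + ((lead_coef g ^+ l)%:P - u1 * w) * p).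
      have -> : r = lead_coef g ^+ l *: p - u1 * g by rewrite rE addrAC subrr add0r.
      rewrite rmorphB rmorphM /= gE -rmorphM -rmorphB /= -mul_polyC; congr map_poly.
      by ring.
    rewrite E; apply: mmin; rewrite -E; apply: leq_ltn_trans (size_poly _ _) _.
    by rewrite -gs.
  have E := congr1 (map_poly e) rE; rewrite eZ rmorphD rmorphM /= r0 addr0 in E.
  have u1x : (map_poly e u1).[xi] = 0.
    have := congr1 (fun f : {poly R} => f.[xi]) E; rewrite hornerZ px mulr0 hornerM => /esym/domR[]//.
  have np : e (lead_coef g ^+ l) *: map_poly e p <> 0.
    move=> h; have := congr1 (fun f : {poly R} => f`_d.-1) h.
    rewrite coefZ coef0 coef_map /= -{1}pd -lead_coefE => /domR[]; [exact: eX | exact: ea].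
  have u10 : map_poly e u1 <> 0 by move=> h; apply: np; rewrite E h mul0r.
  have lcm : lead_coef (map_poly e u1) * lead_coef (map_poly e g) != 0.
    by apply/eqP => /domR[] /eqP; rewrite lead_coef_eq0 => /eqP.
  have su : (d <= size (map_poly e u1))%N.
    rewrite leqNgt; apply/negP => h; exact: u10 (dmin _ u1x h).
  have := size_proper_mul lcm; rewrite -E gm => sE.
  have : (size (e (lead_coef g ^+ l) *: map_poly e p) <= d)%N.
    by rewrite -ped; apply: size_scale_leq.
  have : (0 < m)%N by rewrite -gs size_poly_gt0.
  by move: su; rewrite sE; lia.
have [s sE] : exists s, map_poly e (u * q + w * p) = (e s)%:P /\ e s <> 0.
  exists g`_0; have gC : g = (g`_0)%:P by apply: size1_polyC; rewrite gs m1.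
  rewrite -gE {1}gC map_polyC; split=> // h; apply: g0.
  by rewrite gC map_polyC /= h polyC0.
have [|v [vker vas]] := IH (a * s).
  rewrite -/e rmorphM => /domR[]//; by case: sE.
set f0 := ev idfun v n in vker vas.
have mker f : map_poly e f = 0 -> map_poly f0 f = 0.
  move=> h; apply/polyP => j; rewrite coef_map coef0; apply: vker.
  by have := congr1 (fun f : {poly R} => f`_j) h; rewrite coef_map coef0.
have va : f0 a != 0.
  by apply/eqP => h; apply: vas; rewrite rmorphM h mul0r.
have vs : f0 s != 0.
  by apply/eqP => h; apply: vas; rewrite rmorphM h mulr0.
have : size (map_poly f0 p) != 1%N.
  by rewrite size_map_poly_id0 // pd; apply: contraTneq d2 => ->.
move=> /closed_rootP[y /eqP py]; have [v' [v'n v'E]] := ext v y.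
have mE f : map_poly (ev idfun v' n) f = map_poly f0 f.
  by apply/polyP => j; rewrite !coef_map; exact: v'E.
exists v'; split=> [f|]; rewrite vE v'n mE.
  rewrite evE => fx; have [l [u1 [r [rE rd]]]] := pdiv f p pneq0.
  have r0 : map_poly e r = 0.
    apply: dmin; last by apply: leq_ltn_trans (size_poly _ _) _; rewrite -pd.
    have := congr1 (fun f => (map_poly e f).[xi]) rE.
    by rewrite eZ hornerZ fx mulr0 rmorphD rmorphM /= hornerD hornerM px mulr0 add0r.
  have := congr1 (fun f => (map_poly f0 f).[y]) rE.
  rewrite map_polyZ hornerZ rmorphD rmorphM /= (mker _ r0) addr0 hornerM py mulr0.
  by move/eqP; rewrite rmorphXn mulf_eq0 expf_eq0 (negPf va) andbF => /eqP.
case: sE => sE es qy; have : map_poly f0 (u * q + w * p - s%:P) = 0.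
  by apply: mker; rewrite rmorphB /= sE map_polyC subrr.
move/(congr1 (fun f : {poly k} => f.[y])); rewrite rmorphB rmorphD !rmorphM /= !hornerE.
rewrite map_polyC hornerC qy py !mulr0 add0r sub0r => /eqP; rewrite oppr_eq0.
by rewrite (negPf vs).
Qed.
End Domain.

(** A non-nilpotent element is nonzero at a point with values in some field; [nss_domain] moves the
    values of the generators into [k]. *)
Lemma nullstellensatz (A : alg) (a : A) : fin_gen A -> (forall n, a ^+ n <> 0) ->
  exists f : {lrmorphism A -> k^o}, f a <> 0.
Proof.
move=> [n [x gx]] an.
have [K [f [fK fa]]] : exists (K : alg) (f : {lrmorphism A -> K}), is_field K /\ f a <> 0.
  apply: contrapT => h; have [|m /an//] := @nilpotent_or_field_point _ A a.
  by move=> K f fK; apply: contrapT => fa; apply: h; exists K, f.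
have domK (y z : K) : y * z = 0 -> y = 0 \/ z = 0.
  move=> yz; have [->|/fK uy] := eqVneq y 0; [by left | right].
  by apply: (mulrI uy); rewrite yz mulr0.
have fev p : f (ev (in_alg A) x n p) = ev (in_alg K) (f \o x) n p.
  by apply: ev_nat => // b; apply: (lrmorph_alg f).
have [q qa] := gx a; have [|v [vker vq]] := @nss_domain K (in_alg K) domK n (f \o x) q.
  by rewrite -fev qa.
have [|||h hE] := @quot_lift _ (Pol k n) (polc k n) A (ev (in_alg A) x n) k^o (ev idfun v n) gx.
- by move=> b; rewrite ev_polc.
- by move=> b; rewrite ev_polc /GRing.scale /= mulr1.
- by move=> p px; apply: vker; rewrite -fev px lr0.
by exists h; rewrite -qa hE.
Qed.

End Nullstellensatz.

(** * Evaluation of polynomials and presentations of étale covers *)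

Lemma mpoly_gen_ind (R : comNzRingType) n (P : {mpoly R[n]} -> Prop) :
  (forall a, P a%:MP) -> (forall i, P 'X_i) ->
  (forall p q, P p -> P q -> P (p + q)) -> (forall p q, P p -> P q -> P (p * q)) ->
  forall p, P p.
Proof.
move=> hC hX hD hM; have P1 : P 1 by rewrite -mpolyC1.
have PX m : P 'X_[m].
  rewrite mpolyXE_id; elim/big_rec: _ => // i x _ Px; apply: (hM) => //.
  by elim: (m i) => [//|j Pj]; rewrite exprS; apply: hM.
elim/mpolyind => [|c m p _ _ Pp]; first by rewrite -mpolyC0.
by apply: hD => //; rewrite -mul_mpolyC; apply: hM.
Qed.

Lemma mpoly_hom_eq (R S : comNzRingType) n (f g : {rmorphism {mpoly R[n]} -> S}) :
  (forall a, f a%:MP = g a%:MP) -> (forall i, f 'X_i = g 'X_i) -> f =1 g.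
Proof.
move=> hC hX; apply: mpoly_gen_ind => // p q E E'; first by rewrite !rmorphD E E'.
by rewrite !rmorphM E E'.
Qed.

Definition mev (R S : comNzRingType) n (f : {rmorphism R -> S}) (b : 'I_n -> S) :
  {rmorphism {mpoly R[n]} -> S} := [the {rmorphism {mpoly R[n]} -> S} of mmap f b].

Lemma mevC (R S : comNzRingType) n (f : {rmorphism R -> S}) (b : 'I_n -> S) a :
  mev f b a%:MP = f a.
Proof. exact: mmapC. Qed.

Lemma mevXi (R S : comNzRingType) n (f : {rmorphism R -> S}) (b : 'I_n -> S) i :
  mev f b 'X_i = b i.
Proof. by rewrite /mev /= mmapX mmap1U. Qed.

Definition mmor (R S : comNzRingType) n (f : {rmorphism R -> S}) :
    {rmorphism {mpoly R[n]} -> {mpoly S[n]}} :=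
  [the {rmorphism {mpoly R[n]} -> {mpoly S[n]}} of map_mpoly f].

Lemma mmorC (R S : comNzRingType) n (f : {rmorphism R -> S}) a :
  mmor n f a%:MP = (f a)%:MP.
Proof. exact: map_mpolyC. Qed.

Lemma mmorXi (R S : comNzRingType) n (f : {rmorphism R -> S}) i :
  mmor n f 'X_i = 'X_i.
Proof. by rewrite /mmor /= map_mpolyX. Qed.

Lemma mmor_coef (R S : comNzRingType) n (f : {rmorphism R -> S}) p m :
  (mmor n f p)@_m = f p@_m.
Proof. exact: mcoeff_map_mpoly. Qed.

Lemma mev_nat (R S T : comNzRingType) n (f : {rmorphism R -> S}) (b : 'I_n -> S)
    (g : {rmorphism S -> T}) (h : {rmorphism R -> T}) (d : 'I_n -> T) p :
  (forall a, g (f a) = h a) -> (forall i, g (b i) = d i) ->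
  g (mev f b p) = mev h d p.
Proof.
move=> gf gb; pose gg := [the {rmorphism {mpoly R[n]} -> T} of g \o mev f b].
apply: (@mpoly_hom_eq _ _ _ gg) => [a|i] /=.
  by rewrite -[mmap f b _]/(mev f b _) !mevC.
by rewrite -[mmap f b _]/(mev f b _) !mevXi.
Qed.

Lemma mev_mmor (R S T : comNzRingType) n (f : {rmorphism R -> S})
    (g : {rmorphism S -> T}) (h : {rmorphism R -> T}) (d : 'I_n -> T) p :
  (forall a, g (f a) = h a) -> mev g d (mmor n f p) = mev h d p.
Proof.
move=> gf; pose gg := [the {rmorphism {mpoly R[n]} -> T} of mev g d \o mmor n f].
apply: (@mpoly_hom_eq _ _ _ gg) => [a|i].
  by rewrite [LHS](_ : _ = mev g d (mmor n f a%:MP)) // mmorC !mevC.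
by rewrite [LHS](_ : _ = mev g d (mmor n f 'X_i)) // mmorXi !mevXi.
Qed.

Lemma idspan_fin (R : comNzRingType) (T : finType) (r : T -> R) x :
  idspan (fun y => exists i, y = r i) x <-> exists c, x = \sum_i c i * r i.
Proof.
split=> [|[c ->]].
  apply: (@idspan_sub _ _ (fun x => exists c : T -> R, x = \sum_i c i * r i)).
    split; first by exists (fun=> 0); rewrite big1 // => i; rewrite mul0r.
      move=> _ _ [c ->] [d ->]; exists (fun i => c i + d i).
      by rewrite -big_split; apply: eq_bigr => i _; rewrite mulrDl.
    move=> a _ [c ->]; exists (fun i => a * c i).
    by rewrite mulr_sumr; apply: eq_bigr => i _; rewrite mulrA.
  move=> _ [i ->]; exists (fun j => (j == i)%:R).
  by rewrite (bigD1 i) //= eqxx mul1r big1 ?addr0 // => j /negPf ->; rewrite mul0r.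
apply: ideal_sum => [|i _]; first exact: idspan_ideal.
by apply: idealM; [apply: idspan_ideal | apply: idspan_in; exists i].
Qed.

Section Covers.
Variable k : closedFieldType.
Notation alg := (comUnitAlgType k).

Lemma finite_subalgebra (A : alg) (s : seq A) :
  exists (A0 : alg) (j : {lrmorphism A0 -> A}),
    [/\ fin_gen A0, injective j & forall x, x \in s -> exists x0, j x0 = x].
Proof.
pose n := size s; pose x i := s`_i.
have [||A0 [p [ps pk pc]]] := @quot_exists _ (Pol k n) (polc k n)
   (fun q => ev (in_alg A) x n q = 0).
- split=> [|u v hu hv|r u hu]; first by rewrite rmorph0.
    by rewrite rmorphD hu hv addr0.
  by rewrite rmorphM hu mulr0.
- by rewrite rmorph1; apply/eqP/oner_neq0.
have [||||j jE] := @quot_lift _ (Pol k n) (polc k n) A0 p A (ev (in_alg A) x n) => //.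
- by move=> a; rewrite ev_polc.
- by move=> q /pk.
exists A0, j; split.
- exists n, (fun i => p (polX k n i)) => a; have [q <-] := ps a; exists q.
  rewrite -[in RHS](ev_self q); symmetry; apply: ev_nat => // b; exact: pc.
- move=> a b ab; have [q qa] := ps (a - b); apply/eqP; rewrite -subr_eq0 -qa.
  by apply/eqP/pk; rewrite -jE qa lrB ab subrr.
- move=> y ys; exists (p (polX k n (index y s))); rewrite jE ev_polX ?index_mem //.
  by rewrite /x nth_index.
Qed.

(** Finitely many polynomials have finitely many coefficients, so a finite algebraic situation
    descends to a finitely generated, hence Noetherian, subalgebra. *)
Lemma finite_subalgebra_mpoly (A : alg) n (T : finType) (P : T -> {mpoly A[n]}) :
  exists (A0 : alg) (j : {lrmorphism A0 -> A}),
    [/\ fin_gen A0, injective j & exists P0 : T -> {mpoly A0[n]},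
       forall t, mmor n j (P0 t) = P t].
Proof.
pose s := flatten [seq [seq (P t)@_m | m <- msupp (P t)] | t <- enum T].
have [A0 [j [fg inj lft]]] := finite_subalgebra s; exists A0, j; split=> //.
suff h t : exists p0, mmor n j p0 = P t by have [P0 P0E] := ex_choice h; exists P0.
have [u uE] : exists u : 'X_{1..n} -> A0, forall m, m \in msupp (P t) -> j (u m) = (P t)@_m.
  apply: (@ex_choice _ _ (fun m x => m \in msupp (P t) -> j x = (P t)@_m)) => m.
  have [ms|_] := boolP (m \in msupp (P t)); last by exists 0.
  have [|x xE] := lft (P t)@_m; last by exists x.
  apply/flattenP; exists [seq (P t)@_m | m <- msupp (P t)]; last exact: map_f.
  by apply: map_f; rewrite mem_enum.
exists (\sum_(m <- msupp (P t)) u m *: 'X_[m]); rewrite rmorph_sum [RHS]mpolyE.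
apply: eq_big_seq => m ms /=; rewrite map_mpolyZ map_mpolyX; congr (_ *: _); exact: uE.
Qed.

Lemma mmor_inj (R S : comNzRingType) n (f : {rmorphism R -> S}) :
  injective f -> injective (mmor n f).
Proof.
move=> inj p q pq; apply/mpolyP => m; apply: inj.
by have := congr1 (mcoeff m) pq; rewrite !mmor_coef.
Qed.

Lemma fin_gen_mpoly (A T : alg) n (p : {rmorphism {mpoly A[n]} -> T}) : fin_gen A ->
  (forall a : k, p (a%:A)%:MP = a%:A) -> (forall y, exists x, p x = y) -> fin_gen T.
Proof.
move=> [N [x gx]] pc ps.
pose y i := if (i < N)%N then p (x i)%:MP else
  match insub (i - N)%N with Some j => p 'X_j | None => 0 end.
exists (N + n)%N, y => b; have [q <-] := ps b.
elim/mpoly_gen_ind: q => [a|i|q r [u uE] [v vE]|q r [u uE] [v vE]].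
- have [q <-] := gx a; elim/pol_ind: q => [c|i ilt|q r [u uE] [v vE]|q r [u uE] [v vE]].
  + by exists (polc k _ c); rewrite !ev_polc pc.
  + exists (polX k _ i); rewrite !ev_polX //; first by rewrite /y ilt.
    exact: leq_trans (leq_addr _ _).
  + by exists (u + v); rewrite !rmorphD /= uE vE.
  + by exists (u * v); rewrite !rmorphM /= uE vE.
- exists (polX k _ (N + i)); rewrite ev_polX ?ltn_add2l // /y ltnNge leq_addr /=.
  by rewrite addnC addnK valK.
- by exists (u + v); rewrite !rmorphD /= uE vE.
- by exists (u * v); rewrite !rmorphM /= uE vE.
Qed.

(* A presentation A[x]/(r) with a retraction [xi] modulo the square of the ideal:
   the Jacobian criterion of smoothness in a coordinate-free form. *)
Definition smooth_cover (A B : alg) (f : {lrmorphism A -> B}) : Prop :=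
  exists n (b : 'I_n -> B) m (r : 'I_m -> {mpoly A[n]}) (xi : 'I_n -> {mpoly A[n]}),
  let I := idspan (fun y => exists i, y = r i) in
  [/\ forall y, exists p, mev f b p = y,
      forall p, mev f b p = 0 <-> I p,
      forall j, I (xi j - 'X_j),
      forall i, ipow I 2 (mev (mpolyC n (R := A)) xi (r i))
    & forall (K : alg) (x : {lrmorphism A -> K}), is_field K ->
        exists (L : alg) (i : {lrmorphism K -> L}) (y : {lrmorphism B -> L}),
          is_field L /\ y \o f =1 i \o x].

Definition mconst (A : alg) n : {rmorphism k -> {mpoly A[n]}} :=
  [the {rmorphism k -> {mpoly A[n]}} of mpolyC n (R := A) \o in_alg A].

(** [A[x]/I^2] is a square-zero thickening of [B]. Formal étaleness splits it over [A], and lifting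
    the images of the generators gives the retraction [xi]. *)
Lemma etale_smooth_cover (A B : alg) (f : {lrmorphism A -> B}) :
  etale_cover f -> smooth_cover f.
Proof.
case=> [[n [b [m [r [bs bk]]]]] fe fs].
exists n, b, m, r; pose I := idspan (fun y => exists i, y = r i).
have Ik p : mev f b p = 0 <-> I p by rewrite /I idspan_fin; exact: bk.
have I2 : ~ ipow I 2 1.
  move=> /(ipow_sub (idspan_ideal _) (n := 2) isT) /Ik; rewrite rmorph1; apply/eqP/oner_neq0.
have [C [p [ps pk pc]]] := quot_exists (mconst A n) (ipow_ideal I 2) I2.
have [||h hE] := @quot_lift _ _ (mconst A n) C p B (mev f b) ps pc.
- by move=> a; exact: (etrans (mevC f b a%:A) (lrmorph_alg f a)).
- by move=> x /pk/(ipow_sub (idspan_ideal _) (n := 2) isT)/Ik.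
have [||||a aE] := @quot_lift _ A (in_alg A) A [the {rmorphism A -> A} of idfun] C
   [the {rmorphism A -> C} of p \o mpolyC n (R := A)] => //.
- by move=> y; exists y.
- by move=> x /= ->; rewrite !rmorph0.
have [||[g [ga gh]] _] := fe C B h a (lr_id B).
- split=> [d|c c' hc hc'].
    by have [q <-] := bs d; exists (p q); rewrite hE.
  have [q qc] := ps c; have [q' qc'] := ps c'; rewrite -qc -qc' -rmorphM; apply/pk.
  apply: ipowS; first by apply/Ik; rewrite -hE qc.
  by apply: ipow1; apply/Ik; rewrite -hE qc'.
- by move=> x /=; rewrite aE /= hE; apply: mevC.
have [xi xiE] := ex_choice (fun j => ps (g (b j))).
exists xi; split=> //.
  move=> j; apply/Ik; rewrite rmorphB mevXi -hE xiE; have := gh (b j); rewrite /= => ->; exact: subrr.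
move=> i; apply/pk; have -> : p (mev (mpolyC n (R:=A)) xi (r i)) = g (mev f b (r i)).
  rewrite (mev_nat (h := [the {rmorphism A -> C} of p \o mpolyC n (R:=A)]) (d := g \o b)) //.
  symmetry; apply: mev_nat => // x; rewrite -aE; exact: ga.
by rewrite (proj2 (Ik _)) ?lr0 //; apply: idspan_in; exists i.
Qed.

End Covers.

(** * Purity of étale covers *)

Section Purity.
Variable k : closedFieldType.
Notation alg := (comUnitAlgType k).

Lemma kernel_ideal (A B : alg) (f : {lrmorphism A -> B}) : ideal (fun a => f a = 0).
Proof.
split=> [|x y fx fy|r x fx]; first exact: rmorph0.
  by rewrite lrD fx fy addr0.
by rewrite lrM fx mulr0.
Qed.

(** The conductor of [v] into the span of the [w t]: the linear system is solvable over [A] exactly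
    when this ideal contains 1. *)
Definition combos (A : alg) (K T : finType) (v : K -> A) (w : T -> K -> A) (a : A) :=
  exists c : T -> A, forall x, a * v x = \sum_t c t * w t x.

Lemma combos_ideal (A : alg) (K T : finType) (v : K -> A) (w : T -> K -> A) :
  ideal (combos v w).
Proof.
split.
- by exists (fun=> 0) => x; rewrite mul0r big1 // => t _; rewrite mul0r.
- move=> a b [c cE] [d dE]; exists (fun t => c t + d t) => x.
  by rewrite mulrDl cE dE -big_split; apply: eq_bigr => t _; rewrite mulrDl.
- move=> r a [c cE]; exists (fun t => r * c t) => x.
  by rewrite -mulrA cE mulr_sumr; apply: eq_bigr => t _; rewrite mulrA.
Qed.

(* Newton iteration of the retraction solves the equations [r] modulo ever higher
   powers of a maximal ideal, so the linear system is solvable there to all orders. *)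
Lemma newton_combos (A : alg) n m (K T : finType) (r : 'I_m -> {mpoly A[n]})
    (xi : 'I_n -> {mpoly A[n]}) (E : 'I_m -> 'I_m * 'I_m -> {mpoly A[n]})
    (v : K -> A) (w : T -> K -> A) (b : T -> {mpoly A[n]}) (F : K -> 'I_m -> {mpoly A[n]})
    (phi : {lrmorphism A -> k^o}) (eta : 'I_n -> k) : fin_gen A ->
  (forall i, mev (mpolyC n (R := A)) xi (r i) = \sum_l E i l * (r l.1 * r l.2)) ->
  (forall x, (v x)%:MP - \sum_t b t * (w t x)%:MP = \sum_i F x i * r i) ->
  (forall i, mev phi eta (r i) = 0) ->
  exists a, phi a <> 0 /\ combos v w a.
Proof.
move=> fg rE vE phir; pose m0 a := phi a = 0; have idm : ideal m0 by apply: kernel_ideal.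
pose st (y : 'I_n -> A) j := mev [the {rmorphism A -> A} of idfun] y (xi j).
pose y0 j : A := (eta j)%:A.
have hy s i : ipow m0 (2 ^ s) (mev [the {rmorphism A -> A} of idfun] (iter s st y0) (r i)).
  elim: s i => [|s IH] i /=.
    apply: ipow1; rewrite /m0 (mev_nat (h := phi) (d := eta)) // => j.
    exact: (etrans (lrmorph_alg phi (eta j)) (mulr1 _)).
  set y := iter s st y0.
  have -> : mev [the {rmorphism A -> A} of idfun] (st y) (r i)
     = mev [the {rmorphism A -> A} of idfun] y (mev (mpolyC n (R := A)) xi (r i)).
    by symmetry; apply: mev_nat => // a; rewrite mevC.
  rewrite rE rmorph_sum; apply: ideal_sum; first exact: ipow_ideal.
  move=> l _; rewrite !rmorphM; apply: idealM; first exact: ipow_ideal.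
  by rewrite expnS mul2n -addnn; apply: ipowM.
pose s := #|K|; pose row (u : K -> A) : 'rV[A]_s := \row_i u (enum_val i).
have nA := noeth_fin_gen fg.
pose N (u : 'rV[A]_s) := exists c : T -> A, u = \sum_t c t *: row (w t).
have sN : submod N.
  split.
  - by exists (fun=> 0); rewrite big1 // => t _; rewrite scale0r.
  - move=> _ _ [c ->] [d ->]; exists (fun t => c t + d t).
    by rewrite -big_split; apply: eq_bigr => t _; rewrite scalerDl.
  - move=> a _ [c ->]; exists (fun t => a * c t).
    by rewrite scaler_sumr; apply: eq_bigr => t _; rewrite scalerA.
have [|a [ma [c cE]]] := @krull A 'rV[A]_s nA (noeth_rV nA) m0 N (row v) idm sN.
  move=> M; pose y := iter M st y0.
  pose evy := mev [the {rmorphism A -> A} of idfun] y.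
  exists (\sum_t evy (b t) *: row (w t)); split; first by exists (fun t => evy (b t)).
  set D := fun u => _; have sD := @mspan_submod _ 'rV[A]_s D.
  rewrite [X in mspan _ X]row_sum_delta; apply: (submod_sum sD) => i _.
  apply: mspan_in; exists ((row v - \sum_t evy (b t) *: row (w t)) 0 i), (delta_mx 0 i).
  split=> //; rewrite !mxE summxE.
  have -> : v (enum_val i) - \sum_t (evy (b t) *: row (w t)) 0 i =
      evy ((v (enum_val i))%:MP - \sum_t b t * (w t (enum_val i))%:MP).
    rewrite rmorphB [evy _%:MP]mevC rmorph_sum; congr (_ - _); apply: eq_bigr => t _.
    by rewrite rmorphM [evy _%:MP]mevC !mxE.
  rewrite vE rmorph_sum; apply: ideal_sum; first exact: ipow_ideal.
  move=> l _; rewrite rmorphM; apply: idealM; first exact: ipow_ideal.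
  by apply: (ipow_le _ (hy M l)); apply: ltnW; apply: ltn_expl.
exists (1 - a); split.
  by rewrite lrB lr1 ma subr0; apply/eqP/oner_neq0.
exists c => x; have := congr1 (fun u : 'rV[A]_s => u 0 (enum_rank x)) cE.
rewrite !mxE enum_rankK summxE => ->; apply: eq_bigr => t _.
by rewrite !mxE enum_rankK.
Qed.

(** This plays the role of faithful flatness. If the conductor is proper, it dies at a field point,
    which lifts to the cover. After descending all data to a finitely generated [A0], the
    Nullstellensatz turns this into a [k]-point of [A0] with a solution of the equations above it,
    and [newton_combos] then produces an element of the conductor that does not vanish there. *)
Lemma cover_pure (A B : alg) (f : {lrmorphism A -> B}) (K T : finType) (v : K -> A)
    (w : T -> K -> A) (beta : T -> B) : smooth_cover f ->
  (forall x, f (v x) = \sum_t beta t * f (w t x)) ->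
  exists c : T -> A, forall x, v x = \sum_t c t * w t x.
Proof.
move=> [n [b [m [r [xi [bs bk _ xi2 fs]]]]]] vw; set I := idspan _ in bk xi2.
suff : combos v w 1 by move=> [c cE]; exists c => x; rewrite -cE mul1r.
apply: contrapT => nc; have [K' [phi [fK phik]]] := field_point (combos_ideal v w) nc.
have [L [i [y [fL yi]]]] := fs _ phi fK.
have [E EE] : exists E : 'I_m -> 'I_m * 'I_m -> {mpoly A[n]},
    forall i, mev (mpolyC n (R := A)) xi (r i) = \sum_l E i l * (r l.1 * r l.2).
  apply: (@ex_choice _ _ (fun i e => mev (mpolyC n (R := A)) xi (r i) = \sum_l e l * (r l.1 * r l.2))) => l.
  apply/(idspan_fin (fun l : 'I_m * 'I_m => r l.1 * r l.2)).
  move: (xi2 l); apply: ipow_ind; first exact: idspan_ideal.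
  move=> p q /idspan_fin[c ->].
  pose P q := idspan (fun y => exists l : 'I_m * 'I_m, y = r l.1 * r l.2)
     ((\sum_i c i * r i) * q).
  apply: (@ipow_ind _ I 0 P).
    split; rewrite /P; first by rewrite mulr0; apply: ideal0; apply: idspan_ideal.
      by move=> x1 x2 h1 h2; rewrite mulrDr; apply: idealD => //; apply: idspan_ideal.
    by move=> a x1 h1; rewrite mulrCA; apply: idealM => //; apply: idspan_ideal.
  move=> _ a /idspan_fin[d ->] _; rewrite /P mulrA; apply: ideal_mulr; first exact: idspan_ideal.
  rewrite mulr_suml; apply: ideal_sum; first exact: idspan_ideal.
  move=> s _; rewrite mulr_sumr; apply: ideal_sum; first exact: idspan_ideal.
  move=> t _; rewrite mulrACA; apply: idealM; first exact: idspan_ideal.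
  by apply: idspan_in; exists (s, t).
have [be beE] := ex_choice (fun t => bs (beta t)).
have [F FE] : exists F : K -> 'I_m -> {mpoly A[n]},
    forall x, (v x)%:MP - \sum_t be t * (w t x)%:MP = \sum_i F x i * r i.
  apply: (@ex_choice _ _ (fun x e => (v x)%:MP - \sum_t be t * (w t x)%:MP = \sum_i e i * r i)) => x.
  apply/(idspan_fin r)/bk.
  transitivity (f (v x) - \sum_t beta t * f (w t x)); last by rewrite vw subrr.
  rewrite rmorphB [X in X - _]mevC rmorph_sum; congr (_ - _); apply: eq_bigr => t _.
  rewrite rmorphM beE; congr (_ * _); exact: mevC.
(* Indexes every polynomial in play: equations, retraction, coefficients and both sides of the
   system. *)
pose TT := ('I_m + 'I_n + 'I_m * ('I_m * 'I_m) + T + K * 'I_m + K + T * K)%type.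
pose P (t : TT) : {mpoly A[n]} := match t with
  | inl (inl (inl (inl (inl (inl i))))) => r i
  | inl (inl (inl (inl (inl (inr j))))) => xi j
  | inl (inl (inl (inl (inr l)))) => E l.1 l.2
  | inl (inl (inl (inr t))) => be t
  | inl (inl (inr l)) => F l.1 l.2
  | inl (inr x) => (v x)%:MP
  | inr l => (w l.1 l.2)%:MP
  end.
have [A0 [j [fg inj [P0 P0E]]]] := finite_subalgebra_mpoly P.
pose r0 i := P0 (inl (inl (inl (inl (inl (inl i)))))).
pose xi0 i := P0 (inl (inl (inl (inl (inl (inr i)))))).
pose E0 i l := P0 (inl (inl (inl (inl (inr (i, l)))))).
pose be0 t := P0 (inl (inl (inl (inr t)))).
pose F0 x l := P0 (inl (inl (inr (x, l)))).
pose v0 x := (P0 (inl (inr x)))@_0%MM.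
pose w0 t x := (P0 (inr (t, x)))@_0%MM.
have jinj := mmor_inj (n := n) inj.
have v0E x : j (v0 x) = v x.
  by rewrite /v0 -mmor_coef P0E mcoeffC eqxx mulr1.
have w0E t x : j (w0 t x) = w t x.
  by rewrite /w0 -mmor_coef P0E mcoeffC eqxx mulr1.
have r0E i' : mmor n j (r0 i') = r i' by apply: P0E.
pose c0 := combos v0 w0.
pose q := idspan (fun p : {mpoly A0[n]} => (exists2 a, c0 a & p = a%:MP) \/ exists i, p = r0 i).
(* The ideal [q] is proper: the [L]-point of [B] above [phi] kills the equations and the descended
   conductor. *)
have [q1|q1] := pselect (q 1).
  pose ev0 := mev [the {rmorphism A0 -> L} of y \o (f \o j)] (y \o b).
  have : ev0 1 = 0.
    have idk : ideal (fun p => ev0 p = 0).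
      split=> [|p p' h h'|p p' h]; first exact: rmorph0.
        by rewrite rmorphD h h' addr0.
      by rewrite rmorphM h mulr0.
    apply: (idspan_sub idk _ q1) => _ [[a [c cE] ->]|[i' ->]]; rewrite /ev0.
      rewrite mevC /=; have -> : y (f (j a)) = i (phi (j a)) by apply: yi.
      rewrite phik ?lr0 //; exists (j \o c) => x.
      rewrite -v0E -lrM cE lr_sum; apply: eq_bigr => t _; by rewrite lrM w0E.
    rewrite -(mev_mmor (f := j) (g := [the {rmorphism A -> L} of y \o f])) // r0E.
    rewrite -(mev_nat (f := f) (b := b) (g := y)) // (proj2 (bk _)); first exact: rmorph0.
    by apply: idspan_in; exists i'.
  by rewrite rmorph1; apply/eqP/oner_neq0.
have [T0 [p [ps pk pc]]] := quot_exists (mconst A0 n) (idspan_ideal _) q1.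
have fgT : fin_gen T0 by apply: fin_gen_mpoly fg pc ps.
have [|psi _] := @nullstellensatz k T0 1 fgT.
  by move=> l; rewrite expr1n; apply/eqP/oner_neq0.
have [||||phi0 phi0E] := @quot_lift _ A0 (in_alg A0) A0 [the {rmorphism A0 -> A0} of idfun] k^o
   [the {rmorphism A0 -> k^o} of psi \o (p \o mpolyC n (R := A0))] => //.
- by move=> x; exists x.
- by move=> a /=; rewrite -[_%:MP]/(mconst A0 n a) pc (lrmorph_alg psi).
- by move=> x /= ->; rewrite !rmorph0.
pose eta i := psi (p 'X_i) : k.
have etaE u : mev phi0 eta u = psi (p u).
  rewrite (_ : psi (p u) = [the {rmorphism _ -> _} of psi \o p] u) //.
  by apply: mpoly_hom_eq => [a|l]; rewrite ?mevC ?mevXi //; apply: phi0E.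
have [|||a [pa ca]] := @newton_combos A0 n m K T r0 xi0 E0 v0 w0 be0 F0 phi0 eta fg.
- move=> l; apply: jinj.
  transitivity (\sum_l' E l l' * (r l'.1 * r l'.2)).
    rewrite -EE -(r0E l).
    rewrite (mev_mmor (h := [the {rmorphism A0 -> {mpoly A[n]}} of mpolyC n (R := A) \o j])) //.
    apply: mev_nat => [a|l']; first exact: mmorC.
    exact: P0E.
  rewrite rmorph_sum; apply: eq_bigr => -[l1 l2] _; rewrite !rmorphM !r0E; congr (_ * _); symmetry; exact: P0E.
- move=> x; apply: jinj; transitivity (\sum_i F x i * r i); last first.
    rewrite rmorph_sum; apply: eq_bigr => l _; rewrite rmorphM r0E; congr (_ * _).
    symmetry; exact: P0E.
  rewrite -FE rmorphB rmorph_sum; congr (_ - _).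
    by rewrite [LHS]mmorC; apply: congr1; exact: v0E.
  apply: eq_bigr => t _; rewrite rmorphM; congr (_ * _); first exact: P0E.
  by rewrite [LHS]mmorC; apply: congr1; exact: w0E.
- move=> l; rewrite etaE (proj2 (pk _)); first exact: rmorph0.
  apply: idspan_in; right; by exists l.
apply: pa; rewrite phi0E /= (proj2 (pk _)); first exact: rmorph0.
by apply: idspan_in; left; exists a.
Qed.

Lemma cover_injective (A B : alg) (f : {lrmorphism A -> B}) a :
  smooth_cover f -> f a = 0 -> a = 0.
Proof.
move=> sf fa; have [|c cE] := @cover_pure A B f unit void (fun=> a) (fun=> fun=> 0) (fun=> 0) sf.
  by move=> _; rewrite fa big_pred0 // => -[].
by rewrite (cE tt) big_pred0 // => -[].
Qed.

Lemma cover_pure_mpoly (A B : alg) (f : {lrmorphism A -> B}) n (U T : finType)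
    (v : U -> {mpoly A[n]}) (w : T -> U -> {mpoly A[n]}) (beta : T -> B) : smooth_cover f ->
  (forall x, mmor n f (v x) = \sum_t beta t *: mmor n f (w t x)) ->
  exists c : T -> A, forall x, v x = \sum_t c t *: w t x.
Proof.
move=> sf vw; pose d := (\max_x msize (v x) + \max_t \max_x msize (w t x)).+1.
have [|c cE] := @cover_pure A B f (U * 'X_{1..n < d})%type T (fun x => (v x.1)@_x.2)
   (fun t x => (w t x.1)@_x.2) beta sf.
  move=> [x m] /=; rewrite -(mmor_coef f) vw raddf_sum; apply: eq_bigr => t _.
  exact: (etrans (mcoeffZ _ _ _) (congr1 _ (mmor_coef _ _ _))).
exists c => x; apply/mpolyP => m; rewrite raddf_sum.
have [md|md] := ltnP (mdeg m) d.
  rewrite (cE (x, BMultinom md)) /=; apply: eq_bigr => t _; symmetry; exact: mcoeffZ.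
have big p : (msize p <= d)%N -> p@_m = 0 :> A.
  by move=> pd; apply: memN_msupp_eq0; apply: msize_mdeg_ge; apply: leq_trans md.
rewrite big ?big1 // => [t _|].
  rewrite [LHS](mcoeffZ _ _ _) big ?mulr0 //; apply: leqW; apply: (leq_trans _ (leq_addl _ _)).
  apply: (leq_trans _ (leq_bigmax t)); exact: (leq_bigmax (F := fun x => msize (w t x))).
by apply: leqW; apply: (leq_trans _ (leq_addr _ _)); apply: leq_bigmax.
Qed.

End Purity.

(** * Étale descent of functions and of ideals *)

Section Descent.
Variable k : closedFieldType.
Notation alg := (comUnitAlgType k).

Lemma mmor_const (A C : alg) (phi : {lrmorphism A -> C}) n a :
  mmor n phi (mconst A n a) = mconst C n a.
Proof.
exact: (etrans (mmorC n phi a%:A) (congr1 (@mpolyC n C) (lrmorph_alg phi a))).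
Qed.

Section Pushout.
Variables (A B C : alg) (f : {lrmorphism A -> B}) (phi : {lrmorphism A -> C}).
Variables (n : nat) (b : 'I_n -> B) (m : nat) (r : 'I_m -> {mpoly A[n]}).
Hypothesis bs : forall y, exists p, mev f b p = y.
Hypothesis bk : forall p, mev f b p = 0 <-> idspan (fun y => exists i, y = r i) p.
Let J := idspan (fun y : {mpoly C[n]} => exists i, y = mmor n phi (r i)).

Lemma pushout_kernel (E : alg) (u : {lrmorphism C -> E}) (v : {lrmorphism B -> E}) p :
  (forall a, u (phi a) = v (f a)) -> J p -> mev u (v \o b) p = 0.
Proof.
move=> uv; apply: (@idspan_sub _ _ (fun p => mev u (v \o b) p = 0)).
  split=> [|q q' h h'|q q' h]; first exact: rmorph0.
    by rewrite rmorphD h h' addr0.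
  by rewrite rmorphM h mulr0.
move=> _ [i ->].
rewrite (mev_mmor (h := [the {rmorphism A -> E} of v \o f])) //.
rewrite -(mev_nat (f := f) (b := b) (g := v)) // (proj2 (bk _)); first exact: rmorph0.
by apply: idspan_in; exists i.
Qed.

(** [D] is the tensor product of [B] and [C] over [A]. Algebras are nonzero, and the common target
    [E] is what shows that the ideal [J] is proper. *)
Lemma pushout_exists (E : alg) (u : {lrmorphism C -> E}) (v : {lrmorphism B -> E}) :
  (forall a, u (phi a) = v (f a)) ->
  exists (D : alg) (g : {lrmorphism C -> D}) (psi : {lrmorphism B -> D})
    (p : {rmorphism {mpoly C[n]} -> D}),
    [/\ forall y, exists x, p x = y, forall x, p x = 0 <-> J x,
        forall c, p c%:MP = g c & forall q, psi (mev f b q) = p (mmor n phi q)].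
Proof.
move=> uv; have J1 : ~ J 1.
  by move=> /(pushout_kernel uv); rewrite rmorph1; apply/eqP/oner_neq0.
have [D [p [ps pk pc]]] := quot_exists (mconst C n) (idspan_ideal _) J1.
have [||||g gE] := @quot_lift _ C (in_alg C) C [the {rmorphism C -> C} of idfun] D
   [the {rmorphism C -> D} of p \o mpolyC n (R := C)] => //.
- by move=> y; exists y.
- by move=> x /= ->; rewrite !rmorph0.
have [|||psi psiE] := @quot_lift _ {mpoly A[n]} (mconst A n) B (mev f b) D
   [the {rmorphism {mpoly A[n]} -> D} of p \o mmor n phi] bs.
- by move=> a; exact: (etrans (mevC f b a%:A) (lrmorph_alg f a)).
- by move=> a; rewrite -pc -(mmor_const phi).
- move=> q /bk; apply: (@idspan_sub _ _ (fun q => p (mmor n phi q) = 0)).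
    split=> [|q1 q2 h h'|q1 q2 h]; first by rewrite !rmorph0.
      by rewrite !rmorphD /= -!/(mmor n phi _) h h' addr0.
    by rewrite !rmorphM /= -!/(mmor n phi _) h mulr0.
  by move=> _ [i ->]; apply/pk/idspan_in; exists i.
exists D, g, psi, p; split=> // c; symmetry; exact: gE.
Qed.
End Pushout.

Lemma cover_base_change (A B C : alg) (f : {lrmorphism A -> B}) (phi : {lrmorphism A -> C}) :
  smooth_cover f -> exists (D : alg) (g : {lrmorphism C -> D}) (psi : {lrmorphism B -> D}),
    smooth_cover g /\ forall a, psi (f a) = g (phi a).
Proof.
move=> [n [b [m [r [xi [bs bk xi1 xi2 fs]]]]]].
have [||K [x [fK _]]] := @field_point k C (fun c => c = 0).
- by split=> [|u v -> ->|u v ->]; rewrite ?addr0 ?mulr0.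
- by apply/eqP/oner_neq0.
have [xphi xphiE] := lr_comp phi x.
have [L0 [i0 [y0 [fL0 yi0]]]] := fs K xphi fK.
have [ix ixE] := lr_comp x i0.
have [|D [g [psi [p [ps pk pc psiE]]]]] := @pushout_exists A B C f phi n b m r bs bk L0 ix y0.
  by move=> a; rewrite ixE /=; have := yi0 a; rewrite /= xphiE.
exists D, g, psi; split; last first.
  by move=> a; have := psiE a%:MP; rewrite mevC mmorC pc.
have pmev q : mev g (fun j => p 'X_j) q = p q.
  by symmetry; apply: mpoly_hom_eq => [a|i]; rewrite ?mevC ?mevXi.
exists n, (fun j => p 'X_j), m, (fun i => mmor n phi (r i)), (fun j => mmor n phi (xi j)).
have homI q : idspan (fun y => exists i, y = r i) q ->
    idspan (fun y => exists i, y = mmor n phi (r i)) (mmor n phi q).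
  move=> /idspan_fin[c ->]; apply/idspan_fin; exists (fun i => mmor n phi (c i)).
  by rewrite rmorph_sum; apply: eq_bigr => i _; rewrite rmorphM.
split.
- by move=> y; have [q <-] := ps y; exists q.
- by move=> q; rewrite pmev.
- by move=> j; rewrite -(mmorXi phi j) -rmorphB; apply: homI.
- move=> i; have -> : mev (mpolyC n (R := C)) (fun j => mmor n phi (xi j)) (mmor n phi (r i))
     = mmor n phi (mev (mpolyC n (R := A)) xi (r i)).
    rewrite (mev_mmor (h := [the {rmorphism A -> {mpoly C[n]}} of mpolyC n (R := C) \o phi])) //.
    symmetry; apply: mev_nat => // a; exact: mmorC.
  rewrite -[2%N]muln1; apply: ipow_hom (xi2 i) => q /homI; exact: ipow1.
move=> K' x' fK'; have [xphi' xphiE'] := lr_comp phi x'.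
have [L [i [y [fL yi]]]] := fs K' xphi' fK'.
have [ix' ixE'] := lr_comp x' i.
have uv a : ix' (phi a) = y (f a) by rewrite ixE' /=; have := yi a; rewrite /= xphiE'.
have [|||w wE] := @quot_lift _ {mpoly C[n]} (mconst C n) D p L (mev ix' (y \o b)) ps.
- by move=> a; exact: (etrans (pc _) (lrmorph_alg g a)).
- by move=> a; exact: (etrans (mevC ix' (y \o b) a%:A) (lrmorph_alg ix' a)).
- by move=> q /pk; apply: (pushout_kernel bk uv).
exists L, i, w; split=> // c /=.
rewrite -pc wE; exact: (etrans (mevC ix' (y \o b) c) (ixE' c)).
Qed.

Lemma mpoly_expand (R S : comNzRingType) n d (f : {rmorphism R -> S}) (Q : {mpoly S[n]})
    (r : {mpoly R[n]}) : (msize Q <= d)%N ->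
  \sum_(nu : 'X_{1..n < d}) Q@_nu *: mmor n f ('X_[nu] * r) = Q * mmor n f r.
Proof.
move=> Qd; rewrite {2}(mpolywE Qd) mulr_suml; apply: eq_bigr => nu _.
by rewrite rmorphM /= map_mpolyX -scalerAl.
Qed.

(** The two images of [x] in the tensor square agree, so over [B] a polynomial [q] representing [x]
    is the constant [x] plus multiples of the equations. This is a linear system over [A] with a
    solution in [B]; a solution in [A], provided by purity, evaluates to a preimage of [x]. *)
Lemma cover_descent (A B : alg) (f : {lrmorphism A -> B}) (x : B) : smooth_cover f ->
  (forall (C : alg) (g h : {lrmorphism B -> C}), g \o f =1 h \o f -> g x = h x) ->
  exists a, f a = x.
Proof.
move=> sf xE; have [n [b [m [r [xi [bs bk _ _ _]]]]]] := sf.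
have [//|D [g [psi [p [ps pk pc psiE]]]]] :=
  @pushout_exists A B B f f n b m r bs bk B (lr_id B) (lr_id B).
have [q qx] := bs x.
have /xE xgh : psi \o f =1 g \o f.
  by move=> a /=; have := psiE a%:MP; rewrite mevC mmorC pc.
have /pk/(idspan_fin (fun i => mmor n f (r i)))[Q QE] : p (mmor n f q - x%:MP) = 0.
  by rewrite rmorphB -psiE pc qx xgh subrr.
pose d := (\max_i msize (Q i)).+1.
pose w (t : 'I_1 + 'I_m * 'X_{1..n < d}) : {mpoly A[n]} :=
  if t is inr l then 'X_[l.2] * r l.1 else 1.
have [|c cE] := @cover_pure_mpoly k A B f n unit _ (fun=> q) (fun t _ => w t)
    (fun t => if t is inr l then (Q l.1)@_l.2 else x) sf.
  move=> _; rewrite big_sumType big_ord1 /= rmorph1 -[mmor n f q](GRing.subrK x%:MP) QE addrC.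
  congr (_ + _); last by rewrite -mul_mpolyC mulr1.
  rewrite -(pair_bigA _ (fun i (mu : 'X_{1..n < d}) => (Q i)@_mu *: mmor n f ('X_[mu] * r i))) /=.
  apply: eq_bigr => i _; rewrite [RHS]mpoly_expand //.
  by apply: leqW; apply: leq_bigmax.
exists (c (inl ord0)); rewrite -qx (cE tt) rmorph_sum big_sumType big_ord1 /=.
rewrite -[X in X + _]/(mev f b _) -mul_mpolyC mulr1 mevC big1 ?addr0 // => -[i mu] _ /=.
rewrite -[mmap _ _ _]/(mev f b _) -mul_mpolyC mulrA rmorphM (proj2 (bk (r i))) ?mulr0 //.
by apply: idspan_in; exists i.
Qed.

(** Equality of the two pullbacks of the ideal to the tensor square is a linear system over [A]
    solved in [B]. For the solution in [A] given by purity, the relations [Some mu] put the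
    coefficients of the monomials in the ideal, and the relation [None] expresses [ga l] through
    them. *)
Lemma cover_ideal_descent (A B : alg) (f : {lrmorphism A -> B}) (G : finType) (ga : G -> B) :
  smooth_cover f ->
  (forall (C : alg) (g h : {lrmorphism B -> C}), g \o f =1 h \o f ->
     forall l, idspan (fun y => exists l', y = g (ga l')) (h (ga l))) ->
  forall l, idspan (fun y => exists a, idspan (fun z => exists l', z = ga l') (f a) /\ y = f a)
    (ga l).
Proof.
move=> sf gaP l; have [n [b [m [r [xi [bs bk _ _ _]]]]]] := sf.
have [//|D [g [psi [p [ps pk pc psiE]]]]] :=
  @pushout_exists A B B f f n b m r bs bk B (lr_id B) (lr_id B).
have [q qE] := ex_choice (fun l => bs (ga l)).
have psig : psi \o f =1 g \o f.
  by move=> a /=; have := psiE a%:MP; rewrite mevC mmorC pc.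
have [al [Q QE]] : exists al Q, mmor n f (q l) =
    \sum_l' al l' * (ga l')%:MP + \sum_i Q i * mmor n f (r i).
  have [c cE] := proj1 (idspan_fin (fun l => g (ga l)) _) (gaP D g psi (fsym psig) l).
  have [al alE] := ex_choice (fun l => ps (c l)).
  have /pk/(idspan_fin (fun i => mmor n f (r i)))[Q QE] :
      p (mmor n f (q l) - \sum_l' al l' * (ga l')%:MP) = 0.
    rewrite rmorphB -psiE qE cE rmorph_sum; apply/eqP; rewrite subr_eq0; apply/eqP.
    by apply: eq_bigr => l' _; rewrite rmorphM alE pc.
  by exists al, Q; rewrite -QE addrC GRing.subrK.
pose z (s : G + 'I_m) := match s with inl l' => q l' | inr i => r i end.
have [S SE] : exists S : G -> G + 'I_m -> {mpoly B[n]},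
    forall l1, (ga l1)%:MP = \sum_s S l1 s * mmor n f (z s).
  apply: (@ex_choice _ _ (fun l1 e => (ga l1)%:MP = \sum_s e s * mmor n f (z s))) => l1.
  have [c cE] := proj1 (idspan_fin (fun l => psi (ga l)) _) (gaP D psi g psig l1).
  have [s sE] := ex_choice (fun l => ps (c l)).
  have /pk/(idspan_fin (fun i => mmor n f (r i)))[U UE] :
      p ((ga l1)%:MP - \sum_l' s l' * mmor n f (q l')) = 0.
    rewrite rmorphB pc cE rmorph_sum; apply/eqP; rewrite subr_eq0; apply/eqP.
    by apply: eq_bigr => l' _; rewrite rmorphM sE -psiE qE.
  exists (fun t => match t with inl l' => s l' | inr i => U i end).
  by rewrite big_sumType /= -UE addrC GRing.subrK.
pose S' mu s := \sum_l1 (al l1)@_mu *: S l1 s.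
pose d1 := (\max_l1 msize (al l1) + \max_i msize (Q i))%N.
pose d := (d1 + \max_l1 \max_s msize (S l1 s))%N.
pose M := 'X_{1..n < d}.
have ald l1 : (msize (al l1) <= d)%N.
  apply: (leq_trans _ (leq_addr _ _)); apply: (leq_trans _ (leq_addr _ _)).
  exact: (leq_bigmax (F := fun l1 => msize (al l1))).
have Qd i : (msize (Q i) <= d)%N.
  apply: (leq_trans _ (leq_addr _ _)); apply: (leq_trans _ (leq_addl _ _)).
  exact: leq_bigmax.
have Sd mu s : (msize (S' mu s) <= d)%N.
  apply: (leq_trans (msize_sum _ _ _)); apply/bigmax_leqP => l1 _.
  apply: (leq_trans (msizeZ_le _ _)).
  apply: (leq_trans _ (leq_addl _ _)); apply: (leq_trans _ (leq_bigmax l1)).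
  exact: (leq_bigmax (F := fun s => msize (S l1 s))).
pose w mu := \sum_l1 (al l1)@_mu * ga l1.
have wE (mu : M) : (w mu)%:MP = \sum_s S' mu s * mmor n f (z s) :> {mpoly B[n]}.
  transitivity (\sum_l1 ((al l1)@_mu * ga l1)%:MP_[n]); first exact: rmorph_sum.
  transitivity (\sum_l1 \sum_s (al l1)@_mu *: S l1 s * mmor n f (z s)).
    apply: eq_bigr => l1 _; rewrite mpolyCM SE mulr_sumr; apply: eq_bigr => s _.
    by rewrite -mul_mpolyC mulrA.
  by rewrite exchange_big; apply: eq_bigr => s _; rewrite mulr_suml.
(* [None] is the expansion of [q l] with coefficient [w mu] on the monomial [mu]; [Some mu] records
   a certificate that [w mu] lies in the ideal. *)
have [|c cE] := @cover_pure_mpoly k A B f n (option M) (M + 'I_m * M + M * (G + 'I_m) * M)%type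
    (fun u => if u is Some _ then 0 else q l)
    (fun t u => match t, u with
       | inl (inl mu), None => 'X_[mu]
       | inl (inl mu), Some mu' => (mu == mu')%:R
       | inl (inr e), None => 'X_[e.2] * r e.1
       | inl (inr e), Some _ => 0
       | inr e, None => 0
       | inr e, Some mu' => if e.1.1 == mu' then - ('X_[e.2] * z e.1.2) else 0
       end)
    (fun t => match t with
       | inl (inl mu) => w mu
       | inl (inr e) => (Q e.1)@_e.2
       | inr e => (S' e.1.1 e.1.2)@_e.2 end) sf.
  have m0 : map_mpoly f 0 = 0 :> {mpoly B[n]} by apply: (rmorph0 (mmor n f)).
  case=> [mu|]; rewrite !big_sumType /=.
    rewrite m0 [X in _ + X + _]big1 ?addr0 => [|e _]; last by rewrite scaler0.
    rewrite (bigD1 mu) //= eqxx big1 ?addr0 => [|mu' /negPf ->]; last by rewrite mulr0n m0 scaler0.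
    rewrite -[map_mpoly f 1]/(mmor n f 1) rmorph1 -mul_mpolyC mulr1 wE.
    rewrite -(pair_bigA _ (fun (e : M * (G + 'I_m)) (nu : M) => (S' e.1 e.2)@_nu *:
      map_mpoly f (if e.1 == mu then - ('X_[nu] * z e.2) else 0))) /=.
    rewrite -(pair_bigA _ (fun (mu' : M) s => \sum_(nu : M) (S' mu' s)@_nu *:
      map_mpoly f (if mu' == mu then - ('X_[nu] * z s) else 0))) /=.
    rewrite [X in _ + X](bigD1 mu) //= [X in _ + (_ + X)]big1 ?addr0 => [|mu' /negPf ->]; last first.
      by rewrite big1 // => s _; rewrite big1 // => nu _; rewrite m0 scaler0.
    rewrite eqxx -big_split /= big1 // => s _.
    rewrite -(mpoly_expand f _ (Sd mu s)) -big_split big1 // => nu _ /=.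
    rewrite -[map_mpoly f (- _)]/(mmor n f (- _)) rmorphN scalerN; exact: subrr.
  rewrite [X in _ + _ + X]big1 ?addr0 => [|e _]; last by rewrite m0 scaler0.
  rewrite -[map_mpoly f (q l)]/(mmor n f _) QE; congr (_ + _).
    transitivity (\sum_l1 \sum_(mu : M) (al l1)@_mu *: 'X_[mu] * (ga l1)%:MP).
      by apply: eq_bigr => l1 _; rewrite {1}(mpolywE (ald l1)) mulr_suml.
    rewrite exchange_big; apply: eq_bigr => mu _.
    rewrite map_mpolyX scaler_suml; apply: eq_bigr => l1 _.
    by rewrite mulrC mul_mpolyC scalerA mulrC.
  rewrite -(pair_bigA _ (fun i (nu : M) => (Q i)@_nu *: map_mpoly f ('X_[nu] * r i))) /=.
  by apply: eq_bigr => i _; rewrite -(mpoly_expand f _ (Qd i)).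
have rb i : mev f b (r i) = 0 by apply/bk/idspan_in; exists i.
have cI mu : idspan (fun z => exists l', z = ga l') (f (c (inl (inl mu)))).
  have := congr1 (mev f b) (cE (Some mu)); rewrite !big_sumType /= rmorph0.
  rewrite [X in _ + X + _]big1 ?addr0 => [|e _]; last by rewrite scaler0.
  rewrite (bigD1 mu) //= eqxx big1 ?addr0 => [|mu' /negPf ->]; last by rewrite scaler0.
  rewrite rmorphD -mul_mpolyC mulr1 [mev f b _%:MP]mevC => /esym/eqP.
  rewrite addr_eq0 => /eqP ->; apply: idealN; first exact: idspan_ideal.
  rewrite rmorph_sum; apply: ideal_sum; first exact: idspan_ideal.
  move=> [[mu' s] nu] _ /=; case: eqP => _; last first.
    by rewrite scaler0 rmorph0; apply: ideal0; apply: idspan_ideal.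
  rewrite -mul_mpolyC !(rmorphM, rmorphN); apply: idealM; first exact: idspan_ideal.
  apply: idealN; first exact: idspan_ideal.
  apply: idealM; first exact: idspan_ideal.
  case: s => [l'|i] /=; first by rewrite [mmap _ _ _]qE; apply: idspan_in; exists l'.
  by rewrite [mmap _ _ _]rb; apply: ideal0; apply: idspan_ideal.
rewrite -[X in idspan _ X]qE (cE None) !big_sumType /=.
rewrite [X in _ + _ + X]big1 ?addr0 => [|e _]; last by rewrite scaler0.
rewrite rmorphD rmorph_sum; apply: idealD; first exact: idspan_ideal.
  rewrite -rmorph_sum rmorph_sum; apply: ideal_sum; first exact: idspan_ideal.
  move=> mu _; rewrite -mul_mpolyC rmorphM; apply: ideal_mulr; first exact: idspan_ideal.
  by rewrite [mev f b _%:MP]mevC; apply: idspan_in; exists (c (inl (inl mu))).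
rewrite rmorph_sum; apply: ideal_sum; first exact: idspan_ideal.
move=> [i nu] _ /=; rewrite -mul_mpolyC !rmorphM /= [mmap _ _ (r i)]rb !mulr0.
by apply: ideal0; apply: idspan_ideal.
Qed.

End Descent.

(** * Local rings at smooth points *)

Lemma low_coef (R : idomainType) (P : {poly R}) N : ~ (exists Q, P = Q * 'X^N) ->
  exists d Q, [/\ (d < N)%N, P = Q * 'X^d & Q`_0 <> 0].
Proof.
elim: N P => [|N IH] P nd; first by case: nd; exists P; rewrite expr0 mulr1.
have [P0|P0] := eqVneq P`_0 0; last first.
  by exists 0%N, P; rewrite expr0 mulr1; split=> //; apply/eqP.
have [Q QE] : exists Q, P = Q * 'X.
  have /factor_theorem[Q ->] : root P 0 by rewrite /root horner_coef0 P0.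
  by exists Q; rewrite subr0.
have [|d [S [dN SE S0]]] := IH Q.
  by move=> [S SE]; apply: nd; exists S; rewrite QE SE -mulrA -exprSr.
by exists d.+1, S; split=> //; rewrite QE SE -mulrA -exprSr.
Qed.

Lemma low_coef_mul (R : idomainType) (P Q : {poly R}) N M :
  ~ (exists S, P = S * 'X^N) -> ~ (exists S, Q = S * 'X^M) ->
  ~ exists S, P * Q = S * 'X^(N + M).
Proof.
move=> /low_coef[d [P' [dN -> P0]]] /low_coef[e [Q' [eM -> Q0]]] [S].
rewrite mulrACA -exprD => E.
have E' : P' * Q' = S * 'X^(N + M - (d + e)).
  have X0 : 'X^(d + e) != 0 :> {poly R} by rewrite expf_neq0 // polyX_eq0.
  by apply: (mulIf X0); rewrite E -mulrA -exprD subnK // leq_add // ltnW.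
have := congr1 (fun p : {poly R} => p`_0) E'; rewrite coefM big_ord1 /= subnn coefMXn.
have -> : (0 < N + M - (d + e))%N by lia.
by move/eqP; rewrite mulf_eq0 => /orP[]/eqP.
Qed.

Section SmoothPoints.
Variable k : closedFieldType.
Notation alg := (comUnitAlgType k).

Definition liftable (T : alg) := forall (C D : alg) (h : {lrmorphism C -> D})
  (w : {lrmorphism T -> D}), square_zero_thickening h ->
  exists w' : {lrmorphism T -> C}, h \o w' =1 w.

(** As for étale covers: lift the identity of [T] to the thickening [k[y]/J^2]. *)
Lemma retraction_exists (T : alg) n (y : nat -> T) : generates n y -> liftable T ->
  exists xi : nat -> Pol k n, let J p := ev (in_alg T) y n p = 0 in
    (forall i, (i < n)%N -> J (xi i - polX k n i)) /\
    forall p, J p -> ipow J 2 (ev (polc k n) xi n p).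
Proof.
move=> gy lT; pose J p := ev (in_alg T) y n p = 0.
have idJ : ideal J.
  split; rewrite /J; first by rewrite rmorph0.
    by move=> u v hu hv; rewrite rmorphD hu hv addr0.
  by move=> u v hu; rewrite rmorphM hu mulr0.
have J2 : ~ ipow J 2 1.
  move=> /(ipow_sub idJ (n := 2) isT); rewrite /J rmorph1; apply/eqP/oner_neq0.
have [C [p [ps pk pc]]] := quot_exists (polc k n) (ipow_ideal J 2) J2.
have [||h hE] := @quot_lift _ _ (polc k n) C p T (ev (in_alg T) y n) ps pc.
- by move=> a; rewrite ev_polc.
- by move=> x /pk/(ipow_sub idJ (n := 2) isT).
have [|w wE] := lT C T h (lr_id T).
  split=> [d|c c' hc hc']; first by have [q <-] := gy d; exists (p q); rewrite hE.
  have [q qc] := ps c; have [q' qc'] := ps c'; rewrite -qc -qc' -rmorphM; apply/pk.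
  apply: ipowS; first by rewrite /J -hE qc.
  by apply: ipow1; rewrite /J -hE qc'.
have [xi xiE] := ex_choice (fun i => ps (w (y i))).
exists xi; split=> [i ilt|q Jq].
  by rewrite rmorphB ev_polX // -hE xiE; have := wE (y i) => /= ->; rewrite subrr.
have e1 : p (ev (polc k n) xi n q) = ev (in_alg C) (w \o y) n q.
  by apply: ev_nat => // a; exact: pc.
have e2 : w (ev (in_alg T) y n q) = ev (in_alg C) (w \o y) n q.
  by apply: ev_nat => // a; exact: (lrmorph_alg w a).
by apply/pk; rewrite e1 -e2 Jq; exact: rmorph0.
Qed.

(** Iterating the retraction gives endomorphisms [sg s] of the polynomial ring that preserve values
    in [T] and send [J] into its power [2 ^ s]. The lift of [u * a * b] so obtained vanishes to
    arbitrarily high order at the point, while orders of vanishing of polynomials add. *)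
Lemma smooth_point_product (T : alg) (x : {lrmorphism T -> k^o}) (u a b : T) Na Nb :
  fin_gen T -> liftable T -> let m t := x t = 0 in
  x u <> 0 -> u * a * b = 0 -> ipow m Na a \/ ipow m Nb b.
Proof.
move=> [n [y gy]] lT m xu uab; apply: contrapT => /not_orP[na nb].
have [xi [xi1 xi2]] := retraction_exists gy lT.
pose J p := ev (in_alg T) y n p = 0.
pose v i : k := x (y i).
have xv p : x (ev (in_alg T) y n p) = ev idfun v n p.
  apply: (ev_nat (f := x)) => // c; exact: (etrans (lrmorph_alg x c) (mulr1 _)).
pose eta := fix eta s := if s is s'.+1 then fun i => ev (polc k n) (eta s') n (xi i) else polX k n.
pose sg s := ev (polc k n) (eta s) n.
have sgJ s p : J p -> ipow J (2 ^ s) (sg s p).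
  elim: s p => [|s IH] p Jp; first by rewrite /sg ev_self; apply: ipow1.
  have -> : sg s.+1 p = sg s (ev (polc k n) xi n p).
    by symmetry; apply: ev_nat => // c; rewrite /sg ev_polc.
  rewrite expnS; apply: ipow_hom (xi2 p Jp) => q; exact: IH.
have ysg s p : ev (in_alg T) y n (sg s p) = ev (in_alg T) y n p.
  elim: s p => [|s IH] p; first by rewrite /sg ev_self.
  apply: ev_nat => [c|i ilt]; first by rewrite ev_polc.
  rewrite [eta s.+1 i]/(sg s (xi i)) IH; apply/eqP; rewrite -subr_eq0.
  by have := xi1 i ilt; rewrite rmorphB ev_polX // => ->.
(* [tau p] is [p] at [v + X y], expanded in [X]: the coefficient of [X^d] is the homogeneous part of
   degree [d] at [v], so the [X]-adic order is the order of vanishing at [v]. *)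
pose tau := ev [the {rmorphism k -> {poly Pol k n}} of polyC \o polc k n]
  (fun i => (polc k n (v i))%:P + 'X * (polX k n i)%:P) n.
have tau0 p : (tau p)`_0 = polc k n (ev idfun v n p).
  rewrite -horner_coef0 -[LHS]/(horner_eval 0 (tau p)).
  rewrite (ev_nat (d := polc k n) (y := polc k n \o v)); first last.
  - by move=> i _; rewrite /= /horner_eval !hornerE.
  - by move=> c; rewrite /= /horner_eval hornerC.
  by symmetry; apply: ev_nat.
pose m0 p := ev idfun v n p = 0.
have taum M p : ipow m0 M p -> exists Q, tau p = Q * 'X^M.
  elim: M p => [|M IH] p; first by exists (tau p); rewrite expr0 mulr1.
  pose PP q := exists Q : {poly (Pol k n)}, tau q = Q * 'X^(M.+1).
  apply: (@ipow_ind _ m0 M PP).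
    split=> [|q q' [Q QE] [Q' QE']|q q' [Q QE]]; first by exists 0; rewrite rmorph0 mul0r.
      by exists (Q + Q'); rewrite rmorphD QE QE' mulrDl.
    by exists (tau q * Q); rewrite rmorphM QE mulrA.
  move=> q q' mq /IH[Q QE].
  have /factor_theorem[S SE] : root (tau q) 0.
    by rewrite /root horner_coef0 tau0 mq rmorph0.
  by exists (S * Q); rewrite rmorphM SE QE subr0 exprS; ring.
pose t i := y i - (v i)%:A.
pose evt := ev (in_alg T) t n.
have mt i : m (t i).
  rewrite /m /t lrB (lrmorph_alg x) /v; apply/eqP; rewrite subr_eq0; apply/eqP; symmetry.
  exact: mulr1.
have evtd p d : ipow m d (evt (tau p)`_d).
  elim/pol_ind: p d => [c|i ilt|p q IH IH'|p q IH IH'] d.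
  - rewrite ev_polc /= coefC; case: eqP => [->//|_].
    by rewrite rmorph0; exact: (ideal0 (ipow_ideal m _)).
  - rewrite ev_polX // coefD coefC coefXM coefC.
    case: d => [//|[|d]] /=; rewrite add0r.
      by rewrite /evt ev_polX //; apply: ipow1; apply: mt.
    by rewrite rmorph0; exact: (ideal0 (ipow_ideal m d.+2)).
  - by rewrite rmorphD coefD rmorphD; apply: (idealD (ipow_ideal m d)).
  - rewrite rmorphM coefM rmorph_sum; apply: ideal_sum; first exact: ipow_ideal.
    move=> i _; rewrite rmorphM -[X in ipow _ X](subnKC (ltn_ord i : (i <= d)%N)).
    exact: ipowM.
have evtau p : \sum_(d < size (tau p)) evt (tau p)`_d = ev (in_alg T) y n p.
  pose e1 := ev_step evt 1.
  have -> : \sum_(d < size (tau p)) evt (tau p)`_d = e1 (tau p).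
    by rewrite ev_stepE horner_poly; apply: eq_bigr => i _; rewrite expr1n mulr1.
  apply: ev_nat => [c|i ilt].
    by rewrite /e1 /= ev_stepC /evt ev_polc.
  rewrite /e1 rmorphD rmorphM !ev_stepC ev_stepX /evt ev_polc ev_polX // mul1r.
  by rewrite /t addrC GRing.subrK.
have tauM M p : (exists Q, tau p = Q * 'X^M) -> ipow m M (ev (in_alg T) y n p).
  move=> [Q QE]; rewrite -evtau; apply: ideal_sum; first exact: ipow_ideal.
  move=> d0 _; move: (d0 : nat) => d {d0}; have [dM|dM] := ltnP d M.
    by rewrite QE coefMXn dM rmorph0; exact: (ideal0 (ipow_ideal m _)).
  exact: ipow_le dM (evtd p d).
have [ua uaE] := gy u; have [aa aaE] := gy a; have [ba baE] := gy b.
pose s := (1 + Na + Nb)%N.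
have nu : ~ exists Q, tau (sg s ua) = Q * 'X^1.
  move=> [Q QE]; apply: xu; have := tau0 (sg s ua).
  rewrite QE coefMXn /= -xv ysg uaE => /esym/eqP; rewrite fmorph_eq0 => /eqP; exact.
have na' : ~ exists Q, tau (sg s aa) = Q * 'X^Na.
  by move=> /tauM; rewrite ysg aaE.
have nb' : ~ exists Q, tau (sg s ba) = Q * 'X^Nb.
  by move=> /tauM; rewrite ysg baE.
apply: (low_coef_mul (low_coef_mul nu na') nb').
rewrite -!rmorphM; apply: taum; apply: (@ipow_le _ _ _ (2 ^ s)).
  by apply: ltnW; apply: ltn_expl.
apply: (@ipow_mono _ J); last by apply: sgJ; rewrite /J !rmorphM uaE aaE baE.
by move=> q Jq; rewrite /m0 -xv Jq; exact: rmorph0.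
Qed.

(* The local ring at a smooth point is a domain: by Krull's theorem an element lying in
   all powers of the maximal ideal is killed by a function not vanishing at the point. *)
Lemma smooth_point_domain (T : alg) (x : {lrmorphism T -> k^o}) : fin_gen T -> liftable T ->
  exists u, x u <> 0 /\ forall a b, a * b = 0 -> u * a = 0 \/ u * b = 0.
Proof.
move=> fg lT; pose Ix a := exists u, x u <> 0 /\ u * a = 0.
pose m t := x t = 0; have idm : ideal m by apply: kernel_ideal.
have nT := noeth_fin_gen fg.
have xM u v : x u <> 0 -> x v <> 0 -> x (u * v) <> 0.
  by move=> /eqP xu /eqP xv; rewrite lrM; apply/eqP; rewrite mulf_neq0.
have idI : ideal Ix.
  split; first by exists 1; rewrite mulr0; split=> //; rewrite lr1; apply/eqP/oner_neq0.
    move=> a b [u [xu ua]] [v [xv vb]]; exists (u * v); split; first exact: xM.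
    by rewrite mulrDr -mulrA [v * a]mulrC mulrA ua mul0r add0r -mulrA vb mulr0.
  by move=> r a [u [xu ua]]; exists u; rewrite mulrCA ua mulr0.
have kr a : (forall M, ipow m M a) -> Ix a.
  move=> ha; have [||c [mc c0]] := @krull_ideal T m (fun z => z = 0) a nT idm.
  - by split=> [|u v -> ->|u v ->]; rewrite ?addr0 ?mulr0.
  - by move=> M; exists 0; rewrite subr0.
  exists (1 - c); split=> //; rewrite lrB lr1 mc subr0; exact/eqP/oner_neq0.
have prime a b : a * b = 0 -> Ix a \/ Ix b.
  move=> ab; apply: contrapT => /not_orP[na nb].
  have [Na hNa] : exists M, ~ ipow m M a by apply/existsNP => h; apply/na/kr.
  have [Nb hNb] : exists M, ~ ipow m M b by apply/existsNP => h; apply/nb/kr.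
  have x1 : x 1 <> 0 by rewrite lr1; apply/eqP/oner_neq0.
  by have [] := @smooth_point_product T x 1 a b Na Nb fg lT x1; rewrite ?mul1r.
have [s [sI gen]] := nT _ idI.
have [u [xu us]] : exists u, x u <> 0 /\ forall a, a \in s -> u * a = 0.
  elim: s sI {gen} => [|a s IH] sI.
    by exists 1; split=> //; rewrite lr1; apply/eqP/oner_neq0.
  have [|u [xu us]] := IH; first by move=> c cs; apply: sI; rewrite inE cs orbT.
  have [v [xv va]] := sI a (mem_head _ _); exists (u * v); split; first exact: xM.
  move=> c; rewrite inE => /orP[/eqP->|/us uc]; first by rewrite -mulrA va mulr0.
  by rewrite mulrAC uc mul0r.
have uI a : Ix a -> u * a = 0.
  move=> /gen[n [c [d [ds ->]]]]; rewrite mulr_sumr big1 // => i _.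
  by rewrite mulrCA us ?mulr0.
by exists u; split=> // a b /prime[] /uI; [left | right].
Qed.

End SmoothPoints.

(** * Charts of a functor *)

Section Charts.
Variable k : closedFieldType.
Notation alg := (comUnitAlgType k).

Lemma pull_eq (X : kfunctor k) (A B : alg) (f g : {lrmorphism A -> B}) (x : X A) :
  f =1 g -> pull f x = pull g x.
Proof.
move=> fg; rewrite (@pull_comp _ X A A B (lr_id A) g f); last by move=> a /=; rewrite fg.
by rewrite (@pull_id _ X A (lr_id A)).
Qed.

Lemma pull_idE (X : kfunctor k) (A : alg) (x : X A) : pull (lr_id A) x = x.
Proof. exact: pull_id. Qed.

Lemma unit_ideal_image (A B : alg) (f : {lrmorphism A -> B}) (D : A -> Prop) :
  unit_ideal D -> unit_ideal (fun b => exists2 a, D a & b = f a).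
Proof.
move=> [n [c [d [dD E]]]]; exists n, (f \o c), (f \o d); split=> [i|].
  by exists (d i).
by rewrite -(lr1 f) -E lr_sum; apply: eq_bigr => i _; rewrite lrM.
Qed.

Lemma open_subP (X : kfunctor k) (U : subset_of X) : open_sub U ->
  forall (A : alg) (x : X A), exists D : A -> Prop,
    (U A x -> unit_ideal D) /\ (unit_ideal D -> U A x) /\
    forall (B : alg) (f : {lrmorphism A -> B}), U B (pull f x) <->
      unit_ideal (fun b => exists2 a, D a & b = f a).
Proof.
move=> oU A x; have [D DP] := oU A x; exists D.
have h := DP A (lr_id A); rewrite pull_idE in h.
split=> [/h[n [c [d [dD E]]]]|].
  exists n, c, d; split=> // i; by have [a Da ->] := dD i.
split=> // [[n [c [d [dD E]]]]]; apply/h; exists n, c, d; split=> // i; by exists (d i).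
Qed.

Lemma open_sub_pull (X : kfunctor k) (U : subset_of X) : open_sub U ->
  forall (A B : alg) (f : {lrmorphism A -> B}) (x : X A), U A x -> U B (pull f x).
Proof.
move=> oU A B f x Ux; have [D [h1 [_ h2]]] := open_subP oU x.
by apply/h2/unit_ideal_image/h1.
Qed.

(** The formal properties of an open immersion of the spectrum of [R]: it is a monomorphism, its
    image is open, and square-zero thickenings of its points stay inside. They pass to
    localizations. *)
Definition prechart (X : kfunctor k) (R : alg) (r : X R) : Prop :=
  [/\ forall (A : alg) (u v : {lrmorphism R -> A}), pull u r = pull v r -> u =1 v,
      forall (A : alg) (y : X A) (K : alg) (phi : {lrmorphism A -> K})
        (w : {lrmorphism R -> K}), is_field K -> pull w r = pull phi y ->
        exists d, phi d <> 0 /\ forall (B : alg) (psi : {lrmorphism A -> B}),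
          psi d \is a GRing.unit -> exists u : {lrmorphism R -> B}, pull u r = pull psi y
    & forall (C D : alg) (h : {lrmorphism C -> D}) (y : X C) (w : {lrmorphism R -> D}),
        square_zero_thickening h -> pull w r = pull h y ->
        exists u : {lrmorphism R -> C}, pull u r = y].

Lemma field_unit (K : alg) (x : K) : is_field K -> x <> 0 -> x \is a GRing.unit.
Proof. by move=> fK /eqP; apply: fK. Qed.

Lemma square_zero_unit (C D : alg) (h : {lrmorphism C -> D}) (a : C) :
  square_zero_thickening h -> h a \is a GRing.unit -> a \is a GRing.unit.
Proof.
move=> [hs hz] ua; have [b bE] := hs (h a)^-1.
have e0 : h (1 - a * b) = 0 by rewrite lrB lrM lr1 bE divrr // subrr.
have ee := hz _ _ e0 e0; apply/unitrP; exists (b * (1 + (1 - a * b))).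
have E : a * b * (1 + (1 - a * b)) = 1 by rewrite -[RHS](subr0 1) -ee; ring.
by split; rewrite -[RHS]E; ring.
Qed.

Lemma affine_open_prechart (X : kfunctor k) (U : subset_of X) (R : alg) (r : X R) :
  affine_open U r -> prechart r.
Proof.
move=> [oU [Ur rep]]; split.
- move=> A u v uv; have [_ h] := rep A (pull v r) (open_sub_pull oU v Ur); exact: h.
- move=> A y K phi w fK wE; have [D [_ [_ DP]]] := open_subP oU y.
  have : U K (pull phi y) by rewrite -wE; apply: open_sub_pull.
  move/DP => [n [c [d [dD E]]]].
  have [i di] : exists i, d i <> 0.
    apply/existsNP => h; move: (oner_neq0 K); rewrite -E big1 ?eqxx // => i _.
    by rewrite h mulr0.
  have [a Da da] := dD i; exists a; split=> [|B psi upsi]; first by rewrite -da.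
  have : U B (pull psi y).
    apply/DP; exists 1%N, (fun=> (psi a)^-1), (fun=> psi a); split=> [_|]; first by exists a.
    by rewrite big_ord1 mulVr.
  by move=> /rep[[u uE] _]; exists u.
- move=> C D h y w sz wE; have [E [_ [EP E2]]] := open_subP oU y.
  have : U D (pull h y) by rewrite -wE; apply: open_sub_pull.
  move/E2 => [n [c [d [dD s1]]]]; have [hs hz] := sz.
  have [c' c'E] := ex_choice (fun i => hs (c i)).
  have [d' d'E] : exists d', forall i, E (d' i) /\ d i = h (d' i).
    apply: (@ex_choice _ _ (fun i x => E x /\ d i = h x)) => i.
    by have [a Ea ->] := dD i; exists a.
  pose s := \sum_i c' i * d' i.
  have us : s \is a GRing.unit.
    apply: (square_zero_unit sz); rewrite lr_sum.
    rewrite (eq_bigr (fun i => c i * d i)) ?s1 ?unitr1 // => i _.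
    by rewrite lrM c'E; have [_ ->] := d'E i.
  have /EP/rep[[u uE] _] : unit_ideal E.
    exists n, (fun i => s^-1 * c' i), d'; split=> [i|]; first by have [] := d'E i.
    by rewrite -[RHS](mulVr us) /s mulr_sumr; apply: eq_bigr => i _; rewrite mulrA.
  by exists u.
Qed.

Lemma localization_ext (A L B : alg) (a : A) (l : {lrmorphism A -> L})
    (u v : {lrmorphism L -> B}) : is_localization l a -> u \o l =1 v \o l -> u =1 v.
Proof.
move=> [la lf lk] uv0 b; have [n [c E]] := lf b; have uv x : u (l x) = v (l x) := uv0 x.
have un : u (l a ^+ n) \is a GRing.unit by apply: lr_unit; apply: unitrX.
apply: (mulIr un); rewrite -lrM E uv -E lrM; congr (_ * _).
by rewrite !lrX uv.
Qed.

Lemma fin_gen_localization (A L : alg) (a : A) (l : {lrmorphism A -> L}) :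
  is_localization l a -> fin_gen A -> fin_gen L.
Proof.
move=> [la lf lk] fg.
apply: (@fin_gen_mpoly k A L 1 (mev l (fun=> (l a)^-1)) fg).
  move=> c; exact: (etrans (mevC l (fun=> (l a)^-1) c%:A) (lrmorph_alg l c)).
move=> y; have [n [c E]] := lf y; exists (c%:MP * 'X_ord0 ^+ n).
have lc : mev l (fun _ : 'I_1 => (l a)^-1) c%:MP = l c := mevC _ _ _.
rewrite rmorphM rmorphXn mevXi lc -E exprVn mulrK //; exact: unitrX.
Qed.

Lemma prechart_localization (X : kfunctor k) (R L : alg) (r : X R) (a : R)
    (l : {lrmorphism R -> L}) : is_localization l a -> prechart r -> prechart (pull l r).
Proof.
move=> loc [mono opn lft]; have [la lf lk] := loc.
have pc (A : alg) (u : {lrmorphism L -> A}) : exists ul : {lrmorphism R -> A},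
    ul =1 u \o l /\ pull u (pull l r) = pull ul r.
  by have [ul ulE] := lr_comp l u; exists ul; split=> //; rewrite (pull_comp r ulE).
split.
- move=> A u v; have [ul [ulE ->]] := pc A u; have [vl [vlE ->]] := pc A v.
  by move=> /mono uv; apply: (localization_ext loc) => x; rewrite -ulE -vlE uv.
- move=> A y K phi w fK; have [wl [wlE ->]] := pc K w => E.
  have [d0 [phd0 h]] := opn A y K phi wl fK E.
  have nn n : d0 ^+ n <> 0.
    move=> h0; have := congr1 phi h0; rewrite lrX lr0 => /eqP.
    have := unitrX n (field_unit fK phd0); case: eqP => // ->; by rewrite unitr0.
  have [L0 [l0 loc0]] := localization_exists nn; have [l0u l0f l0k] := loc0.
  have [u0 u0E] := h L0 l0 l0u.
  have [phi' phi'E] := localization_univ loc0 (field_unit fK phd0).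
  (* On the open set [d0] the pulled back function [a] is a fraction; its numerator [al] cuts out
     the smaller open set. *)
  have [M [al alE]] := l0f (u0 a).
  have wa : phi' (u0 a) = w (l a).
    have [pu puE] := lr_comp u0 phi'.
    rewrite -[LHS]puE -[RHS]wlE; apply: mono; rewrite E (pull_comp r puE) u0E.
    by symmetry; apply: pull_comp => x /=; rewrite phi'E.
  have pal : phi al \is a GRing.unit.
    rewrite -phi'E -alE lrM lrX phi'E wa; rewrite unitrM lr_unit //=.
    by apply: unitrX; apply: field_unit.
  exists (d0 * al); split.
    rewrite lrM => h0; have : phi d0 * phi al \is a GRing.unit.
      by rewrite unitrM pal field_unit.
    by rewrite h0 unitr0.
  move=> B psi; rewrite lrM unitrM => /andP[ud0 ual].
  have [psi' psi'E] := localization_univ loc0 ud0.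
  have [pu puE] := lr_comp u0 psi'.
  have ua : pu a \is a GRing.unit.
    move: ual; rewrite -psi'E -alE lrM unitrM => /andP[]; by rewrite puE.
  have [u uE] := localization_univ loc ua; exists u.
  have [ul [ulE ->]] := pc B u.
  rewrite (pull_comp (f := l0) (g := psi') (h := psi)); last by move=> x /=; rewrite psi'E.
  rewrite -u0E -(pull_comp r puE); apply: pull_eq => x; by rewrite ulE /= uE.
- move=> C D h y w sz; have [wl [wlE ->]] := pc D w => E.
  have [ul ulE] := lft C D h y wl sz E.
  have ua : ul a \is a GRing.unit.
    apply: (square_zero_unit sz); have [hu huE] := lr_comp ul h.
    have -> : h (ul a) = w (l a).
      by rewrite -[LHS]huE -[RHS]wlE; apply: mono; rewrite (pull_comp r huE) ulE.
    exact: lr_unit.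
  have [u uE] := localization_univ loc ua; exists u.
  have [ul' [ul'E ->]] := pc C u; rewrite -ulE; apply: pull_eq => x; by rewrite ul'E /= uE.
Qed.

Definition chart (X : kfunctor k) (R : alg) (r : X R) : Prop := fin_gen R /\ prechart r.

Lemma chart_localization (X : kfunctor k) (R L : alg) (r : X R) (a : R)
    (l : {lrmorphism R -> L}) : is_localization l a -> chart r -> chart (pull l r).
Proof.
move=> loc [fg pr]; split; first exact: fin_gen_localization loc fg.
exact: prechart_localization loc pr.
Qed.

Section GL3.
Variable q : nat.
Let GL : kfunctor k := GL3_functor k.

Lemma val_pull_GL3 (A B : alg) (f : {lrmorphism A -> B}) (g : GL A) :
  val (pull f g : GL3 B) = map_mx f (val (g : GL3 A)).
Proof. by []. Qed.

Lemma GL3_universal : exists (O : alg) (ga : GL O), fin_gen O /\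
  forall (A : alg) (g : GL A), exists u : {lrmorphism O -> A}, pull u ga = g.
Proof.
pose P := {mpoly k[9]}.
have [A0 [p [ps pinj pc]]] := @ring_alg k P [the {rmorphism k -> P} of mpolyC 9 (R := k)].
pose ix (i j : 'I_3) : 'I_9 := inord (3 * i + j).
pose X : 'M[A0]_3 := \matrix_(i, j) p 'X_(ix i j).
have hom (A : alg) (g : 'M[A]_3) : exists u : {lrmorphism A0 -> A}, map_mx u X = g.
  pose b (l : 'I_9) : A := g (inord (l %/ 3)) (inord (l %% 3)).
  have [||u uE] := @quot_lift _ _ _ A0 p A (mev (in_alg A) b) ps pc.
  - by move=> a; exact: mevC.
  - by move=> x px; rewrite (pinj x 0) ?rmorph0.
  exists u; apply/matrixP => i j; rewrite !mxE uE mevXi /b /ix.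
  have lt : (3 * i + j < 9)%N by case: i j => [i ilt] [j jlt] /=; lia.
  rewrite inordK // mulnC divnMDl // modnMDl divn_small // addn0 modn_small //.
  by rewrite !inord_val.
have nn n : (\det X) ^+ n <> 0.
  move=> h; have [u uE] := hom k^o 1%:M; have := congr1 u h.
  rewrite lrX lr0 -[u (\det X)](det_map_mx u) uE det1 expr1n; apply/eqP/oner_neq0.
have [O [l loc]] := localization_exists nn; have [lu lf lk] := loc.
have uX : map_mx l X \in unitmx by rewrite unitmxE det_map_mx.
exists O, (exist _ (map_mx l X) uX : GL O); split.
  apply: (fin_gen_localization loc); exists 9, (fun i => p 'X_(inord i)).
  move=> a; have [x <-] := ps a.
  elim/mpoly_gen_ind: x => [c|i|x y [u uE] [v vE]|x y [u uE] [v vE]].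
  - exists (polc k 9 c); rewrite ev_polc; symmetry; exact: pc.
  - exists (polX k 9 i); by rewrite ev_polX // inord_val.
  - by exists (u + v); rewrite !rmorphD uE vE.
  - by exists (u * v); rewrite !rmorphM uE vE.
move=> A g; have [u uE] := hom A (val (g : GL3 A)).
have ud : u (\det X) \is a GRing.unit.
  by rewrite -(det_map_mx u) uE -unitmxE; exact: (valP (g : GL3 A)).
have [v vE] := localization_univ loc ud; exists v; apply: val_inj.
rewrite [LHS]val_pull_GL3 /= -uE; apply/matrixP => i j; by rewrite !mxE vE.
Qed.

Variables (X : kfunctor k) (u : kmorphism X GL).
Hypothesis u_lfp : locally_finitely_presented u.

(** The affine open of [GL3] given by local finite presentation is shrunk to a principal open of
    [GL3], whose coordinate ring is visibly finitely generated, and the localized [R] is generated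
    by finitely many elements over it. *)
Lemma chart_cover (K : alg) (x : X K) : is_field K ->
  exists (R : alg) (r : X R) (w : {lrmorphism R -> K}), chart r /\ pull w r = x.
Proof.
move=> fK; have [U [R [r [V [T [t [aU aV Ux UV [f fE [n [b [m [rr [bs bk]]]]]]]]]]]]] := u_lfp x fK.
have prU := affine_open_prechart aU; have [oU [Ur rep]] := aU; have [oV [Vt Vrep]] := aV.
have [O [ga [fgO Ouniv]]] := GL3_universal.
have [[w wE] _] := rep K x Ux.
have [e eE] := Ouniv R (u R r).
have [D [_ [_ DP]]] := open_subP oV ga.
have [ew ewE] := lr_comp e w.
have : V K (pull ew ga).
  rewrite (pull_comp ga ewE) eE -kfun_nat wE; exact: UV.
move/DP => [l [c [d [dD E]]]].
have [i di] : exists i, d i <> 0.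
  apply/existsNP => h; move: (oner_neq0 K); rewrite -E big1 ?eqxx // => i _.
  by rewrite h mulr0.
have [a Da da] := dD i.
have wea : w (e a) <> 0 by rewrite -[w _]ewE -da.
have nO k0 : a ^+ k0 <> 0.
  move=> h; have := unitrX k0 (field_unit fK wea); by rewrite -!lrX h !lr0 unitr0.
have nR k0 : e a ^+ k0 <> 0.
  move=> h; have := unitrX k0 (field_unit fK wea); by rewrite -lrX h lr0 unitr0.
have [Oa [lO locO]] := localization_exists nO; have [lOu lOf lOk] := locO.
have [R' [lR locR]] := localization_exists nR; have [lRu lRf lRk] := locR.
have [w' w'E] := localization_univ locR (field_unit fK wea).
have VOa : V Oa (pull lO ga).
  apply/DP; exists 1%N, (fun=> (lO a)^-1), (fun=> lO a); split=> [_|]; first by exists a.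
  by rewrite big_ord1 mulVr.
have [[tau tauE] _] := Vrep _ _ VOa.
have [le leE] := lr_comp e lR.
have [|eps epsE] := @localization_univ _ O Oa R' a lO le locO; first by rewrite leE.
have [lf lfE] := lr_comp f lR; have [et etE] := lr_comp tau eps.
have ftau x0 : lR (f x0) = eps (tau x0).
  have VR' : V R' (pull lf t).
    exact: open_sub_pull.
  rewrite -[LHS]lfE -[RHS]etE; have [_ h] := Vrep _ _ VR'; apply: h => //.
  rewrite (pull_comp t lfE) (pull_comp t etE) fE tauE -eE -(pull_comp ga leE).
  by symmetry; apply: pull_comp => y /=; rewrite epsE.
exists R', (pull lR r), w'; split; last first.
  rewrite -(pull_comp r (h := w)) //; by move=> y /=; rewrite w'E.
split; last exact: prechart_localization locR prU.
pose P := mev eps (lR \o b).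
have PR y : exists p, P p = lR y.
  have [p <-] := bs y; elim/mpoly_gen_ind: p => [c0|j|p p' [s sE] [s' s'E]|p p' [s sE] [s' s'E]].
  - exists (tau c0)%:MP; transitivity (eps (tau c0)); first exact: mevC.
    rewrite -ftau; apply: congr1; symmetry; exact: mevC.
  - exists 'X_j; transitivity (lR (b j)); first exact: mevXi.
    apply: congr1; symmetry; exact: mevXi.
  - exists (s + s'); rewrite rmorphD sE s'E -lrD; apply: congr1; symmetry; exact: (rmorphD (mev f b)).
  - exists (s * s'); rewrite rmorphM sE s'E -lrM; apply: congr1; symmetry; exact: (rmorphM (mev f b)).
apply: (@fin_gen_mpoly k Oa R' n P (fin_gen_localization locO fgO)).
  by move=> c0; exact: (etrans (mevC eps (lR \o b) c0%:A) (lrmorph_alg eps c0)).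
move=> y; have [N [c0 cE]] := lRf y; have [s sE] := PR c0.
exists (s * ((lO a)^-1 ^+ N)%:MP); rewrite rmorphM sE -cE.
have -> : P ((lO a)^-1 ^+ N)%:MP = eps ((lO a)^-1 ^+ N) := mevC _ _ _.
have -> : eps ((lO a)^-1 ^+ N) = (lR (e a) ^+ N)^-1.
  by rewrite lrX lrV // exprVn epsE leE.
by rewrite mulrK // unitrX.
Qed.

End GL3.
End Charts.

(** * Gluing functions from charts *)

Section Gluing.
Variable k : closedFieldType.
Notation alg := (comUnitAlgType k).

Lemma localization_zero (A : alg) (d z : A) :
  (forall (B : alg) (psi : {lrmorphism A -> B}), psi d \is a GRing.unit -> psi z = 0) ->
  exists n, d ^+ n * z = 0.
Proof.
move=> h; have [[n dn]|nn] := pselect (exists n, d ^+ n = 0); first by exists n; rewrite dn mul0r.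
have [|L [l [lu _ lk]]] := @localization_exists k A d.
  by move=> n dn; apply: nn; exists n.
by apply: lk; apply: h.
Qed.

(** If the annihilator of [z] were proper, a field point killing it would contradict vanishing near
    that point. *)
Lemma local_zero (A : alg) (z : A) :
  (forall (K : alg) (phi : {lrmorphism A -> K}), is_field K ->
     exists d, phi d <> 0 /\ forall (B : alg) (psi : {lrmorphism A -> B}),
       psi d \is a GRing.unit -> psi z = 0) -> z = 0.
Proof.
move=> h; have idI : ideal (fun a => a * z = 0).
  split=> [|a b az bz|r a az]; first by rewrite mul0r.
    by rewrite mulrDl az bz addr0.
  by rewrite -mulrA az mulr0.
rewrite -(mul1r z); apply: contrapT => I1.
have [K [phi [fK phi0]]] := field_point idI I1.
have [d [pd dP]] := h K phi fK; have [n dn] := localization_zero dP.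
have := phi0 _ dn; rewrite lrX => h0; have := unitrX n (field_unit fK pd).
by rewrite h0 unitr0.
Qed.

Variables (X : kfunctor k) (Zc : subset_of X).
Hypothesis Zc_pull : forall (A B : alg) (f : {lrmorphism A -> B}) (y : X A),
  Zc y -> Zc (pull f y).
Variable Dat : forall R : alg, X R -> R -> Prop.
Hypothesis Dat_chart : forall (R : alg) (r : X R) c, Dat r c -> prechart r.
Hypothesis Dat_cover : forall (K : alg) (y : X K), is_field K -> Zc y ->
  exists (R : alg) (r : X R) c (w : {lrmorphism R -> K}), Dat r c /\ pull w r = y.
Hypothesis Dat_compat : forall (A R R' : alg) (r : X R) (r' : X R') c c'
  (u : {lrmorphism R -> A}) (u' : {lrmorphism R' -> A}),
  Dat r c -> Dat r' c' -> Zc (pull u r) -> pull u r = pull u' r' -> u c = u' c'.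

Definition glued (A : alg) (y : X A) (a : A) : Prop :=
  forall (B : alg) (psi : {lrmorphism A -> B}) (R : alg) (r : X R) c (u : {lrmorphism R -> B}),
    Dat r c -> pull u r = pull psi y -> u c = psi a.

Lemma piece_at (A K : alg) (phi : {lrmorphism A -> K}) (y : X A) : is_field K -> Zc y ->
  exists d, phi d <> 0 /\ exists (R : alg) (r : X R) c, Dat r c /\
    forall (B : alg) (psi : {lrmorphism A -> B}),
      psi d \is a GRing.unit -> exists u : {lrmorphism R -> B}, pull u r = pull psi y.
Proof.
move=> fK Zy; have [R [r [c [w [Dc wE]]]]] := Dat_cover fK (Zc_pull phi Zy).
have [_ opn _] := Dat_chart Dc; have [d [pd dP]] := opn _ _ _ _ _ fK wE.
by exists d; split=> //; exists R, r, c.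
Qed.

Lemma local_value (A : alg) (y : X A) d (R : alg) (r : X R) c : Zc y -> Dat r c ->
  (forall (B : alg) (psi : {lrmorphism A -> B}),
      psi d \is a GRing.unit -> exists u : {lrmorphism R -> B}, pull u r = pull psi y) ->
  exists M b, forall (B : alg) (psi : {lrmorphism A -> B}), psi d \is a GRing.unit ->
    forall (R' : alg) (r' : X R') c' (u : {lrmorphism R' -> B}), Dat r' c' ->
    pull u r' = pull psi y -> u c' * psi d ^+ M = psi b.
Proof.
move=> Zy Dc h; have [[n dn]|nn] := pselect (exists n, d ^+ n = 0).
  (* A nilpotent [d] becomes invertible in no algebra, so any value will do. *)
  exists 0%N, 0 => B psi ud; have := unitrX n ud; by rewrite -lrX dn lr0 unitr0.
have [|L [l loc]] := @localization_exists k A d; first by move=> n dn; apply: nn; exists n.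
have [lu lf lk] := loc; have [u0 u0E] := h L l lu; have [M [b bE]] := lf (u0 c).
exists M, b => B psi ud R' r' c' u Dc' uE.
have [psi' psi'E] := localization_univ loc ud; have [v vE] := lr_comp u0 psi'.
have vr : pull v r = pull u r'.
  rewrite uE (pull_comp r vE) u0E; symmetry; apply: pull_comp => x /=; by rewrite psi'E.
have -> : u c' = v c.
  symmetry; apply: (Dat_compat Dc Dc' _ vr); rewrite vr uE; exact: Zc_pull.
by rewrite vE /= -!psi'E -lrX -lrM bE.
Qed.

(** Sections over an affine cover: the fractions [b i / d i ^+ M i] agree on overlaps after
    multiplication by a common power [N], and a partition of unity by powers of the [d i] assembles
    them. *)
Lemma glued_exists (A : alg) (y : X A) : Zc y -> exists a, glued y a.
Proof.
move=> Zy; pose D d := exists (R : alg) (r : X R) c, Dat r c /\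
    forall (B : alg) (psi : {lrmorphism A -> B}),
      psi d \is a GRing.unit -> exists u : {lrmorphism R -> B}, pull u r = pull psi y.
have [|n [s [d [dD s1]]]] := @unit_ideal_field k A D.
  by move=> K phi fK; have [d [pd Dd]] := piece_at phi fK Zy; exists d.
have [M [b bP]] : exists M b, forall i (B : alg) (psi : {lrmorphism A -> B}),
    psi (d i) \is a GRing.unit ->
    forall (R' : alg) (r' : X R') c' (u : {lrmorphism R' -> B}), Dat r' c' ->
    pull u r' = pull psi y -> u c' * psi (d i) ^+ M i = psi (b i).
  have [F FP] : exists F : 'I_n -> nat * A, forall i (B : alg) (psi : {lrmorphism A -> B}),
    psi (d i) \is a GRing.unit ->
    forall (R' : alg) (r' : X R') c' (u : {lrmorphism R' -> B}), Dat r' c' ->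
    pull u r' = pull psi y -> u c' * psi (d i) ^+ (F i).1 = psi (F i).2.
    apply: (@ex_choice _ _ (fun i F => forall (B : alg) (psi : {lrmorphism A -> B}),
    psi (d i) \is a GRing.unit ->
    forall (R' : alg) (r' : X R') c' (u : {lrmorphism R' -> B}), Dat r' c' ->
    pull u r' = pull psi y -> u c' * psi (d i) ^+ F.1 = psi F.2)) => i.
    have [R [r [c [Dc cP]]]] := dD i; have [M [b bP]] := local_value Zy Dc cP.
    by exists (M, b).
  by exists (fun i => (F i).1), (fun i => (F i).2).
have [N NP] : exists N, forall i j,
    (d i * d j) ^+ N * (d j ^+ M j * b i - b j * d i ^+ M i) = 0.
  have [F FP] : exists F : 'I_n * 'I_n -> nat, forall ij,
     (d ij.1 * d ij.2) ^+ F ij * (d ij.2 ^+ M ij.2 * b ij.1 - b ij.2 * d ij.1 ^+ M ij.1) = 0.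
    apply: (@ex_choice _ _ (fun ij e => (d ij.1 * d ij.2) ^+ e *
      (d ij.2 ^+ M ij.2 * b ij.1 - b ij.2 * d ij.1 ^+ M ij.1) = 0)) => -[i j] /=.
    apply: localization_zero => B psi; rewrite lrM unitrM => /andP[ui uj].
    have [R [r [c [Dc cP]]]] := dD i; have [u uE] := cP B psi ui.
    rewrite lrB !lrM !lrX -(bP i B psi ui _ _ _ _ Dc uE) -(bP j B psi uj _ _ _ _ Dc uE).
    by rewrite mulrCA mulrA subrr.
  exists (\max_ij F ij) => i j; have := leq_bigmax (F := F) (i, j) => /subnK <-.
  by rewrite exprD -mulrA FP mulr0.
(* Multipliers [e] whose product with the function sought is already global; [I] contains a power of
   each [d j], hence 1. *)
pose I e := exists b', forall i (B : alg) (psi : {lrmorphism A -> B}),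
    psi (d i) \is a GRing.unit ->
    forall (R' : alg) (r' : X R') c' (u : {lrmorphism R' -> B}), Dat r' c' ->
    pull u r' = pull psi y -> psi e * u c' = psi b'.
have idI : ideal I.
  split.
  - by exists 0 => *; rewrite !lr0 mul0r.
  - move=> e e' [b1 h1] [b2 h2]; exists (b1 + b2) => i B psi ui R' r' c' u Dc uE.
    by rewrite !lrD mulrDl (h1 i B psi ui _ _ _ _ Dc uE) (h2 i B psi ui _ _ _ _ Dc uE).
  - move=> e e' [b1 h1]; exists (e * b1) => i B psi ui R' r' c' u Dc uE.
    by rewrite !lrM -mulrA (h1 i B psi ui _ _ _ _ Dc uE).
have [a aP] : I 1.
  apply: (ideal_powers idI s1) => j; exists (N + M j)%N, (d j ^+ N * b j).
  move=> i B psi ui R' r' c' u Dc uE.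
  have E := congr1 psi (NP i j); rewrite lrM lrX lrM lrB !lrM !lrX lr0 in E.
  have uM := bP i B psi ui _ _ _ _ Dc uE.
  apply: (mulIr (unitrX (M i + N) ui)); apply/eqP; rewrite -subr_eq0 -E -uM.
  rewrite lrM !lrX !exprD exprMn; apply/eqP.
  by move: (psi (d i) ^+ M i) (psi (d i) ^+ N) (psi (d j) ^+ N) (psi (d j) ^+ M j) => *; ring.
exists a => B psi R r c u Dc uE; apply/eqP; rewrite -subr_eq0; apply/eqP.
have idI' : ideal (fun e => e * (u c - psi a) = 0).
  split=> [|e e' h h'|e e' h]; first by rewrite mul0r.
    by rewrite mulrDl h h' addr0.
  by rewrite -mulrA h mulr0.
rewrite -[LHS]mul1r; apply: (ideal_powers idI' (s := index_enum 'I_n)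
   (c := psi \o s) (d := psi \o d)) => [|i].
  by rewrite -(lr1 psi) -s1 lr_sum; apply: eq_bigr => i _; rewrite lrM.
apply: localization_zero => C th ui; have [tp tpE] := lr_comp psi th.
have [tu tuE] := lr_comp u th.
have utp : tp (d i) \is a GRing.unit by rewrite tpE.
have tuy : pull tu r = pull tp y by rewrite (pull_comp r tuE) uE -(pull_comp y tpE).
have E := aP i C tp utp R r c tu Dc tuy; rewrite lr1 mul1r in E.
by rewrite lrB -[th (u c)]tuE -[th (psi a)]tpE E subrr.
Qed.

Lemma glued_unique (A : alg) (y : X A) a b : Zc y -> glued y a -> glued y b -> a = b.
Proof.
move=> Zy ga gb; apply/eqP; rewrite -subr_eq0; apply/eqP; apply: local_zero => K phi fK.
have [d [pd [R [r [c [Dc h]]]]]] := piece_at phi fK Zy; exists d; split=> // B psi ud.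
have [u uE] := h B psi ud.
by rewrite lrB -(ga B psi _ _ _ _ Dc uE) -(gb B psi _ _ _ _ Dc uE) subrr.
Qed.

(** Functions being total, the value 0 is assigned outside [Zc]. *)
Lemma glued_function : exists h : forall A : alg, X A -> A,
  [/\ function_on Zc h,
      forall (R A : alg) (r : X R) c (u : {lrmorphism R -> A}), Dat r c -> Zc (pull u r) ->
        h A (pull u r) = u c
    & forall (A : alg) (y : X A), ~ Zc y -> h A y = 0].
Proof.
have ex A (y : X A) : exists a, (Zc y -> glued y a) /\ (~ Zc y -> a = 0).
  have [Zy|nZ] := pselect (Zc y); last by exists 0.
  by have [a ga] := glued_exists Zy; exists a.
pose h A y := projT1 (cid (ex A y)).
have hP A y : Zc y -> glued y (h A y) by exact: (projT2 (cid (ex A y))).1.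
have h0 A y : ~ Zc y -> h A y = 0 by exact: (projT2 (cid (ex A y))).2.
exists h; split=> //.
- move=> A B f y Zy; have Zfy := Zc_pull f Zy; apply: (glued_unique Zfy (hP _ _ Zfy)).
  move=> C psi R r c u Dc uE; have [fp fpE] := lr_comp f psi.
  rewrite -[psi _]fpE; apply: (hP _ _ Zy _ _ _ _ _ _ Dc); by rewrite uE -(pull_comp y fpE).
- move=> R A r c u Dc Zu; symmetry.
  have /= <- // := hP _ _ Zu A (lr_id A) R r c u Dc; by rewrite pull_idE.
Qed.

Lemma glued_semi_invariant (h : forall A : alg, X A -> A) (A : alg) (y y' : X A) (chi : A) :
  function_on Zc h -> 
  (forall (R A : alg) (r : X R) c (u : {lrmorphism R -> A}), Dat r c -> Zc (pull u r) ->
        h A (pull u r) = u c) ->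
  Zc y -> Zc y' ->
  (forall (B R R' : alg) (psi : {lrmorphism A -> B}) (r : X R) (r' : X R') c c'
     (u : {lrmorphism R -> B}) (u' : {lrmorphism R' -> B}), Dat r c -> Dat r' c' ->
     pull u r = pull psi y -> pull u' r' = pull psi y' -> u' c' = psi chi * u c) ->
  h A y' = chi * h A y.
Proof.
move=> hn hv Zy Zy' H; apply/eqP; rewrite -subr_eq0; apply/eqP; apply: local_zero => K phi fK.
have [d [pd [R [r [c [Dc hd]]]]]] := piece_at phi fK Zy.
have [d' [pd' [R' [r' [c' [Dc' hd']]]]]] := piece_at phi fK Zy'.
exists (d * d'); split.
  rewrite lrM => h0; have : phi d * phi d' \is a GRing.unit by rewrite unitrM !field_unit.
  by rewrite h0 unitr0.
move=> B psi; rewrite lrM unitrM => /andP[ud ud'].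
have [u uE] := hd B psi ud; have [u' u'E] := hd' B psi ud'.
have Zu : Zc (pull u r) by rewrite uE; apply: Zc_pull.
have Zu' : Zc (pull u' r') by rewrite u'E; apply: Zc_pull.
rewrite lrB lrM -!hn // -uE -u'E (hv _ _ _ _ _ Dc Zu) (hv _ _ _ _ _ Dc' Zu').
by rewrite (H B R R' psi r r' c c' u u' Dc Dc' uE u'E) subrr.
Qed.

End Gluing.

(** * Smooth loci and charts on which their ideals are prime *)

Section PrimeCharts.
Variable k : closedFieldType.
Notation alg := (comUnitAlgType k).

Definition primeI (R : alg) (I : R -> Prop) : Prop :=
  ~ I 1 /\ forall a b, I (a * b) -> I a \/ I b.

Lemma fin_gen_quotient (R T : alg) (p : {lrmorphism R -> T}) :
  (forall y, exists x, p x = y) -> fin_gen R -> fin_gen T.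
Proof.
move=> ps [n [x gx]]; exists n, (p \o x) => t; have [a <-] := ps t; have [q <-] := gx a.
exists q; symmetry; apply: ev_nat => // c; exact: (lrmorph_alg p c).
Qed.

Lemma nss_ideal (R : alg) (I : R -> Prop) (b : R) : fin_gen R -> ideal I ->
  (forall x : {lrmorphism R -> k^o}, (forall a, I a -> x a = 0) -> x b = 0) ->
  exists n, I (b ^+ n).
Proof.
move=> fg idI h; have [I1|I1] := pselect (I 1).
  by exists 0%N.
have [T [p [ps pk]]] := alg_quot idI I1; apply: contrapT => nex.
have [|x xb] := @nullstellensatz k T (p b) (fin_gen_quotient ps fg).
  by move=> n hn; apply: nex; exists n; apply/pk; rewrite lrX.
have [xp xpE] := lr_comp p x; apply: xb; rewrite -[LHS]xpE; apply: h => a /pk pa.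
by rewrite xpE /= pa; exact: lr0.
Qed.

Lemma primeI_pow (R : alg) (I : R -> Prop) b n : primeI I -> I (b ^+ n) -> I b.
Proof.
by move=> [I1 pI]; elim: n => [/I1//|n IH]; rewrite exprS => /pI[//|/IH].
Qed.

Lemma nss_prime (R : alg) (I : R -> Prop) (b : R) : fin_gen R -> ideal I -> primeI I ->
  (forall x : {lrmorphism R -> k^o}, (forall a, I a -> x a = 0) -> x b = 0) -> I b.
Proof. by move=> fg idI pI /(nss_ideal fg idI)[n] /(primeI_pow pI). Qed.

Lemma local_mem (R : alg) (I : R -> Prop) (b : R) : fin_gen R -> ideal I ->
  (forall x : {lrmorphism R -> k^o}, (forall a, I a -> x a = 0) ->
     exists a, x a <> 0 /\ I (a * b)) -> I b.
Proof.
move=> fg idI h; have idJ : ideal (fun a => I (a * b)).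
  split=> [|u v hu hv|r u hu]; first by rewrite mul0r; apply: ideal0.
    by rewrite mulrDl; apply: idealD.
  by rewrite -mulrA; apply: idealM.
have [|n] := @nss_ideal R (fun a => I (a * b)) 1 fg idJ; last by rewrite expr1n mul1r.
move=> x xI; have [|a [xa Iab]] := h x; last by case: xa; apply: xI.
by move=> a Ia; apply: xI; apply: ideal_mulr.
Qed.

Definition eqfam := forall A : alg, 'M[A]_3 -> seq A.

(** Two requirements: the equations commute with change of algebra, and their zero locus in [GL3] is
    formally smooth. *)
Definition eqfam_ok (q : nat) (F : eqfam) : Prop :=
  (forall (A B : alg) (f : {lrmorphism A -> B}) (g : 'M[A]_3),
     F B (map_mx f g) = map f (F A g)) /\
  forall (C D : alg) (h : {lrmorphism C -> D}) (g : GL3_functor k D),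
    square_zero_thickening h -> (forall e, e \in F D (val (g : GL3 D)) -> e = 0) ->
    exists2 g' : GL3_functor k C, pull h g' = g &
      forall e, e \in F C (val (g' : GL3 C)) -> e = 0.

Variable q : nat.
Variables (X : kfunctor k) (u : kmorphism X (GL3_functor k)).
Hypothesis u_smooth : formally_smooth u.

Definition mat (A : alg) (y : X A) : 'M[A]_3 := val (u A y : GL3 A).

Lemma mat_pull (A B : alg) (f : {lrmorphism A -> B}) (y : X A) :
  mat (pull f y) = map_mx f (mat y).
Proof. by rewrite /mat kfun_nat. Qed.

Section Family.
Variable F : eqfam.
Hypothesis Fok : eqfam_ok q F.

Definition van (A : alg) (y : X A) : Prop := forall e, e \in @F A (mat y) -> e = 0.

Definition VI (R : alg) (r : X R) : R -> Prop := idspan (fun e => e \in @F R (mat r)).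

Lemma VI_ideal (R : alg) (r : X R) : ideal (VI r). Proof. exact: idspan_ideal. Qed.

Lemma VI_van (R A : alg) (r : X R) (w : {lrmorphism R -> A}) :
  van (pull w r) <-> forall e, VI r e -> w e = 0.
Proof.
have [Fn _] := Fok; split=> [h e|h e].
  apply: (@idspan_sub _ _ (fun e => w e = 0)); first exact: kernel_ideal.
  by move=> a ar; apply: h; rewrite mat_pull Fn map_f.
by rewrite mat_pull Fn => /mapP[a ar ->]; apply: h; apply: idspan_in.
Qed.

Lemma van_pull (A B : alg) (f : {lrmorphism A -> B}) (y : X A) : van y -> van (pull f y).
Proof.
by move=> h; apply/VI_van => e [n [c [d [dD ->]]]]; rewrite lr_sum big1 // => i _;
  rewrite (h _ (dD i)) mulr0 lr0.
Qed.

Lemma VI_localization (R L : alg) (r : X R) a (l : {lrmorphism R -> L}) y :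
  is_localization l a ->
  (VI (pull l r) y <-> exists n x, VI r x /\ y * l a ^+ n = l x).
Proof.
have [Fn _] := Fok; move=> [la lf lk]; split; last first.
  move=> [n [x [Ix E]]]; have un := unitrX n la.
  rewrite -(mulrK un y) E; apply: ideal_mulr; first exact: VI_ideal.
  case: Ix => m [c [d [dD ->]]]; rewrite lr_sum; apply: ideal_sum; first exact: VI_ideal.
  move=> i _; rewrite lrM; apply: idealM; first exact: VI_ideal.
  by apply: idspan_in; rewrite mat_pull Fn map_f.
apply: (@idspan_sub _ _ (fun y => exists n x, VI r x /\ y * l a ^+ n = l x)).
  split.
  - by exists 0%N, 0; rewrite mul0r lr0; split=> //; exact: (ideal0 (VI_ideal r)).
  - move=> y1 y2 [n [x [Ix E]]] [m [x' [Ix' E']]]; exists (n + m)%N, (x * a ^+ m + x' * a ^+ n).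
    split; last by rewrite lrD !lrM !lrX -E -E' exprD mulrDl !mulrA [y2 * _ * _]mulrAC.
    by apply: idealD; [exact: VI_ideal | |]; apply: ideal_mulr => //; exact: VI_ideal.
  - move=> s y1 [n [x [Ix E]]]; have [m [c cE]] := lf s; exists (m + n)%N, (c * x).
    split; first by apply: idealM => //; exact: VI_ideal.
    by rewrite lrM -E -cE exprD mulrACA.
move=> e; rewrite mat_pull Fn => /mapP[b br ->]; exists 0%N, b; rewrite mulr1.
by split=> //; apply: idspan_in.
Qed.

(** A point of the locus is lifted in two stages: its matrix inside the locus of [GL3], then the
    point itself along the formally smooth [u]. The lift stays in the chart. *)
Lemma liftable_chart (R T : alg) (r : X R) (p : {lrmorphism R -> T}) : prechart r ->
  (forall y, exists x, p x = y) -> (forall x, p x = 0 <-> VI r x) -> liftable T.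
Proof.
move=> [mono _ lft] ps pk C D h w sz; have [Fn Fs] := Fok.
have [wp wpE] := lr_comp p w.
have vD : van (pull wp r).
  by apply/VI_van => e /pk pe; rewrite wpE /= pe; exact: lr0.
have [gC gCE gCv] := Fs C D h (u D (pull wp r)) sz vD.
have [y yE yh] := u_smooth sz (esym gCE).
have [v vE] := lft C D h y wp sz (esym yh).
have vC : van (pull v r) by move=> e; rewrite /mat vE yE; apply: gCv.
have [|w' w'E] := @alg_quot_lift k R T C p v ps.
  by move=> x /pk; move/VI_van: vC; apply.
exists w' => t; have [x <-] := ps t; rewrite /= w'E.
have [hv hvE] := lr_comp v h; rewrite -[LHS]hvE -[RHS]wpE.
by apply: mono; rewrite (pull_comp r hvE) vE yh.
Qed.

Lemma smooth_chart_prime (R : alg) (r : X R) (x : {lrmorphism R -> k^o}) : chart r ->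
  van (pull x r) -> exists a, x a <> 0 /\ forall b c, VI r (b * c) -> VI r (a * b) \/ VI r (a * c).
Proof.
move=> [fg pr] /VI_van xV.
have I1 : ~ VI r 1 by move=> /xV; rewrite lr1; apply/eqP/oner_neq0.
have [T [p [ps pk]]] := alg_quot (VI_ideal r) I1.
have [|xT xTE] := @alg_quot_lift k R T k^o p x ps; first by move=> a /pk/xV.
have [t [xt tP]] := smooth_point_domain xT (fin_gen_quotient ps fg) (liftable_chart pr ps pk).
have [a aE] := ps t; exists a; split; first by rewrite -xTE aE.
move=> b c /pk; rewrite lrM => /tP; rewrite -aE -!lrM => -[] /pk; by [left|right].
Qed.

Lemma prime_localization (R L : alg) (r : X R) a (l : {lrmorphism R -> L}) :
  is_localization l a -> primeI (VI r) -> ~ VI r a -> primeI (VI (pull l r)).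
Proof.
move=> loc [I1 pI] na; have [la lf lk] := loc.
have nX n : ~ VI r (a ^+ n) by move/(primeI_pow (conj I1 pI)).
have con n x b : VI r x -> l b * l a ^+ n = l x -> VI r b.
  move=> Ix E; have /lk[m mE] : l (b * a ^+ n - x) = 0 by rewrite lrB lrM lrX E subrr.
  have : VI r (a ^+ m * (b * a ^+ n)).
    rewrite -(GRing.subrK x (b * a ^+ n)) mulrDr mE add0r.
    by apply: idealM => //; exact: VI_ideal.
  by move=> /pI[/nX//|/pI[//|/nX//]].
split=> [/(VI_localization r _ loc)[n [x [Ix]]]|b c /(VI_localization r _ loc)[n [x [Ix E]]]].
  by rewrite -(lr1 l) => /(con _ _ _ Ix).
have [m [b' bE]] := lf b; have [m' [c' cE]] := lf c.
have : VI r (b' * c').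
  apply: (con n (x * a ^+ (m + m'))).
    by apply: ideal_mulr => //; exact: VI_ideal.
  by rewrite !lrM lrX -E -bE -cE exprD; move: (l a ^+ n) (l a ^+ m) (l a ^+ m') => *; ring.
by move=> /pI[Ib|Ic]; [left|right]; apply/(VI_localization r _ loc); [exists m, b' | exists m', c'].
Qed.

(** The local ring of a smooth locus is a domain, so inverting one function that is nonzero at the
    point makes the ideal of the locus prime. *)
Lemma prime_chart (R : alg) (r : X R) (x : {lrmorphism R -> k^o}) : chart r ->
  van (pull x r) -> exists a (R' : alg) (l : {lrmorphism R -> R'}) (x' : {lrmorphism R' -> k^o}),
    [/\ is_localization l a, chart (pull l r), primeI (VI (pull l r)) & x' \o l =1 x].
Proof.
move=> cr xv; have [a [xa aP]] := smooth_chart_prime cr xv.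
have nn n : a ^+ n <> 0.
  move=> h; apply: (elimN eqP (expf_neq0 n (introN eqP xa))).
  by have := congr1 x h; rewrite lrX lr0.
have [L [l loc]] := localization_exists nn; have [la lf lk] := loc.
have xu : x a \is a GRing.unit by rewrite unitfE; apply/eqP.
have [x' x'E] := localization_univ loc xu.
exists a, L, l, x'; split=> //; first exact: chart_localization loc cr.
have xV : van (pull x' (pull l r)) by rewrite -(pull_comp r (h := x)) // => t; rewrite /= x'E.
split; first by move=> /(proj1 (VI_van _ _) xV); rewrite lr1; apply/eqP/oner_neq0.
move=> b c /(VI_localization r _ loc)[n [y [Iy E]]].
have [m [b' bE]] := lf b; have [m' [c' cE]] := lf c.
have /lk[N NE] : l (b' * c' * a ^+ n - y * a ^+ (m + m')) = 0.
  rewrite lrB !lrM !lrX -E -bE -cE exprD.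
  by move: (l a ^+ n) (l a ^+ m) (l a ^+ m') => *; ring.
have : VI r ((a ^+ N * a ^+ n * b') * c').
  have -> : a ^+ N * a ^+ n * b' * c' = a ^+ N * (b' * c' * a ^+ n - y * a ^+ (m + m'))
      + a ^+ N * a ^+ (m + m') * y.
    by move: (a ^+ n) (a ^+ N) (a ^+ (m + m')) => *; ring.
  by rewrite NE add0r; apply: idealM => //; exact: VI_ideal.
move/aP=> [h|h]; [left|right]; apply/(VI_localization r _ loc).
  exists (m + (N + n).+1)%N, (a * (a ^+ N * a ^+ n * b')); split=> //.
  rewrite !lrM !lrX -bE exprD exprS exprD.
  by move: (l a ^+ m) (l a ^+ N) (l a ^+ n) => *; ring.
by exists m'.+1, (a * c'); split=> //; rewrite lrM -cE exprS mulrCA.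
Qed.

End Family.
End PrimeCharts.

(** * Three by three matrices and the zip group in coordinates *)

Definition o0 : 'I_3 := @Ordinal 3 0 isT.
Definition o1 : 'I_3 := @Ordinal 3 1 isT.
Definition o2 : 'I_3 := @Ordinal 3 2 isT.

Lemma ord3_ind (P : 'I_3 -> Prop) : P o0 -> P o1 -> P o2 -> forall i, P i.
Proof.
move=> h0 h1 h2 [[|[|[|i]]] ilt] //.
- by rewrite (_ : Ordinal ilt = o0) //; apply: val_inj.
- by rewrite (_ : Ordinal ilt = o1) //; apply: val_inj.
- by rewrite (_ : Ordinal ilt = o2) //; apply: val_inj.
Qed.

Lemma sum3 (V : nmodType) (F : 'I_3 -> V) : \sum_i F i = F o0 + F o1 + F o2.
Proof.
rewrite !big_ord_recr big_ord0 /= add0r.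
by congr (F _ + F _ + F _); apply: val_inj.
Qed.

Lemma prod3 (R : comNzRingType) (F : 'I_3 -> R) : \prod_i F i = F o0 * F o1 * F o2.
Proof.
rewrite !big_ord_recr big_ord0 /= mul1r.
by congr (F _ * F _ * F _); apply: val_inj.
Qed.

Ltac gen_mx g := move: (g o0 o0) (g o0 o1) (g o0 o2) (g o1 o0) (g o1 o1) (g o1 o2)
  (g o2 o0) (g o2 o1) (g o2 o2).

Section Matrices.
Variable R : comUnitRingType.
Implicit Types x y g : 'M[R]_3.

Definition mk3 (a b c d e f g h i : R) : 'M[R]_3 := \matrix_(r, s)
  nth 0 (nth [::] [:: [:: a; b; c]; [:: d; e; f]; [:: g; h; i]] r) s.

Lemma mul3E x y i j : (x *m y) i j = x i o0 * y o0 j + x i o1 * y o1 j + x i o2 * y o2 j.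
Proof. by rewrite mxE sum3. Qed.

Definition simp3 := (@mulr0 R, @mul0r R, @mulr1 R, @mul1r R, @addr0 R, @add0r R).

Lemma mat3P x y : (forall i j, x i j = y i j) -> x = y.
Proof. by move=> h; apply/matrixP. Qed.

(** Minors of the first two rows, named by their columns. *)
Definition M01 g := g o0 o0 * g o1 o1 - g o0 o1 * g o1 o0.
Definition M02 g := g o0 o0 * g o1 o2 - g o0 o2 * g o1 o0.
Definition M12 g := g o0 o1 * g o1 o2 - g o0 o2 * g o1 o1.

Lemma det2 (m : 'M[R]_2) : \det m = m ord0 ord0 * m ord_max ord_max - m ord0 ord_max * m ord_max ord0.
Proof.
rewrite (expand_det_row _ ord0) big_ord_recl big_ord1 /cofactor !det_mx11 !mxE /=.
have -> : lift ord0 ord0 = ord_max :> 'I_2 by apply: val_inj.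
have -> : lift ord_max ord0 = ord0 :> 'I_2 by apply: val_inj.
by rewrite expr0 expr1 mul1r; move: (m _ _) (m _ _) (m _ _) (m _ _) => *; ring.
Qed.

Lemma det3 g : \det g = g o2 o0 * M12 g - g o2 o1 * M02 g + g o2 o2 * M01 g.
Proof.
rewrite (expand_det_row _ o2) sum3 /cofactor !det2 !mxE.
have -> : lift o2 ord0 = o0 by apply: val_inj.
have -> : lift o2 ord_max = o1 by apply: val_inj.
have -> : lift o0 ord0 = o1 by apply: val_inj.
have -> : lift o0 ord_max = o2 by apply: val_inj.
have -> : lift o1 ord0 = o0 by apply: val_inj.
have -> : lift o1 ord_max = o2 by apply: val_inj.
have -> : (-1) ^+ (o2 + o0) = 1 :> R by rewrite -signr_odd expr0.
have -> : (-1) ^+ (o2 + o1) = -1 :> R by rewrite -signr_odd expr1.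
have -> : (-1) ^+ (o2 + o2) = 1 :> R by rewrite -signr_odd expr0.
by rewrite /M12 /M02 /M01; gen_mx g => *; ring.
Qed.

End Matrices.

Lemma mk3_eta (R : comUnitRingType) (x : 'M[R]_3) :
  x = mk3 (x o0 o0) (x o0 o1) (x o0 o2) (x o1 o0) (x o1 o1) (x o1 o2) (x o2 o0) (x o2 o1) (x o2 o2).
Proof. by apply: mat3P; apply: ord3_ind; apply: ord3_ind; rewrite mxE. Qed.

Section ZipElements.
Variables (R : comUnitRingType) (q : nat).
Hypothesis q0 : (0 < q)%N.
Hypothesis qD : forall a b : R, (a + b) ^+ q = a ^+ q + b ^+ q.
Implicit Types x y g : 'M[R]_3.

(** The inverse of [y] in a zip pair with first member [x]: the Levi part is determined by the
    Frobenius of [x], and [e1], [e2] are free coordinates on the unipotent radical of [Q]. Passing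
    to the inverse makes the action polynomial in these data. *)
Definition yinv x (e1 e2 : R) : 'M[R]_3 :=
  mk3 (x o2 o2 ^+ q) e1 e2
      0 (x o1 o1 ^+ q) (x o0 o1 ^+ q)
      0 (x o1 o0 ^+ q) (x o0 o0 ^+ q).

Definition parab x : Prop := [/\ x \in unitmx, x o0 o2 = 0 & x o1 o2 = 0].

Lemma Pminus_parab x : Pminus mu x <-> parab x.
Proof.
split=> [[ux h]|[ux h02 h12]]; first by split=> //; apply: h.
by split=> //; apply: ord3_ind; apply: ord3_ind.
Qed.

Lemma parab_det x : parab x -> \det x = x o2 o2 * M01 x.
Proof. by move=> [_ h02 h12]; rewrite det3 /M12 /M02 h02 h12; gen_mx x => *; ring. Qed.

Lemma parab_units x : parab x -> x o2 o2 \is a GRing.unit /\ M01 x \is a GRing.unit.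
Proof.
move=> px; have := parab_det px; have [ux _ _] := px; move: ux.
by rewrite unitmxE => + E; rewrite E unitrM => /andP[].
Qed.

Lemma frob_mul (a b : R) : (a * b) ^+ q = a ^+ q * b ^+ q. Proof. exact: exprMn. Qed.
Lemma frob_zero : (0 : R) ^+ q = 0. Proof. by rewrite expr0n; case: q q0. Qed.
Lemma frob_opp (a : R) : (- a) ^+ q = - a ^+ q.
Proof. by apply/eqP; rewrite -addr_eq0 -qD addNr frob_zero. Qed.

Lemma yinv_det x e1 e2 : \det (yinv x e1 e2) = x o2 o2 ^+ q * M01 x ^+ q.
Proof.
rewrite det3 /M12 /M01 /M02 !mxE /= qD frob_opp !frob_mul.
by move: (x o0 o0 ^+ q) (x o0 o1 ^+ q) (x o1 o0 ^+ q) (x o1 o1 ^+ q) (x o2 o2 ^+ q) => *; ring.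
Qed.

Lemma yinv_unit x e1 e2 : parab x -> yinv x e1 e2 \in unitmx.
Proof.
by move=> /parab_units[u1 u2]; rewrite unitmxE yinv_det unitrM !unitrX.
Qed.

Lemma frob_levi_inverse x : parab x -> frobG q (levi mu x) *m yinv x 0 0 = 1%:M.
Proof.
move=> px; pose lx := map_mx (fun a : R => a ^+ q) (levi mu x).
have JJ : J3 R *m J3 R = 1%:M.
  by apply: mat3P; apply: ord3_ind; apply: ord3_ind; rewrite mul3E !mxE /= ?simp3.
have WE : yinv x 0 0 = J3 R *m lx^T *m J3 R.
  by apply: mat3P; apply: ord3_ind; apply: ord3_ind; rewrite !mul3E !mxE /= ?frob_zero ?simp3.
have ul : lx^T \in unitmx.
  have [u1 u2] := parab_units px.
  rewrite unitmx_tr unitmxE det3 /M12 /M02 /M01 !mxE /= frob_zero.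
  by rewrite ?simp3 oppr0 add0r -(frob_mul (x o0 o0)) -(frob_mul (x o0 o1)) -frob_opp -qD
    unitrM !unitrX.
by rewrite WE /frobG -!mulmxA (mulmxA (J3 R) (J3 R)) JJ mul1mx (mulmxA (invmx _)) mulVmx //
  mul1mx JJ.
Qed.

Lemma invmx_unique x y : x *m y = 1%:M -> invmx x = y.
Proof.
move=> xy; have [ux _] := mulmx1_unit xy.
by rewrite -[RHS]mul1mx -(mulVmx ux) -mulmxA xy mulmx1.
Qed.

Lemma zip_group_yinv x y : zip_group q x y -> parab x /\ exists e1 e2, invmx y = yinv x e1 e2.
Proof.
move=> [/Pminus_parab px [uy y0] E]; split=> //.
have LW := frob_levi_inverse px; rewrite E in LW; set W := yinv x 0 0 in LW.
have y10 : y o1 o0 = 0 by apply: y0.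
have y20 : y o2 o0 = 0 by apply: y0.
(* Solves the first row of [y *m yinv = 1] for [e1] and [e2]. *)
pose f j := - (x o2 o2 ^+ q * (y o0 o1 * W o1 j + y o0 o2 * W o2 j)).
exists (f o1), (f o2); apply: invmx_unique; apply: mat3P => i j.
have := congr1 (fun m : 'M[R]_3 => m i j) LW.
have h00 : y o0 o0 * x o2 o2 ^+ q = 1.
  by have := congr1 (fun m : 'M[R]_3 => m o0 o0) LW; rewrite mul3E !mxE /= ?simp3.
rewrite !mul3E /f /W; move: i j; apply: ord3_ind; apply: ord3_ind; rewrite !mxE /= ?simp3 ?y10 ?y20 ?simp3 //.
- by move=> _; rewrite mulrN mulrA h00 mul1r -addrA addNr.
- by move=> _; rewrite mulrN mulrA h00 mul1r -addrA addNr.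
Qed.


Lemma yinv_zip_group x e1 e2 : parab x -> zip_group q x (invmx (yinv x e1 e2)).
Proof.
move=> px; have uy := yinv_unit e1 e2 px; set y := invmx _.
have yy : y *m yinv x e1 e2 = 1%:M by rewrite /y mulVmx.
have yy' : yinv x e1 e2 *m y = 1%:M by rewrite /y mulmxV.
have [u22 uD] := parab_units px; have LW := frob_levi_inverse px.
have r1 := congr1 (fun m : 'M[R]_3 => m o1 o0) yy'.
have r2 := congr1 (fun m : 'M[R]_3 => m o2 o0) yy'.
rewrite !mul3E !mxE /= ?simp3 in r1 r2.
have uDq : M01 x ^+ q \is a GRing.unit by apply: unitrX.
have DE : M01 x ^+ q = x o0 o0 ^+ q * x o1 o1 ^+ q - x o0 o1 ^+ q * x o1 o0 ^+ q.
  by rewrite /M01 qD frob_opp !frob_mul.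
have y10 : y o1 o0 = 0.
  apply: (mulrI uDq); rewrite mulr0 DE.
  transitivity (x o0 o0 ^+ q * (x o1 o1 ^+ q * y o1 o0 + x o0 o1 ^+ q * y o2 o0) -
    x o0 o1 ^+ q * (x o1 o0 ^+ q * y o1 o0 + x o0 o0 ^+ q * y o2 o0)); last by rewrite r1 r2; ring.
  by move: (x o0 o0 ^+ q) (x o0 o1 ^+ q) (x o1 o0 ^+ q) (x o1 o1 ^+ q) (y o1 o0) (y o2 o0) => *; ring.
have y20 : y o2 o0 = 0.
  apply: (mulrI uDq); rewrite mulr0 DE.
  transitivity (x o1 o1 ^+ q * (x o1 o0 ^+ q * y o1 o0 + x o0 o0 ^+ q * y o2 o0) -
    x o1 o0 ^+ q * (x o1 o1 ^+ q * y o1 o0 + x o0 o1 ^+ q * y o2 o0)); last by rewrite r1 r2; ring.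
  by move: (x o0 o0 ^+ q) (x o0 o1 ^+ q) (x o1 o0 ^+ q) (x o1 o1 ^+ q) (y o1 o0) (y o2 o0) => *; ring.
split; first exact/Pminus_parab.
  split; first by rewrite /y unitmx_inv.
  by apply: ord3_ind; apply: ord3_ind.
have [_ uW] := mulmx1_unit LW.
apply: (can_inj (mulmxK uW)); rewrite LW; symmetry; apply: mat3P => i j.
have := congr1 (fun m : 'M[R]_3 => m i j) yy.
rewrite !mul3E; move: i j; apply: ord3_ind; apply: ord3_ind;
  by rewrite !mxE /= ?simp3 ?y10 ?y20 ?simp3.
Qed.

Lemma yinv_mul x x' : parab x -> parab x' -> x o2 o0 = 0 -> x o2 o1 = 0 -> 
  yinv (x *m x') 0 0 = yinv x' 0 0 *m yinv x 0 0.
Proof.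
move=> [_ h02 h12] [_ h02' h12'] h20 h21; rewrite /yinv !mul3E.
apply: mat3P; apply: ord3_ind; apply: ord3_ind;
  rewrite !mul3E !mxE /= ?h02 ?h12 ?h02' ?h12' ?h20 ?h21 ?simp3 ?qD ?frob_mul //;
  by move: (x o0 o0 ^+ q) (x o0 o1 ^+ q) (x o1 o0 ^+ q) (x o1 o1 ^+ q) (x o2 o2 ^+ q)
    (x' o0 o0 ^+ q) (x' o0 o1 ^+ q) (x' o1 o0 ^+ q) (x' o1 o1 ^+ q) (x' o2 o2 ^+ q) => *; ring.
Qed.

End ZipElements.

(** * Identities between minors and their behaviour under the action *)

Section Identities.
Variable R : comUnitRingType.
Implicit Types x y g : 'M[R]_3.

Definition N02 g := g o2 o2 * g o0 o0 - g o2 o0 * g o0 o2.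

(** This identity and the two that follow show that modulo [M02], with [det g] invertible, the
    ideals [(g00, g02)] and [(g00, g10)] are generated by [N02] and [M01] respectively. *)
Lemma g00_det g : g o0 o0 * \det g = N02 g * M01 g + (g o2 o0 * g o0 o1 - g o0 o0 * g o2 o1) * M02 g.
Proof. by rewrite det3 /N02 /M01 /M02 /M12; gen_mx g => *; ring. Qed.

Lemma g02_det g : g o0 o2 * \det g = - (N02 g * M12 g) + (g o2 o2 * g o0 o1 - g o0 o2 * g o2 o1) * M02 g.
Proof. by rewrite det3 /N02 /M01 /M02 /M12; gen_mx g => *; ring. Qed.

Lemma g10_det g : g o1 o0 * \det g =
  (g o2 o2 * g o1 o0 - g o2 o0 * g o1 o2) * M01 g + (g o2 o0 * g o1 o1 - g o1 o0 * g o2 o1) * M02 g.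
Proof. by rewrite det3 /M01 /M02 /M12; gen_mx g => *; ring. Qed.

Variable q : nat.
Hypothesis q0 : (0 < q)%N.
Hypothesis qD : forall a b : R, (a + b) ^+ q = a ^+ q + b ^+ q.

Definition zact x e1 e2 g := x *m g *m yinv q x e1 e2.

Lemma zactE x e1 e2 g i j : zact x e1 e2 g i j =
  (x i o0 * g o0 o0 + x i o1 * g o1 o0 + x i o2 * g o2 o0) * yinv q x e1 e2 o0 j +
  (x i o0 * g o0 o1 + x i o1 * g o1 o1 + x i o2 * g o2 o1) * yinv q x e1 e2 o1 j +
  (x i o0 * g o0 o2 + x i o1 * g o1 o2 + x i o2 * g o2 o2) * yinv q x e1 e2 o2 j.
Proof. by rewrite /zact !mul3E. Qed.

Section Parabolic.
Variables (x : 'M[R]_3) (e1 e2 : R) (g : 'M[R]_3).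
Hypothesis px : parab x.

Let h02 : x o0 o2 = 0. Proof. by case: px. Qed.
Let h12 : x o1 o2 = 0. Proof. by case: px. Qed.

(** With [M02_zact]: the pair of minors transforms linearly through the Frobenius of the Levi block
    of [x], and for [x01 = 0] this makes [M02] semi-invariant. *)
Lemma M01_zact : M01 (zact x e1 e2 g) =
  M01 x * x o2 o2 ^+ q * (x o1 o1 ^+ q * M01 g + x o1 o0 ^+ q * M02 g).
Proof.
rewrite /M01 /M02 !zactE !mxE /= h02 h12.
move: (x o0 o0 ^+ q) (x o0 o1 ^+ q) (x o1 o0 ^+ q) (x o1 o1 ^+ q) (x o2 o2 ^+ q) => *.
by gen_mx x; gen_mx g => *; ring.
Qed.

Lemma M02_zact : M02 (zact x e1 e2 g) =
  M01 x * x o2 o2 ^+ q * (x o0 o1 ^+ q * M01 g + x o0 o0 ^+ q * M02 g).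
Proof.
rewrite /M01 /M02 !zactE !mxE /= h02 h12.
move: (x o0 o0 ^+ q) (x o0 o1 ^+ q) (x o1 o0 ^+ q) (x o1 o1 ^+ q) (x o2 o2 ^+ q) => *.
by gen_mx x; gen_mx g => *; ring.
Qed.

Lemma det_zact : \det (zact x e1 e2 g) =
  (x o2 o2 * M01 x) * (x o2 o2 ^+ q * M01 x ^+ q) * \det g.
Proof.
by rewrite /zact !det_mulmx yinv_det // (parab_det px) mulrAC.
Qed.

Lemma g00_zact : zact x e1 e2 g o0 o0 = (x o0 o0 * g o0 o0 + x o0 o1 * g o1 o0) * x o2 o2 ^+ q.
Proof. by rewrite zactE !mxE /= h02 ?simp3. Qed.

Lemma g10_zact : zact x e1 e2 g o1 o0 = (x o1 o0 * g o0 o0 + x o1 o1 * g o1 o0) * x o2 o2 ^+ q.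
Proof. by rewrite zactE !mxE /= h12 ?simp3. Qed.

Hypothesis h01 : x o0 o1 = 0.
Hypothesis q1 : (0 : R) ^+ q = 0.

Lemma M01_borel : M01 x = x o0 o0 * x o1 o1.
Proof. by rewrite /M01 h01 mul0r subr0. Qed.

Lemma N02_zact : N02 (zact x e1 e2 g) =
  x o2 o2 ^+ q * x o0 o0 ^+ q * x o0 o0 * (x o2 o1 * M02 g + x o2 o2 * N02 g).
Proof.
rewrite /N02 /M02 !zactE !mxE /= h02 h01 q1.
move: (x o0 o0 ^+ q) (x o0 o1 ^+ q) (x o1 o0 ^+ q) (x o1 o1 ^+ q) (x o2 o2 ^+ q) => *.
by gen_mx x; gen_mx g => *; ring.
Qed.

Lemma g01_zact : g o0 o0 = 0 -> g o0 o2 = 0 ->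
  zact x e1 e2 g o0 o1 = x o0 o0 * x o1 o1 ^+ q * g o0 o1.
Proof.
move=> h h'; rewrite zactE !mxE /= h02 h01 h h' ?simp3.
by move: (x o1 o1 ^+ q) (x o1 o0 ^+ q) => *; gen_mx x; gen_mx g => *; ring.
Qed.

Lemma g02_zact : g o0 o0 = 0 ->
  zact x e1 e2 g o0 o2 = x o0 o0 * x o0 o0 ^+ q * g o0 o2.
Proof.
move=> h; rewrite zactE !mxE /= h02 h01 h q1 ?simp3.
by move: (x o0 o0 ^+ q) => *; gen_mx x; gen_mx g => *; ring.
Qed.

End Parabolic.
End Identities.

(** * The loci D, Z and X and their smoothness *)

Section Families.
Variable k : closedFieldType.
Notation alg := (comUnitAlgType k).
Variable q : nat.

(** The whole of [GL3], then the closures of the strata of w_0 s_alpha1 (D), of s_alpha2 (Z) and of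
    s_alpha1 (X). *)
Definition F0 : eqfam k := fun A g => [::].
Definition FD : eqfam k := fun A g => [:: M02 g].
Definition FZ : eqfam k := fun A g => [:: g o0 o0; g o0 o2].
Definition FX : eqfam k := fun A g => [:: g o0 o0; g o1 o0].

Section Naturality.
Variables (A B : alg) (f : {lrmorphism A -> B}) (g : 'M[A]_3).
Lemma M01_map : M01 (map_mx f g) = f (M01 g).
Proof. by rewrite /M01 !mxE lrB !lrM. Qed.
Lemma M02_map : M02 (map_mx f g) = f (M02 g).
Proof. by rewrite /M02 !mxE lrB !lrM. Qed.
Lemma N02_map : N02 (map_mx f g) = f (N02 g).
Proof. by rewrite /N02 !mxE lrB !lrM. Qed.
Lemma det_map : \det (map_mx f g) = f (\det g).
Proof. exact: det_map_mx. Qed.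
Lemma yinv_map x e1 e2 : yinv q (map_mx f x) (f e1) (f e2) = map_mx f (yinv q x e1 e2).
Proof.
by apply: mat3P; apply: ord3_ind; apply: ord3_ind; rewrite !mxE /= ?lrX ?lr0.
Qed.
End Naturality.

Lemma lift_matrix (C D : alg) (h : {lrmorphism C -> D}) (g : 'M[D]_3) :
  square_zero_thickening h -> exists g0 : 'M[C]_3, map_mx h g0 = g.
Proof.
move=> [hs _]; have [s sE] := ex_choice hs.
by exists (map_mx s g); apply/matrixP => i j; rewrite !mxE sE.
Qed.

Lemma lift_unit (C D : alg) (h : {lrmorphism C -> D}) (g : GL3_functor k D) (g0 : 'M[C]_3) :
  square_zero_thickening h -> map_mx h g0 = val (g : GL3 D) ->
  exists g1 : GL3_functor k C, val (g1 : GL3 C) = g0 /\ pull h g1 = g.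
Proof.
move=> sz E; have u0 : g0 \in unitmx.
  rewrite unitmxE; apply: (square_zero_unit sz).
  by rewrite -(det_map_mx h) E -unitmxE; exact: (valP (g : GL3 D)).
by exists (exist _ g0 u0 : GL3 C); split=> //; apply: val_inj; rewrite /= E.
Qed.

Lemma F0_ok : eqfam_ok q F0.
Proof.
split=> // C D h g sz _; have [g0 E] := lift_matrix (val (g : GL3 D)) sz.
by have [g1 [_ g1E]] := lift_unit sz E; exists g1.
Qed.

Lemma FZ_ok : eqfam_ok q FZ.
Proof.
split=> [A B f g|C D h g sz gv]; first by rewrite /FZ /= !mxE.
have [g0 E] := lift_matrix (val (g : GL3 D)) sz.
pose g2 : 'M[C]_3 := \matrix_(i, j) if (i == o0) && (j != o1) then 0 else g0 i j.
have E2 : map_mx h g2 = val (g : GL3 D).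
  rewrite -E; apply/matrixP; apply: ord3_ind; apply: ord3_ind; rewrite !mxE //= lr0.
    have := congr1 (fun m : 'M[D]_3 => m o0 o0) E; rewrite !mxE => ->.
    by symmetry; apply: gv; rewrite /FZ inE eqxx.
  have := congr1 (fun m : 'M[D]_3 => m o0 o2) E; rewrite !mxE => ->.
  by symmetry; apply: gv; rewrite /FZ !inE eqxx orbT.
have [g1 [g1v g1E]] := lift_unit sz E2; exists g1 => // e.
by rewrite g1v /FZ !inE !mxE /= => /orP[]/eqP.
Qed.

Lemma FX_ok : eqfam_ok q FX.
Proof.
split=> [A B f g|C D h g sz gv]; first by rewrite /FX /= !mxE.
have [g0 E] := lift_matrix (val (g : GL3 D)) sz.
pose g2 : 'M[C]_3 := \matrix_(i, j) if (j == o0) && (i != o2) then 0 else g0 i j.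
have E2 : map_mx h g2 = val (g : GL3 D).
  rewrite -E; apply/matrixP; apply: ord3_ind; apply: ord3_ind; rewrite !mxE //= lr0.
    have := congr1 (fun m : 'M[D]_3 => m o0 o0) E; rewrite !mxE => ->.
    by symmetry; apply: gv; rewrite /FX inE eqxx.
  have := congr1 (fun m : 'M[D]_3 => m o1 o0) E; rewrite !mxE => ->.
  by symmetry; apply: gv; rewrite /FX !inE eqxx orbT.
have [g1 [g1v g1E]] := lift_unit sz E2; exists g1 => // e.
by rewrite g1v /FX !inE !mxE /= => /orP[]/eqP.
Qed.

(* The gradient of [M02] pairs with (g20 g01, g22 g11, g22 g01, g20 g11) to det g modulo
   [M02], so one Newton step corrects any lift. *)
Lemma FD_ok : eqfam_ok q FD.
Proof.
split=> [A B f g|C D h g sz gv]; first by rewrite /FD /= M02_map.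
have [g0 E] := lift_matrix (val (g : GL3 D)) sz.
have hM : h (M02 g0) = 0 by rewrite -M02_map E; apply: gv; rewrite /FD inE eqxx.
pose e := M02 g0; pose U := \det g0 + g0 o2 o1 * e.
have uU : U \is a GRing.unit.
  apply: (square_zero_unit sz); rewrite lrD lrM hM mulr0 addr0 -(det_map_mx h) E -unitmxE.
  exact: (valP (g : GL3 D)).
have [_ hz] := sz; have ee : e * e = 0 by apply: hz.
pose s := - (e / U).
have ss : s * s = 0.
  by rewrite /s mulrNN mulrACA ee mul0r.
have hs : h s = 0 by rewrite /s lrN lrM hM mul0r oppr0.
pose d : 'M[C]_3 := mk3 (g0 o2 o0 * g0 o0 o1) 0 (g0 o2 o2 * g0 o0 o1)
  (g0 o2 o0 * g0 o1 o1) 0 (g0 o2 o2 * g0 o1 o1) 0 0 0.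
pose g2 := g0 + s *: d.
have E2 : map_mx h g2 = val (g : GL3 D).
  by rewrite -E; apply/matrixP => i j; rewrite !mxE lrD lrM hs mul0r addr0.
have [g1 [g1v g1E]] := lift_unit sz E2; exists g1 => // x.
rewrite g1v /FD inE => /eqP ->.
have -> : M02 g2 = e + s * U + s * s * (g0 o2 o0 * g0 o0 o1 * (g0 o2 o2 * g0 o1 o1) -
   g0 o2 o2 * g0 o0 o1 * (g0 o2 o0 * g0 o1 o1)).
  rewrite /U /e /M02 /g2 !mxE /= det3 /M02 /M12 /M01; move: s {hs ss g2 E2 g1 g1v g1E} => s.
  by move: (g0 o0 o0) (g0 o0 o1) (g0 o0 o2) (g0 o1 o0) (g0 o1 o1) (g0 o1 o2)
    (g0 o2 o0) (g0 o2 o1) (g0 o2 o2) => *; ring.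
by rewrite ss mul0r addr0 /s mulNr divrK // subrr.
Qed.

Lemma dual_numbers : exists (C : alg) (h : {lrmorphism C -> k^o}) (e : C),
  [/\ square_zero_thickening h, e * e = 0, h e = 0 & forall c : k, c != 0 -> e * c%:A <> 0].
Proof.
pose I (p : {poly k}) := exists s, p = s * 'X^2.
have idI : ideal I.
  split=> [|p p' [s ->] [s' ->]|p p' [s ->]]; first by exists 0; rewrite mul0r.
    by exists (s + s'); rewrite mulrDl.
  by exists (p * s); rewrite mulrA.
have I1 : ~ I 1.
  by move=> [s /(congr1 (fun p : {poly k} => p`_0))/eqP]; rewrite coef1 coefMXn /= oner_eq0.
have [C [p [ps pk pc]]] := quot_exists [the {rmorphism k -> {poly k}} of polyC] idI I1.
have [||h hE] := @quot_lift _ {poly k} [the {rmorphism k -> {poly k}} of polyC] C p k^o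
   [the {rmorphism {poly k} -> k^o} of horner_eval 0] ps pc.
- by move=> a; rewrite /= /horner_eval hornerC /GRing.scale /= mulr1.
- by move=> x /pk[s ->]; rewrite /= /horner_eval hornerM hornerXn expr0n mulr0.
exists C, h, (p 'X); split.
- split=> [d|c c']; first by exists d%:A; rewrite lrmorph_alg /GRing.scale /= mulr1.
  have [s <-] := ps c; have [s' <-] := ps c'; rewrite !hE /= /horner_eval => s0 s0'.
  have /factor_theorem[t ->] : root s 0 by apply/eqP.
  have /factor_theorem[t' ->] : root s' 0 by apply/eqP.
  by rewrite -rmorphM; apply/pk; exists (t * t'); rewrite subr0 mulrACA expr2.
- by rewrite -rmorphM; apply/pk; exists 1; rewrite mul1r expr2.
- by rewrite hE /= /horner_eval hornerX.
- move=> c c0; rewrite -pc -rmorphM => /pk[s].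
  move=> /(congr1 (fun p : {poly k} => p`_1)); rewrite coefXM coefC coefMXn /=.
  by apply/eqP.
Qed.

End Families.

(** * Tangent vectors; Z and X as divisors of D *)

Section Tangent.
Variable k : closedFieldType.
Notation alg := (comUnitAlgType k).
Variable q : nat.
Variables (X : kfunctor k) (u : kmorphism X (GL3_functor k)).
Hypothesis u_smooth : formally_smooth u.

Definition jet (C : alg) (J : {rmorphism k -> C}) (e : C) (g d : 'M[k]_3) : 'M[C]_3 :=
  \matrix_(i, j) (J (g i j) + e * J (d i j)).

(** A first-order deformation inside the locus, along which [b] moves at speed [c], lifts to the
    chart; an element of the ideal of the locus would vanish on it. *)
Lemma tangent_nonvanishing (F : eqfam k) (R : alg) (r : X R) (x : {lrmorphism R -> k^o})
    (b : forall A : alg, 'M[A]_3 -> A) (d : 'M[k]_3) (c : k) : eqfam_ok q F -> chart r ->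
  (forall (A B : alg) (f : {lrmorphism A -> B}) (g : 'M[A]_3), b B (map_mx f g) = f (b A g)) ->
  c != 0 ->
  (forall (C : alg) (J : {rmorphism k -> C}) (e : C), e * e = 0 ->
     (forall y, y \in @F C (jet J e (mat u (pull x r)) d) -> y = 0) /\
     b C (jet J e (mat u (pull x r)) d) = e * J c) ->
  ~ VI u F r (b R (mat u r)).
Proof.
move=> Fok [_ [_ _ lft]] bn c0 H; have [C [h [e [sz ee he nz]]]] := dual_numbers k.
have [Fz bE] := H C [the {rmorphism k -> C} of in_alg C] e ee; set g1 := jet _ _ _ _ in Fz bE.
have gE : map_mx h g1 = val (u k^o (pull x r) : GL3 k^o).
  apply/matrixP => i j; rewrite !mxE lrD lrM he mul0r addr0.
  by rewrite /= lrmorph_alg /GRing.scale /= mulr1.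
have [g2 [g2v g2E]] := lift_unit sz gE.
have [y yE yh] := u_smooth sz (esym g2E).
have [v vE] := lft C k^o h y x sz (esym yh).
have my : mat u y = g1 by rewrite /mat yE g2v.
move=> Ib; have vy : van u F (pull v r) by move=> z; rewrite vE my; apply: Fz.
have := proj1 (VI_van u Fok r v) vy _ Ib; rewrite -bn -mat_pull vE my bE.
exact: nz.
Qed.

Section Points.
Variables (R : alg) (r : X R) (x : {lrmorphism R -> k^o}).
Hypothesis cr : chart r.
Let g : 'M[k]_3 := mat u (pull x r).

Let gu : \det g != 0.
Proof.
have := valP (u k^o (pull x r) : GL3 k^o); rewrite unitmxE unitfE; exact.
Qed.

(** The direction is that of the Newton step for D, along which [M02] has derivative [det g]. *)
Lemma M02_nonvanishing : M02 g = 0 -> ~ VI u (@F0 k) r (M02 (mat u r)).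
Proof.
move=> g0; apply: (tangent_nonvanishing (b := fun A g => M02 g) (x := x) (c := \det g)
  (d := mk3 (g o2 o0 * g o0 o1) 0 (g o2 o2 * g o0 o1)
    (g o2 o0 * g o1 o1) 0 (g o2 o2 * g o1 o1) 0 0 0) (@F0_ok k q) cr) => //.
  by move=> *; exact: M02_map.
move=> C J e ee; split=> //; rewrite -/g.
transitivity (J (M02 g) + e * J (\det g + g o2 o1 * M02 g)); last first.
  by rewrite g0 rmorph0 mulr0 addr0 add0r.
rewrite det3 /jet /M12 /M01 /M02 !mxE /= !(rmorphD, rmorphB, rmorphM, rmorph0, rmorphN).
clear g0; by gen_mx g => *; ring.
Qed.

(** At a point of X the chosen direction is tangent to D and moves [M01] at speed [- M12], which is
    nonzero since [det g = g20 M12] there. *)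
Lemma M01_nonvanishing : g o0 o0 = 0 -> g o1 o0 = 0 -> ~ VI u (@FD k) r (M01 (mat u r)).
Proof.
move=> g0 g1; have dE : \det g = g o2 o0 * M12 g.
  by rewrite det3 /M02 /M01 g0 g1; ring.
apply: (tangent_nonvanishing (b := fun A g => M01 g) (x := x) (c := - M12 g)
  (d := mk3 (g o0 o2) 0 0 (g o1 o2) 0 0 0 0 0) (@FD_ok k q) cr) => //.
- by move=> *; exact: M01_map.
- by rewrite oppr_eq0; apply: contraNneq gu => h; rewrite dE h mulr0.
move=> C J e ee; rewrite -/g; split=> [y|].
  rewrite /FD inE => /eqP ->; rewrite /M02 !mxE /= g0 g1 !rmorph0.
  by gen_mx g => *; ring.
rewrite /M12 /M01 !mxE /= g0 g1 !(rmorphD, rmorphB, rmorphM, rmorph0, rmorphN).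
by gen_mx g => *; ring.
Qed.

Lemma N02_nonvanishing : g o0 o0 = 0 -> g o0 o2 = 0 -> ~ VI u (@FD k) r (N02 (mat u r)).
Proof.
move=> g0 g1; have dE : \det g = - g o0 o1 * (g o2 o2 * g o1 o0 - g o2 o0 * g o1 o2).
  by rewrite det3 /M02 /M01 /M12 g0 g1; ring.
apply: (tangent_nonvanishing (b := fun A g => N02 g) (x := x)
  (c := g o2 o2 * g o1 o0 - g o2 o0 * g o1 o2)
  (d := mk3 (g o1 o0) 0 (g o1 o2) 0 0 0 0 0 0) (@FD_ok k q) cr) => //.
- by move=> *; exact: N02_map.
- by apply: contraNneq gu => h; rewrite dE h mulr0.
move=> C J e ee; rewrite -/g; split=> [y|].
  rewrite /FD inE => /eqP ->; rewrite /M02 !mxE /= g0 g1 !rmorph0.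
  by gen_mx g => *; ring.
rewrite /N02 !mxE /= g0 g1 !(rmorphD, rmorphB, rmorphM, rmorph0, rmorphN).
by gen_mx g => *; ring.
Qed.

Lemma g10_nonvanishing : g o0 o0 = 0 -> g o0 o2 = 0 -> g o1 o0 = 0 ->
  ~ VI u (@FZ k) r (mat u r o1 o0).
Proof.
move=> g0 g1 g2; apply: (tangent_nonvanishing (b := fun A g => g o1 o0) (x := x) (c := 1)
  (d := mk3 0 0 0 1 0 0 0 0 0) (@FZ_ok k q) cr) => //.
- by move=> *; rewrite mxE.
- exact: oner_neq0.
move=> C J e ee; rewrite -/g; split=> [y|].
  by rewrite /FZ !inE => /orP[]/eqP ->; rewrite !mxE /= ?g0 ?g1 !rmorph0 mulr0 addr0.
by rewrite !mxE /= g2 !rmorph0 add0r.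
Qed.

End Points.

Section Ideals.
Variables (A : alg) (y : X A).

Lemma det_mat_unit : \det (mat u y) \is a GRing.unit.
Proof. by rewrite -unitmxE; exact: (valP (u A y : GL3 A)). Qed.

Lemma VI_FD e : VI u (@FD k) y e <-> exists s, e = M02 (mat u y) * s.
Proof.
split=> [[n [c [d [dD ->]]]]|[s ->]].
  exists (\sum_i c i); rewrite mulr_sumr; apply: eq_bigr => i _.
  by have := dD i; rewrite /FD inE => /eqP ->; rewrite mulrC.
by apply: ideal_mulr; [exact: VI_ideal | apply: idspan_in; rewrite /FD inE].
Qed.

Lemma VI_FD_M02 : VI u (@FD k) y (M02 (mat u y)).
Proof. by apply/VI_FD; exists 1; rewrite mulr1. Qed.

Lemma unit_mulI (I : A -> Prop) a b : ideal I -> b \is a GRing.unit -> I (a * b) -> I a.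
Proof. by move=> idI ub Iab; rewrite -(mulrK ub a); apply: ideal_mulr. Qed.

Lemma VI_FZ_00 : VI u (@FZ k) y (mat u y o0 o0).
Proof. by apply: idspan_in; rewrite /FZ !inE eqxx. Qed.
Lemma VI_FZ_02 : VI u (@FZ k) y (mat u y o0 o2).
Proof. by apply: idspan_in; rewrite /FZ !inE eqxx orbT. Qed.
Lemma VI_FX_00 : VI u (@FX k) y (mat u y o0 o0).
Proof. by apply: idspan_in; rewrite /FX !inE eqxx. Qed.
Lemma VI_FX_10 : VI u (@FX k) y (mat u y o1 o0).
Proof. by apply: idspan_in; rewrite /FX !inE eqxx orbT. Qed.

(** Z is the principal divisor [N02 = 0] in D: modulo [M02] the products of [g00] and [g02] with the
    unit [det g] are multiples of [N02]. *)
Lemma VI_FZP e : VI u (@FZ k) y e <-> exists s t, e = N02 (mat u y) * s + t /\ VI u (@FD k) y t.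
Proof.
have idD := VI_ideal u (@FD k) y; have idZ := VI_ideal u (@FZ k) y; have ud := det_mat_unit.
split=> [|[s [t [-> /VI_FD[s' ->]]]]].
  apply: (@idspan_sub _ _ (fun e => exists s t, e = N02 (mat u y) * s + t /\ VI u (@FD k) y t)).
    split=> [|e1 e2 [s [t [-> h]]] [s' [t' [-> h']]]|c e1 [s [t [-> h]]]].
    - by exists 0, 0; rewrite mulr0 addr0; split=> //; exact: (ideal0 idD).
    - by exists (s + s'), (t + t'); split; [move: (N02 _) => *; ring | apply: idealD].
    - by exists (c * s), (c * t); split; [move: (N02 _) => *; ring | apply: idealM].
  move=> e1; rewrite /FZ !inE => /orP[]/eqP ->.
    exists (M01 (mat u y) / \det (mat u y)), ((mat u y o2 o0 * mat u y o0 o1 -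
      mat u y o0 o0 * mat u y o2 o1) * M02 (mat u y) / \det (mat u y)).
    rewrite mulrA -mulrDl -g00_det mulrK //; split=> //.
    apply: (ideal_mulr idD); apply: (idealM idD); exact: VI_FD_M02.
  exists (- M12 (mat u y) / \det (mat u y)), ((mat u y o2 o2 * mat u y o0 o1 -
      mat u y o0 o2 * mat u y o2 o1) * M02 (mat u y) / \det (mat u y)).
  rewrite mulrA -mulrDl mulrN -g02_det mulrK //; split=> //.
  apply: (ideal_mulr idD); apply: (idealM idD); exact: VI_FD_M02.
have h0 := VI_FZ_00; have h2 := VI_FZ_02.
rewrite /N02 /M01 /M02; apply: (idealD idZ); apply: (ideal_mulr idZ); apply: (idealB idZ);
  by [exact: (ideal_mulr idZ) | exact: (idealM idZ)].
Qed.

Lemma VI_FXP e : VI u (@FX k) y e <-> exists s t, e = M01 (mat u y) * s + t /\ VI u (@FD k) y t.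
Proof.
have idD := VI_ideal u (@FD k) y; have idX := VI_ideal u (@FX k) y; have ud := det_mat_unit.
split=> [|[s [t [-> /VI_FD[s' ->]]]]].
  apply: (@idspan_sub _ _ (fun e => exists s t, e = M01 (mat u y) * s + t /\ VI u (@FD k) y t)).
    split=> [|e1 e2 [s [t [-> h]]] [s' [t' [-> h']]]|c e1 [s [t [-> h]]]].
    - by exists 0, 0; rewrite mulr0 addr0; split=> //; exact: (ideal0 idD).
    - by exists (s + s'), (t + t'); split; [move: (M01 _) => *; ring | apply: idealD].
    - by exists (c * s), (c * t); split; [move: (M01 _) => *; ring | apply: idealM].
  move=> e1; rewrite /FX !inE => /orP[]/eqP ->.
    exists (N02 (mat u y) / \det (mat u y)), ((mat u y o2 o0 * mat u y o0 o1 -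
      mat u y o0 o0 * mat u y o2 o1) * M02 (mat u y) / \det (mat u y)).
    rewrite mulrA -mulrDl (mulrC (M01 _)) -g00_det mulrK //; split=> //.
    apply: (ideal_mulr idD); apply: (idealM idD); exact: VI_FD_M02.
  exists ((mat u y o2 o2 * mat u y o1 o0 - mat u y o2 o0 * mat u y o1 o2) / \det (mat u y)),
    ((mat u y o2 o0 * mat u y o1 o1 -
      mat u y o1 o0 * mat u y o2 o1) * M02 (mat u y) / \det (mat u y)).
  rewrite mulrA -mulrDl (mulrC (M01 _)) -g10_det mulrK //; split=> //.
  apply: (ideal_mulr idD); apply: (idealM idD); exact: VI_FD_M02.
have h0 := VI_FX_00; have h1 := VI_FX_10.
rewrite /N02 /M01 /M02; apply: (idealD idX); apply: (ideal_mulr idX); apply: (idealB idX);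
  by [exact: (ideal_mulr idX) | exact: (idealM idX)].
Qed.

End Ideals.
End Tangent.

(** * Algebras that are domains *)

Section DomainTools.
Variable k : closedFieldType.
Notation alg := (comUnitAlgType k).

Definition domain (T : alg) : Prop := forall a b : T, a * b = 0 -> a = 0 \/ b = 0.

Lemma domain_pow (T : alg) (a : T) n : domain T -> a ^+ n = 0 -> a = 0.
Proof.
move=> dT; elim: n => [/eqP|n IH]; first by rewrite oner_eq0.
by rewrite exprS => /dT[].
Qed.

Lemma domain_nz_pow (T : alg) (a : T) n : domain T -> a <> 0 -> a ^+ n <> 0.
Proof. by move=> dT na /(domain_pow dT). Qed.

Lemma domain_unit (T : alg) (a : T) : a \is a GRing.unit -> a <> 0.
Proof. by move=> + a0; rewrite a0 unitr0. Qed.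

Lemma domain_mulI (T : alg) (a b c : T) : domain T -> a <> 0 -> a * b = a * c -> b = c.
Proof.
move=> dT na /eqP; rewrite -subr_eq0 -mulrBr => /eqP /dT[//|/eqP].
by rewrite subr_eq0 => /eqP.
Qed.

Lemma localization_inj (T L : alg) (a : T) (l : {lrmorphism T -> L}) b :
  domain T -> a <> 0 -> is_localization l a -> l b = 0 -> b = 0.
Proof. by move=> dT na [_ _ lk] /lk[n /dT[/(domain_pow dT)|]]. Qed.

Lemma localization_domain (T L : alg) (a : T) (l : {lrmorphism T -> L}) :
  domain T -> a <> 0 -> is_localization l a -> domain L.
Proof.
move=> dT na loc x y xy; have [la lf lk] := loc.
have [n [c E]] := lf x; have [m [d E']] := lf y.
have : l (c * d) = 0 by rewrite lrM -E -E' mulrACA xy mul0r.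
move/(localization_inj dT na loc)/dT => [] h; [left|right].
  by apply: (mulIr (unitrX n la)); rewrite E h lr0 mul0r.
by apply: (mulIr (unitrX m la)); rewrite E' h lr0 mul0r.
Qed.

Lemma prime_quotient (R : alg) (I : R -> Prop) : ideal I -> primeI I ->
  exists (T : alg) (p : {lrmorphism R -> T}),
    [/\ forall y, exists x, p x = y, forall x, p x = 0 <-> I x & domain T].
Proof.
move=> idI [I1 pI]; have [T [p [ps pk]]] := alg_quot idI I1; exists T, p; split=> // a b.
have [x <-] := ps a; have [y <-] := ps b; rewrite -lrM => /pk/pI[] /pk; by [left|right].
Qed.

Lemma domain_nss (T : alg) (a : T) : fin_gen T -> domain T ->
  (forall x : {lrmorphism T -> k^o}, x a = 0) -> a = 0.
Proof.
move=> fg dT h; apply: contrapT => na.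
by have [|x] := @nullstellensatz k T a fg; [move=> n; apply: domain_nz_pow | rewrite h].
Qed.

(** By Krull's theorem a nonzero element of a Noetherian domain is not divisible by all powers of an
    element that vanishes at a point. *)
Lemma order_exists (T : alg) (x : {lrmorphism T -> k^o}) (t f : T) : fin_gen T -> domain T ->
  x t = 0 -> f <> 0 -> exists j f1, f = t ^+ j * f1 /\ forall s, f1 <> t * s.
Proof.
move=> fg dT xt nf; apply: contrapT => nex.
have div n : exists f1, f = t ^+ n * f1.
  elim: n => [|n [f1 E]]; first by exists f; rewrite mul1r.
  have [[s sE]|ns] := pselect (exists s, f1 = t * s).
    by exists s; rewrite exprSr -mulrA -sE.
  by case: nex; exists n, f1; split=> // s sE; apply: ns; exists s.
have idm : ideal (fun a => x a = 0) by exact: kernel_ideal.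
have id0 : ideal (fun a : T => a = 0).
  by split=> [|a b -> ->|r a ->]; rewrite ?addr0 ?mulr0.
have [M|a [xa /dT[|//]]] := krull_ideal (noeth_fin_gen fg) idm id0 (v := f).
  exists 0; split=> //; rewrite subr0; have [f1 ->] := div M.
  apply: (ideal_mulr (ipow_ideal _ M)); elim: M {f1} => [//|M IH].
  rewrite exprS; exact: ipowS.
move/eqP; rewrite subr_eq0 => /eqP a1.
by move: xa; rewrite -a1 lr1; apply/eqP/oner_neq0.
Qed.

Lemma poly_alg (A : alg) : exists (P : alg) (p : {rmorphism {poly A} -> P})
    (i : {lrmorphism A -> P}),
  [/\ forall y, exists s, p s = y, injective p, forall a, p a%:P = i a &
    forall (B : alg) (h : {lrmorphism A -> B}) (b : B),
      exists v : {lrmorphism P -> B}, forall s, v (p s) = (map_poly h s).[b]].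
Proof.
pose c := [the {rmorphism k -> {poly A}} of polyC \o in_alg A].
have [P [p [ps pinj pc]]] := @ring_alg k {poly A} c.
pose i0 a := p a%:P.
have iD : {morph i0 : x y / x + y} by move=> x y; rewrite /i0 !rmorphD.
have iM : {morph i0 : x y / x * y} by move=> x y; rewrite /i0 !rmorphM.
have i1 : i0 1 = 1 by rewrite /i0 !rmorph1.
have iC b : i0 b%:A = b%:A by rewrite -pc.
exists P, p, (mk_lrmorphism iD iM i1 iC); split=> // B h b.
pose e : {rmorphism {poly A} -> B} := ev_step h b.
have eE s : e s = (map_poly h s).[b] by rewrite ev_stepE.
have [||v vE] := @quot_lift _ _ _ P p B e ps pc.
- move=> a; rewrite eE /= map_polyC hornerC; exact: (lrmorph_alg h a).
- by move=> s s0; rewrite (pinj s 0) ?rmorph0.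
by exists v => s; rewrite vE eE.
Qed.

Lemma mpoly_domain (T : alg) n : domain T -> forall p p' : {mpoly T[n]},
  p * p' = 0 -> p = 0 \/ p' = 0.
Proof.
move=> dT.
have ax : GRing.integral_domain_axiom T.
  by move=> a b /dT[] ->; rewrite eqxx ?orbT.
(* The domain property is packed into a structure, over which polynomial rings are known to be
   domains. *)
pose D : idomainType := HB.pack (GRing.ComUnitRing.sort (GRing.ComUnitAlgebra.sort T))
  (GRing.ComUnitRing_isIntegral.Build (GRing.ComUnitAlgebra.sort T) ax).
have h (p p' : {mpoly D[n]}) : p * p' = 0 -> p = 0 \/ p' = 0.
  by move/eqP; rewrite mulf_eq0 => /orP[]/eqP; [left|right].
exact: h.
Qed.

End DomainTools.

(** * Universal elements of the parabolic and of the Borel *)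

Section UniversalParabolic.
Variable k : closedFieldType.
Notation alg := (comUnitAlgType k).

Definition gen_parab (R : nzRingType) (bor : bool) (X : 'I_9 -> R) : 'M[R]_3 :=
  \matrix_(r, s) nth 0 (nth [::] [:: [:: X (inord 0); if bor then 0 else X (inord 1); 0];
    [:: X (inord 2); X (inord 3); 0]; [:: X (inord 4); X (inord 5); X (inord 6)]] r) s.

(** The coordinate ring over [T] of the parabolic, or of the Borel if [bor], times a plane. It is
    again a finitely generated domain, so identities in the group element can be tested on a single
    element over a domain. *)
Lemma universal_parabolic (bor : bool) (T : alg) : fin_gen T -> domain T ->
  exists (T' : alg) (j : {lrmorphism T -> T'}) (x : 'M[T']_3) (e1 e2 : T'),
  [/\ fin_gen T', domain T', parab x, bor -> x o0 o1 = 0 &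
    forall (A : alg) (h : {lrmorphism T -> A}) (y : 'M[A]_3) (f1 f2 : A),
      parab y -> (bor -> y o0 o1 = 0) ->
      exists h' : {lrmorphism T' -> A},
        [/\ h' \o j =1 h, map_mx h' x = y, h' e1 = f1 & h' e2 = f2]].
Proof.
move=> fg dT; pose P := {mpoly T[9]}.
have [A0 [p [ps pinj pc]]] := @ring_alg k P (mconst T 9).
pose i0 a := p a%:MP.
have iD : {morph i0 : x y / x + y} by move=> x y; rewrite /i0 !rmorphD.
have iM : {morph i0 : x y / x * y} by move=> x y; rewrite /i0 !rmorphM.
have i1 : i0 1 = 1 by rewrite /i0 !rmorph1.
have iC b : i0 b%:A = b%:A by rewrite -pc.
pose i := mk_lrmorphism iD iM i1 iC.
have dA : domain A0.
  move=> a b; have [x <-] := ps a; have [y <-] := ps b; rewrite -rmorphM -[0](rmorph0 p).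
  move=> /pinj /(mpoly_domain dT)[] ->; rewrite rmorph0; by [left|right].
have fgA : fin_gen A0.
  apply: (@fin_gen_mpoly k T A0 9 p fg) => [a|]; [exact: iC | exact: ps].
pose X : 'M[A0]_3 := gen_parab bor (fun l => p 'X_l).
have hom (A : alg) (h : {lrmorphism T -> A}) (y : 'M[A]_3) (f1 f2 : A) :
    y o0 o2 = 0 -> y o1 o2 = 0 -> (bor -> y o0 o1 = 0) ->
    exists u : {lrmorphism A0 -> A}, [/\ forall a, u (i a) = h a, map_mx u X = y,
      u (p 'X_(inord 7)) = f1 & u (p 'X_(inord 8)) = f2].
  move=> h02 h12 h01; pose b (l : 'I_9) : A := nth 0 [:: y o0 o0; y o0 o1; y o1 o0; y o1 o1;
    y o2 o0; y o2 o1; y o2 o2; f1; f2] l.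
  have [||u uE] := @quot_lift _ _ _ A0 p A (mev h b) ps pc.
  - move=> a; exact: (etrans (mevC h b a%:A) (lrmorph_alg h a)).
  - by move=> x px; rewrite (pinj x 0) ?rmorph0.
  exists u; split.
  - by move=> a; rewrite [LHS]uE; exact: mevC.
  - apply: mat3P; apply: ord3_ind; apply: ord3_ind;
      rewrite !mxE /= ?lr0 ?uE ?mevXi /b ?inordK //.
    by case: ifP => b0; [rewrite lr0 h01 | rewrite uE mevXi /b inordK].
  - by rewrite uE mevXi /b inordK.
  - by rewrite uE mevXi /b inordK.
have nd : \det X <> 0.
  move=> h; have [||K [f _]] := @field_point k T (fun c => c = 0).
  - by split=> [|u v -> ->|u v ->]; rewrite ?addr0 ?mulr0.
  - by apply/eqP/oner_neq0.
  have [||_|u [_ uX _ _]] := hom K f 1%:M 0 0; rewrite ?mxE //.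
  have := congr1 u h; rewrite lr0 -[u (\det X)](det_map_mx u) uX det1; apply/eqP/oner_neq0.
have [L [l loc]] := localization_exists (fun n => domain_nz_pow (n := n) dA nd).
have [lu lf lk] := loc; have [j jE] := lr_comp i l.
exists L, j, (map_mx l X), (l (p 'X_(inord 7))), (l (p 'X_(inord 8))); split.
- exact: (fin_gen_localization loc fgA).
- exact: (localization_domain dA nd loc).
- by split; [rewrite unitmxE det_map_mx | rewrite !mxE lr0 | rewrite !mxE lr0].
- by move=> b; rewrite !mxE /= b lr0.
move=> A h y f1 f2 [uy h02 h12] h01; have [u [ui uX u7 u8]] := hom A h y f1 f2 h02 h12 h01.
have ud : u (\det X) \is a GRing.unit by rewrite -(det_map_mx u) uX -unitmxE.
have [v vE] := localization_univ loc ud; exists v; split.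
- by move=> a; rewrite /= jE /= vE ui.
- by rewrite -uX; apply/matrixP => r s; rewrite !mxE vE.
- by rewrite vE.
- by rewrite vE.
Qed.

End UniversalParabolic.

(** * Covering by good charts and comparing charts *)

Section GoodCover.
Variable k : closedFieldType.
Notation alg := (comUnitAlgType k).
Variable q : nat.
Variables (X : kfunctor k) (u : kmorphism X (GL3_functor k)).
Hypothesis u_lfp : locally_finitely_presented u.

(** Good charts are given around [k]-points only, yet they cover all field points: by the
    Nullstellensatz the functions [a], together with the ideal of the locus, generate the unit
    ideal. *)
Lemma good_cover (F : eqfam k) (Good : forall R : alg, X R -> Prop) : eqfam_ok q F ->
  (forall (R : alg) (r : X R) (x : {lrmorphism R -> k^o}), chart r -> van u F (pull x r) ->
     exists a (L : alg) (l : {lrmorphism R -> L}),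
     [/\ is_localization l a, x a <> 0 & Good L (pull l r)]) ->
  forall (K : alg) (y : X K), is_field K -> van u F y ->
  exists (R : alg) (r : X R) (w : {lrmorphism R -> K}), Good R r /\ pull w r = y.
Proof.
move=> Fok h K y fK vy; have [R [r [w [cr wE]]]] := chart_cover u_lfp y fK.
pose D a := exists (L : alg) (l : {lrmorphism R -> L}), is_localization l a /\ Good L (pull l r).
have [n [c [d [dD E]]]] : idspan (fun a => D a \/ VI u F r a) 1.
  have [fgR _] := cr.
  have [|n] := @nss_ideal k R _ 1 fgR (idspan_ideal (fun a => D a \/ VI u F r a));
    last by rewrite expr1n.
  move=> x xI; have vx : van u F (pull x r).
    by apply/(VI_van _ Fok) => e Ie; apply: xI; apply: idspan_in; right.
  have [a [L [l [loc xa gL]]]] := h R r x cr vx.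
  by case: xa; apply: xI; apply: idspan_in; left; exists L, l.
have [i wdi] : exists i, w (d i) <> 0.
  apply/existsNP => h0; move: (oner_neq0 K); rewrite -(lr1 w) E lr_sum big1 ?eqxx // => i _.
  by rewrite lrM h0 mulr0.
have [[L [l [loc gL]]]|Ii] := dD i; last first.
  by case: wdi; apply: (proj1 (VI_van u Fok r w)) => //; rewrite wE.
have [w' w'E] := localization_univ loc (field_unit fK wdi).
exists L, (pull l r), w'; split=> //; rewrite -wE; symmetry; apply: pull_comp => x /=.
by rewrite w'E.
Qed.

(** Near a common field point one chart maps to a localization of the other algebra; comparisons
    between charts go through such a localization. *)
Lemma chart_link (R' B : alg) (r' : X R') (y : X B) (K : alg) (w' : {lrmorphism R' -> K})
    (w : {lrmorphism B -> K}) : chart r' -> is_field K -> pull w' r' = pull w y ->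
  exists d (L : alg) (l : {lrmorphism B -> L}) (v : {lrmorphism R' -> L})
    (wL : {lrmorphism L -> K}),
  [/\ is_localization l d, w d <> 0, pull v r' = pull l y, wL \o l =1 w & wL \o v =1 w'].
Proof.
move=> [_ [mono opn _]] fK E; have [d [wd dP]] := opn B y K w w' fK E.
have nn n : d ^+ n <> 0.
  move=> h0; have := congr1 w h0; rewrite lrX lr0 => /eqP.
  have := unitrX n (field_unit fK wd); case: eqP => // ->; by rewrite unitr0.
have [L [l loc]] := localization_exists nn; have [lu lf lk] := loc.
have [v vE] := dP L l lu; have [wL wLE] := localization_univ loc (field_unit fK wd).
exists d, L, l, v, wL; split=> // a.
have [vw vwE] := lr_comp v wL; rewrite -vwE; apply: mono; rewrite (pull_comp r' vwE) vE E.
by symmetry; apply: pull_comp => b /=; rewrite wLE.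
Qed.

End GoodCover.

(** * The action on the torsor and reductions to charts *)

Section Action.
Variable k : closedFieldType.
Notation alg := (comUnitAlgType k).
Variable q : nat.
Hypothesis q1 : (1 < q)%N.
Hypothesis qD : forall (A : alg) (a b : A), (a + b) ^+ q = a ^+ q + b ^+ q.
Variables (Y : zip_space k q) (u : kmorphism Y (GL3_space k q)).
Hypothesis u_act : forall (A : alg) (x y : 'M[A]_3) (p : Y A),
  zipE q x y -> u A (act x y p) = act x y (u A p).
Hypothesis u_smooth : formally_smooth u.
Hypothesis u_lfp : locally_finitely_presented u.

Let q0 : (0 < q)%N. Proof. exact: ltnW. Qed.

Definition ac (A : alg) (x : 'M[A]_3) (e1 e2 : A) (p : Y A) : Y A :=
  act x (invmx (yinv q x e1 e2)) p.

Lemma ac_zipE (A : alg) (x : 'M[A]_3) (e1 e2 : A) : parab x ->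
  zipE q x (invmx (yinv q x e1 e2)).
Proof. exact: (yinv_zip_group q0 (@qD A)). Qed.

Lemma ac_zipE' (A : alg) (x : 'M[A]_3) (e1 e2 : A) : parab x -> x o0 o1 = 0 ->
  zipE' q x (invmx (yinv q x e1 e2)).
Proof.
move=> px h01; split; first exact: ac_zipE.
have [ux h02 h12] := px; split=> //; apply/is_trig_mxP.
by apply: ord3_ind; apply: ord3_ind.
Qed.

Lemma zipE_ac (A : alg) (x y : 'M[A]_3) : zipE q x y ->
  parab x /\ exists e1 e2, forall p : Y A, act x y p = ac x e1 e2 p.
Proof.
move=> z; have [px [e1 [e2 E]]] := zip_group_yinv q0 (@qD A) z.
by split=> //; exists e1, e2 => p; rewrite /ac -E invmxK.
Qed.

Lemma zipE'_ac (A : alg) (x y : 'M[A]_3) : zipE' q x y ->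
  [/\ parab x, x o0 o1 = 0 & exists e1 e2, forall p : Y A, act x y p = ac x e1 e2 p].
Proof.
move=> [/zipE_ac[px h] [_ /is_trig_mxP t]]; split=> //; exact: t.
Qed.

Lemma mat_ac (A : alg) (x : 'M[A]_3) (e1 e2 : A) (p : Y A) : parab x ->
  mat u (ac x e1 e2 p) = zact q x e1 e2 (mat u p).
Proof.
move=> px; have z := ac_zipE e1 e2 px; have [ux uy] := zipE_unit z.
by rewrite /mat /ac u_act // val_GL3_act // invmxK.
Qed.

Lemma map_parab (A B : alg) (f : {lrmorphism A -> B}) (x : 'M[A]_3) : parab x ->
  parab (map_mx f x).
Proof.
by move=> [ux h02 h12]; split; rewrite ?mxE ?h02 ?h12 ?lr0 //; apply: map_unitmx_rmorph.
Qed.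

Lemma ac_pull (A B : alg) (f : {lrmorphism A -> B}) (x : 'M[A]_3) (e1 e2 : A) (p : Y A) :
  parab x -> pull f (ac x e1 e2 p) = ac (map_mx f x) (f e1) (f e2) (pull f p).
Proof.
move=> px; rewrite /ac act_pull; last exact: ac_zipE.
congr (act _ _ _); symmetry; apply: invmx_unique.
rewrite yinv_map -map_mxM mulmxV ?map_mx1 //; exact: (yinv_unit q0 (@qD A)).
Qed.

Lemma parab1 (A : alg) : parab (1%:M : 'M[A]_3).
Proof. by split; rewrite ?unitmx1 // !mxE. Qed.

Lemma ac_1 (A : alg) (p : Y A) : ac 1%:M 0 0 p = p.
Proof.
rewrite /ac; suff -> : yinv q (1%:M : 'M[A]_3) 0 0 = 1%:M by rewrite invmx1 act_1.
by apply: mat3P; apply: ord3_ind; apply: ord3_ind;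
  rewrite !mxE /= ?expr1n ?(frob_zero _ q0).
Qed.

Definition stable (bor : bool) (F : eqfam k) : Prop :=
  forall (A : alg) (x : 'M[A]_3) (e1 e2 : A) (p : Y A), parab x -> (bor -> x o0 o1 = 0) ->
    van u F p -> van u F (ac x e1 e2 p).

Lemma stable_F0 bor : stable bor (@F0 k).
Proof. by []. Qed.

Lemma stable_FD : stable true (@FD k).
Proof.
move=> A x e1 e2 p px h01 h y; rewrite /FD inE => /eqP ->.
rewrite mat_ac // M02_zact // h01 // (h (M02 (mat u p))) ?inE //.
by rewrite (frob_zero _ q0) mul0r add0r !mulr0.
Qed.

Lemma stable_FX bor : stable bor (@FX k).
Proof.
move=> A x e1 e2 p px h01 h y.
have h0 : mat u p o0 o0 = 0 by apply: h; rewrite /FX !inE eqxx.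
have h1 : mat u p o1 o0 = 0 by apply: h; rewrite /FX !inE eqxx orbT.
by rewrite /FX !inE mat_ac // => /orP[]/eqP ->; rewrite ?g00_zact ?g10_zact // h0 h1
  !mulr0 addr0 mul0r.
Qed.

Lemma stable_FZ : stable true (@FZ k).
Proof.
move=> A x e1 e2 p px h01 h y.
have h0 : mat u p o0 o0 = 0 by apply: h; rewrite /FZ !inE eqxx.
have h1 : mat u p o0 o2 = 0 by apply: h; rewrite /FZ !inE eqxx orbT.
rewrite /FZ !inE mat_ac // => /orP[]/eqP ->.
  by rewrite g00_zact // h0 h01 // mulr0 mul0r addr0 mul0r.
by rewrite g02_zact ?h01 ?(frob_zero _ q0) // h1 mulr0.
Qed.

Lemma van_FD (A : alg) (p : Y A) : van u (@FD k) p <-> M02 (mat u p) = 0.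
Proof.
split=> [h|h y]; first by apply: h; rewrite /FD inE.
by rewrite /FD inE => /eqP ->.
Qed.

Lemma van_FZ (A : alg) (p : Y A) :
  van u (@FZ k) p <-> mat u p o0 o0 = 0 /\ mat u p o0 o2 = 0.
Proof.
split=> [h|[h h'] y]; first by split; apply: h; rewrite /FZ !inE eqxx ?orbT.
by rewrite /FZ !inE => /orP[]/eqP ->.
Qed.

Lemma van_FX (A : alg) (p : Y A) :
  van u (@FX k) p <-> mat u p o0 o0 = 0 /\ mat u p o1 o0 = 0.
Proof.
split=> [h|[h h'] y]; first by split; apply: h; rewrite /FX !inE eqxx ?orbT.
by rewrite /FX !inE => /orP[]/eqP ->.
Qed.

Lemma van_FZ_FD (A : alg) (p : Y A) : van u (@FZ k) p -> van u (@FD k) p.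
Proof. by move=> /van_FZ[h h']; apply/van_FD; rewrite /M02 h h' !mul0r subrr. Qed.

Lemma van_FX_FD (A : alg) (p : Y A) : van u (@FX k) p -> van u (@FD k) p.
Proof. by move=> /van_FX[h h']; apply/van_FD; rewrite /M02 h h' mul0r mulr0 subrr. Qed.

(** Equality over an arbitrary algebra is local, so it suffices to compare the data on a
    localization of one chart, modulo the ideal of the locus. *)
Lemma compat_reduction (F : eqfam k) (Dat : forall R : alg, Y R -> R -> Prop) :
  eqfam_ok q F ->
  (forall (R : alg) (r : Y R) c, Dat R r c -> chart r) ->
  (forall (R R' : alg) (r : Y R) (r' : Y R') c c' d (L : alg) (l : {lrmorphism R -> L})
     (v : {lrmorphism R' -> L}) (K : alg) (w : {lrmorphism L -> K}),
     Dat R r c -> Dat R' r' c' -> is_localization l d -> pull v r' = pull l r ->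
     is_field K -> van u F (pull w (pull l r)) -> VI u F (pull l r) (l c - v c')) ->
  forall (A R R' : alg) (r : Y R) (r' : Y R') c c'
  (h : {lrmorphism R -> A}) (h' : {lrmorphism R' -> A}),
  Dat R r c -> Dat R' r' c' -> van u F (pull h r) -> pull h r = pull h' r' -> h c = h' c'.
Proof.
move=> Fok Dc H A R R' r r' c c' h h' Dr Dr' vh E; apply/eqP; rewrite -subr_eq0; apply/eqP.
apply: local_zero => K phi fK.
have [w wE] := lr_comp h phi; have [w' w'E] := lr_comp h' phi.
have ww : pull w' r' = pull w r by rewrite (pull_comp r' w'E) -E (pull_comp r wE).
have [d [L [l [v [wL [loc wd vE wLE wLE']]]]]] := chart_link (Dc _ _ _ Dr') fK ww.
exists (h d); split; first by move: wd; rewrite wE.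
move=> B psi ud; have [hp hpE] := lr_comp h psi; have [hp' hp'E] := lr_comp h' psi.
have [|uL uLE] := @localization_univ _ R L B d l hp loc; first by rewrite hpE.
have [vL vLE] := lr_comp v uL.
have uLr : pull uL (pull l r) = pull psi (pull h r).
  by rewrite -(pull_comp r hpE); symmetry; apply: pull_comp => a /=; rewrite uLE.
have [_ [mono' _ _]] := Dc _ _ _ Dr'.
have vh' a : hp' a = vL a.
  apply: mono'; rewrite (pull_comp r' hp'E) -E (pull_comp r' vLE) vE; exact/esym.
rewrite lrB -[psi (h c)]hpE -[psi (h' c')]hp'E -uLE vh' vLE /= -lrB.
have vw : van u F (pull wL (pull l r)).
  rewrite -(pull_comp r (h := w)); last by move=> a; rewrite /= -wLE.
  rewrite (pull_comp r wE); exact: (van_pull Fok).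
have I := H _ _ _ _ _ _ _ _ _ _ _ _ Dr Dr' loc vE fK vw.
have vu : van u F (pull uL (pull l r)) by rewrite uLr; apply: (van_pull Fok).
exact: (proj1 (VI_van u Fok (pull l r) uL) vu).
Qed.

(** A natural identity in a point and a group element is reduced to a prime chart of the locus and
    the universal group element over it, hence to a domain [T]. The specialization of that element
    to the identity is kept for arguments by connectedness. *)
Lemma universal_reduction (F : eqfam k) (bor : bool) (Good : forall R : alg, Y R -> Prop)
    (z : forall A : alg, Y A -> 'M[A]_3 -> A -> A -> A) :
  eqfam_ok q F ->
  (forall (R : alg) (r : Y R), Good R r -> chart r /\ primeI (VI u F r)) ->
  (forall (K : alg) (y : Y K), is_field K -> van u F y ->
     exists (R : alg) (r : Y R) (w : {lrmorphism R -> K}), Good R r /\ pull w r = y) ->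
  (forall (A B : alg) (f : {lrmorphism A -> B}) (p : Y A) x e1 e2, van u F p -> parab x ->
     (bor -> x o0 o1 = 0) -> z B (pull f p) (map_mx f x) (f e1) (f e2) = f (z A p x e1 e2)) ->
  (forall (R : alg) (r : Y R) (T : alg) (m : {lrmorphism R -> T}) (x : 'M[T]_3) (e1 e2 : T),
     Good R r -> fin_gen T -> domain T -> (forall a, m a = 0 <-> VI u F r a) ->
     parab x -> (bor -> x o0 o1 = 0) ->
     (exists (T1 : alg) (s : {lrmorphism T -> T1}), [/\ map_mx s x = 1%:M, s e1 = 0 & s e2 = 0]) ->
     z T (pull m r) x e1 e2 = 0) ->
  forall (A : alg) (p : Y A) x e1 e2, van u F p -> parab x -> (bor -> x o0 o1 = 0) ->
    z A p x e1 e2 = 0.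
Proof.
move=> Fok Gc cov zn H A p x e1 e2 vp px h01; apply: local_zero => K phi fK.
have [R [r [w [Gr wE]]]] := cov K _ fK (van_pull Fok (f := phi) vp).
have [[fgR prR] pI] := Gc _ _ Gr; have [_ opn _] := prR.
have [d [pd dP]] := opn _ _ _ _ _ fK wE; exists d; split=> // B psi ud.
have [h hE] := dP B psi ud.
have [T [m [ms mk dT]]] := prime_quotient (VI_ideal u F r) pI.
have fgT := fin_gen_quotient ms fgR.
have [T' [j [x' [e1' [e2' [fgT' dT' px' h01' univ]]]]]] := universal_parabolic bor fgT dT.
have vh : van u F (pull h r) by rewrite hE; apply: (van_pull Fok).
have [|hT hTE] := @alg_quot_lift k R T B m h ms.
  by move=> a /mk; apply: (proj1 (VI_van u Fok r h) vh).
have [||h' [h'j h'x h'1 h'2]] := univ B hT (map_mx psi x) (psi e1) (psi e2).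
- exact: map_parab.
- by move=> b; rewrite mxE h01 // lr0.
have [||s [sj sx s1 s2]] := univ T (lr_id T) 1%:M 0 0; first exact: parab1.
  by move=> _; rewrite mxE.
have [mj mjE] := lr_comp m j.
have jinj a : j a = 0 -> a = 0.
  by move=> ja; have := sj a; rewrite /= ja lr0.
have pE : pull psi p = pull h' (pull mj r).
  rewrite -hE -(pull_comp r (h := h)) // => a /=.
  by rewrite mjE /= -hTE; exact: (esym (h'j (m a))).
have vm : van u F (pull mj r).
  by apply/(VI_van u Fok) => e Ie; rewrite mjE /= (proj2 (mk e) Ie) lr0.
rewrite -zn // pE -h'x -h'1 -h'2 zn // (H _ r T' mj) ?lr0 //; last by exists T, s.
move=> a; rewrite mjE /=; split=> [/jinj/mk//|/mk ->]; exact: lr0.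
Qed.

End Action.

(** * Refining charts; order along a divisor *)

Section Refinement.
Variable k : closedFieldType.
Notation alg := (comUnitAlgType k).
Variable q : nat.
Variables (X : kfunctor k) (u : kmorphism X (GL3_functor k)).
Hypothesis u_smooth : formally_smooth u.
Hypothesis u_lfp : locally_finitely_presented u.

Lemma localization_id (A : alg) : is_localization (lr_id A) 1.
Proof.
split=> [|b|c /= ->]; first exact: unitr1.
  by exists 0%N, b; rewrite mulr1.
by exists 0%N; rewrite mulr0.
Qed.

Lemma localization_comp (A B C : alg) (l : {lrmorphism A -> B}) (m : {lrmorphism B -> C})
    (g : {lrmorphism A -> C}) a b : g =1 m \o l -> is_localization l a ->
  is_localization m b -> exists c, is_localization g c.
Proof.
move=> gE [la lf lk] [mb mf mk]; have [n [b' bE]] := lf b; exists (a * b').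
have gc : g (a * b') = m (l a) ^+ n.+1 * m b.
  by rewrite gE /= !lrM -bE lrM lrX exprS -mulrA [_ * m b]mulrC.
have gb' : g b' = m b * m (l a) ^+ n by rewrite gE /= -bE lrM lrX.
split.
- by rewrite gc unitrM mb unitrX // lr_unit.
- move=> y; have [N [y' yE]] := mf y; have [M [y2 y2E]] := lf y'.
  exists (N + M)%N, (y2 * b' ^+ M * (a ^+ n.+1) ^+ N); rewrite gc 2!lrM !lrX gb'.
  rewrite [g y2]gE [g a]gE /= -y2E lrM lrX -yE !exprS !exprMn !exprD.
  move: (m (l a)) (m b) => a2 b2; move: (a2 ^+ n) => a1.
  by move: (a1 ^+ N) (a1 ^+ M) (a2 ^+ N) (a2 ^+ M) (b2 ^+ N) (b2 ^+ M) => *; ring.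
- move=> z; rewrite gE => /mk[i iE].
  have /lk[j jE] : l (b' ^+ i * z) = 0.
    by rewrite lrM lrX -bE exprMn mulrAC iE mul0r.
  exists (i + j)%N; rewrite exprMn !exprD.
  have -> : a ^+ i * a ^+ j * (b' ^+ i * b' ^+ j) * z =
    a ^+ i * b' ^+ j * (a ^+ j * (b' ^+ i * z)).
    by move: (a ^+ i) (a ^+ j) (b' ^+ i) (b' ^+ j) => *; ring.
  by rewrite jE mulr0.
Qed.

(** Primality of one ideal survives inverting a function that is nonzero at the point, so the loci
    are treated one after the other. *)
Lemma refine_chart (Fs : seq (eqfam k)) (R : alg) (r : X R) (x : {lrmorphism R -> k^o}) :
  (forall F, List.In F Fs -> eqfam_ok q F /\ van u F (pull x r)) -> chart r ->
  exists a (L : alg) (l : {lrmorphism R -> L}) (x' : {lrmorphism L -> k^o}),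
    [/\ is_localization l a, chart (pull l r), x' \o l =1 x &
      forall F, List.In F Fs -> primeI (VI u F (pull l r))].
Proof.
elim: Fs R r x => [|F Fs IH] R r x FF cr.
  by exists 1, R, (lr_id R), x; rewrite pull_idE; split=> //; exact: localization_id.
have [Fok Fx] := FF F (or_introl erefl).
have [a1 [R1 [l1 [x1 [loc1 cr1 p1 x1E]]]]] := prime_chart u_smooth Fok cr Fx.
have E1 : pull x1 (pull l1 r) = pull x r by rewrite -(pull_comp r (h := x)).
have [|//|a2 [L [l2 [x2 [loc2 cr2 x2E p2]]]]] := IH R1 (pull l1 r) x1.
  by move=> F' iF'; rewrite E1; apply: FF; right.
have [l lE] := lr_comp l1 l2; have [c locc] := localization_comp lE loc1 loc2.
exists c, L, l, x2; rewrite (pull_comp r lE); split=> //.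
  by move=> b; rewrite /= lE /= -x1E; exact: x2E.
move=> F' [<-|/p2//]; apply: (prime_localization Fok loc2 p1) => Ia2.
have [u2 _ _] := loc2; have := lr_unit x2 u2; have -> : x2 (l2 a2) = x1 a2 := x2E a2.
by rewrite (proj1 (VI_van u Fok (pull l1 r) x1)) ?unitr0 // E1.
Qed.

Lemma localization_point (A L K : alg) (a : A) (l : {lrmorphism A -> L})
    (x : {lrmorphism L -> K}) (y : {lrmorphism A -> K}) : is_localization l a ->
  x \o l =1 y -> y a <> 0.
Proof. by move=> [la _ _] E; rewrite -E /=; apply: domain_unit; apply: lr_unit. Qed.

Lemma VI_map (F : eqfam k) (A B : alg) (f : {lrmorphism A -> B}) (y : X A) e :
  eqfam_ok q F -> VI u F y e -> VI u F (pull f y) (f e).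
Proof.
move=> [Fn _] [n [c [d [dD ->]]]]; rewrite lr_sum; apply: ideal_sum; first exact: VI_ideal.
move=> i _; rewrite lrM; apply: idealM; first exact: VI_ideal.
by apply: idspan_in; rewrite mat_pull Fn map_f.
Qed.

Lemma VI_localization_inj (F : eqfam k) (R L : alg) (r : X R) a (l : {lrmorphism R -> L}) b :
  eqfam_ok q F -> is_localization l a -> primeI (VI u F r) -> ~ VI u F r a ->
  VI u F (pull l r) (l b) -> VI u F r b.
Proof.
move=> Fok loc [I1 pI] na /(VI_localization u Fok r _ loc)[n [x [Ix E]]].
have nX m : ~ VI u F r (a ^+ m) by move/(primeI_pow (conj I1 pI)).
have [_ _ lk] := loc; have /lk[m mE] : l (b * a ^+ n - x) = 0 by rewrite lrB lrM lrX E subrr.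
have : VI u F r (a ^+ m * (b * a ^+ n)).
  rewrite -(GRing.subrK x (b * a ^+ n)) mulrDr mE add0r.
  by apply: idealM => //; exact: VI_ideal.
by move=> /pI[/nX//|/pI[//|/nX//]].
Qed.

Lemma link_prime (F : eqfam k) (R L K : alg) (r : X R) a (l : {lrmorphism R -> L})
    (w : {lrmorphism L -> K}) :
  eqfam_ok q F -> is_localization l a -> primeI (VI u F r) -> van u F (pull w (pull l r)) ->
  primeI (VI u F (pull l r)) /\ forall b, VI u F (pull l r) (l b) -> VI u F r b.
Proof.
move=> Fok loc pI vw; have na : ~ VI u F r a.
  move=> Ia; have [la _ _] := loc; apply: (domain_unit (lr_unit w la)).
  exact: (proj1 (VI_van u Fok _ w) vw _ (VI_map l Fok Ia)).
split; first exact: (prime_localization Fok loc pI na).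
by move=> b; apply: (VI_localization_inj Fok loc pI na).
Qed.

Lemma chart_check (F : eqfam k) (Good : forall R : alg, X R -> Prop)
    (z : forall A : alg, X A -> A) : eqfam_ok q F ->
  (forall (R : alg) (r : X R), Good R r -> prechart r) ->
  (forall (K : alg) (y : X K), is_field K -> van u F y ->
     exists (R : alg) (r : X R) (w : {lrmorphism R -> K}), Good R r /\ pull w r = y) ->
  function_on (van u F) z ->
  (forall (R A : alg) (r : X R) (h : {lrmorphism R -> A}), Good R r ->
     van u F (pull h r) -> z A (pull h r) = 0) ->
  forall (A : alg) (y : X A), van u F y -> z A y = 0.
Proof.
move=> Fok Gc cov zn H A y vy; apply: local_zero => K phi fK.
have [R [r [w [Gr wE]]]] := cov K _ fK (van_pull Fok (f := phi) vy).
have [_ opn _] := Gc _ _ Gr.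
have [d [pd dP]] := opn _ _ _ _ _ fK wE; exists d; split=> // B psi ud.
have [h hE] := dP B psi ud; rewrite -zn // -hE; apply: H Gr _; rewrite hE.
exact: (van_pull Fok).
Qed.

(** Modulo the ideal of [F], divide by [b] as often as possible; the process stops by
    [order_exists], and the last quotient, not divisible by [b], is nonzero on the divisor [F']. *)
Lemma chart_order (F F' : eqfam k) (b : forall A : alg, 'M[A]_3 -> A) (R : alg) (r : X R)
    (x : {lrmorphism R -> k^o}) (f : R) : 
  eqfam_ok q F -> chart r -> primeI (VI u F r) -> van u F (pull x r) ->
  x (b R (mat u r)) = 0 ->
  (forall e, VI u F' r e <-> exists s t, e = b R (mat u r) * s + t /\ VI u F r t) ->
  ~ VI u F r f ->
  exists j c, VI u F r (f - b R (mat u r) ^+ j * c) /\ ~ VI u F' r c.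
Proof.
move=> Fok [fg pr] pI vx xb F'P nf.
have [T [m [ms mk dT]]] := prime_quotient (VI_ideal u F r) pI.
have [|xT xTE] := @alg_quot_lift k R T k^o m x ms.
  by move=> a /mk; apply: (proj1 (VI_van u Fok r x) vx).
have [||j [f1 [fE f1E]]] := @order_exists k T xT (m (b R (mat u r))) (m f)
  (fin_gen_quotient ms fg) dT.
- by rewrite xTE.
- by move/mk.
have [c cE] := ms f1; exists j, c; split.
  by apply/mk; rewrite lrB lrM lrX cE fE subrr.
move=> /F'P[s [t [E It]]]; apply: (f1E (m s)).
by rewrite -cE E lrD lrM (proj2 (mk t) It) addr0.
Qed.

End Refinement.

(** * Characters of the torus *)

Section Characters.
Variable A : comUnitRingType.
Implicit Types (x : 'M[A]_3) (l m : 'rV[int]_3).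

Lemma torus_char_weight a b c x :
  torus_char (weight a b c) x = x o0 o0 ^ a * x o1 o1 ^ b * x o2 o2 ^ c.
Proof. by rewrite /torus_char prod3 !mxE. Qed.

Lemma borel_units x : parab x -> x o0 o1 = 0 -> forall i, x i i \is a GRing.unit.
Proof.
move=> px h01; have [u2] := parab_units px; rewrite /M01 h01 mul0r subr0 unitrM => /andP[u0 u1].
exact: ord3_ind.
Qed.

Lemma torus_char_unit l x : (forall i, x i i \is a GRing.unit) ->
  torus_char l x \is a GRing.unit.
Proof. by move=> ux; rewrite /torus_char prod3 !unitrM !unitrXz ?ux. Qed.

Lemma torus_charD l m x : (forall i, x i i \is a GRing.unit) ->
  torus_char (l + m) x = torus_char l x * torus_char m x.
Proof.
move=> ux; rewrite /torus_char -big_split; apply: eq_bigr => i _ /=.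
by rewrite mxE exprzDr.
Qed.

Lemma torus_char0 x : torus_char 0 x = 1.
Proof. by rewrite /torus_char big1 // => i _; rewrite mxE expr0z. Qed.

Lemma torus_charX l x n : (forall i, x i i \is a GRing.unit) ->
  torus_char (l *+ n) x = torus_char l x ^+ n.
Proof.
move=> ux; elim: n => [|n IH]; first by rewrite mulr0n torus_char0.
by rewrite mulrS torus_charD // IH exprS.
Qed.

Lemma torus_charB l m x : (forall i, x i i \is a GRing.unit) ->
  torus_char (l - m) x * torus_char m x = torus_char l x.
Proof. by move=> ux; rewrite -torus_charD // GRing.subrK. Qed.

End Characters.

Lemma torus_char_map (k : fieldType) (A B : comUnitAlgType k) (f : {lrmorphism A -> B})
    (l : 'rV[int]_3) (x : 'M[A]_3) : (forall i, x i i \is a GRing.unit) ->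
  torus_char l (map_mx f x) = f (torus_char l x).
Proof.
move=> ux; rewrite /torus_char rmorph_prod; apply: eq_bigr => i _.
rewrite mxE; case: (l 0 i) => n; first exact: (esym (lrX f _ n)).
rewrite NegzE -!exprnN; symmetry; apply: (etrans (lrV f (unitrX n.+1 (ux i)))).
by congr (_^-1); exact: lrX.
Qed.

(** * Division by [M01] along X inside D *)

Section Division.
Variable k : closedFieldType.
Notation alg := (comUnitAlgType k).
Variable q : nat.
Hypothesis q1 : (1 < q)%N.
Hypothesis qD : forall (A : alg) (a b : A), (a + b) ^+ q = a ^+ q + b ^+ q.
Variables (Y : zip_space k q) (u : kmorphism Y (GL3_space k q)).
Hypothesis u_act : forall (A : alg) (x y : 'M[A]_3) (p : Y A),
  zipE q x y -> u A (act x y p) = act x y (u A p).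
Hypothesis u_smooth : formally_smooth u.
Hypothesis u_lfp : locally_finitely_presented u.

Let q0 : (0 < q)%N. Proof. exact: ltnW. Qed.

Definition semi (lam : 'rV[int]_3) (V : subset_of Y) (f : forall A : alg, Y A -> A) : Prop :=
  forall (A : alg) (x : 'M[A]_3) e1 e2 (p : Y A), V A p -> parab x -> x o0 o1 = 0 ->
    f A (ac x e1 e2 p) = torus_char lam x * f A p.

(** Where [M02] vanishes, the linear action on the pair of minors reduces to a scalar on [M01]. *)
Lemma torus_char_M01 (A : alg) (x : 'M[A]_3) e1 e2 (p : Y A) : parab x -> x o0 o1 = 0 ->
  van u (@FD k) p ->
  M01 (mat u (ac x e1 e2 p)) = torus_char (weight 1 (1 + q%:Z) q%:Z) x * M01 (mat u p).
Proof.
move=> px h01 /van_FD h; rewrite mat_ac // M01_zact // h M01_borel // torus_char_weight.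
rewrite mulr0 addr0 expr1z exprzDr; last exact: (borel_units px h01).
by rewrite expr1z -!exprnP; move: (x o1 o1 ^+ q) (x o2 o2 ^+ q) (M01 (mat u p)) => *; ring.
Qed.

Lemma torus_char_N02 (A : alg) (x : 'M[A]_3) e1 e2 (p : Y A) : parab x -> x o0 o1 = 0 ->
  van u (@FD k) p ->
  N02 (mat u (ac x e1 e2 p)) = torus_char (weight (1 + q%:Z) 0 (1 + q%:Z)) x * N02 (mat u p).
Proof.
move=> px h01 /van_FD h; rewrite mat_ac // N02_zact ?(frob_zero _ q0) // h torus_char_weight.
rewrite mulr0 add0r expr0z mulr1 !exprzDr; do ?exact: (borel_units px h01).
by rewrite !expr1z -!exprnP; move: (x o0 o0 ^+ q) (x o2 o2 ^+ q) (N02 (mat u p)) => *; ring.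
Qed.

Lemma van_FX_of (A : alg) (p : Y A) : van u (@FD k) p -> M01 (mat u p) = 0 -> van u (@FX k) p.
Proof.
move=> /van_FD h2 h1; apply/van_FX; have ud := det_mat_unit u p.
by split; apply: (mulIr ud); rewrite mul0r ?g00_det ?g10_det h1 h2 !mulr0 addr0.
Qed.

Lemma FD_good (R : alg) (r : Y R) (x : {lrmorphism R -> k^o}) : chart r ->
  van u (@FD k) (pull x r) -> primeI (VI u (@FD k) r) -> ~ VI u (@FD k) r (M01 (mat u r)).
Proof.
move=> cr vx pI; have [h0|h0] := eqVneq (M01 (mat u (pull x r))) 0.
  have /van_FX[h1 h2] := van_FX_of vx h0.
  exact: (M01_nonvanishing q u_smooth cr h1 h2).
move=> I; move: h0; rewrite mat_pull M01_map.
by rewrite (proj1 (VI_van u (@FD_ok k q) r x) vx _ I) eqxx.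
Qed.

Section DivideM01.
Variables (f : forall A : alg, Y A -> A) (lam : 'rV[int]_3).
Arguments f : clear implicits.
Hypothesis f_nat : forall (A B : alg) (h : {lrmorphism A -> B}) (p : Y A),
  f B (pull h p) = h (f A p).
Hypothesis f_semi : semi lam (van u (@FD k)) f.

(** The orders along X of the restriction of [f] to D, over all prime charts that meet X; the least
    one is the exponent to divide by. *)
Definition x_order (i : nat) : Prop := exists (R : alg) (r : Y R) (x : {lrmorphism R -> k^o}) c,
  [/\ chart r /\ van u (@FX k) (pull x r), primeI (VI u (@FD k) r), primeI (VI u (@FX k) r),
      VI u (@FD k) r (f R r - M01 (mat u r) ^+ i * c) & ~ VI u (@FX k) r c].

Lemma x_order_exists (R : alg) (r : Y R) (x : {lrmorphism R -> k^o}) : chart r ->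
  van u (@FX k) (pull x r) -> primeI (VI u (@FD k) r) -> primeI (VI u (@FX k) r) ->
  ~ VI u (@FD k) r (f R r) ->
  exists i c, VI u (@FD k) r (f R r - M01 (mat u r) ^+ i * c) /\ ~ VI u (@FX k) r c.
Proof.
move=> cr vx pD pX nf.
apply: (chart_order (b := fun A g => M01 g) (@FD_ok k q) cr pD (van_FX_FD vx) _
  (VI_FXP u r) nf).
have /van_FX[h0 h1] := vx.
by rewrite -M01_map -mat_pull /M01 h0 h1 mul0r mulr0 subrr.
Qed.

Definition div_chart i (R : alg) (r : Y R) (c : R) : Prop :=
  [/\ chart r, primeI (VI u (@FD k) r), ~ VI u (@FD k) r (M01 (mat u r))
    & VI u (@FD k) r (f R r - M01 (mat u r) ^+ i * c)].

(** Near X the division is possible because [i] is at most every order; away from X the function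
    [M01] is invertible and any exponent works. *)
Lemma div_chart_cover i : (forall j, x_order j -> (i <= j)%N) ->
  forall (K : alg) (y : Y K), is_field K -> van u (@FD k) y ->
  exists (R : alg) (r : Y R) (w : {lrmorphism R -> K}),
    (exists c, div_chart i r c) /\ pull w r = y.
Proof.
move=> imin; apply: (good_cover u_lfp (Good := fun R r => exists c, div_chart i r c)
  (@FD_ok k q)) => R r x cr vx.
have [h0|h0] := eqVneq (M01 (mat u (pull x r))) 0.
  have vX := van_FX_of vx h0.
  have [||a [L [l [x' [loc crL x'E pL]]]]] :=
    @refine_chart k q Y u u_smooth [:: @FD k; @FX k] R r x.
  - by move=> F /= [<-|[<-|//]]; [split=> //; exact: FD_ok | split=> //; exact: FX_ok].
  - exact: cr.
  exists a, L, l; split=> //; first exact: (localization_point loc x'E).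
  have pD := pL _ (or_introl erefl); have pX := pL _ (or_intror (or_introl erefl)).
  have x'r : pull x' (pull l r) = pull x r by rewrite -(pull_comp r (h := x)).
  have vD : van u (@FD k) (pull x' (pull l r)) by rewrite x'r.
  have nM := FD_good crL vD pD.
  have [If|nf] := pselect (VI u (@FD k) (pull l r) (f L (pull l r))).
    by exists 0; split=> //; rewrite mulr0 subr0.
  have vX' : van u (@FX k) (pull x' (pull l r)) by rewrite x'r.
  have [j [c [jE nc]]] := x_order_exists crL vX' pD pX nf.
  have ij : (i <= j)%N by apply: imin; exists L, (pull l r), x', c.
  by exists (M01 (mat u (pull l r)) ^+ (j - i) * c); split=> //; rewrite mulrA -exprD subnKC.
have nn n : (M01 (mat u r)) ^+ n <> 0.
  move=> h; move/(congr1 x): h; rewrite lrX lr0 -M01_map -mat_pull.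
  by apply/eqP; rewrite expf_eq0 negb_and h0 orbT.
have [R1 [l1 loc1]] := localization_exists nn; have [u1 _ _] := loc1.
have [|x1 x1E] := localization_univ (f := x) loc1.
  by rewrite -M01_map -mat_pull unitfE.
have [||a [L [l2 [x' [loc2 crL x'E pL]]]]] :=
    @refine_chart k q Y u u_smooth [:: @FD k] R1 (pull l1 r) x1.
- move=> F /= [<-|//]; split; first exact: FD_ok.
  by rewrite -(pull_comp r (h := x)) // => b; rewrite /= x1E.
- exact: (chart_localization loc1 cr).
have pD := pL _ (or_introl erefl).
have [l lE] := lr_comp l1 l2; have [c locc] := localization_comp lE loc1 loc2.
have uM : M01 (mat u (pull l r)) \is a GRing.unit.
  by rewrite mat_pull M01_map lE /=; apply: (lr_unit l2 u1).
exists c, L, l; split=> //.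
  apply: (localization_point (x := x') locc) => b /=; rewrite lE -x1E; exact: x'E.
exists (f L (pull l r) / M01 (mat u (pull l r)) ^+ i); split.
- by rewrite (pull_comp r lE).
- by rewrite (pull_comp r lE).
- rewrite (pull_comp r lE) in uM *; move=> I; have [I1 _] := pD; apply: I1.
  by rewrite -(mulrV uM); apply: ideal_mulr I; exact: VI_ideal.
- rewrite mulrCA mulrV ?unitrX // mulr1 subrr; exact: (ideal0 (VI_ideal _ _ _)).
Qed.

Lemma div_chart_compat i (A R R' : alg) (r : Y R) (r' : Y R') c c'
  (h : {lrmorphism R -> A}) (h' : {lrmorphism R' -> A}) :
  div_chart i r c -> div_chart i r' c' -> van u (@FD k) (pull h r) ->
  pull h r = pull h' r' -> h c = h' c'.
Proof.
apply: (compat_reduction (@FD_ok k q)); first by move=> R0 r0 c0 [].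
move=> R0 R0' r0 r0' c0 c0' d L l v K w [_ pD nM E] [_ _ _ E'] loc vE fK vw.
have [[_ pL] inj] := link_prime (@FD_ok k q) loc pD vw.
have nML : ~ VI u (@FD k) (pull l r0) (M01 (mat u (pull l r0)) ^+ i).
  move/(primeI_pow (conj (proj1 (link_prime (@FD_ok k q) loc pD vw)).1 pL)).
  by rewrite mat_pull M01_map => /inj.
have := VI_map l (@FD_ok k q) E; have := VI_map v (@FD_ok k q) E'.
rewrite vE !lrB !lrM !lrX -!M01_map -!mat_pull -!f_nat vE => I' I.
have := idealB (VI_ideal u (@FD k) (pull l r0)) I' I.
have -> : forall a b c d : L, a - b * c - (a - b * d) = b * (d - c) by move=> *; ring.
by move=> /pL[/nML|].
Qed.

(** The quotient is glued from the charts of [div_chart]. Its weight follows by cancelling [M01],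
    which is nonzero on these irreducible charts of D, and a chart attaining the least order
    contains the point of X where [f1] is nonzero. *)
Lemma divide_M01 (R : alg) (r : Y R) (x : {lrmorphism R -> k^o}) : chart r ->
  van u (@FX k) (pull x r) -> primeI (VI u (@FD k) r) -> primeI (VI u (@FX k) r) ->
  ~ VI u (@FD k) r (f R r) ->
  exists i (f1 : forall A : alg, Y A -> A),
  [/\ function_on (van u (@FD k)) f1,
      forall (A : alg) (p : Y A), van u (@FD k) p -> f A p = M01 (mat u p) ^+ i * f1 A p,
      semi (lam - weight 1 (1 + q%:Z) q%:Z *+ i) (van u (@FD k)) f1
    & exists p : Y k^o, van u (@FX k) p /\ f1 k^o p <> 0].
Proof.
move=> cr vx pD pX nf.
have [i [xi imin]] : exists i, x_order i /\ forall j, x_order j -> (i <= j)%N.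
  have ex : exists i, `[< x_order i >].
    have [i [c [E nc]]] := x_order_exists cr vx pD pX nf.
    by exists i; apply/asboolP; exists R, r, x, c.
  have [i /asboolP xi im] := ex_minnP ex; exists i; split=> // j xj.
  by apply: im; apply/asboolP.
have Fok := @FD_ok k q.
have cov := div_chart_cover imin.
have [|f1 [f1n f1v f10]] := @glued_function k Y (van u (@FD k))
   (fun A B h y => van_pull Fok (f := h) (y := y)) (@div_chart i)
   (fun R r c Dc => let: And4 (conj _ pr) _ _ _ := Dc in pr) _ (@div_chart_compat i).
  by move=> K y fK vy; have [R1 [r1 [w [[c Dc] wE]]]] := cov K y fK vy; exists R1, r1, c, w.
have fE (A : alg) (p : Y A) : van u (@FD k) p -> f A p = M01 (mat u p) ^+ i * f1 A p.
  move=> vp; apply/eqP; rewrite -subr_eq0; apply/eqP; move: A p vp.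
  apply: (chart_check Fok (Good := fun R r => exists c, div_chart i r c)
    (z := fun A p => f A p - M01 (mat u p) ^+ i * f1 A p)) => //.
  - by move=> R0 r0 [c [[]]].
  - by move=> A B h p vp; rewrite f_nat f1n // mat_pull M01_map [RHS]lrB [X in _ = _ - X]lrM lrX.
  - move=> R0 A r0 h [c Dc] vh; have [_ _ _ E] := Dc.
    rewrite (f1v _ _ _ _ _ Dc vh) f_nat mat_pull M01_map -lrX -lrM -lrB.
    exact: (proj1 (VI_van u Fok r0 h) vh).
exists i, f1; split=> //.
  move=> A y e1 e2 p vp py h01.
  have uy := borel_units py h01.
  have ut := torus_char_unit (weight 1 (1 + q%:Z) q%:Z) uy.
  (* Multiplying by the character of [M01 ^+ i] replaces the difference of weights by the weights of
     [f] and of [M01 ^+ i]. *)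
  apply: (mulrI (unitrX i ut)); rewrite -torus_charX // mulrA [X in _ = X * _]mulrC torus_charB //.
  rewrite torus_charX //.
  apply/eqP; rewrite -subr_eq0; apply/eqP; move: A p y e1 e2 vp py h01 {uy ut}.
  suff H (A : alg) (p : Y A) y e1 e2 : van u (@FD k) p -> parab y -> (true -> y o0 o1 = 0) ->
     torus_char (weight 1 (1 + q%:Z) q%:Z) y ^+ i * f1 A (ac y e1 e2 p) -
     torus_char lam y * f1 A p = 0 by move=> *; apply: H.
  move: A p y e1 e2; apply: (universal_reduction (bor := true) Fok
    (Good := fun R r => exists c, div_chart i r c)
    (z := fun A p y e1 e2 => torus_char (weight 1 (1 + q%:Z) q%:Z) y ^+ i * f1 A (ac y e1 e2 p) -
     torus_char lam y * f1 A p)) => //.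
  - by move=> R0 r0 [c []].
  - move=> A B h p y e1 e2 vp py h01; have uy := borel_units py (h01 isT).
    rewrite lrB !lrM lrX -!torus_char_map // f1n // -ac_pull // f1n //.
    exact: (stable_FD q1 qD u_act).
  - move=> R0 r0 T m y e1 e2 [c Dc] fgT dT mI py h01 _; have [_ pD0 nM _] := Dc.
    have vm : van u (@FD k) (pull m r0) by apply/(VI_van u Fok) => e /mI.
    have va : van u (@FD k) (ac y e1 e2 (pull m r0)) by apply: (stable_FD q1 qD u_act).
    have nMT : M01 (mat u (pull m r0)) ^+ i <> 0.
      by apply: domain_nz_pow => //; rewrite mat_pull M01_map => /mI.
    apply/eqP; rewrite subr_eq0; apply/eqP; apply: (domain_mulI dT nMT).
    transitivity (f T (ac y e1 e2 (pull m r0))).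
      by rewrite fE // torus_char_M01 ?h01 // exprMn mulrA [_ ^+ i * _]mulrC.
    by rewrite f_semi ?h01 // fE // mulrCA.
have [R1 [r1 [x1 [c [[cr1 vx1] pD1 pX1 E nc]]]]] := xi.
have Dc : div_chart i r1 c by split=> //; exact: (FD_good cr1 (van_FX_FD vx1) pD1).
have [x2 [x2I x2c]] : exists x2 : {lrmorphism R1 -> k^o},
    (forall a, VI u (@FX k) r1 a -> x2 a = 0) /\ x2 c <> 0.
  apply: contrapT => nex; apply: nc; apply: (nss_prime (proj1 cr1) (VI_ideal _ _ _) pX1) => x2 x2I.
  by apply: contrapT => x2c; apply: nex; exists x2.
have vx2 : van u (@FX k) (pull x2 r1) by apply/(VI_van u (@FX_ok k q)).
by exists (pull x2 r1); split=> //; rewrite (f1v _ _ _ _ _ Dc) //; exact: van_FX_FD.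
Qed.

End DivideM01.
End Division.

(** * Moving along a projective line in X *)

Section Line.
Variable k : closedFieldType.
Notation alg := (comUnitAlgType k).
Variable q : nat.
Hypothesis q1 : (1 < q)%N.
Hypothesis qD : forall (A : alg) (a b : A), (a + b) ^+ q = a ^+ q + b ^+ q.
Hypothesis qk : q%:R = 0 :> k.
Variables (Y : zip_space k q) (u : kmorphism Y (GL3_space k q)).
Hypothesis u_act : forall (A : alg) (x y : 'M[A]_3) (p : Y A),
  zipE q x y -> u A (act x y p) = act x y (u A p).
Hypothesis u_smooth : formally_smooth u.
Hypothesis u_lfp : locally_finitely_presented u.

Let q0 : (0 < q)%N. Proof. exact: ltnW. Qed.

Section Unipotent.
Variable A : alg.
Implicit Types (a b c d t : A) (p : Y A).

Definition blk a b c d : 'M[A]_3 := mk3 a b 0 c d 0 0 0 1.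

Lemma blk_det a b c d : \det (blk a b c d) = a * d - b * c.
Proof. by rewrite det3 /M12 /M02 /M01 !mxE /=; ring. Qed.

Lemma blk_parab a b c d : a * d - b * c \is a GRing.unit -> parab (blk a b c d).
Proof. by move=> h; split; rewrite ?unitmxE ?blk_det // !mxE. Qed.

Lemma blk_mul a b c d a' b' c' d' : blk a b c d *m blk a' b' c' d' =
  blk (a * a' + b * c') (a * b' + b * d') (c * a' + d * c') (c * b' + d * d').
Proof.
by apply: mat3P; apply: ord3_ind; apply: ord3_ind; rewrite !mul3E !mxE /= ?simp3.
Qed.

(** The affine part of the projective line, Levi modulo Borel, through [p]. *)
Definition line c p : Y A := ac (blk 1 c 0 1) 0 0 p.

Lemma line_parab c : parab (blk 1 c 0 1).
Proof. by apply: blk_parab; rewrite mulr0 subr0 mulr1 unitr1. Qed.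

Lemma line_M02 c p : M02 (mat u (line c p)) = M02 (mat u p) + c ^+ q * M01 (mat u p).
Proof.
have px := line_parab c; rewrite mat_ac // M02_zact // {1}/M01 !mxE /= !expr1n.
by move: (c ^+ q) (M01 _) (M02 _) => *; ring.
Qed.

Lemma line_van c p : van u (@FX k) p -> van u (@FX k) (line c p).
Proof. by apply: (@stable_FX k q q1 qD Y u u_act false) => //; exact: line_parab. Qed.

Lemma line_N02 c p : van u (@FX k) p -> N02 (mat u (line c p)) = - mat u p o2 o0 *
  (mat u p o0 o2 + c * mat u p o1 o2 + c ^+ q * (mat u p o0 o1 + c * mat u p o1 o1)).
Proof.
move=> vp; have /van_FX[h _] : van u (@FX k) (line c p) by exact: line_van.
 rewrite /N02 h mat_ac //; last exact: line_parab.
rewrite !zactE !mxE /= !expr1n; move: (c ^+ q) => cq.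
by gen_mx (mat u p) => *; ring.
Qed.

(** Change of coordinate at infinity: for invertible [c] the translate is a Borel element applied to
    the point of parameter [c' = 1/c] in the other affine chart of the projective line. *)
Lemma line_blk c c' p : c * c' = 1 ->
  line c p = ac (blk c 0 1 (- c')) 0 0 (ac (blk c' 1 1 0) 0 0 p).
Proof.
move=> cc; have p1 : parab (blk c 0 1 (- c')).
  by apply: blk_parab; rewrite mul0r subr0 mulrN cc unitrN unitr1.
have p2 : parab (blk c' 1 1 0).
  by apply: blk_parab; rewrite mulr0 mulr1 sub0r unitrN unitr1.
have E : blk 1 c 0 1 = blk c 0 1 (- c') *m blk c' 1 1 0.
  rewrite blk_mul; congr blk; rewrite ?mulr0 ?mul0r ?mulr1 ?mul1r ?addr0 ?cc //.
  by rewrite subrr.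
rewrite /line /ac E -act_M; do ?exact: (ac_zipE q1 qD).
congr (act _ _ _); apply: invmx_unique.
rewrite (yinv_mul (@qD A)) //; try by rewrite mxE.
rewrite !mulmxA mulmxK; last exact: (yinv_unit q0 (@qD A)).
by rewrite mulmxV //; exact: (yinv_unit q0 (@qD A)).
Qed.

End Unipotent.

Lemma map_blk (A B : alg) (f : {lrmorphism A -> B}) a b c d :
  map_mx f (blk a b c d) = blk (f a) (f b) (f c) (f d).
Proof.
by apply: mat3P; apply: ord3_ind; apply: ord3_ind; rewrite !mxE /= ?lr0 ?lr1.
Qed.

Lemma line_pull (A B : alg) (f : {lrmorphism A -> B}) c (p : Y A) :
  pull f (line c p) = line (f c) (pull f p).
Proof. by rewrite /line ac_pull ?map_blk ?lr0 ?lr1 //; exact: line_parab. Qed.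

Lemma nonzero_eval (P : {poly k}) : (forall c, c != 0 -> P.[c] = 0) -> P = 0.
Proof.
move=> h; have : P * 'X = 0.
  apply/eqP; apply: contraT => /closed_nonrootP[c].
  rewrite rootE hornerM hornerX mulf_eq0 negb_or => /andP[h1 c0].
  by rewrite (h c c0) eqxx in h1.
by move/eqP; rewrite mulf_eq0 polyX_eq0 orbF => /eqP.
Qed.

Lemma reverse_poly (G : {poly k}) : exists H : {poly k}, (size H <= (size G).+1)%N /\
  forall c, c != 0 -> H.[c] = c ^+ size G * G.[c^-1].
Proof.
exists (\sum_(i < size G) G`_i *: 'X^(size G - i)); split=> [|c c0].
  apply: (leq_trans (size_sum _ _ _)); apply/bigmax_leqP => i _.
  by apply: (leq_trans (size_scale_leq _ _)); rewrite size_polyXn ltnS leq_subr.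
rewrite horner_sum horner_coef mulr_sumr; apply: eq_bigr => i _.
rewrite hornerZ hornerXn exprVn mulrCA; congr (_ * _).
by rewrite expfB_cond // (negbTE c0) add0n ltnW.
Qed.

Lemma torus_quotient (c : k) (a b : int) : c != 0 ->
  c ^ a * (- c^-1) ^ b = (-1) ^ b * c ^ (a - b).
Proof. by move=> c0; rewrite -[- c^-1]mulN1r expfzMl exprz_inv mulrCA expfzDr. Qed.

Section Degree.
Variables (f : forall A : alg, Y A -> A) (lam : 'rV[int]_3) (p : Y k^o).
Arguments f : clear implicits.
Hypothesis f_nat : function_on (van u (@FX k)) f.
Hypothesis f_semi : semi lam (van u (@FX k)) f.
Hypothesis vp : van u (@FX k) p.

Lemma const_point (P : alg) (i : {lrmorphism k^o -> P}) (v : {lrmorphism P -> k^o}) :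
  pull v (pull i p) = p.
Proof.
have [vi viE] := lr_comp i v; rewrite -(pull_comp p viE); apply: pull_id => a.
have -> : a = (a : k)%:A :> k^o by rewrite /GRing.scale /= mulr1.
exact: lrmorph_alg.
Qed.

Lemma horner_pt (P : alg) (m : {rmorphism {poly k^o} -> P}) :
  (forall (B : alg) (h : {lrmorphism k^o -> B}) (b : B),
      exists v : {lrmorphism P -> B}, forall s, v (m s) = (map_poly h s).[b]) ->
  forall t : k^o, exists v : {lrmorphism P -> k^o}, forall s : {poly k^o}, v (m s) = s.[t].
Proof.
move=> ev t; have [v vE] := ev k^o (lr_id k^o) t; exists v => s.
by rewrite vE; congr (_.[t]); apply/polyP => j; rewrite coef_map_id0.
Qed.

Lemma blk_poly (P : alg) (m : {rmorphism {poly k^o} -> P})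
    (i : {lrmorphism k^o -> P}) (sa sb sc sd : {poly k^o}) :
  (forall y, exists s, m s = y) -> 
  (forall (B : alg) (h : {lrmorphism k^o -> B}) (b : B),
      exists v : {lrmorphism P -> B}, forall s, v (m s) = (map_poly h s).[b]) ->
  sa * sd - sb * sc \is a GRing.unit ->
  exists F : {poly k^o}, f P (ac (blk (m sa) (m sb) (m sc) (m sd)) 0 0 (pull i p)) = m F /\
    forall t : k^o, f k^o (ac (blk sa.[t] sb.[t] sc.[t] sd.[t]) 0 0 p) = F.[t].
Proof.
move=> ms ev ud; set y := ac _ _ _ _; have [F FE] := ms (f P y).
exists F; split; first exact/esym.
move=> t.
have [v vm] := horner_pt ev t.
have pm : parab (blk (m sa) (m sb) (m sc) (m sd)).
  by apply: blk_parab; rewrite -!rmorphM -rmorphB; apply: rmorph_unit.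
rewrite -(vm F) FE -f_nat; last first.
  apply: (@stable_FX k q q1 qD Y u u_act false) => //; exact: (van_pull (@FX_ok k q)).
by rewrite /y ac_pull // map_blk !vm lr0 const_point.
Qed.

(** [F] and [G] are the restrictions to the two affine charts of the line, and up to sign
    [F(c) = c^(l0 - l1) G(1/c)] for the weight [l]. So the restriction is a section of a line bundle
    of degree [l0 - l1]. *)
Lemma line_poly (P : alg) (m : {rmorphism {poly k^o} -> P}) (i : {lrmorphism k^o -> P}) :
  (forall y, exists s, m s = y) -> 
  (forall (B : alg) (h : {lrmorphism k^o -> B}) (b : B),
      exists v : {lrmorphism P -> B}, forall s, v (m s) = (map_poly h s).[b]) ->
  exists F : {poly k^o}, [/\ f P (line (m 'X) (pull i p)) = m F,
    forall t : k^o, f k^o (line t p) = F.[t] &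
    F != 0 -> (size F)%:Z <= lam 0 o0 - lam 0 o1 + 1].
Proof.
move=> ms ev.
have [|F [Fm Ft]] := @blk_poly P m i 1 'X 0 1 ms ev.
  by rewrite mulr0 subr0 mulr1 unitr1.
have [|G [_ Gt]] := @blk_poly P m i 'X 1 1 0 ms ev.
  by rewrite mulr0 mulr1 sub0r unitrN1.
rewrite rmorph1 rmorph0 in Fm.
have Ft' t : f k^o (line t p) = F.[t].
  by rewrite -Ft hornerX !hornerE.
exists F; split=> // F0.
set n : int := lam 0 o0 - lam 0 o1.
have E1 (c : k^o) : c != 0 -> F.[c] = (-1) ^ lam 0 o1 * c ^ n * G.[c^-1].
  move=> c0; rewrite -Ft' (@line_blk k^o c c^-1); last by rewrite mulfV.
  rewrite f_semi; first last.
  - by rewrite mxE.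
  - by apply: blk_parab; rewrite mul0r subr0 mulrN mulfV // unitrN1.
  - apply: (@stable_FX k q q1 qD Y u u_act false) => //.
    by apply: blk_parab; rewrite mulr0 mulr1 sub0r unitrN1.
  rewrite -Gt hornerX !hornerE; congr (_ * _).
  rewrite /torus_char prod3 !mxE /= exp1rz mulr1; exact: torus_quotient.
have [H [Hs HE]] := reverse_poly G.
(* The exponent [n] may be negative; multiplying by [X ^ (size G + e)] turns the relation into an
   identity of polynomials. *)
pose e := absz n; have [t tE] : exists t : nat, n + e%:Z = t%:Z.
  by exists (absz (n + e%:Z)); rewrite /e; lia.
have E2 : F * 'X^(size G + e) = ((-1) ^ lam 0 o1) *: (H * 'X^t) :> {poly k}.
  apply/eqP; rewrite -subr_eq0; apply/eqP; apply: nonzero_eval => c c0.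
  apply/eqP; rewrite hornerD hornerN subr_eq0; apply/eqP.
  have ct : c ^+ t = c ^ n * c ^+ e.
    by rewrite (exprnP c) -tE expfzDr.
  rewrite hornerZ !hornerM !hornerXn E1 // HE // ct exprD.
  by move: (_ ^ lam 0 o1) (c ^ n) (c ^+ size G) (c ^+ e) G.[c^-1] => *; ring.
have := congr1 (fun s : {poly k} => size s) E2.
have s0 : (-1 : k) ^ lam 0 o1 != 0 by apply: expfz_neq0; rewrite oppr_eq0 oner_eq0.
rewrite size_scale // size_mulXn // => E3.
have : (size (H * 'X^t)%R <= size H + t)%N.
  by apply: (leq_trans (size_polyMleq _ _)); rewrite size_polyXn addnS.
rewrite -E3 => E4; clear E1 E2 E3 HE s0 Gt Ft' Fm Ft; clearbody e n.
move: (size F) (size G) (size H) tE Hs E4 => a b c tE Hs E4; lia.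
Qed.

End Degree.
End Line.

(** * Polynomials with simple roots *)

Section SimpleRoots.
Variable k : closedFieldType.

(** Let [P ^+ j] be the highest power dividing [F]. If the quotient vanished at every root of [P],
    then [P], having simple roots, would divide it. *)
Lemma simple_root_factor (P F : {poly k}) : (1 < size P)%N -> F != 0 ->
  (forall c, root P c -> P^`().[c] != 0) ->
  exists j c (G : {poly k}), [/\ F = P ^+ j * G, root P c & G.[c] != 0].
Proof.
move=> sP F0 simple; pose Q j := P ^+ j %| F.
have exQ : exists j, Q j by exists 0%N; rewrite /Q expr0 dvd1p.
have P0 : P != 0 by rewrite -size_poly_gt0; exact: ltnW.
have bQ j : Q j -> (j <= size F)%N.
  move=> /(dvdp_leq F0); apply: leq_trans; apply: leq_trans (leq_pred _).
  by rewrite size_exp leq_pmull // -ltnS prednK // ltnW.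
have [j Qj jmax] := ex_maxnP exQ bQ.
have [G GE] : exists G, F = P ^+ j * G.
  by have /dvdpP[G ->] := Qj; exists G; rewrite mulrC.
have nG : ~~ (P %| G).
  apply/negP => /dvdpP[H HE]; suff /jmax : Q j.+1 by rewrite ltnn.
  by apply/dvdpP; exists H; rewrite GE HE exprS mulrCA [P ^+ j * P]mulrC.
suff [c [rc Gc]] : exists c, root P c /\ G.[c] != 0 by exists j, c, G.
apply: contrapT => nex; case/negP: nG.
have gG : gcdp P G %| G by exact: dvdp_gcdr.
have gr z : root P z -> G.[z] = 0 -> root (gcdp P G) z.
  by move=> Pz Gz; rewrite root_gcd Pz /root Gz eqxx.
have /dvdpP[h hE] : gcdp P G %| P by exact: dvdp_gcdl.
move: (gcdp P G) gG gr h hE => g gG gr h hE.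
have [/eqP/size_poly1P[a a0 ha]|sh] := eqVneq (size h) 1%N.
  by rewrite hE ha mul_polyC dvdpZl.
have /closed_rootP[z rz] := sh; have Pz : root P z by rewrite hE rootM rz.
have Gz : G.[z] = 0.
  by apply: contrapT => /eqP Gz; apply: nex; exists z.
have gz := gr z Pz Gz.
have := simple z Pz; rewrite hE derivM hornerD !hornerM.
by move: gz rz; rewrite !rootE => /eqP -> /eqP ->; rewrite mulr0 mul0r addr0 eqxx.
Qed.

Variable q : nat.
Hypothesis q1 : (1 < q)%N.
Hypothesis qk : q%:R = 0 :> k.

(** Up to the factor [- g20], the restriction of [N02] to the line through a point of X, see
    [line_N02]. *)
Definition theta (g : 'M[k]_3) : {poly k} :=
  (g o0 o2)%:P + (g o1 o2)%:P * 'X + 'X^q * ((g o0 o1)%:P + (g o1 o1)%:P * 'X).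

Lemma theta_eval g c : (theta g).[c] =
  g o0 o2 + c * g o1 o2 + c ^+ q * (g o0 o1 + c * g o1 o1).
Proof. by rewrite /theta !hornerE ![c * _]mulrC. Qed.

(** As [q] is zero in [k], the derivative is [g12 + c^q g11]. At a multiple root, eliminating [c]
    between it and [theta] gives [M12 = 0]. *)
Lemma theta_simple g c : M12 g != 0 -> root (theta g) c -> (theta g)^`().[c] != 0.
Proof.
have q0 : ('X^(q.-1) : {poly k}) *+ q = 0.
  by rewrite -mulr_natr -[q%:R](rmorph_nat (@polyC k)) qk mulr0.
have dE : (theta g)^`() = (g o1 o2)%:P + 'X^q * (g o1 o1)%:P.
  rewrite /theta !(derivD, derivM, derivC, derivX, derivXn) q0.
  by rewrite !mul0r !add0r !mulr1.
move=> nz; rewrite rootE theta_eval dE hornerD hornerM hornerXn !hornerC.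
move=> /eqP h; apply: contraNneq nz => h'.
move: h h'; rewrite /M12; move: (c ^+ q) => cq h h'.
have E : g o0 o2 + cq * g o0 o1 = 0.
  by rewrite -[RHS]h -[LHS]addr0 -[X in _ + X](mulr0 c) -h'; ring.
apply/eqP; transitivity (g o0 o1 * (g o1 o2 + cq * g o1 o1) - g o1 o1 * (g o0 o2 + cq * g o0 o1)).
  by ring.
by rewrite E mulr0 subr0 -[RHS](mulr0 (g o0 o1)) -h'; congr (_ * _); ring.
Qed.

Lemma size_theta (g : 'M[k]_3) : g o1 o1 != 0 -> size (theta g) = q.+2.
Proof.
move=> nz; have -> : theta g = ((g o0 o2)%:P + (g o1 o2)%:P * 'X) +
   ((g o0 o1)%:P + (g o1 o1)%:P * 'X) * 'X^q by rewrite /theta [X in _ + X]mulrC.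
have s2 (a b : k) : (size (a%:P + b%:P * 'X)%R <= 2)%N.
  apply: (leq_trans (size_polyD _ _)); rewrite geq_max; apply/andP; split.
    by apply: (leq_trans (size_polyC_leq1 _)).
  by rewrite mul_polyC; apply: (leq_trans (size_scale_leq _ _)); rewrite size_polyX.
have sE : size ((g o0 o1)%:P + (g o1 o1)%:P * 'X)%R = 2%N.
  by rewrite addrC [(g o1 o1)%:P * _]mul_polyC size_polyDl ?size_scale ?size_polyX //
    ltnS size_polyC_leq1.
have n0 : (g o0 o1)%:P + (g o1 o1)%:P * 'X != 0 by rewrite -size_poly_gt0 sE.
rewrite addrC size_polyDl size_mulXn // sE ?addn2 //.
by apply: (leq_ltn_trans (s2 _ _)); rewrite ?addn2 !ltnS ltnW.
Qed.

End SimpleRoots.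

(** * Order along Z at a point of X *)

Section ExactOrder.
Variable k : closedFieldType.
Notation alg := (comUnitAlgType k).
Variable q : nat.
Hypothesis q1 : (1 < q)%N.
Hypothesis qD : forall (A : alg) (a b : A), (a + b) ^+ q = a ^+ q + b ^+ q.
Hypothesis qk : q%:R = 0 :> k.
Variables (Y : zip_space k q) (u : kmorphism Y (GL3_space k q)).
Hypothesis u_act : forall (A : alg) (x y : 'M[A]_3) (p : Y A),
  zipE q x y -> u A (act x y p) = act x y (u A p).
Hypothesis u_smooth : formally_smooth u.
Hypothesis u_lfp : locally_finitely_presented u.

Let q0 : (0 < q)%N. Proof. exact: ltnW. Qed.

Variables (f : forall A : alg, Y A -> A) (lam : 'rV[int]_3).
Arguments f : clear implicits.
Hypothesis f_nat : function_on (van u (@FD k)) f.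
Hypothesis f_semi : semi lam (van u (@FD k)) f.

Definition divides_as (j : nat) (R : alg) (r : Y R) (c : R) : Prop :=
  forall (A : alg) (h : {lrmorphism R -> A}), van u (@FD k) (pull h r) ->
    f A (pull h r) = N02 (mat u (pull h r)) ^+ j * h c.

Definition exact_order (j : nat) (R : alg) (r : Y R) (c : R) : Prop :=
  divides_as j r c /\ ~ VI u (@FZ k) r c.

(** Since [f] is natural on D only, its restriction is read in the quotient of the chart by the
    ideal of D; there it is zero or has a finite order along Z. *)
Lemma order_dichotomy (R : alg) (r : Y R) (x : {lrmorphism R -> k^o}) : chart r ->
  van u (@FZ k) (pull x r) -> primeI (VI u (@FD k) r) ->
  divides_as 0 r 0 \/ exists j c, exact_order j r c.
Proof.
move=> cr vx pD; have Fok := @FD_ok k q.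
have [T [m [ms mk _]]] := prime_quotient (VI_ideal u (@FD k) r) pD.
have vm : van u (@FD k) (pull m r) by apply/(VI_van u Fok) => e /mk.
have [b bE] := ms (f T (pull m r)).
have rep (A : alg) (h : {lrmorphism R -> A}) : van u (@FD k) (pull h r) ->
    f A (pull h r) = h b.
  move=> vh; have [|hT hTE] := @alg_quot_lift k R T A m h ms.
    by move=> a /mk; apply: (proj1 (VI_van u Fok r h) vh).
  by rewrite -hTE bE -f_nat // -(pull_comp r (h := h)) // => a; rewrite /= hTE.
have [Ib|nb] := pselect (VI u (@FD k) r b); [left|right].
  move=> A h vh; rewrite rep // (proj1 (VI_van u Fok r h) vh b Ib) lr0 mulr0 //.
have /van_FZ[h0 h2] := vx.
have [|j [c [E nc]]] := chart_order (b := fun A g => N02 g) Fok cr pD (van_FZ_FD vx) _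
  (VI_FZP u r) nb.
  by rewrite -N02_map -mat_pull /N02 h0 h2 !mulr0 subrr.
exists j, c; split=> // A h vh; rewrite rep // mat_pull N02_map -lrX -lrM; apply/eqP.
by rewrite -subr_eq0 -lrB (proj1 (VI_van u Fok r h) vh _ E).
Qed.

Lemma line_02 (A : alg) (c : A) (p : Y A) : mat u (line c p) o0 o2 =
  mat u p o0 o2 + c * mat u p o1 o2 + c ^+ q * (mat u p o0 o1 + c * mat u p o1 o1).
Proof.
rewrite mat_ac //; last exact: line_parab.
rewrite !zactE !mxE /= !expr1n; move: (c ^+ q) => cq.
by gen_mx (mat u p) => *; ring.
Qed.

Section OnLine.
Variables (p : Y k^o) (t : k^o) (R : alg) (r : Y R) (x : {lrmorphism R -> k^o}).
Variables (P : alg) (m : {rmorphism {poly k^o} -> P}) (i : {lrmorphism k^o -> P}).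
Hypotheses (vp : van u (@FX k) p) (cr : chart r) (xr : pull x r = line t p).
Hypothesis ms : forall y, exists s, m s = y.
Hypothesis minj : injective m.
Hypothesis mC : forall a, m a%:P = i a.
Hypothesis ev : forall (B : alg) (h : {lrmorphism k^o -> B}) (b : B),
  exists v : {lrmorphism P -> B}, forall s, v (m s) = (map_poly h s).[b].
Variable F : {poly k^o}.
Hypothesis Fm : f P (line (m 'X) (pull i p)) = m F.

Let y := line (m 'X) (pull i p).

Lemma theta_on_line :
  N02 (mat u y) = m ((- mat u p o2 o0)%:P * theta q (mat u p : 'M[k]_3)).
Proof.
rewrite /y line_N02 //; last exact: (van_pull (@FX_ok k q)).
rewrite mat_pull !mxE /theta !(rmorphM, rmorphD, rmorphN, rmorphXn).
rewrite -!mC /=.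
by rewrite [m 'X * m _]mulrC [m 'X * m (_ o1 o1)%:P]mulrC.
Qed.

(** Restriction to the line of a local division by [N02]. The chart contains only a neighbourhood of
    the point [t] of the line, whence the denominator [D], nonzero at [t]. *)
Lemma line_divides j c : divides_as j r c ->
  exists (D S : {poly k^o}) N, [/\ D.[t] != 0,
    D ^+ N * F = theta q (mat u p : 'M[k]_3) ^+ j * S & c = 0 -> S = 0].
Proof.
move=> jc; have [v0 v0E] := horner_pt ev t.
have E0 : pull x r = pull v0 y.
  by rewrite xr /y line_pull // v0E hornerX const_point.
have fk : is_field (k^o : alg) by move=> a; rewrite unitfE.
have [d [L [l [v [w [loc v0d vE _ _]]]]]] := chart_link cr fk E0.
have [d' d'E] := ms d; have [ld lf lk] := loc.
have vy : van u (@FD k) (pull l y).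
  by apply: (van_pull (@FD_ok k q)); apply: van_FX_FD; apply: line_van => //;
     apply: (van_pull (@FX_ok k q)).
have E1 : l (m F) = l (N02 (mat u y)) ^+ j * v c.
  rewrite -Fm -f_nat; last first.
    by apply: van_FX_FD; apply: line_van => //; apply: (van_pull (@FX_ok k q)).
  by rewrite -vE jc vE // mat_pull N02_map.
have [M [s sE]] : exists M s, v c * l d ^+ M = l s /\ (c = 0 -> s = 0).
  have [->|c0] := pselect (c = 0); first by exists 0%N, 0; rewrite !lr0 mul0r.
  by have [M [s sE]] := lf (v c); exists M, s.
move: sE => [sE s0]; have [s' s'E] := ms s.
have /lk[n nE] : l (d ^+ M * m F - N02 (mat u y) ^+ j * s) = 0.
  by rewrite lrB !lrM !lrX E1 -sE; move: (_ ^+ j) (_ ^+ M) => *; ring.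
exists d', (((- mat u p o2 o0)%:P) ^+ j * d' ^+ n * s'), (n + M)%N; split.
- by rewrite -v0E d'E; apply/eqP.
- apply: minj; rewrite -[LHS]subr0 -nE.
  rewrite theta_on_line; rewrite !(rmorphM, rmorphXn) exprMn d'E s'E exprD.
  move: (m (theta _ _) ^+ j) (m (_%:P) ^+ j) (d ^+ n) (d ^+ M) (m F) => *; ring.
- move=> /s0 s00; have -> : s' = 0 by apply: minj; rewrite rmorph0 s'E.
  by rewrite mulr0.
Qed.

End OnLine.

(** The restriction of [f] to the line is [theta^j G] with [G] nonzero at some root [t] of [theta].
    At that point, which lies in X and Z, the order along Z is at most [j], and the degree of the
    restriction bounds [(q + 1) j]. *)
Lemma exact_point (p0 : Y k^o) : van u (@FX k) p0 -> f k^o p0 != 0 ->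
  exists (R : alg) (r : Y R) (x : {lrmorphism R -> k^o}) j c,
  [/\ chart r /\ exact_order j r c, primeI (VI u (@FD k) r), primeI (VI u (@FZ k) r),
      van u (@FZ k) (pull x r) /\ van u (@FX k) (pull x r)
    & (q.+1 * j)%:Z <= lam 0 o0 - lam 0 o1].
Proof.
move=> vp0 fp0.
have semiX : semi lam (van u (@FX k)) f.
  by move=> A y e1 e2 p1 vp1; apply: f_semi; apply: van_FX_FD.
have natX : function_on (van u (@FX k)) f.
  by move=> A B h p1 vp1; apply: f_nat; apply: van_FX_FD.
(* A lower unipotent element moves the point so that [g11] is nonzero, which gives [theta] its full
   degree [q + 1]; being in the Borel, it keeps [f] nonzero. *)
have [p [vp fp g11]] : exists p, [/\ van u (@FX k) p, f k^o p != 0 & mat u p o1 o1 != 0].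
  have [g11|g11] := eqVneq (mat u p0 o1 o1) 0; last by exists p0.
  have M12nz : mat u p0 o0 o1 != 0.
    have := det_mat_unit u p0; have /van_FX[h0 h1] := vp0.
    apply: contraTneq => h; rewrite det3 /M01 /M02 /M12 h0 h1 h g11 unitfE.
    by rewrite !(mul0r, mulr0, subrr, addr0) eqxx.
  (* The entry [g11] after translation with parameter [s]; its linear coefficient [g01] is
     nonzero. *)
  pose Q : {poly k} := (mat u p0 o0 o1)%:P * 'X + (mat u p0 o1 o2)%:P * 'X^q +
    (mat u p0 o0 o2)%:P * 'X^(q.+1).
  have Q0 : Q != 0.
    apply: contraNneq M12nz => /(congr1 (fun s : {poly k} => s`_1)).
    rewrite /Q !coefD !coefCM coefX !coefXn coef0 /= !eqSS.
    rewrite (_ : (1 == q)%N = false) 1?(_ : (0 == q)%N = false); last 2 first.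
    - by apply/negbTE; rewrite neq_ltn q0.
    - by apply/negbTE; rewrite neq_ltn q1.
    by rewrite !mulr0 !addr0 mulr1 => ->.
  have /closed_nonrootP[s] := Q0; rewrite rootE => Qs.
  have ps : parab (blk (1 : k^o) 0 s 1).
    by apply: blk_parab; rewrite mul0r subr0 mulr1 unitr1.
  exists (ac (blk (1 : k^o) 0 s 1) 0 0 p0); split.
  - exact: (@stable_FX k q q1 qD Y u u_act false).
  - rewrite semiX ?mxE // mulf_neq0 //.
    have := torus_char_unit lam (borel_units ps _); rewrite unitfE; apply.
    by rewrite mxE.
  - rewrite mat_ac // zactE !mxE /= !expr1n g11.
    apply: contraNneq Qs => h; rewrite /Q !hornerE -[X in _ == X]h; apply/eqP.
    rewrite !exprS; move: (s ^+ q) => sq.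
    by gen_mx (mat u p0 : 'M[k]_3) => *; ring.
have M12p : M12 (mat u p) != 0.
  have := det_mat_unit u p; have /van_FX[h0 h1] := vp.
  apply: contraTneq => h; rewrite det3 h /M01 /M02 h0 h1 unitfE.
  by rewrite !(mul0r, mulr0, subrr, addr0) eqxx.
have [P [m [i [ms minj mC ev]]]] := poly_alg (k^o : alg).
have [F [Fm Ft Fs]] := line_poly q1 qD u_act natX semiX vp i ms ev.
have F0 : F != 0.
  apply: contraNneq fp => h; move: (Ft 0); rewrite h horner0 /line.
  suff -> : blk (1 : k^o) 0 0 1 = 1%:M by rewrite ac_1 // => ->.
  by apply: mat3P; apply: ord3_ind; apply: ord3_ind; rewrite !mxE.
have sth := size_theta q1 g11.
have [||j [t [G [FE rt Gt]]]] := @simple_root_factor k (theta q (mat u p)) F _ F0.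
- by rewrite sth.
- by move=> c; apply: theta_simple.
have vX : van u (@FX k) (line (t : k^o) p) by apply: line_van.
have vZ : van u (@FZ k) (line (t : k^o) p).
  apply/van_FZ; have /van_FX[-> _] := vX; split=> //.
  by rewrite line_02 -theta_eval; apply/eqP.
have fk : is_field (k^o : alg) by move=> a; rewrite unitfE.
have [R0 [r0 [w0 [cr0 w0E]]]] := chart_cover u_lfp (line (t : k^o) p) fk.
have [|//|a [R [l [x [loc cr xE pr]]]]] :=
  @refine_chart k q Y u u_smooth [:: @FD k; @FZ k] R0 r0 w0.
  move=> F' /= [<-|[<-|//]]; rewrite w0E; split=> //; try exact: van_FZ_FD.
    exact: FD_ok.
  exact: FZ_ok.
have pD := pr _ (or_introl erefl); have pZ := pr _ (or_intror (or_introl erefl)).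
have xr : pull x (pull l r0) = line (t : k^o) p by rewrite -w0E -(pull_comp r0 (h := w0)).
have vx : van u (@FZ k) (pull x (pull l r0)) by rewrite xr.
(* If [f] vanished on D near this point, its restriction [F] to the line would be zero. *)
have [z0|[j' [c ex]]] := order_dichotomy cr vx pD.
  have [D [S [N [Dt E S0]]]] := line_divides vp cr xr ms minj mC ev Fm z0.
  move: E; rewrite S0 // mulr0 => /eqP; rewrite mulf_eq0 (negbTE F0) orbF expf_eq0.
  by case/andP=> _ /eqP D0; move: Dt; rewrite D0 horner0 eqxx.
exists R, (pull l r0), x, j', c; split=> //; first by rewrite xr.
have [D [S [N [Dt E _]]]] := line_divides vp cr xr ms minj mC ev Fm ex.1.
have th0 : theta q (mat u p : 'M[k]_3) != 0 by rewrite -size_poly_gt0 sth.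
(* Otherwise cancelling [theta^j] leaves a factor [theta] in [D^N G], which is nonzero at the root
   [t]. *)
have jj : (j' <= j)%N.
  rewrite leqNgt; apply/negP => lt.
  have E2 : D ^+ N * G = theta q (mat u p : 'M[k]_3) ^+ (j' - j) * S :> {poly k}.
    apply: (mulfI (expf_neq0 j th0)); rewrite [RHS]mulrA -exprD subnKC ?(ltnW lt) //.
    by rewrite mulrCA -FE E.
  have := congr1 (fun s : {poly k} => s.[t]) E2; rewrite !hornerM !horner_exp.
  have /eqP -> := rt; rewrite expr0n subn_eq0 leqNgt lt mul0r => /eqP.
  by rewrite mulf_eq0 (negbTE Gt) orbF expf_eq0 (negbTE Dt) andbF.
have G0 : G != 0 by apply: contraNneq Gt => ->; rewrite horner0.
have sF : (size F = (q.+1 * j + size G))%N.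
  have se := size_exp (theta q (mat u p : 'M[k]_3)) j; rewrite sth /= in se.
  rewrite FE size_mul ?expf_neq0 // -se.
  by rewrite -[X in (X + _).-1 = _]prednK // size_poly_gt0 expf_neq0.
have := Fs F0; rewrite sF; have : (0 < size G)%N by rewrite size_poly_gt0.
have : (q.+1 * j' <= q.+1 * j)%N by rewrite leq_mul2l jj orbT.
move: (q.+1 * j')%N (q.+1 * j)%N (size G) (lam 0 o0 - lam 0 o1) => a1 b1 c1 d1; lia.
Qed.

End ExactOrder.

(** * The leading coefficient along Z *)

Section DivideN02.
Variable k : closedFieldType.
Notation alg := (comUnitAlgType k).
Variable q : nat.
Hypothesis q1 : (1 < q)%N.
Hypothesis qD : forall (A : alg) (a b : A), (a + b) ^+ q = a ^+ q + b ^+ q.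
Variables (Y : zip_space k q) (u : kmorphism Y (GL3_space k q)).
Hypothesis u_act : forall (A : alg) (x y : 'M[A]_3) (p : Y A),
  zipE q x y -> u A (act x y p) = act x y (u A p).
Hypothesis u_smooth : formally_smooth u.
Hypothesis u_lfp : locally_finitely_presented u.
Variables (f : forall A : alg, Y A -> A) (lam : 'rV[int]_3).
Arguments f : clear implicits.
Hypothesis f_nat : function_on (van u (@FD k)) f.
Hypothesis f_semi : semi lam (van u (@FD k)) f.

(** Fixed elements of the group over [k] act on points over all algebras, which allows orders and
    leading coefficients to be compared along an orbit of [k]-points. *)
Definition acst (A : alg) (x : 'M[k]_3) (e1 e2 : k) (p : Y A) : Y A :=
  ac (map_mx (in_alg A) x) (in_alg A e1) (in_alg A e2) p.

Lemma cst_parab (A : alg) (x : 'M[k]_3) : parab x -> parab (map_mx (in_alg A) x).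
Proof.
by move=> [ux h02 h12]; split; rewrite ?map_unitmx // mxE ?h02 ?h12 rmorph0.
Qed.

Lemma acst_pull (A B : alg) (h : {lrmorphism A -> B}) x e1 e2 (p : Y A) : parab x ->
  pull h (acst x e1 e2 p) = acst x e1 e2 (pull h p).
Proof.
move=> px; rewrite /acst ac_pull //; last exact: cst_parab.
have hE a : h (in_alg A a) = in_alg B a by exact: lrmorph_alg.
by rewrite !hE; congr (ac _ _ _ _); apply/matrixP => i j; rewrite !mxE hE.
Qed.

Lemma acst_k x e1 e2 (p : Y k^o) : acst x e1 e2 p = ac (x : 'M[k^o]_3) e1 e2 p.
Proof.
have hE a : in_alg k^o a = a by rewrite /= /GRing.scale /= mulr1.
by rewrite /acst !hE; congr (ac _ _ _ _); apply/matrixP => i j; rewrite !mxE hE.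
Qed.

Lemma acst_1 (A : alg) (p : Y A) : acst 1%:M 0 0 p = p.
Proof. by rewrite /acst !rmorph0 map_mx1 ac_1. Qed.

Lemma torus_char_cst (A : alg) (l : 'rV[int]_3) (x : 'M[k]_3) : parab x -> x o0 o1 = 0 ->
  torus_char l (map_mx (in_alg A) x) = in_alg A (torus_char l x).
Proof.
move=> px h01; have ux := borel_units px h01.
rewrite /torus_char rmorph_prod; apply: eq_bigr => i _; rewrite mxE; symmetry.
by rewrite rmorphXz.
Qed.

Definition good (R : alg) (r : Y R) : Prop :=
  [/\ chart r, primeI (VI u (@FD k) r) & primeI (VI u (@FZ k) r)].

Lemma good_point (R : alg) (r : Y R) : good r ->
  exists x : {lrmorphism R -> k^o}, van u (@FZ k) (pull x r).
Proof.
move=> [[fg _] _ pZ]; apply: contrapT => nex; case: (pZ) => I1 _; apply: I1.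
apply: (nss_prime fg (VI_ideal _ _ _) pZ) => x xI; case: nex; exists x.
exact/(VI_van u (@FZ_ok k q)).
Qed.

Lemma good_cover_Z (K : alg) (y : Y K) : is_field K -> van u (@FZ k) y ->
  exists (R : alg) (r : Y R) (w : {lrmorphism R -> K}), good r /\ pull w r = y.
Proof.
apply: (good_cover u_lfp (Good := good) (@FZ_ok k q)) => R r x cr vx.
have [|//|a [L [l [x' [loc crL x'E pL]]]]] :=
    @refine_chart k q Y u u_smooth [:: @FD k; @FZ k] R r x.
  move=> F /= [<-|[<-|//]]; [split; [exact: FD_ok | exact: van_FZ_FD] | split=> //; exact: FZ_ok].
exists a, L, l; split=> //; first exact: (localization_point loc x'E).
by split=> //; [exact: (pL _ (or_introl erefl)) | exact: (pL _ (or_intror (or_introl erefl)))].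
Qed.

Section Link.
Variables (R R' L K : alg) (r : Y R) (r' : Y R') (d : R) (l : {lrmorphism R -> L})
  (v : {lrmorphism R' -> L}) (w : {lrmorphism L -> K}) (x : 'M[k]_3) (e1 e2 : k).
Hypotheses (px : parab x) (h01 : x o0 o1 = 0) (gr : good r) (loc : is_localization l d).
Hypothesis vE : pull v r' = acst x e1 e2 (pull l r).
Hypothesis vw : van u (@FZ k) (pull w (pull l r)).

Let W : 'rV[int]_3 := weight (1 + q%:Z) 0 (1 + q%:Z).

(** Both divisions are compared over the domain that D cuts out on the overlap. Cancelling [N02]
    bounds [m] by [j], and in the case of equality the leading coefficients correspond through the
    character. *)
Lemma link_divides j c m c' : exact_order u f j r c -> divides_as u f m r' c' ->
  (m <= j)%N /\ (m = j -> VI u (@FZ k) (pull l r)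
    (in_alg L (torus_char (lam - W *+ j) x) * l c - v c')).
Proof.
move=> [jc nc] mc; have FokD := @FD_ok k q; have FokZ := @FZ_ok k q.
have [cr pD pZ] := gr.
have vwD := van_FZ_FD vw.
have [pDL injD] := link_prime FokD loc pD vwD.
have [pZL injZ] := link_prime FokZ loc pZ vw.
have [x0 vx0] := good_point gr.
have nN : ~ VI u (@FD k) (pull l r) (N02 (mat u (pull l r))).
  rewrite mat_pull N02_map => /injD; have /van_FZ[h0 h2] := vx0.
  exact: (N02_nonvanishing q u_smooth cr h0 h2).
have [T [s [ss sk dT]]] := prime_quotient (VI_ideal u (@FD k) (pull l r)) pDL.
pose y := pull s (pull l r).
have vy : van u (@FD k) y by apply/(VI_van u FokD) => e /sk.
have px' := cst_parab T px.
have h01' : map_mx (in_alg T) x o0 o1 = 0 by rewrite mxE h01 rmorph0.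
have ux := borel_units px h01.
have vay : van u (@FD k) (acst x e1 e2 y).
  exact: (stable_FD q1 qD u_act).
have [sl slE] := lr_comp l s; have [sv svE] := lr_comp v s.
have yE : y = pull sl r by rewrite (pull_comp r slE).
have ayE : acst x e1 e2 y = pull sv r' by rewrite (pull_comp r' svE) vE acst_pull.
pose tau := in_alg T (torus_char W x); pose chi := in_alg T (torus_char lam x).
have utau : tau \is a GRing.unit by apply: rmorph_unit; apply: torus_char_unit.
have Nac : N02 (mat u (acst x e1 e2 y)) = tau * N02 (mat u y).
  by rewrite /acst (torus_char_N02 q1 qD u_act) // torus_char_cst.
have fac : f T (acst x e1 e2 y) = chi * f T y.
  by rewrite /acst f_semi // torus_char_cst.
have E : chi * (N02 (mat u y) ^+ j * s (l c)) = (tau * N02 (mat u y)) ^+ m * s (v c').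
  have <- : f T y = N02 (mat u y) ^+ j * s (l c).
    by rewrite {1}yE jc -?yE // slE.
  by rewrite -fac -Nac {1}ayE mc -?ayE // svE.
have nNy n : N02 (mat u y) ^+ n <> 0.
  by apply: domain_nz_pow => //; rewrite /y mat_pull N02_map => /sk.
have uchi : chi \is a GRing.unit by apply: rmorph_unit; apply: torus_char_unit.
(* If [j < m], cancelling [N02 ^+ j] makes [c] a multiple of [N02], so that it vanishes on Z. *)
have mj : (m <= j)%N.
  rewrite leqNgt; apply/negP => lt; apply: nc; apply: injZ.
  have E2 : s (l c) = N02 (mat u y) * (chi^-1 * tau ^+ m * N02 (mat u y) ^+ (m - j).-1 * s (v c')).
    apply: (mulrI uchi); apply: (domain_mulI dT (nNy j)).
    have Nm : N02 (mat u y) ^+ m =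
        N02 (mat u y) ^+ j * (N02 (mat u y) * N02 (mat u y) ^+ (m - j).-1).
      by rewrite -exprS -exprD prednK ?subn_gt0 // subnKC // ltnW.
    rewrite [LHS]mulrCA E exprMn Nm -[in RHS]mulrA -[in RHS]mulrA.
    rewrite [N02 _ * (chi^-1 * _)]mulrCA (mulVKr uchi).
    move: (N02 (mat u y)) => N; move: (N ^+ j) (N ^+ (m - j).-1) (tau ^+ m) (s (v c')) => *; ring.
  have [b bE] := ss (chi^-1 * tau ^+ m * N02 (mat u y) ^+ (m - j).-1 * s (v c')).
  apply/VI_FZP; exists b, (l c - N02 (mat u (pull l r)) * b); split; first by rewrite addrC GRing.subrK.
  by apply/sk; rewrite lrB lrM bE -N02_map -mat_pull -/y -E2 subrr.
split=> // mjE; apply/VI_FZP; exists 0, (in_alg L (torus_char (lam - W *+ j) x) * l c - v c').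
rewrite mulr0 add0r; split=> //; apply/sk; rewrite lrB lrM.
have -> : s (in_alg L (torus_char (lam - W *+ j) x)) = chi / tau ^+ j.
  apply: (etrans (lrmorph_alg s _)); apply: (mulIr (unitrX j utau)).
  rewrite divrK ?unitrX // /tau -rmorphXn -torus_charX // -/(in_alg T _) -rmorphM /=.
  by rewrite torus_charB.
apply/eqP; rewrite subr_eq0; apply/eqP; apply: (mulIr (unitrX j utau)).
apply: (domain_mulI dT (nNy j)); move: E; rewrite mjE exprMn => E.
transitivity (chi * (N02 (mat u y) ^+ j * s (l c))); last first.
  rewrite E; move: (N02 (mat u y)) (s (v c')) => N sv0.
  by move: (tau ^+ j) (N ^+ j) => *; ring.
by rewrite mulrAC (mulrVK (unitrX j utau)) mulrCA.
Qed.

End Link.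

(** The order along Z is the same at both ends of a translation: [link_divides] is applied in the
    two directions. *)
Lemma exact_transfer (R R' K : alg) (r : Y R) (r' : Y R') (w : {lrmorphism R -> K})
    (w' : {lrmorphism R' -> K}) (x x' : 'M[k]_3) (e1 e2 e1' e2' : k) j c :
  is_field K -> parab x -> x o0 o1 = 0 -> parab x' -> x' o0 o1 = 0 -> good r -> good r' ->
  pull w' r' = acst x e1 e2 (pull w r) -> pull w r = acst x' e1' e2' (pull w' r') ->
  van u (@FZ k) (pull w r) -> exact_order u f j r c -> exists c', exact_order u f j r' c'.
Proof.
move=> fK px h01 px' h01' gr gr' E E' vw ex.
have [cr _ _] := gr; have [cr' pD' _] := gr'.
have Ew : pull w' r' = pull w (acst x e1 e2 r) by rewrite acst_pull.
have Ew' : pull w r = pull w' (acst x' e1' e2' r') by rewrite acst_pull.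
have [d [L [l [v [wL [loc _ vE wlE wvE]]]]]] := chart_link cr' fK Ew.
have [d' [L' [l' [v' [wL' [loc' _ vE' wlE' wvE']]]]]] := chart_link cr fK Ew'.
rewrite acst_pull // in vE; rewrite acst_pull // in vE'.
have vL : van u (@FZ k) (pull wL (pull l r)) by rewrite -(pull_comp r (h := w)).
have vw' : van u (@FZ k) (pull w' r').
  rewrite E; apply: (stable_FZ q1 qD u_act) => //; first exact: cst_parab.
  by rewrite mxE h01 rmorph0.
have vL' : van u (@FZ k) (pull wL' (pull l' r')) by rewrite -(pull_comp r' (h := w')).
have [x0 vx0] := good_point gr'.
have [z0|[m [c' ex']]] := order_dichotomy f_nat cr' vx0 pD'.
  (* If [f] is zero on D near [r'], it is divisible to the order [j + 1], which [link_divides]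
     excludes. *)
  have zj : divides_as u f j.+1 r' 0.
    by move=> A h vh; rewrite z0 // !lr0 !mulr0.
  have [] := link_divides px h01 gr loc vE vL ex zj; by rewrite ltnn.
have [mj _] := link_divides px h01 gr loc vE vL ex ex'.1.
have [jm _] := link_divides px' h01' gr' loc' vE' vL' ex' ex.1.
by exists c'; rewrite (_ : j = m) //; apply/eqP; rewrite eqn_leq jm.
Qed.

Hypothesis act_inv : forall (x : 'M[k^o]_3) e1 e2 (p : Y k^o), parab x -> x o0 o1 = 0 ->
  exists (x' : 'M[k^o]_3) e1' e2', [/\ parab x', x' o0 o1 = 0
    & p = ac x' e1' e2' (ac x e1 e2 p)].

(** The order is locally constant along Z, so the leading coefficient can be extended by 0 over the
    charts where the order is not [j]. *)
Definition leading j (R : alg) (r : Y R) (c : R) : Prop :=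
  good r /\ (exact_order u f j r c \/ (forall c', ~ exact_order u f j r c') /\ c = 0).

Lemma link_leading (R R' L K : alg) (r : Y R) (r' : Y R') (d : R) (l : {lrmorphism R -> L})
  (v : {lrmorphism R' -> L}) (w : {lrmorphism L -> K}) (x x' : 'M[k]_3) (e1 e2 e1' e2' : k) j c c' :
  is_field K -> parab x -> x o0 o1 = 0 -> parab x' -> x' o0 o1 = 0 -> is_localization l d ->
  pull v r' = acst x e1 e2 (pull l r) -> pull w (pull l r) = acst x' e1' e2' (pull w (pull v r')) ->
  van u (@FZ k) (pull w (pull l r)) -> leading j r c -> leading j r' c' ->
  VI u (@FZ k) (pull l r) (in_alg L (torus_char
     (lam - weight (1 + q%:Z) 0 (1 + q%:Z) *+ j) x) * l c - v c').
Proof.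
move=> fK px h01 px' h01' loc vE E' vw [gr Dr] [gr' Dr'].
have [wl wlE] := lr_comp l w; have [wv wvE] := lr_comp v w.
have E1 : pull wv r' = acst x e1 e2 (pull wl r).
  by rewrite (pull_comp r' wvE) vE acst_pull // (pull_comp r wlE).
have E2 : pull wl r = acst x' e1' e2' (pull wv r').
  by rewrite (pull_comp r wlE) E' (pull_comp r' wvE).
have vl : van u (@FZ k) (pull wl r) by rewrite (pull_comp r wlE).
have vv : van u (@FZ k) (pull wv r').
  rewrite E1; apply: (stable_FZ q1 qD u_act) => //; first exact: cst_parab.
  by rewrite mxE h01 rmorph0.
case: Dr Dr' => [ex|[nex ->]] [ex'|[nex' ->]].
- exact: (link_divides px h01 gr loc vE vw ex ex'.1).2.
- have [c2 ex2] := exact_transfer fK px h01 px' h01' gr gr' E1 E2 vl ex.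
  by case: (nex' _ ex2).
- have [c2 ex2] := exact_transfer fK px' h01' px h01 gr' gr E2 E1 vv ex'.
  by case: (nex _ ex2).
- rewrite !lr0 mulr0 subr0; exact: (ideal0 (VI_ideal _ _ _)).
Qed.

(** Semi-invariance is stated for [k]-points, which is the form consumed by the test on [k]-points
    in [weight0_inv]. *)
Lemma divide_N02 j : exists f2 : forall A : alg, Y A -> A,
  [/\ function_on (van u (@FZ k)) f2,
      forall (x : 'M[k^o]_3) e1 e2 (p : Y k^o), van u (@FZ k) p -> parab x -> x o0 o1 = 0 ->
        f2 k^o (ac x e1 e2 p) =
        torus_char (lam - weight (1 + q%:Z) 0 (1 + q%:Z) *+ j) x * f2 k^o p
    & forall (R A : alg) (r : Y R) c (h : {lrmorphism R -> A}), good r ->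
        exact_order u f j r c -> van u (@FZ k) (pull h r) -> f2 A (pull h r) = h c].
Proof.
have Fok := @FZ_ok k q.
have cov (K : alg) (y : Y K) : is_field K -> van u (@FZ k) y ->
    exists (R : alg) (r : Y R) c (w : {lrmorphism R -> K}), leading j r c /\ pull w r = y.
  move=> fK vy; have [R [r [w [gr wE]]]] := good_cover_Z fK vy.
  have [[c ex]|nex] := pselect (exists c, exact_order u f j r c).
    by exists R, r, c, w; split=> //; split=> //; left.
  by exists R, r, 0, w; split=> //; split=> //; right; split=> // c' ex; apply: nex; exists c'.
have compat : forall (A R R' : alg) (r : Y R) (r' : Y R') c c'
  (h : {lrmorphism R -> A}) (h' : {lrmorphism R' -> A}),
  leading j r c -> leading j r' c' -> van u (@FZ k) (pull h r) -> pull h r = pull h' r' ->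
  h c = h' c'.
  apply: (compat_reduction Fok); first by move=> R r c [[]].
  move=> R R' r r' c c' d L l v K w Dr Dr' loc vE fK vw.
  have := @link_leading R R' L K r r' d l v w 1%:M 1%:M 0 0 0 0 j c c' fK.
  have p1 := parab1 (k^o : alg); have h1 : (1%:M : 'M[k]_3) o0 o1 = 0 by rewrite mxE.
  move=> /(_ p1 h1 p1 h1 loc); rewrite !acst_1 vE => /(_ erefl erefl vw Dr Dr').
  have -> : torus_char (lam - weight (1 + q%:Z) 0 (1 + q%:Z) *+ j) (1%:M : 'M[k]_3) = 1.
    by rewrite /torus_char big1 // => i _; rewrite mxE eqxx exp1rz.
  by rewrite rmorph1 mul1r.
have [|f2 [f2n f2v _]] := @glued_function k Y (van u (@FZ k))
   (fun A B h y => van_pull Fok (f := h) (y := y)) (@leading j) _ cov compat.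
  by move=> R r c [[[]]].
exists f2; split=> //; last by move=> R A r c h gr ex vh; apply: f2v => //; split=> //; left.
move=> x e1 e2 p vp px h01.
have fk : is_field (k^o : alg) by move=> a; rewrite unitfE.
have vap : van u (@FZ k) (ac x e1 e2 p) by apply: (stable_FZ q1 qD u_act).
have [R [r [c [w [Dr wE]]]]] := cov k^o p fk vp.
have [R' [r' [c' [w' [Dr' wE']]]]] := cov k^o _ fk vap.
have [x' [e1' [e2' [px' h01' pE]]]] := act_inv e1 e2 p px h01.
have [[cr' _ _] _] := Dr'.
have Ew : pull w' r' = pull w (acst x e1 e2 r) by rewrite acst_pull // wE' acst_k wE.
have [d [L [l [v [wL [loc _ vE wlE wvE]]]]]] := chart_link cr' fk Ew.
rewrite acst_pull // in vE.
have wlr : pull wL (pull l r) = p by rewrite -(pull_comp r (h := w)).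
have wvr : pull wL (pull v r') = ac x e1 e2 p by rewrite -(pull_comp r' (h := w')).
have I : VI u (@FZ k) (pull l r) (in_alg L (torus_char
     (lam - weight (1 + q%:Z) 0 (1 + q%:Z) *+ j) x) * l c - v c').
  apply: (@link_leading R R' L k^o r r' d l v wL x x' e1 e2 e1' e2') => //.
    by rewrite wvr wlr acst_k.
  by rewrite wlr.
have vwl : van u (@FZ k) (pull wL (pull l r)) by rewrite wlr.
have := proj1 (VI_van u Fok _ wL) vwl _ I; rewrite lrB lrM => /eqP; rewrite subr_eq0 => /eqP.
have -> : wL (in_alg L (torus_char (lam - weight (1 + q%:Z) 0 (1 + q%:Z) *+ j) x)) =
   torus_char (lam - weight (1 + q%:Z) 0 (1 + q%:Z) *+ j) x.
  by apply: (etrans (lrmorph_alg wL _)); rewrite /GRing.scale /= mulr1.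
have -> : wL (l c) = w c := wlE c; have -> : wL (v c') = w' c' := wvE c'.
have f2p : f2 k^o p = w c by rewrite -wE (f2v _ _ _ _ _ Dr) ?wE.
have f2a : f2 k^o (ac x e1 e2 p) = w' c' by rewrite -wE' (f2v _ _ _ _ _ Dr') ?wE'.
by rewrite f2p f2a => ->.
Qed.

End DivideN02.

(** * A function of weight zero on Z *)

Lemma weights_cancel (K : fieldType) (a b c : K) (b1 b2 b3 A B : int) (N m q : nat) :
  a != 0 -> b != 0 -> c != 0 ->
  N%:Z * b1 = A + (1 + q%:Z) * B -> N%:Z * b2 + m%:Z = q%:Z * A + (1 + q%:Z) * B ->
  N%:Z * b3 + q%:Z * m%:Z = (1 + q%:Z) * B ->
  (a ^ b1 * b ^ b2 * c ^ b3) ^+ N * (b * c ^+ q) ^+ m * (a * b ^+ q) ^ (- A) *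
    (c * (a * b) * (c ^+ q * (a * b) ^+ q)) ^ (- B) = 1.
Proof.
move=> a0 b0 c0 E1 E2 E3; rewrite !exprnP !expfzMl !exprz_exp.
transitivity (a ^ (b1 * N%:Z + - A + - B + q%:Z * - B) *
  b ^ (b2 * N%:Z + m%:Z + q%:Z * - A + - B + q%:Z * - B) *
  c ^ (b3 * N%:Z + q%:Z * m%:Z + - B + q%:Z * - B)).
  rewrite !expfzDr //.
  move: (a ^ (b1 * N)) (a ^ (- A)) (a ^ (- B)) (a ^ (q%:Z * - B)) => a1 a2 a3 a4.
  move: (b ^ (b2 * N)) (b ^ m) (b ^ (q%:Z * - A)) (b ^ (- B)) (b ^ (q%:Z * - B)) => *.
  move: (c ^ (b3 * N)) (c ^ (q%:Z * m)) (c ^ (- B)) (c ^ (q%:Z * - B)) => *.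
  by ring.
have -> : b1 * N%:Z + - A + - B + q%:Z * - B = 0 by rewrite mulrC E1; ring.
have -> : b2 * N%:Z + m%:Z + q%:Z * - A + - B + q%:Z * - B = 0 by rewrite [b2 * _]mulrC E2; ring.
have -> : b3 * N%:Z + q%:Z * m%:Z + - B + q%:Z * - B = 0 by rewrite [b3 * _]mulrC E3; ring.
by rewrite !expr0z !mulr1.
Qed.

Lemma regroup_powers (K : fieldType) (a a' b b' c c' d d' : K) (m n : nat) (i j : int) :
  (a * a') ^+ m * (b * b') ^+ n * (c * c') ^ i * (d * d') ^ j =
  a ^+ m * b ^+ n * c ^ i * d ^ j * (a' ^+ m * b' ^+ n * c' ^ i * d' ^ j).
Proof.
rewrite !exprMn !expfzMl; move: (a ^+ m) (a' ^+ m) (b ^+ n) (b' ^+ n) => *.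
by move: (c ^ i) (c' ^ i) (d ^ j) (d' ^ j) => *; ring.
Qed.

Lemma lr_exprz (k : fieldType) (A B : comUnitAlgType k) (h : {lrmorphism A -> B}) (a : A) (n : int) :
  a \is a GRing.unit -> h (a ^ n) = h a ^ n.
Proof.
case: n => n ua; first exact: (lrX h a n).
rewrite NegzE -!exprnN; apply: (etrans (lrV h (unitrX n.+1 ua))).
by congr (_^-1); exact: lrX.
Qed.

Section WeightZero.
Variable k : closedFieldType.
Notation alg := (comUnitAlgType k).
Variable q : nat.
Hypothesis q1 : (1 < q)%N.
Hypothesis qD : forall (A : alg) (a b : A), (a + b) ^+ q = a ^+ q + b ^+ q.
Variables (Y : zip_space k q) (u : kmorphism Y (GL3_space k q)).
Hypothesis u_act : forall (A : alg) (x y : 'M[A]_3) (p : Y A),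
  zipE q x y -> u A (act x y p) = act x y (u A p).
Hypothesis u_smooth : formally_smooth u.
Hypothesis u_lfp : locally_finitely_presented u.

Let q0 : (0 < q)%N. Proof. exact: ltnW. Qed.

Lemma van_FZ_unit (A : alg) (p : Y A) : van u (@FZ k) p -> mat u p o0 o1 \is a GRing.unit.
Proof.
move=> /van_FZ[h0 h2]; have := det_mat_unit u p; rewrite det3 /M12 /M02 /M01 h0 h2.
have -> : forall a b c d e f g : A, a * (b * c - 0 * d) - e * (0 * c - 0 * f) +
    g * (0 * d - b * f) = b * (a * c - g * f) by move=> *; ring.
by rewrite unitrM => /andP[].
Qed.

Variables (f2 : forall A : alg, Y A -> A) (lam : 'rV[int]_3) (m : nat).
Arguments f2 : clear implicits.
Hypothesis f2_nat : function_on (van u (@FZ k)) f2.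
Hypothesis f2_semi : forall (x : 'M[k^o]_3) e1 e2 (p : Y k^o), van u (@FZ k) p ->
  parab x -> x o0 o1 = 0 -> f2 k^o (ac x e1 e2 p) = torus_char lam x * f2 k^o p.
Let l0 := lam 0 o0. Let l1 := lam 0 o1. Let l2 := lam 0 o2.
Hypothesis mE : m%:Z = - (1 + q%:Z) * (l1 - q%:Z * l0 + (q%:Z - 1) * l2).

(* The exponents are those for which the weights of [f2], [g10], [g01] and [det g] on the
   locus [g00 = g02 = 0] cancel. *)
Definition weight0 (A : alg) (p : Y A) : A :=
  f2 A p ^+ (1 + q ^ 3) * mat u p o1 o0 ^+ m *
  mat u p o0 o1 ^ (- ((1 + q%:Z) * (q%:Z * l1 + (1 - q%:Z) * l0 - l2))) *
  (\det (mat u p)) ^ (- (q%:Z * q%:Z * l0 - q%:Z * l1 + l2)).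

Lemma weight0_nat : function_on (van u (@FZ k)) weight0.
Proof.
move=> A B h p vp; have u01 := van_FZ_unit vp; have ud := det_mat_unit u p.
rewrite /weight0 f2_nat // mat_pull det_map !mxE !lrM !lrX !lr_exprz //.
Qed.

Lemma weight0_inv_k (x : 'M[k^o]_3) e1 e2 (p : Y k^o) : van u (@FZ k) p -> parab x ->
  x o0 o1 = 0 -> weight0 (ac x e1 e2 p) = weight0 p.
Proof.
move=> vp px h01; have /van_FZ[h0 h2] := vp; have ux := borel_units px h01.
have x00 : (x o0 o0 : k) != 0 by rewrite -unitfE; exact: ux.
have x11 : (x o1 o1 : k) != 0 by rewrite -unitfE; exact: ux.
have x22 : (x o2 o2 : k) != 0 by rewrite -unitfE; exact: ux.
rewrite /weight0 f2_semi // mat_ac // g10_zact // h0 mulr0 add0r.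
rewrite g01_zact // det_zact //; last exact: qD.
rewrite M01_borel // /torus_char prod3 -/l0 -/l1 -/l2.
set A := (X in (- X)); set B := (X in (_ * \det _) ^ (- X)).
have := @weights_cancel k _ _ _ l0 l1 l2 A B (1 + q ^ 3) m q x00 x11 x22.
move=> W; rewrite -[RHS]mul1r -W; first last.
- rewrite /B PoszD !expnS expn0 muln1 !PoszM mE; ring.
- rewrite /A /B PoszD !expnS expn0 muln1 !PoszM mE; ring.
- rewrite /A /B PoszD !expnS expn0 muln1 !PoszM; ring.
have -> : x o1 o1 * mat u p o1 o0 * x o2 o2 ^+ q = x o1 o1 * x o2 o2 ^+ q * mat u p o1 o0
  by exact: mulrAC.
exact: regroup_powers.
Qed.

(** After reduction to a finitely generated domain, the equality is tested on [k]-points. *)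
Lemma weight0_inv (A : alg) (p : Y A) (x : 'M[A]_3) e1 e2 : van u (@FZ k) p -> parab x ->
  x o0 o1 = 0 -> weight0 (ac x e1 e2 p) = weight0 p.
Proof.
move=> vp px h01; apply/eqP; rewrite -subr_eq0; apply/eqP.
move: A p x e1 e2 vp px h01.
suff H (A : alg) (p : Y A) x e1 e2 : van u (@FZ k) p -> parab x -> (true -> x o0 o1 = 0) ->
  weight0 (ac x e1 e2 p) - weight0 p = 0 by move=> *; apply: H.
move: A p x e1 e2; apply: (universal_reduction (bor := true) (@FZ_ok k q)
    (Good := fun R r => chart r /\ primeI (VI u (@FZ k) r))
    (z := fun A p x e1 e2 => weight0 (ac x e1 e2 p) - weight0 p)) => //.
- apply: (good_cover u_lfp (Good := fun R r => chart r /\ primeI (VI u (@FZ k) r))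
    (@FZ_ok k q)) => R r x cr vx.
  have [a [L [l [x' [loc crL pL x'E]]]]] := prime_chart u_smooth (@FZ_ok k q) cr vx.
  by exists a, L, l; split=> //; exact: (localization_point loc x'E).
- move=> A B h p x e1 e2 vp px h01; rewrite lrB -!weight0_nat //; first by rewrite -ac_pull.
  by apply: (stable_FZ q1 qD u_act).
- move=> R r T m' x e1 e2 _ fgT dT mI px h01 _; apply: (domain_nss fgT dT) => y.
  have vm : van u (@FZ k) (pull m' r) by apply/(VI_van u (@FZ_ok k q)) => e /mI.
  rewrite lrB -!weight0_nat //; last by apply: (stable_FZ q1 qD u_act).
  rewrite ac_pull // weight0_inv_k ?subrr //.
  + exact: (van_pull (@FZ_ok k q)).
  + exact: map_parab.
  + by rewrite mxE h01 // lr0.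
Qed.

End WeightZero.

(** * Closures and reduced closed subsets *)

Section ClosedSubsets.
Variable k : closedFieldType.
Notation alg := (comUnitAlgType k).

Lemma field_inj (K L : alg) (f : {lrmorphism K -> L}) a : is_field K -> f a = 0 -> a = 0.
Proof.
move=> fK fa; apply: contrapT => na; apply: (domain_unit (lr_unit f (field_unit fK na))).
exact: fa.
Qed.

Lemma closed_closure (X : kfunctor k) (Z C : subset_of X) : closed_sub Z ->
  (forall (K : alg) (y : X K), is_field K -> C K y -> Z K y) ->
  forall (K : alg) (y : X K), is_field K -> closure_of C y -> Z K y.
Proof.
move=> cZ CZ K y fK cy; apply: contrapT => nZ.
(* The complement of [Z] as an open subfunctor: the points none of whose field specializations lies
   in [Z]. *)
pose U : subset_of X := fun A x => forall (L : alg) (h : {lrmorphism A -> L}), is_field L ->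
  ~ Z L (pull h x).
have oU : open_sub U.
  move=> A x; have [D DP] := cZ A x; exists D => B f; split.
    move=> Ux; apply: unit_ideal_field => L phi fL; have [g gE] := lr_comp f phi.
    apply: contrapT => nex; apply: (Ux L phi fL); rewrite -(pull_comp x gE); apply/DP => a Da.
    rewrite gE; apply: contrapT => na; apply: nex; exists (f a) => //.
    by exists a.
  move=> [n [c [d [dD s1]]]] L h fL; have [g gE] := lr_comp f h.
  rewrite -(pull_comp x gE) => /DP gD; move: (oner_neq0 L); rewrite -(lr1 h) -s1 lr_sum big1 ?eqxx //.
  by move=> i _; have [a Da ->] := dD i; have := gD a Da; rewrite gE /= lrM => ->; rewrite mulr0.
have Uy : U K y.
  move=> L h fL; have [D DP] := cZ K y => /DP hD; apply: nZ.
  rewrite -[y]pull_idE; apply/DP => a /hD; exact: field_inj.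
have [L [y' [fL Uy' Cy']]] := cy U oU Uy.
by have := Uy' L (lr_id L) fL; rewrite pull_idE; apply; apply: CZ.
Qed.

Lemma reduced_sub_closed (X : kfunctor k) (Z C : subset_of X) : closed_sub Z ->
  (forall (K : alg) (y : X K), is_field K -> C K y -> Z K y) ->
  forall (A : alg) (y : X A), reduced_sub (closure_of C) y -> Z A y.
Proof. by move=> cZ CZ A y; apply=> // K z fK; apply: closed_closure. Qed.

End ClosedSubsets.

(** * Descent along an étale torsor *)

Section TorsorDescent.
Variable k : closedFieldType.
Notation alg := (comUnitAlgType k).
Variable q : nat.
Variables (Y : zip_space k q) (X : kfunctor k) (pr : kmorphism Y X) (H : subgroup_pred k).
Hypothesis tor : is_torsor H pr.
Variable V : subset_of Y.
Arguments V : clear implicits.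
Arguments H : clear implicits.
Hypothesis V_pull : forall (A B : alg) (f : {lrmorphism A -> B}) (p : Y A),
  V A p -> V B (pull f p).
Hypothesis V_act : forall (A : alg) (x y : 'M[A]_3) (p : Y A),
  H A x y -> V A p -> V A (act x y p).

(** The image in the base of a stable subset, phrased by a condition on all lifts because lifts
    exist only after an étale cover. *)
Definition lifts_in : subset_of X := fun A s =>
  forall (B : alg) (g : {lrmorphism A -> B}) (p : Y B), pr B p = pull g s -> V B p.

Lemma lifts_in_pull (A B : alg) (f : {lrmorphism A -> B}) (s : X A) :
  lifts_in s -> lifts_in (pull f s).
Proof.
move=> Ws C g p E; have [h hE] := lr_comp f g; apply: (Ws C h); by rewrite (pull_comp s hE).
Qed.

Lemma same_image (A : alg) (p p' : Y A) : pr A p = pr A p' ->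
  exists x y, H A x y /\ p' = act x y p.
Proof.
have [_ h _] := tor; move=> /h[[x y] [[Hxy E] _]]; by exists x, y.
Qed.

Lemma lift_exists (A : alg) (s : X A) : exists (B : alg) (f : {lrmorphism A -> B}) (p : Y B),
  smooth_cover f /\ pr B p = pull f s.
Proof.
have [_ _ h] := tor; have [B [f [ef [p E]]]] := h A s.
by exists B, f, p; split=> //; apply: etale_smooth_cover.
Qed.

Lemma lifts_in_image (A : alg) (p : Y A) : V A p -> lifts_in (pr A p).
Proof.
move=> Vp B g p'; rewrite -kfun_nat => E.
have [x [y [Hxy ->]]] := same_image (esym E); exact: V_act (V_pull g Vp).
Qed.

Section Function.
Variable h : forall A : alg, Y A -> A.
Arguments h : clear implicits.
Hypothesis h_nat : function_on V h.
Hypothesis h_inv : forall (A : alg) (x y : 'M[A]_3) (p : Y A),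
  H A x y -> V A p -> h A (act x y p) = h A p.

(** On a cover carrying a lift of [s], invariance makes the value of [h] independent of the lift, so
    it satisfies the condition of [cover_descent]. *)
Lemma descended_value (A : alg) (s : X A) : lifts_in s ->
  exists a, forall (B : alg) (g : {lrmorphism A -> B}) (p : Y B),
    pr B p = pull g s -> h B p = g a.
Proof.
move=> Ws; have [B [f [p [cf pE]]]] := lift_exists s.
have same (C : alg) (p1 p2 : Y C) : pr C p1 = pr C p2 -> V C p1 -> h C p1 = h C p2.
  by move=> /same_image[x [y [Hxy ->]]] V1; rewrite h_inv.
have Vp : V B p := Ws B f p pE.
have [|a aE] := cover_descent (x := h B p) cf.
  move=> C g g' gg; rewrite -!h_nat //; apply: same; last exact: V_pull.
  rewrite !kfun_nat pE; have [e eE] := lr_comp f g; have [e' e'E] := lr_comp f g'.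
  by rewrite -(pull_comp s eE) -(pull_comp s e'E); apply: pull_eq => b; rewrite eE e'E gg.
exists a => C g p' p'E; have [D [g2 [psi [cg2 psiE]]]] := cover_base_change g cf.
apply/eqP; rewrite -subr_eq0; apply/eqP; apply: (cover_injective cg2); rewrite lrB.
rewrite -psiE aE -!h_nat //; last exact: Ws p'E.
apply/eqP; rewrite subr_eq0; apply/eqP; apply: same; last by apply: V_pull; exact: Ws p'E.
rewrite !kfun_nat pE p'E; have [e eE] := lr_comp f psi; have [e' e'E] := lr_comp g g2.
rewrite -(pull_comp s eE) -(pull_comp s e'E); apply: pull_eq => b.
by rewrite eE e'E /= psiE.
Qed.

Lemma torsor_descent : exists hX : forall A : alg, X A -> A,
  function_on lifts_in hX /\
  forall (A : alg) (p : Y A), lifts_in (pr A p) -> hX A (pr A p) = h A p.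
Proof.
have ex A (s : X A) : exists a, lifts_in s ->
    forall (B : alg) (g : {lrmorphism A -> B}) (p : Y B), pr B p = pull g s -> h B p = g a.
  have [/descended_value[a aP]|nW] := pselect (lifts_in s); [by exists a | by exists 0].
pose hX A s := projT1 (cid (ex A s)).
have hP A s := projT2 (cid (ex A s)).
exists hX; split=> [A B f s Ws|A p Wp]; last first.
  by have := hP A _ Wp A (lr_id A) p; rewrite pull_idE => /(_ erefl) ->.
have [C [g [p [cg pE]]]] := lift_exists (pull f s).
have E1 := hP B _ (lifts_in_pull (f := f) Ws) C g p pE; have [e eE] := lr_comp f g.
have E2 := hP A _ Ws C e p; rewrite (pull_comp s eE) in E2.
apply/eqP; rewrite -subr_eq0; apply/eqP; apply: (cover_injective cg); rewrite lrB -E1.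
by rewrite E2 // eE /= subrr.
Qed.

End Function.
End TorsorDescent.

(** * Bruhat cells in coordinates *)

Section BruhatCells.
Variable q : nat.
Hypothesis q0 : (0 < q)%N.
Variable A : comUnitRingType.

Lemma inord0 : inord 0 = o0 :> 'I_3. Proof. by apply: val_inj; rewrite /= inordK. Qed.
Lemma inord1 : inord 1 = o1 :> 'I_3. Proof. by apply: val_inj; rewrite /= inordK. Qed.
Lemma inord2 : inord 2 = o2 :> 'I_3. Proof. by apply: val_inj; rewrite /= inordK. Qed.

Lemma s_alpha1E : s_alpha1 A = mk3 0 1 0 1 0 0 0 0 1.
Proof.
rewrite /s_alpha1 inord0 inord1.
by apply: mat3P; apply: ord3_ind; apply: ord3_ind; rewrite !mxE ?tpermL ?tpermR ?tpermD.
Qed.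

Lemma s_alpha2E : s_alpha2 A = mk3 1 0 0 0 0 1 0 1 0.
Proof.
rewrite /s_alpha2 inord1 inord2.
by apply: mat3P; apply: ord3_ind; apply: ord3_ind; rewrite !mxE ?tpermL ?tpermR ?tpermD.
Qed.

Lemma J3E : J3 A = mk3 0 0 1 0 1 0 1 0 0.
Proof. by apply: mat3P; apply: ord3_ind; apply: ord3_ind; rewrite !mxE. Qed.

Ltac mk3_compute := apply: mat3P; apply: ord3_ind; apply: ord3_ind;
  rewrite ?mul3E !mxE /= ?simp3.

Lemma z_twistE : z_twist q A = mk3 0 0 1 1 0 0 0 1 0.
Proof.
have JJ : J3 A *m J3 A = 1%:M.
  by rewrite J3E; mk3_compute.
have ss : s_alpha1 A *m s_alpha1 A = 1%:M.
  by rewrite s_alpha1E; mk3_compute.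
have st : (map_mx (fun a => a ^+ q) (s_alpha1 A))^T = s_alpha1 A.
  by rewrite s_alpha1E; mk3_compute; rewrite ?expr1n ?expr0n //; case: q q0.
rewrite /z_twist /frobG st (invmx_unique ss) /w_0 -!mulmxA JJ mulmx1.
by rewrite s_alpha1E J3E; mk3_compute.
Qed.

Lemma borel_entries (x : 'M[A]_3) : borel x -> [/\ x o0 o1 = 0, x o0 o2 = 0 & x o1 o2 = 0].
Proof. by move=> [_ /is_trig_mxP t]; split; apply: t. Qed.

Lemma cell_s2 (g : 'M[A]_3) : bruhat_cell q (s_alpha2 A) g -> g o0 o0 = 0 /\ g o0 o2 = 0.
Proof.
move=> [b [b' [/borel_entries[b01 b02 b12] /borel_entries[c01 c02 c12] E]]].
have e i := congr1 (fun x : 'M[A]_3 => x o0 i) E.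
have := e o1; have := e o2; rewrite s_alpha2E z_twistE !mul3E !mxE /= !simp3.
by rewrite b01 b02 c01 c02 !simp3 => -> ->.
Qed.

Lemma cell_w0s1 (g : 'M[A]_3) : bruhat_cell q (w_0 A *m s_alpha1 A) g -> M02 g = 0.
Proof.
move=> [b [b' [/borel_entries[b01 b02 b12] /borel_entries[c01 c02 c12] E]]].
have e j i := congr1 (fun x : 'M[A]_3 => x j i) E.
have := (e o0 o1, e o0 o2, e o1 o1, e o1 o2); rewrite /w_0 s_alpha1E J3E z_twistE !mul3E !mxE /=.
rewrite !simp3 b01 b02 b12 c01 c02 !simp3 => -[[[E1 E2] E3] E4].
by rewrite /M02 E1 E2 E3 E4; gen_mx b; gen_mx b' => *; ring.
Qed.

Lemma s2_cell (g : 'M[A]_3) : g \in unitmx -> g o0 o0 = 0 -> g o0 o2 = 0 ->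
  g o1 o0 \is a GRing.unit -> bruhat_cell q (s_alpha2 A) g.
Proof.
(* As [w * g10 = g20], subtracting [w] times row 1 from row 2 leaves a lower triangular factor after
   the permutation. *)
move=> ug h0 h2 u10; pose t := g o1 o0; pose w := g o2 o0 / t.
pose b : 'M[A]_3 := mk3 1 0 0 0 1 0 0 w 1.
pose b' : 'M[A]_3 := mk3 (g o0 o1) 0 0 (g o2 o1 - w * g o1 o1) (g o2 o2 - w * g o1 o2) 0
  (g o1 o1) (g o1 o2) t.
have wt : w * t = g o2 o0 by rewrite /w divrK.
have E : g *m z_twist q A = b *m s_alpha2 A *m b'.
  rewrite z_twistE s_alpha2E; mk3_compute; rewrite ?h0 ?h2 ?wt //.
  - by rewrite GRing.subrK.
  - by rewrite GRing.subrK.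
have ub : \det b = 1 by rewrite det3 /M12 /M02 /M01 !mxE /=; ring.
have us : \det (s_alpha2 A) = -1 by rewrite s_alpha2E det3 /M12 /M02 /M01 !mxE /=; ring.
have uz : \det (z_twist q A) = 1 by rewrite z_twistE det3 /M12 /M02 /M01 !mxE /=; ring.
exists b, b'; split=> //; split.
- by rewrite unitmxE ub unitr1.
- by apply/is_trig_mxP; apply: ord3_ind; apply: ord3_ind => //; rewrite mxE.
- have := congr1 (fun x : 'M[A]_3 => \det x) E; rewrite det_mulmx uz mulr1 !det_mulmx ub us mul1r mulN1r.
  by move: ug; rewrite !unitmxE => ug dE; rewrite -unitrN -dE.
- by apply/is_trig_mxP; apply: ord3_ind; apply: ord3_ind => //; rewrite mxE.
Qed.

End BruhatCells.

(** * The closed stratum of s_alpha2 in Flag(S) and pseudo-completeness *)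

Section FlagClosed.
Variable k : closedFieldType.
Notation alg := (comUnitAlgType k).
Variable q : nat.
Hypothesis q1 : (1 < q)%N.
Hypothesis qD : forall (A : alg) (a b : A), (a + b) ^+ q = a ^+ q + b ^+ q.
Variables (Y : zip_space k q) (u : kmorphism Y (GL3_space k q)).
Hypothesis u_act : forall (A : alg) (x y : 'M[A]_3) (p : Y A),
  zipE q x y -> u A (act x y p) = act x y (u A p).
Variables (X : kfunctor k) (pr : kmorphism Y X).
Hypothesis tor : is_torsor (@zipE' k q) pr.

Let Fok := @FZ_ok k q.
Let V : subset_of Y := fun A p => van u (@FZ k) p.
Arguments V : clear implicits.
Let V_pull (A B : alg) (f : {lrmorphism A -> B}) (p : Y A) : V A p -> V B (pull f p).
Proof. exact: (van_pull Fok). Qed.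
Let V_act (A : alg) (x y : 'M[A]_3) (p : Y A) : zipE' q x y -> V A p -> V A (act x y p).
Proof.
move=> z vp; have [px h01 [e1 [e2 ->]]] := zipE'_ac q1 qD Y z.
exact: (stable_FZ q1 qD u_act).
Qed.

Lemma VI_FZ_idspan (A : alg) (p : Y A) e : VI u (@FZ k) p e <->
  idspan (fun z => exists b : bool, z = mat u p o0 (if b then o0 else o2)) e.
Proof.
split; [apply: (idspan_sub (idspan_ideal _)) | apply: (idspan_sub (VI_ideal u (@FZ k) p))].
- move=> z; rewrite /FZ !inE => /orP[]/eqP ->; apply: idspan_in; by [exists true | exists false].
- by move=> z [[] ->]; [exact: VI_FZ_00 | exact: VI_FZ_02].
Qed.

(** At a lift over an étale cover the condition is given by the ideal [(g00, g02)]. Stability of Z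
    under the Borel makes its two pullbacks to the tensor square equal, so it is generated by
    functions of the base. *)
Lemma lifts_in_FZ_closed : closed_sub (lifts_in pr V).
Proof.
move=> A s; have [B [f [p [cf pE]]]] := lift_exists tor s.
pose ga (b : bool) := mat u p o0 (if b then o0 else o2).
have gen l : idspan (fun y => exists a, VI u (@FZ k) p (f a) /\ y = f a) (ga l).
  have [|n [c [d [dD E]]]] := @cover_ideal_descent k A B f bool ga cf _ l.
    move=> C g h gh l'; pose J := idspan (fun y => exists l0, y = g (ga l0)).
    have idJ : ideal J by exact: idspan_ideal.
    have [J1|J1] := pselect (J 1); first by rewrite -[h _]mulr1; apply: (idealM idJ).
    have [C' [m [ms mk]]] := alg_quot idJ J1; apply/mk.
    have [mg mgE] := lr_comp g m; have [mh mhE] := lr_comp h m.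
    have vg : V C' (pull mg p).
      apply/(VI_van u Fok) => e /VI_FZ_idspan; apply: (idspan_sub (kernel_ideal mg)).
      by move=> z [b ->]; rewrite mgE; apply/mk; apply: idspan_in; exists b.
    have E : pr C' (pull mg p) = pr C' (pull mh p).
      rewrite !kfun_nat pE; have [a1 a1E] := lr_comp f mg; have [a2 a2E] := lr_comp f mh.
      rewrite -(pull_comp s a1E) -(pull_comp s a2E); apply: pull_eq => a.
      by rewrite a1E a2E /= mgE mhE /=; congr (m _); exact: gh.
    have [x [y [z E2]]] := same_image tor E.
    have : V C' (pull mh p) by rewrite E2; apply: V_act.
    move=> /(VI_van u Fok) v; rewrite -[m _]mhE; apply: v; apply/VI_FZ_idspan.
    by apply: idspan_in; exists l'.
  exists n, c, d; split=> // i; have [a [Ia aE]] := dD i.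
  by exists a; split=> //; apply/VI_FZ_idspan.
exists (fun a => VI u (@FZ k) p (f a)) => C phi; split=> [Ws a Ia|kD].
  have [D [g [psi [cg psiE]]]] := cover_base_change phi cf.
  apply: (cover_injective cg); rewrite -psiE.
  have : V D (pull psi p).
    apply: (Ws D g); rewrite kfun_nat pE.
    have [e eE] := lr_comp f psi; have [e' e'E] := lr_comp phi g.
    rewrite -(pull_comp s eE) -(pull_comp s e'E); apply: pull_eq => b.
    by rewrite eE e'E /= psiE.
  by move=> /(VI_van u Fok); apply.
move=> C2 h p2 p2E; have [phi2 phi2E] := lr_comp phi h.
have [D [g [psi [cg psiE]]]] := cover_base_change phi2 cf.
have vp : V D (pull psi p).
  apply/(VI_van u Fok) => e /VI_FZ_idspan; apply: (idspan_sub (kernel_ideal psi)).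
  move=> z [b ->]; apply: (idspan_sub (kernel_ideal psi) _ (gen b)) => y [a [Ia ->]].
  by rewrite psiE phi2E /= kD // !lr0.
have E : pr D (pull psi p) = pr D (pull g p2).
  rewrite !kfun_nat pE p2E -(pull_comp s phi2E).
  have [e eE] := lr_comp f psi; have [e' e'E] := lr_comp phi2 g.
  rewrite -(pull_comp s eE) -(pull_comp s e'E); apply: pull_eq => b.
  by rewrite eE e'E /= psiE.
have [x [y [z E2]]] := same_image tor E.
have /van_FZ : V D (pull g p2) by rewrite E2; apply: V_act.
rewrite mat_pull !mxE => -[h0 h2]; apply/van_FZ.
by split; apply: (cover_injective cg).
Qed.

Lemma lifts_in_field (K L : alg) (s : X K) (f : {lrmorphism K -> L}) (p : Y L) :
  is_field K -> pr L p = pull f s -> V L p -> lifts_in pr V s.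
Proof.
move=> fK pE Vp; have [D DP] := lifts_in_FZ_closed s.
have /DP fD : lifts_in pr V (pull f s) by rewrite -pE; apply: (lifts_in_image tor V_pull V_act).
by rewrite -[s]pull_idE; apply/DP => a /fD; apply: field_inj.
Qed.

Definition cell_points : subset_of X := fun K x =>
  exists (L : alg) (f : {lrmorphism K -> L}) (p : Y L),
    [/\ is_field L, pr L p = pull f x & GL3_stratum (fun A => s_alpha2 A) (u L p)].

Lemma cell_points_lifts (K : alg) (x : X K) : is_field K -> cell_points x -> lifts_in pr V x.
Proof.
move=> fK [L [f [p [fL pE st]]]]; apply: (lifts_in_field fK pE).
by apply/van_FZ; apply: (cell_s2 (ltnW q1) st).
Qed.

Lemma closed_sub_pull (Z : subset_of X) (A B : alg) (f : {lrmorphism A -> B}) (x : X A) :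
  closed_sub Z -> Z A x -> Z B (pull f x).
Proof.
move=> cZ Zx; have [D DP] := cZ A x.
have /DP D0 : Z A (pull (lr_id A) x) by rewrite pull_idE.
by apply/DP => a /D0 /= ->; exact: lr0.
Qed.

Let Zs := reduced_sub (closure_of cell_points).

(** The [k]-points of Z with [g10] nonzero lie in the cell of s_alpha2; as [g10] is nonzero in the
    domain [T], they are dense in its spectrum, which therefore maps into the reduced closure. *)
Lemma cell_closure_T (R T : alg) (r : Y R) (m : {lrmorphism R -> T}) : fin_gen T -> domain T ->
  van u (@FZ k) (pull m r) -> m (mat u r o1 o0) <> 0 -> Zs (pr T (pull m r)).
Proof.
move=> fgT dT vm n10 Z cZ ZP; have [D DP] := cZ T (pr T (pull m r)).
rewrite -[pr _ _]pull_idE; apply/DP => d Dd /=.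
suff : d * m (mat u r o1 o0) = 0 by move/dT => [].
apply: (domain_nss fgT dT) => y; rewrite lrM.
have [->|y10] := eqVneq (y (m (mat u r o1 o0))) 0; first by rewrite mulr0.
have fk : is_field (k^o : alg) by move=> a; rewrite unitfE.
suff /DP yD : Z k^o (pull y (pr T (pull m r))) by rewrite yD // mul0r.
apply: ZP => // U oU Uy; exists k^o, (pull y (pr T (pull m r))); split=> //.
exists k^o, (lr_id k^o), (pull y (pull m r)); split=> //.
  rewrite pull_idE; exact: (kfun_nat pr y (pull m r)).
have /van_FZ[h0 h2] : van u (@FZ k) (pull y (pull m r)) by apply: V_pull.
apply: (s2_cell (ltnW q1)) => //; first exact: (valP (u _ (pull y (pull m r)) : GL3 _)).
by rewrite -/(mat u (pull y (pull m r))) !mat_pull !mxE unitfE.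
Qed.

(** The invariant function descends to the closed stratum, where pseudo-completeness makes it equal
    to the constant 0 near the given point. In the domain [T], vanishing on a nonempty open set is
    vanishing. *)
Lemma vanishing_propagates (h : forall A : alg, Y A -> A) (R : alg) (r : Y R)
    (T : alg) (m : {lrmorphism R -> T}) (y : {lrmorphism T -> k^o}) :
  pseudo_complete Zs -> function_on V h ->
  (forall (A : alg) (x y : 'M[A]_3) (p : Y A), zipE' q x y -> V A p ->
     h A (act x y p) = h A p) ->
  fin_gen T -> domain T -> van u (@FZ k) (pull m r) -> m (mat u r o1 o0) <> 0 ->
  h k^o (pull y (pull m r)) = 0 -> h T (pull m r) = 0.
Proof.
move=> pc h_nat h_inv fgT dT vm n10 h0.
have [hX [hXn hXv]] := torsor_descent tor V_pull h_nat h_inv.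
have ZW (A : alg) (s : X A) : Zs s -> lifts_in pr V s.
  apply: reduced_sub_closed; first exact: lifts_in_FZ_closed.
  by move=> K s' fK; apply: cell_points_lifts.
have nX : function_on Zs hX by move=> A B f s /ZW; apply: hXn.
have ZT := cell_closure_T fgT dT vm n10; set sT := pr T _ in ZT.
have Zpull (A : alg) (f : {lrmorphism T -> A}) : Zs (pull f sT).
  move=> Z cZ ZP; apply: closed_sub_pull => //; exact: ZT cZ ZP.
have fk : is_field (k^o : alg) by move=> a; rewrite unitfE.
have [U [c [oU Us UP]]] := pc hX nX k^o (pull y sT) fk (Zpull _ y).
have hE (A : alg) (f : {lrmorphism T -> A}) : hX A (pull f sT) = f (h T (pull m r)).
  rewrite /sT -kfun_nat hXv; first exact: h_nat.
  by apply: (lifts_in_image tor V_pull V_act); exact: (van_pull Fok).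
have c0 : c = 0.
  have := UP k^o _ (Zpull _ y) Us; rewrite hE -h_nat // h0 /GRing.scale /= mulr1.
  exact: esym.
have [D DP] := oU T sT; move: Us => /DP[n [a [d [dD s1]]]].
have [i di] : exists i, d i <> 0.
  apply/existsNP => h1; move: (oner_neq0 (k^o : alg)); rewrite -s1 big1 ?eqxx // => i _.
  by rewrite h1 mulr0.
have [b Db bE] := dD i; have nb : b <> 0 by move=> b0; apply: di; rewrite bE b0 lr0.
have [L [l loc]] := localization_exists (fun n => domain_nz_pow (n := n) dT nb).
have [lb _ _] := loc.
apply: (localization_inj dT nb loc); rewrite -hE.
have Ul : U L (pull l sT).
  apply/DP; exists 1%N, (fun=> (l b)^-1), (fun=> l b); split=> [_|]; first by exists b.
  by rewrite big_ord1 mulVr.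
by rewrite (UP L _ (Zpull _ l) Ul) c0 scale0r.
Qed.

End FlagClosed.

(** * Generic vanishing on D as a locally constant, invariant condition *)

Section GenericVanishing.
Variable k : closedFieldType.
Notation alg := (comUnitAlgType k).
Variable q : nat.
Hypothesis q1 : (1 < q)%N.
Hypothesis qD : forall (A : alg) (a b : A), (a + b) ^+ q = a ^+ q + b ^+ q.
Variables (Y : zip_space k q) (u : kmorphism Y (GL3_space k q)).
Hypothesis u_act : forall (A : alg) (x y : 'M[A]_3) (p : Y A),
  zipE q x y -> u A (act x y p) = act x y (u A p).
Hypothesis u_smooth : formally_smooth u.
Hypothesis u_lfp : locally_finitely_presented u.

Let q0 : (0 < q)%N. Proof. exact: ltnW. Qed.

Variable f : forall A : alg, Y A -> A.
Arguments f : clear implicits.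
Hypothesis f_nat : forall (A B : alg) (h : {lrmorphism A -> B}) (p : Y A),
  f B (pull h p) = h (f A p).

(** By [line_M02] the equation says that the translate [line c] lies in D, and for [M01] nonzero
    exactly one [c] satisfies it. So [f] is required to vanish where the affine line through each
    such point of the chart meets D, even if the chart itself avoids D. *)
Definition vanish (R : alg) (r : Y R) : Prop := forall (x : {lrmorphism R -> k^o}) (c : k^o),
  M01 (mat u (pull x r)) <> 0 ->
  M02 (mat u (pull x r)) + c ^+ q * M01 (mat u (pull x r)) = 0 ->
  f k^o (line c (pull x r)) = 0.

Lemma frobenius_sum (A : alg) n (F : 'I_n -> A) : (\sum_i F i) ^+ q = \sum_i F i ^+ q.
Proof.
apply: (big_morph (fun a : A => a ^+ q)); first exact: qD.
by rewrite expr0n; case: q q0.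
Qed.

Lemma frobenius_root (a : k) : exists c : k, c ^+ q = a.
Proof.
have : size ('X^q - a%:P : {poly k}) != 1%N by rewrite size_XnsubC // eqSS -lt0n.
move=> /closed_rootP[c]; rewrite rootE !hornerE subr_eq0 => /eqP <-; by exists c.
Qed.

Lemma horner_map_sum (A B : alg) (h : {lrmorphism A -> B}) (s : {poly A}) (b : B) :
  (map_poly h s).[b] = \sum_(i < size s) h s`_i * b ^+ i.
Proof.
rewrite (@horner_coef_wide _ (size s)); last exact: size_poly.
by apply: eq_bigr => i _; rewrite coef_map_id0 // lr0.
Qed.

Section Twist.
Variables (R R1 : alg) (r : Y R) (l : {lrmorphism R -> R1}).
Hypothesis loc : is_localization l (M01 (mat u r)).

(** The [q]-th power of [s(c)], for the root [c] of [M02 + c^q M01 = 0]: only [c^q] is a function on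
    the chart, and this power involves nothing else. *)
Definition twist (s : {poly R}) : R1 :=
  \sum_(i < size s) l s`_i ^+ q * (- (l (M02 (mat u r)) / l (M01 (mat u r)))) ^+ i.

Lemma twist_eval (z : {lrmorphism R1 -> k^o}) (x : {lrmorphism R -> k^o}) (c : k^o)
    (s : {poly R}) : z \o l =1 x ->
  M02 (mat u (pull x r)) + c ^+ q * M01 (mat u (pull x r)) = 0 ->
  z (twist s) = (map_poly x s).[c] ^+ q.
Proof.
move=> zl E; have [lu _ _] := loc; rewrite horner_map_sum frobenius_sum /twist lr_sum.
have cq : c ^+ q = z (- (l (M02 (mat u r)) / l (M01 (mat u r)))).
  have zu := lr_unit z lu; apply: (mulIr zu).
  rewrite lrN lrM lrV // mulNr divrK //; apply/eqP; rewrite -addr_eq0 addrC; apply/eqP.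
  rewrite -[RHS]E !mat_pull M01_map M02_map -!zl //.
apply: eq_bigr => i _; rewrite lrM !lrX -cq exprMn -zl /=.
by rewrite -!exprM mulnC.
Qed.

End Twist.

Lemma line_polynomial (R : alg) (r : Y R) : exists F : {poly R},
  forall (x : {lrmorphism R -> k^o}) (c : k^o), f k^o (line c (pull x r)) = (map_poly x F).[c].
Proof.
have [P [m [i [ms minj mC ev]]]] := poly_alg R.
have [F FE] := ms (f P (line (m 'X) (pull i r))); exists F => x c.
have [v vE] := ev k^o x c; rewrite -vE FE -f_nat line_pull // vE map_polyX hornerX.
have [vi viE] := lr_comp i v; rewrite -(pull_comp r viE); congr (f _ (line _ _)).
by apply: pull_eq => a; rewrite viE /= -mC vE map_polyC hornerC.
Qed.

Lemma vanish_twist (R R1 : alg) (r : Y R) (l : {lrmorphism R -> R1}) (F : {poly R}) (d : R) :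
  is_localization l (M01 (mat u r)) -> fin_gen R -> domain R -> M01 (mat u r) <> 0 -> d <> 0 ->
  (forall (x : {lrmorphism R -> k^o}) (c : k^o), f k^o (line c (pull x r)) = (map_poly x F).[c]) ->
  (forall (x : {lrmorphism R -> k^o}) (c : k^o), x d <> 0 -> M01 (mat u (pull x r)) <> 0 ->
    M02 (mat u (pull x r)) + c ^+ q * M01 (mat u (pull x r)) = 0 ->
    f k^o (line c (pull x r)) = 0) -> twist r l F = 0.
Proof.
move=> loc fg dR nM nd FE H; have [lu lf lk] := loc.
have dR1 := localization_domain dR nM loc.
have ld : l d <> 0 by move/(localization_inj dR nM loc).
suff : l d * twist r l F = 0 by move/dR1 => [].
apply: (domain_nss (fin_gen_localization loc fg) dR1) => z; rewrite lrM.
have [->|zd] := eqVneq (z (l d)) 0; first by rewrite mul0r.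
have [x xE] := lr_comp l z.
have xM : M01 (mat u (pull x r)) <> 0.
  by rewrite mat_pull M01_map xE; apply: domain_unit; apply: (lr_unit z lu).
have [c cE] := frobenius_root (- (M02 (mat u (pull x r)) / M01 (mat u (pull x r)))).
have E : M02 (mat u (pull x r)) + c ^+ q * M01 (mat u (pull x r)) = 0.
  by rewrite cE mulNr divfK ?subrr //; apply/eqP.
rewrite (twist_eval loc (x := x) (c := c)) //.
rewrite -FE H // ?(frob_zero _ q0) ?mulr0 //.
by rewrite xE; apply/eqP.
Qed.

(** The condition amounts to the equation [twist F = 0] in a domain, so a nonempty open set suffices
    to test it. *)
Lemma vanish_dense (R : alg) (r : Y R) (d : R) : fin_gen R -> domain R -> d <> 0 ->
  (forall (x : {lrmorphism R -> k^o}) (c : k^o), x d <> 0 -> M01 (mat u (pull x r)) <> 0 ->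
    M02 (mat u (pull x r)) + c ^+ q * M01 (mat u (pull x r)) = 0 ->
    f k^o (line c (pull x r)) = 0) -> vanish r.
Proof.
move=> fg dR nd H x c nM E.
have nMR : M01 (mat u r) <> 0 by move=> h; apply: nM; rewrite mat_pull M01_map h lr0.
have [R1 [l loc]] := localization_exists (fun n => domain_nz_pow (n := n) dR nMR).
have [F FE] := line_polynomial r.
have ux : x (M01 (mat u r)) \is a GRing.unit.
  by rewrite unitfE -M01_map -mat_pull; apply/eqP.
have [z zE] := localization_univ loc ux.
have := twist_eval loc (z := z) F zE E.
rewrite (vanish_twist loc fg dR nMR nd FE H) lr0 -FE => /esym/eqP.
by rewrite expf_eq0 => /andP[_ /eqP].
Qed.

Definition dchart (R : alg) (r : Y R) : Prop := chart r /\ domain R.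

Lemma VI_F0 (A : alg) (p : Y A) e : VI u (@F0 k) p e <-> e = 0.
Proof.
split=> [|->]; last exact: (ideal0 (VI_ideal _ _ _)).
by move=> [n [c [d [dD ->]]]]; rewrite big1 // => i _; have := dD i; rewrite in_nil.
Qed.

Lemma prime_F0 (A : alg) (p : Y A) : primeI (VI u (@F0 k) p) <-> domain A.
Proof.
split=> [[_ pI] a b ab|dA]; last first.
  split; first by move=> /VI_F0; apply/eqP/oner_neq0.
  by move=> a b /VI_F0/dA[] h; [left|right]; apply/VI_F0.
by have /pI[] : VI u (@F0 k) p (a * b) by [apply/VI_F0]; move=> /VI_F0; [left|right].
Qed.

Lemma dchart_cover (K : alg) (y : Y K) : is_field K ->
  exists (R : alg) (r : Y R) (w : {lrmorphism R -> K}), dchart r /\ pull w r = y.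
Proof.
move=> fK; apply: (good_cover u_lfp (Good := dchart) (@F0_ok k q)) => // R r x cr vx.
have [a [L [l [x' [loc crL pL x'E]]]]] := prime_chart u_smooth (@F0_ok k q) cr vx.
exists a, L, l; split; first exact: loc.
  exact: (localization_point loc x'E).
by split=> //; apply/(prime_F0 (pull l r)).
Qed.

Lemma vanish_link (R R' K : alg) (r : Y R) (r' : Y R') (w : {lrmorphism R -> K})
    (w' : {lrmorphism R' -> K}) : is_field K -> dchart r -> dchart r' ->
  pull w r = pull w' r' -> vanish r' -> vanish r.
Proof.
move=> fK [[fg pr] dR] [cr' dR'] E vr'.
have [d [L [l [v [wL [loc wd vE wlE wvE]]]]]] := chart_link cr' fK (esym E).
apply: (@vanish_dense R r d) => // [d0|x c xd]; first by apply: wd; rewrite d0 lr0.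
have ux : x d \is a GRing.unit by rewrite unitfE; apply/eqP.
have [x' x'E] := localization_univ loc ux; have [xv xvE] := lr_comp v x'.
have <- : pull xv r' = pull x r.
  rewrite (pull_comp r' xvE) vE; symmetry; apply: pull_comp => a; by rewrite /= x'E.
exact: vr'.
Qed.

Definition generic (R : alg) (r : Y R) (c : R) : Prop :=
  dchart r /\ (vanish r /\ c = 0 \/ ~ vanish r /\ c = 1).

Lemma generic_idempotent : exists e : forall A : alg, Y A -> A,
  [/\ forall (A B : alg) (h : {lrmorphism A -> B}) (p : Y A), e B (pull h p) = h (e A p),
      forall (A : alg) (p : Y A), e A p * e A p = e A p,
      forall (A : alg) (x y : 'M[A]_3) (p : Y A), zipE q x y -> e A (act x y p) = e A p
    & forall (R A : alg) (r : Y R) c (h : {lrmorphism R -> A}), generic r c ->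
        e A (pull h r) = h c].
Proof.
have Fok := @F0_ok k q.
have tr (A : alg) (p : Y A) : van u (@F0 k) p by [].
have cov (K : alg) (y : Y K) : is_field K -> van u (@F0 k) y ->
    exists (R : alg) (r : Y R) c (w : {lrmorphism R -> K}), generic r c /\ pull w r = y.
  move=> fK _; have [R [r [w [dr wE]]]] := dchart_cover y fK.
  have [vr|nv] := pselect (vanish r).
    by exists R, r, 0, w; split=> //; split=> //; left.
  by exists R, r, 1, w; split=> //; split=> //; right.
have compat : forall (A R R' : alg) (r : Y R) (r' : Y R') c c'
    (h : {lrmorphism R -> A}) (h' : {lrmorphism R' -> A}),
    generic r c -> generic r' c' -> van u (@F0 k) (pull h r) -> pull h r = pull h' r' ->
    h c = h' c'.
  apply: (compat_reduction Fok); first by move=> R r c [[]].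
  move=> R R' r r' c c' d L l v K w [dr Dr] [dr' Dr'] loc vE fK _; apply/VI_F0.
  have [wl wlE] := lr_comp l w; have [wv wvE] := lr_comp v w.
  have E : pull wl r = pull wv r' by rewrite (pull_comp r wlE) (pull_comp r' wvE) vE.
  have v1 := vanish_link fK dr dr' E; have v2 := vanish_link fK dr' dr (esym E).
  case: Dr => [[vr ->]|[nr ->]]; case: Dr' => [[vr' ->]|[nr' ->]].
  - by rewrite !lr0 subrr.
  - by case: nr'; apply: v2.
  - by case: nr; apply: v1.
  - by rewrite !lr1 subrr.
have [|e [en ev _]] := @glued_function k Y (van u (@F0 k))
   (fun A B h y => van_pull Fok (f := h) (y := y)) (@generic) _ cov compat.
  by move=> R r c [[[]]].
have en' (A B : alg) (h : {lrmorphism A -> B}) (p : Y A) : e B (pull h p) = h (e A p).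
  exact: en.
have ev' (R A : alg) (r : Y R) c (h : {lrmorphism R -> A}) : generic r c ->
        e A (pull h r) = h c.
  by move=> g; apply: ev.
have cov' (K : alg) (y : Y K) : is_field K -> van u (@F0 k) y ->
    exists (R : alg) (r : Y R) (w : {lrmorphism R -> K}), (exists c, generic r c) /\ pull w r = y.
  by move=> fK vy; have [R [r [c [w [g E]]]]] := cov K y fK vy; exists R, r, w; split=> //; exists c.
have ee (A : alg) (p : Y A) : e A p * e A p = e A p.
  apply/eqP; rewrite -subr_eq0; apply/eqP; move: A p (tr A p).
  apply: (chart_check Fok (Good := fun R r => exists c, generic r c)
    (z := fun A p => e A p * e A p - e A p)) => //.
  - by move=> R r [c [[[]]]].
  - by move=> A B h p _; rewrite en' lrB lrM.
  - move=> R A r h [c g] _; rewrite (ev' _ _ _ _ h g) -lrM -lrB.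
    by have [_ [[_ ->]|[_ ->]]] := g; rewrite ?mulr0 ?mulr1 subrr lr0.
exists e; split=> // A x y p z; have [px [e1 [e2 ->]]] := zipE_ac q1 qD Y z.
apply/eqP; rewrite -subr_eq0; apply/eqP; move: A p x e1 e2 (tr A p) px {y z}.
suff H (A : alg) (p : Y A) x e1 e2 : van u (@F0 k) p -> parab x -> (false -> x o0 o1 = 0) ->
  e A (ac x e1 e2 p) - e A p = 0 by move=> *; apply: H.
move: A p x e1 e2; apply: (universal_reduction (bor := false) Fok
    (Good := fun R r => exists c, generic r c)
    (z := fun A p x e1 e2 => e A (ac x e1 e2 p) - e A p)) => //.
- by move=> R r [c [[cr dR] _]]; split=> //; apply/prime_F0.
- by move=> A B h p x e1 e2 _ px _; rewrite lrB -!en' ac_pull.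
- move=> R r T m x e1 e2 _ fgT dT mI px _ [T1 [s [sx s1 s2]]].
  have idem a : a * a = a -> a = 0 \/ a = 1 :> T.
    move=> /eqP; rewrite -subr_eq0 -{3}[a]mulr1 -mulrBr => /eqP/dT[]; first by left.
    by move/eqP; rewrite subr_eq0 => /eqP; right.
  have E : s (e T (ac x e1 e2 (pull m r))) = s (e T (pull m r)).
    by rewrite -!en' ac_pull // sx s1 s2 ac_1.
  have n01 : (0 : T1) <> 1 by move/esym/eqP; rewrite oner_eq0.
  case: (idem _ (ee _ (ac x e1 e2 (pull m r)))) E => ->;
    case: (idem _ (ee _ (pull m r))) => ->; rewrite ?subrr // lr0 lr1 => E.
  - by case: n01.
  - by case: n01; rewrite E.
Qed.

End GenericVanishing.

(** * From generic nonvanishing to nonvanishing on D near X *)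

Section GenericPoint.
Variable k : closedFieldType.
Notation alg := (comUnitAlgType k).
Variable q : nat.
Hypothesis q1 : (1 < q)%N.
Hypothesis qD : forall (A : alg) (a b : A), (a + b) ^+ q = a ^+ q + b ^+ q.
Variables (Y : zip_space k q) (u : kmorphism Y (GL3_space k q)).
Hypothesis u_act : forall (A : alg) (x y : 'M[A]_3) (p : Y A),
  zipE q x y -> u A (act x y p) = act x y (u A p).
Hypothesis u_smooth : formally_smooth u.
Hypothesis u_lfp : locally_finitely_presented u.
Variable f : forall A : alg, Y A -> A.
Arguments f : clear implicits.
Hypothesis f_nat : forall (A B : alg) (h : {lrmorphism A -> B}) (p : Y A),
  f B (pull h p) = h (f A p).

Lemma two_nonzero (R : alg) (a b : R) : fin_gen R -> domain R -> a <> 0 -> b <> 0 ->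
  exists z : {lrmorphism R -> k^o}, z a <> 0 /\ z b <> 0.
Proof.
move=> fg dR na nb; apply: contrapT => nex.
suff /dR[] : a * b = 0 by [].
apply: (domain_nss fg dR) => z; rewrite lrM.
have [->|za] := eqVneq (z a) 0; first by rewrite mul0r.
have [->|zb] := eqVneq (z b) 0; first by rewrite mulr0.
by case: nex; exists z; split; apply/eqP.
Qed.

Lemma two_nonzero_van (F : eqfam k) (R : alg) (r : Y R) (a b : R) : eqfam_ok q F -> chart r ->
  primeI (VI u F r) -> ~ VI u F r a -> ~ VI u F r b ->
  exists z : {lrmorphism R -> k^o}, [/\ van u F (pull z r), z a <> 0 & z b <> 0].
Proof.
move=> Fok [fg _] pI na nb; apply: contrapT => nex; have [_ pI2] := pI.
suff /pI2[] : VI u F r (a * b) by [].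
apply: (nss_prime fg (VI_ideal _ _ _) pI) => z zI; rewrite lrM.
have [->|za] := eqVneq (z a) 0; first by rewrite mul0r.
have [->|zb] := eqVneq (z b) 0; first by rewrite mulr0.
case: nex; exists z; split; [exact/(VI_van u Fok) | exact/eqP | exact/eqP].
Qed.

(* If [f = M02 * s] near [x] then, on the line through [r], a power of [D] times [f] is a
   multiple of [M02 + c^q M01]; taking [c^q = - M02 / M01] kills [f] generically. *)
Lemma nonvanishing_on_D (R : alg) (r : Y R) (x : {lrmorphism R -> k^o}) : chart r -> domain R ->
  van u (@FD k) (pull x r) -> primeI (VI u (@FD k) r) -> ~ vanish u f r ->
  ~ VI u (@FD k) r (f R r).
Proof.
move=> cr dR vx pD nv /VI_FD[s fE]; have [fg pr] := cr; have Fok := @FD_ok k q.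
have nMD := FD_good u_smooth cr vx pD.
have nM : M01 (mat u r) <> 0 by move=> h; apply: nMD; rewrite h; exact: (ideal0 (VI_ideal _ _ _)).
have [R1 [l1 loc1]] := localization_exists (fun n => domain_nz_pow (n := n) dR nM).
have dR1 := localization_domain dR nM loc1; have [lu _ _] := loc1.
have fg1 := fin_gen_localization loc1 fg.
have [P [m [i [ms minj mC ev]]]] := poly_alg R.
have [F FE] := ms (f P (line (m 'X) (pull i r))).
have Fx (x1 : {lrmorphism R -> k^o}) (c : k^o) : f k^o (line c (pull x1 r)) = (map_poly x1 F).[c].
  have [v vE] := ev k^o x1 c; rewrite -vE FE -f_nat line_pull // vE map_polyX hornerX.
  have [vi viE] := lr_comp i v; rewrite -(pull_comp r viE); congr (f _ (line _ _)).
  by apply: pull_eq => a; rewrite viE /= -mC vE map_polyC hornerC.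
have [v0 v0E] := ev k^o x 0.
have line0 (p : Y k^o) : line 0 p = p.
  rewrite /line (_ : blk _ _ _ _ = 1%:M) ?ac_1 //.
  by apply: mat3P; apply: ord3_ind; apply: ord3_ind; rewrite !mxE.
have E0 : pull x r = pull v0 (line (m 'X) (pull i r)).
  rewrite line_pull // v0E map_polyX hornerX line0.
  have [vi viE] := lr_comp i v0; rewrite -(pull_comp r viE).
  by apply: pull_eq => a; rewrite viE /= -mC v0E map_polyC hornerC.
have fk : is_field (k^o : alg) by move=> a; rewrite unitfE.
have [d [L [l [v [wL [loc v0d vE _ _]]]]]] := chart_link cr fk E0.
have [D DE] := ms d; have [ld lf lk] := loc.
have [N [S SE]] : exists N (S : {poly R}), D ^+ N * F =
    ((M02 (mat u r))%:P + 'X^q * (M01 (mat u r))%:P) * S.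
  have [M [s1 s1E]] := lf (v s); have [S0 S0E] := ms s1.
  have yM : M02 (mat u (line (m 'X) (pull i r))) =
      m ((M02 (mat u r))%:P + 'X^q * (M01 (mat u r))%:P).
    by rewrite line_M02 // mat_pull M02_map M01_map [RHS]rmorphD [X in _ = _ + X]rmorphM !mC (rmorphXn m).
  have E1 : l (m F) = l (M02 (mat u (line (m 'X) (pull i r)))) * v s.
    rewrite FE -f_nat -vE f_nat fE lrM; congr (_ * _).
    by rewrite -!M02_map -!mat_pull vE.
  have /lk[n nE] : l (d ^+ M * m F - M02 (mat u (line (m 'X) (pull i r))) * s1) = 0.
    rewrite lrB !lrM !lrX E1 -s1E; move: (l d ^+ M) (l (M02 _)) (v s) => *; ring.
  exists (n + M)%N, (D ^+ n * S0); apply: minj; rewrite -[LHS]subr0 -nE yM.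
  rewrite !(rmorphM, rmorphXn) DE S0E exprD; move: (m (_ + _)) (d ^+ n) (d ^+ M) (m F) => *; ring.
have tF : twist u r l1 F <> 0.
  move=> t0; apply: nv => x1 c nM1 E.
  have ux : x1 (M01 (mat u r)) \is a GRing.unit.
    by rewrite unitfE -M01_map -mat_pull; apply/eqP.
  have [z zE] := localization_univ loc1 ux.
  have := twist_eval q1 qD loc1 (z := z) F zE E; rewrite t0 lr0 -Fx => /esym/eqP.
  by rewrite expf_eq0 => /andP[_ /eqP].
have root_at (z : {lrmorphism R1 -> k^o}) : exists (x1 : {lrmorphism R -> k^o}) (c : k^o),
    z \o l1 =1 x1 /\ M02 (mat u (pull x1 r)) + c ^+ q * M01 (mat u (pull x1 r)) = 0.
  have [x1 x1E] := lr_comp l1 z.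
  have xM : M01 (mat u (pull x1 r)) <> 0.
    by rewrite mat_pull M01_map x1E; apply: domain_unit; apply: (lr_unit z lu).
  have [c cE] := frobenius_root q1 (- (M02 (mat u (pull x1 r)) / M01 (mat u (pull x1 r)))).
  exists x1, c; split=> [a|]; first by rewrite x1E.
  by rewrite cE mulNr divfK ?subrr //; apply/eqP.
have tD : twist u r l1 D <> 0.
  have nD0 : ~ VI u (@FD k) r D`_0.
    move=> I; apply: v0d; rewrite -DE v0E -[RHS](proj1 (VI_van u Fok r x) vx _ I).
    by rewrite horner_coef0 coef_map_id0 // lr0.
  have [x1 [vx1 D0 M1]] := two_nonzero_van Fok cr pD nD0 nMD.
  have ux : x1 (M01 (mat u r)) \is a GRing.unit by rewrite unitfE; apply/eqP.
  have [z zE] := localization_univ loc1 ux.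
  have /van_FD E := vx1; move=> t0.
  have := twist_eval q1 qD loc1 (z := z) (x := x1) (c := 0) D zE.
  rewrite (frob_zero _ (ltnW q1)) mul0r addr0 => /(_ E).
  rewrite t0 lr0 horner_coef0 coef_map_id0 ?lr0 // => /esym/eqP.
  by rewrite expf_eq0 => /andP[_ /eqP].
have [z [zF zD]] := two_nonzero fg1 dR1 tF tD.
have [x1 [c [zE E]]] := root_at z.
have tz := twist_eval q1 qD loc1 _ zE E.
have := congr1 (fun s : {poly R} => (map_poly x1 s).[c]) SE.
have hm (s1 s2 : {poly R}) : (map_poly x1 (s1 * s2)).[c] = (map_poly x1 s1).[c] * (map_poly x1 s2).[c].
  by rewrite rmorphM hornerM.
have hX n : (map_poly x1 (D ^+ n)).[c] = (map_poly x1 D).[c] ^+ n.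
  by rewrite rmorphXn horner_exp.
rewrite !hm hX.
have -> : (map_poly x1 ((M02 (mat u r))%:P + 'X^q * (M01 (mat u r))%:P)).[c] = 0.
  rewrite rmorphD rmorphM rmorphXn /= map_polyX !map_polyC hornerD hornerM hornerXn !hornerC.
  by rewrite /= -[RHS]E mat_pull M01_map M02_map.
rewrite mul0r => /eqP; rewrite mulf_eq0 expf_eq0 => /orP[/andP[_ /eqP D0]|/eqP F0].
  by apply: zD; rewrite tz D0 (frob_zero _ (ltnW q1)).
by apply: zF; rewrite tz F0 (frob_zero _ (ltnW q1)).
Qed.

(** The chart is shrunk until the ideals of D and X are prime; by [vanish_dense] this does not
    affect generic nonvanishing. *)
Lemma generic_FX_chart (R : alg) (r : Y R) (x : {lrmorphism R -> k^o}) : dchart r ->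
  ~ vanish u f r -> van u (@FX k) (pull x r) ->
  exists (L : alg) (r' : Y L) (x' : {lrmorphism L -> k^o}),
  [/\ chart r', van u (@FX k) (pull x' r'), primeI (VI u (@FD k) r'), primeI (VI u (@FX k) r')
    & ~ VI u (@FD k) r' (f L r')].
Proof.
move=> [cr dR] nv vx.
have [|//|a [L [l [x' [loc crL x'E pL]]]]] :=
    @refine_chart k q Y u u_smooth [:: @F0 k; @FD k; @FX k] R r x.
  move=> F /= [<-|[<-|[<-|//]]]; split=> //; do ?exact: van_FX_FD.
  - exact: F0_ok.
  - exact: FD_ok.
  - exact: FX_ok.
have p0 := pL _ (or_introl erefl); have pD := pL _ (or_intror (or_introl erefl)).
have pX := pL _ (or_intror (or_intror (or_introl erefl))).
have xr : pull x' (pull l r) = pull x r by rewrite -(pull_comp r (h := x)).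
exists L, (pull l r), x'; split=> //; first by rewrite xr.
apply: (@nonvanishing_on_D L (pull l r) x') => //.
- exact/(prime_F0 u (pull l r)).
- by rewrite xr; exact: van_FX_FD.
move=> vL; apply: nv; have xa := localization_point loc x'E.
apply: (@vanish_dense k q q1 qD Y u f f_nat R r a) => //; first by case: cr.
  by move=> a0; apply: xa; rewrite a0 lr0.
move=> x1 c x1a; have ux : x1 a \is a GRing.unit by rewrite unitfE; apply/eqP.
have [x2 x2E] := localization_univ loc ux.
have <- : pull x2 (pull l r) = pull x1 r.
  by rewrite -(pull_comp r (h := x1)) // => b; rewrite /= x2E.
exact: vL.
Qed.

End GenericPoint.

(** * The Frobenius in the characteristic of [k] *)

Section Characteristic.
Variables (Fq : finFieldType) (k : fieldType) (iota : {rmorphism Fq -> k}).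

Lemma card_pnat_pchar (R : comNzRingType) (h : {rmorphism Fq -> R}) :
  [pchar R].-nat #|Fq|.
Proof.
have [p pr_p pc] := finPcharP Fq.
have /abelem_pgroup := fin_ring_pchar_abelem pc; rewrite /pgroup cardsT.
by rewrite (eq_pnat _ (pcharf_eq (rmorph_pchar h pc))).
Qed.

Lemma frobenius_additive (A : comUnitAlgType k) (a b : A) :
  (a + b) ^+ #|Fq| = a ^+ #|Fq| + b ^+ #|Fq|.
Proof.
apply: exprDn_pchar; exact: (card_pnat_pchar [the {rmorphism Fq -> A} of in_alg A \o iota]).
Qed.

Lemma card_zero : #|Fq|%:R = 0 :> k.
Proof.
have [p pr_p pc] := finPcharP Fq; have := card_finNzRing_gt1 Fq.
have /abelem_pgroup := fin_ring_pchar_abelem pc; rewrite /pgroup cardsT.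
move=> /p_natP[[|n] ->]; first by rewrite expn0.
by rewrite natrX (pcharf0 (rmorph_pchar iota pc)) expr0n.
Qed.

End Characteristic.

(** * Vanishing of [f] on D *)

Section Vanishing.
Variable k : closedFieldType.
Notation alg := (comUnitAlgType k).
Variable q : nat.
Hypothesis q1 : (1 < q)%N.
Hypothesis qD : forall (A : alg) (a b : A), (a + b) ^+ q = a ^+ q + b ^+ q.
Hypothesis qk : q%:R = 0 :> k.
Variables (S : kfunctor k) (zeta : stack_map q S).
Hypothesis zeta_smooth : stack_map_smooth zeta.
Hypothesis zeta_surj : stack_map_surjective_on_components zeta.
Variable FlagS : flag_space zeta.
Hypothesis FlagS_pc : pseudo_complete_length1 FlagS.
Variables (a1 a2 a3 : int) (f : forall A : alg, tors zeta A -> A).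
Arguments f : clear implicits.
Hypothesis a13 : 0 < a1 - a3.
Hypothesis f_section : Vflag_section (weight a1 a2 a3) f.

Let Y := tors zeta.
Let u : kmorphism Y (GL3_space k q) := tors_map zeta.
Let u_act : forall (A : alg) (x y : 'M[A]_3) (p : Y A),
  zipE q x y -> u A (act x y p) = act x y (u A p).
Proof. exact: (tors_map_act (s := zeta)). Qed.
Let u_smooth : formally_smooth u. Proof. by case: zeta_smooth. Qed.
Let u_lfp : locally_finitely_presented u. Proof. by case: zeta_smooth. Qed.
Let f_nat (A B : alg) (h : {lrmorphism A -> B}) (p : Y A) : f B (pull h p) = h (f A p).
Proof. by case: f_section. Qed.
Let fk : is_field (k^o : alg). Proof. by move=> a; rewrite unitfE. Qed.

Lemma section_semi (V : subset_of Y) : semi (weight a1 a2 a3) V f.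
Proof.
move=> A x e1 e2 p _ px h01; have [_ h] := f_section; apply: h.
exact: (ac_zipE' q1 qD).
Qed.

(** At [c = 0] the condition [vanish] covers the points of D with [M01] nonzero. These are dense in
    D near [y], so the condition would force [f] to vanish at [y]. *)
Lemma generic_at (y : Y k^o) : van u (@FD k) y -> f k^o y <> 0 ->
  exists (R : alg) (r : Y R) (w : {lrmorphism R -> k^o}),
    [/\ dchart r, pull w r = y & ~ vanish u f r].
Proof.
move=> vy fy; have [R0 [r0 [w0 [cr0 w0E]]]] := chart_cover u_lfp y fk.
have [|//|a [R [l [x [loc cr xE pL]]]]] :=
    @refine_chart k q Y u u_smooth [:: @F0 k; @FD k] R0 r0 w0.
  move=> F /= [<-|[<-|//]]; rewrite w0E; split=> //; [exact: F0_ok | exact: FD_ok].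
have p0 := pL _ (or_introl erefl); have pD := pL _ (or_intror (or_introl erefl)).
have xy : pull x (pull l r0) = y by rewrite -w0E -(pull_comp r0 (h := w0)).
have vx : van u (@FD k) (pull x (pull l r0)) by rewrite xy.
exists R, (pull l r0), x; split=> //; first by split=> //; exact/(prime_F0 u (pull l r0)).
have nM := FD_good u_smooth cr vx pD.
have nf : ~ VI u (@FD k) (pull l r0) (f R (pull l r0)).
  by move/(proj1 (VI_van u (@FD_ok k q) _ x) vx); rewrite -f_nat xy.
have [z [vz zM zf]] := two_nonzero_van (@FD_ok k q) cr pD nM nf.
move=> /(_ z 0); rewrite mat_pull M01_map => /(_ zM).
have /van_FD := vz; rewrite mat_pull => ->; rewrite (frob_zero _ (ltnW q1)) mul0r addr0.
move=> /(_ erefl); rewrite /line (_ : blk _ _ _ _ = 1%:M) ?ac_1 // ?f_nat //.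
  by move=> h; apply: zf; rewrite f_nat.
by apply: mat3P; apply: ord3_ind; apply: ord3_ind; rewrite !mxE.
Qed.

(** The idempotent descends to [S] and is constant on connected components. By surjectivity of
    [zeta], the component of the image of [y] contains points lying over X, and there [f] is still
    generically nonzero on D. *)
Lemma generic_on_FX (y : Y k^o) : van u (@FD k) y -> f k^o y <> 0 ->
  exists (R : alg) (r : Y R) (x : {lrmorphism R -> k^o}),
    [/\ dchart r, ~ vanish u f r & van u (@FX k) (pull x r)].
Proof.
move=> vy fy; have [e [en ee einv ev]] := generic_idempotent q1 qD u_smooth u_lfp f_nat.
have tor := tors_proj_torsor zeta.
pose V : subset_of Y := fun A p => True.
have [|||eS [eSn eSv]] := @torsor_descent k q Y S (tors_proj zeta) (@zipE k q) tor V _ e.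
- by [].
- by move=> A B h p _; exact: en.
- by move=> A x y' p z _; exact: einv.
have all (A : alg) (s : S A) : lifts_in (tors_proj zeta) V s by [].
have ey : e k^o y = 1.
  have [R [r [w [dr <- nv]]]] := generic_at vy fy.
  by rewrite (ev R k^o r 1 w) ?lr1 //; split=> //; right.
(* A permutation matrix with [g00 = g10 = 0], that is, a point of X. *)
pose g : 'M[k^o]_3 := mk3 0 1 0 0 0 1 1 0 0.
have dg : \det g = 1 by rewrite det3 /M12 /M02 /M01 !mxE /=; ring.
have ug : g \in unitmx by rewrite unitmxE dg unitr1.
have [L [h [p [fL [C [cC Cs Cp]] pg]]]] :=
  zeta_surj (tors_proj zeta k^o y) fk (exist _ g ug : GL3_space k q k^o) fk.
pose U1 : subset_of S := fun A s => eS A s \is a GRing.unit.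
pose U2 : subset_of S := fun A s => 1 - eS A s \is a GRing.unit.
have open_unit (z : forall A : alg, S A -> A) :
    (forall (A B : alg) (h0 : {lrmorphism A -> B}) s, z B (pull h0 s) = h0 (z A s)) ->
    open_sub (fun A s => z A s \is a GRing.unit).
  move=> zn A s; exists (fun a => a = z A s) => B h0; rewrite zn; split.
    move=> uz; exists 1%N, (fun=> (h0 (z A s))^-1), (fun=> h0 (z A s)).
    by split=> [_|]; [exists (z A s) | rewrite big_ord1 mulVr].
  move=> [n [c [d [dD s1]]]]; apply/unitrP; exists (\sum_i c i).
  have E : (\sum_i c i) * h0 (z A s) = 1.
    by rewrite mulr_suml -s1; apply: eq_bigr => i _; have [_ -> ->] := dD i.
  by split; [exact: E | rewrite mulrC; exact: E].
have eSn' (A B : alg) (h0 : {lrmorphism A -> B}) s : eS B (pull h0 s) = h0 (eS A s).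
  exact: eSn.
have o1 : open_sub U1 by exact: open_unit.
have o2 : open_sub U2.
  by apply: (open_unit (fun A s => 1 - eS A s)) => A B h0 s; rewrite eSn' lrB lr1.
have idem (A : alg) (s : S A) : eS A s * (1 - eS A s) = 0.
  have [B [g0 [p0 [cg p0E]]]] := lift_exists tor s.
  apply: (cover_injective cg); rewrite lrM lrB lr1 -eSn' -p0E eSv //.
  by rewrite mulrBr mulr1 ee subrr.
have ep : e L p = 1.
  have /eqP := idem L (tors_proj zeta L p); rewrite eSv //.
  have [e0 _|e0] := eqVneq (e L p) 0; last first.
    move=> /eqP h0; have : 1 - e L p = 0 by apply: (mulrI (fL _ e0)); rewrite mulr0.
    by move/eqP; rewrite subr_eq0 => /eqP.
  (* Otherwise the open sets where the idempotent is 1 and where it is 0 would disconnect the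
     component. *)
  have [|||K [s [fK Cs' Us1 Us2]]] := cC U1 U2 o1 o2.
  - move=> K s fK Cs'; have := idem K s; have [E _|n0 _] := eqVneq (eS K s) 0.
      by right; rewrite /U2 E subr0 unitr1.
    by left; apply: fK.
  - exists k^o, (tors_proj zeta k^o y); split=> //.
    by rewrite /U1 eSv // ey unitr1.
  - exists L, (tors_proj zeta L p); split=> //.
    by rewrite /U2 eSv // e0 subr0 unitr1.
  have := idem K s; have : eS K s * (1 - eS K s) \is a GRing.unit by rewrite unitrM Us1.
  by move=> + E; rewrite E unitr0.
have [R [r [w [dr wE]]]] := dchart_cover u_smooth u_lfp p fL.
have nv : ~ vanish u f r.
  move=> vr; have g0 : generic u f r 0 by split=> //; left.
  by have := ev R L r 0 w g0; rewrite wE ep lr0 => /eqP; rewrite oner_eq0.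
have vw : van u (@FX k) (pull w r).
  apply/van_FX; rewrite wE /mat; have -> : u L p = pull h (exist _ g ug : GL3_space k q k^o) := pg.
  by rewrite /= !mxE /= !lr0.
have [[fg _] dR] := dr.
suff [x vx] : exists x : {lrmorphism R -> k^o}, van u (@FX k) (pull x r) by exists R, r, x.
apply: contrapT => nex.
have [|n] := @nss_ideal k R (VI u (@FX k) r) 1 fg (VI_ideal _ _ _).
  by move=> x xI; case: nex; exists x; exact/(VI_van u (@FX_ok k q)).
rewrite expr1n => /(proj1 (VI_van u (@FX_ok k q) r w) vw); rewrite lr1.
by apply/eqP/oner_neq0.
Qed.

Lemma act_inverse (x : 'M[k^o]_3) e1 e2 (p : Y k^o) : parab x -> x o0 o1 = 0 ->
  exists (x' : 'M[k^o]_3) e1' e2', [/\ parab x', x' o0 o1 = 0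
    & p = ac x' e1' e2' (ac x e1 e2 p)].
Proof.
move=> px h01; have tor := flag_proj_torsor FlagS; have [inv _ _] := tor.
have E := inv _ x _ p (ac_zipE' q1 qD e1 e2 px h01).
have [x' [y' [z pE]]] := same_image tor E.
have [px' h01' [e1' [e2' h]]] := zipE'_ac q1 qD Y z.
by exists x', e1', e2'; split=> //; rewrite -h.
Qed.

Lemma vanishing_on_D (y : Y k^o) : van u (@FD k) y -> f k^o y = 0.
Proof.
move=> vy; apply: contrapT => fy.
have [R0 [r0 [x0 [dr0 nv0 vx0]]]] := generic_on_FX vy fy.
have [R1 [r1 [x1 [cr1 vx1 pD1 pX1 nf1]]]] :=
  generic_FX_chart q1 qD u_act u_smooth f_nat dr0 nv0 vx0.
have [i [f1 [f1n _ f1s [p [vp fp]]]]] :=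
  divide_M01 q1 qD u_act u_smooth u_lfp f_nat (@section_semi _) cr1 vx1 pD1 pX1 nf1.
have [|R [r [x [j [c [[cr ex] pD pZ [vZ vX] bound]]]]]] :=
  exact_point q1 qD qk u_act u_smooth u_lfp f1n f1s vp; first exact/eqP.
have [f2 [f2n f2s f2v]] := divide_N02 q1 qD u_act u_smooth u_lfp f1n f1s act_inverse j.
set lam := (X in torus_char X) in f2s.
have l0 : lam 0 o0 = a1 - i%:Z - (1 + q%:Z) * j%:Z.
  by rewrite /lam /weight !(mxE, mulmxnE) /=; lia.
have l1 : lam 0 o1 = a2 - (1 + q%:Z) * i%:Z.
  by rewrite /lam /weight !(mxE, mulmxnE) /=; lia.
have l2 : lam 0 o2 = a3 - q%:Z * i%:Z - (1 + q%:Z) * j%:Z.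
  by rewrite /lam /weight !(mxE, mulmxnE) /=; lia.
have {}bound : (1 + q%:Z) * j%:Z <= a1 - a2 + q%:Z * i%:Z.
  by move: bound; rewrite /weight !(mxE, mulmxnE) /=; lia.
(* The exponent of [g10] in [weight0]. *)
pose C : int := - (1 + q%:Z) * (lam 0 o1 - q%:Z * lam 0 o0 + (q%:Z - 1) * lam 0 o2).
have Cpos : 0 < C.
  rewrite /C l0 l1 l2.
  (* Up to the factor [1 + q], this is a sum of two terms: the first is nonnegative by the bound on
     [j], the second positive because [a1 - a3 > 0]. *)
  have -> : - (1 + q%:Z) * (a2 - (1 + q%:Z) * i%:Z - q%:Z * (a1 - i%:Z - (1 + q%:Z) * j%:Z)
     + (q%:Z - 1) * (a3 - q%:Z * i%:Z - (1 + q%:Z) * j%:Z)) =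
    (1 + q%:Z) * ((a1 - a2 + q%:Z * i%:Z - (1 + q%:Z) * j%:Z) +
      (q%:Z - 1) * ((a1 - a3) + (q%:Z - 1) * i%:Z)) by ring.
  have q1' : 0 < q%:Z - 1 by lia.
  have i0 : 0 <= i%:Z by [].
  apply: Num.Theory.mulr_gt0; first by lia.
  have : 0 < (q%:Z - 1) * ((a1 - a3) + (q%:Z - 1) * i%:Z).
    apply: Num.Theory.mulr_gt0 => //; apply: Num.Theory.ltr_wpDr => //.
    by apply: Num.Theory.mulr_ge0 => //; apply: Order.POrderTheory.ltW.
  by move: bound; move: (_ * j%:Z) ((q%:Z - 1) * (_ + _)) => *; lia.
have [m mE] : exists m : nat, m%:Z = C by exists (absz C); lia.
have m0 : (0 < m)%N by lia.
have [T [mm [ms mk dT]]] := prime_quotient (VI_ideal u (@FZ k) r) pZ.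
have fgT := fin_gen_quotient ms (proj1 cr).
have Fok := @FZ_ok k q.
have vm : van u (@FZ k) (pull mm r) by apply/(VI_van u Fok) => e /mk.
have [|xT xTE] := @alg_quot_lift k R T k^o mm x ms.
  by move=> a /mk; apply: (proj1 (VI_van u Fok r x) vZ).
have xr : pull xT (pull mm r) = pull x r.
  by rewrite -(pull_comp r (h := x)) // => a; rewrite /= xTE.
have /van_FZ[g0 g2] := vZ; have /van_FX[_ g10] := vX.
have n10 : mm (mat u r o1 o0) <> 0.
  move/mk; exact: (g10_nonvanishing q u_smooth cr g0 g2 g10).
have gr : good u r by split.
have nf2 : f2 T (pull mm r) <> 0.
  by rewrite (f2v _ _ _ _ _ gr ex vm) => /mk; case: ex.
have := @vanishing_propagates k q q1 qD Y u u_act (flag FlagS) (flag_proj FlagS)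
  (flag_proj_torsor FlagS) (@weight0 k q Y u f2 lam m) R r T mm xT (proj2 FlagS_pc).
move=> /(_ (weight0_nat lam m f2n)).
have inv : forall (A : alg) (x y : 'M[A]_3) (p : Y A), zipE' q x y -> van u (@FZ k) p ->
     weight0 u f2 lam m (act x y p) = weight0 u f2 lam m p.
  move=> A x' y' p' z vp'; have [px' h01' [e1 [e2 ->]]] := zipE'_ac q1 qD Y z.
  exact: (weight0_inv q1 qD u_act u_smooth u_lfp f2n f2s mE).
move=> /(_ inv fgT dT vm n10); rewrite xr.
(* The chosen point lies in X, so [g10] vanishes there, and its exponent [m] is positive. *)
have h0 : weight0 u f2 lam m (pull x r) = 0.
  by rewrite /weight0 g10 expr0n eqn0Ngt m0 mulr0 !mul0r.
move=> /(_ h0); rewrite /weight0.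
have u01 := van_FZ_unit vm; have ud := det_mat_unit u (pull mm r).
(* In the domain [T] one factor of [weight0] must vanish, but [det g] and [g01] are units and [f2]
   and [g10] are nonzero. *)
move/dT => [|h1]; last by apply: (domain_unit (unitrXz _ ud)); exact: h1.
move/dT => [|h1]; last by apply: (domain_unit (unitrXz _ u01)); exact: h1.
move/dT => [/(domain_pow dT)//|/(domain_pow dT)].
by rewrite mat_pull mxE.
Qed.

End Vanishing.

(** * Division of [f] by the Hasse invariant *)

Section Quotient.
Variable k : closedFieldType.
Notation alg := (comUnitAlgType k).
Variable q : nat.
Hypothesis q1 : (1 < q)%N.
Hypothesis qD : forall (A : alg) (a b : A), (a + b) ^+ q = a ^+ q + b ^+ q.
Variables (Y : zip_space k q) (u : kmorphism Y (GL3_space k q)).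
Hypothesis u_act : forall (A : alg) (x y : 'M[A]_3) (p : Y A),
  zipE q x y -> u A (act x y p) = act x y (u A p).
Hypothesis u_smooth : formally_smooth u.
Hypothesis u_lfp : locally_finitely_presented u.
Variables (f Ha : forall A : alg, Y A -> A) (lam lamH : 'rV[int]_3).
Arguments f : clear implicits.
Arguments Ha : clear implicits.
Hypothesis f_nat : forall (A B : alg) (h : {lrmorphism A -> B}) (p : Y A),
  f B (pull h p) = h (f A p).
Hypothesis f_semi : semi lam (fun A p => True) f.
Hypothesis Ha_nat : forall (A B : alg) (h : {lrmorphism A -> B}) (p : Y A),
  Ha B (pull h p) = h (Ha A p).
Hypothesis Ha_semi : semi lamH (fun A p => True) Ha.
Hypothesis Ha_zero : forall (A : alg) (p : Y A), Ha A p = 0 -> M02 (mat u p) = 0.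
Hypothesis f_zero : forall y : Y k^o, van u (@FD k) y -> f k^o y = 0.

(** Over the quotient by [Ha] the point satisfies [Ha = 0], hence [M02 = 0]. *)
Lemma Ha_divides (A : alg) (p : Y A) : exists t, M02 (mat u p) = Ha A p * t.
Proof.
pose I a := exists t, a = Ha A p * t.
have idI : ideal I.
  split=> [|_ _ [t ->] [t' ->]|c _ [t ->]]; first by exists 0; rewrite mulr0.
    by exists (t + t'); rewrite mulrDr.
  by exists (c * t); rewrite mulrCA.
have [I1|I1] := pselect (I 1); first by rewrite -[M02 _]mulr1; exact: (idealM idI).
have [B [m [ms mk]]] := alg_quot idI I1; apply/mk; rewrite -M02_map -mat_pull.
by apply: Ha_zero; rewrite Ha_nat; apply/mk; exists 1; rewrite mulr1.
Qed.

Definition quotient_chart (R : alg) (r : Y R) (c : R) : Prop :=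
  [/\ dchart r, Ha R r <> 0 & f R r = Ha R r * c].

Lemma quotient_of_M02 (R : alg) (r : Y R) s : dchart r -> M02 (mat u r) <> 0 ->
  f R r = M02 (mat u r) * s -> exists c, quotient_chart r c.
Proof.
move=> dr nM fE; have [t tE] := Ha_divides r; exists (t * s); split=> //.
  by move=> h; apply: nM; rewrite tE h mul0r.
by rewrite mulrA -tE.
Qed.

(** Around a point of D the ideal of D is prime and [f] vanishes at its [k]-points, so [f] is a
    multiple of [M02] and thus of [Ha]. Away from D the function [M02] is invertible, and so is its
    divisor [Ha]. *)
Lemma quotient_cover (K : alg) (y : Y K) : is_field K -> van u (@F0 k) y ->
  exists (R : alg) (r : Y R) (w : {lrmorphism R -> K}), (exists c, quotient_chart r c) /\ pull w r = y.
Proof.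
apply: (good_cover u_lfp (Good := fun R r => exists c, quotient_chart r c) (@F0_ok k q)).
move=> R r x cr _; have [h0|h0] := eqVneq (M02 (mat u (pull x r))) 0.
  have [|//|a [L [l [x' [loc crL x'E pL]]]]] :=
      @refine_chart k q Y u u_smooth [:: @F0 k; @FD k] R r x.
    move=> F /= [<-|[<-|//]]; split=> //; [exact: F0_ok | exact: FD_ok | exact/van_FD].
  have p0 := pL _ (or_introl erefl); have pD := pL _ (or_intror (or_introl erefl)).
  exists a, L, l; split=> //; first exact: (localization_point loc x'E).
  have dL : dchart (pull l r) by split=> //; exact/(prime_F0 u (pull l r)).
  have x'r : pull x' (pull l r) = pull x r by rewrite -(pull_comp r (h := x)).
  have nM : M02 (mat u (pull l r)) <> 0.
    have /= n := M02_nonvanishing q u_smooth crL (x := x').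
    move=> h; apply: n; first by rewrite x'r.
    by rewrite h; exact: (ideal0 (VI_ideal _ _ _)).
  have /VI_FD[s sE] : VI u (@FD k) (pull l r) (f L (pull l r)).
    apply: (nss_prime (proj1 crL) (VI_ideal _ _ _) pD) => z zI; rewrite -f_nat.
    by apply: f_zero; apply/(VI_van u (@FD_ok k q)).
  exact: quotient_of_M02 dL nM sE.
have nn n : (M02 (mat u r)) ^+ n <> 0.
  move=> h; move/(congr1 x): h; rewrite lrX lr0 -M02_map -mat_pull.
  by apply/eqP; rewrite expf_eq0 negb_and h0 orbT.
have [R1 [l1 loc1]] := localization_exists nn; have [u1 _ _] := loc1.
have [|x1 x1E] := localization_univ (f := x) loc1.
  by rewrite -M02_map -mat_pull unitfE.
have v0 : van u (@F0 k) (pull x1 (pull l1 r)) by [].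
have [a [L [l2 [x' [loc2 crL pL x'E]]]]] :=
  prime_chart u_smooth (@F0_ok k q) (chart_localization loc1 cr) v0.
have [l lE] := lr_comp l1 l2; have [c locc] := localization_comp lE loc1 loc2.
exists c, L, l; split=> //.
  apply: (localization_point (x := x') locc) => b /=; rewrite lE -x1E; exact: x'E.
have uM : M02 (mat u (pull l r)) \is a GRing.unit.
  by rewrite mat_pull M02_map lE /=; apply: (lr_unit l2 u1).
apply: (@quotient_of_M02 L (pull l r) (f L (pull l r) / M02 (mat u (pull l r)))).
- rewrite (pull_comp r lE); split=> //; exact/(prime_F0 u (pull l2 (pull l1 r))).
- exact: domain_unit.
- by rewrite mulrCA mulrV // mulr1.
Qed.

(** [Ha] is nonzero on charts that are domains, so local quotients are unique; this makes them
    compatible and gives their weight. *)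
Lemma quotient_exists : exists g : forall A : alg, Y A -> A,
  [/\ forall (A B : alg) (h : {lrmorphism A -> B}) (p : Y A), g B (pull h p) = h (g A p),
      semi (lam - lamH) (fun A p => True) g
    & forall (A : alg) (p : Y A), f A p = Ha A p * g A p].
Proof.
have Fok := @F0_ok k q.
have tr (A : alg) (p : Y A) : van u (@F0 k) p by [].
have cov (K : alg) (y : Y K) : is_field K -> van u (@F0 k) y ->
    exists (R : alg) (r : Y R) c (w : {lrmorphism R -> K}), quotient_chart r c /\ pull w r = y.
  by move=> fK vy; have [R [r [w [[c g] E]]]] := quotient_cover fK vy; exists R, r, c, w.
have compat : forall (A R R' : alg) (r : Y R) (r' : Y R') c c'
    (h : {lrmorphism R -> A}) (h' : {lrmorphism R' -> A}),
    quotient_chart r c -> quotient_chart r' c' -> van u (@F0 k) (pull h r) ->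
    pull h r = pull h' r' -> h c = h' c'.
  apply: (compat_reduction Fok); first by move=> R r c [[]].
  move=> R R' r r' c c' d L l v K w [[cr dR] nH E] [_ _ E'] loc vE fK vw; apply/VI_F0.
  have pR : primeI (VI u (@F0 k) r) by apply/prime_F0.
  have [/prime_F0 dL inj] := link_prime Fok loc pR vw.
  suff /dL[h0|//] : Ha L (pull l r) * (l c - v c') = 0.
    case: nH; apply/(VI_F0 u r); apply: inj; apply/VI_F0; by rewrite -Ha_nat.
  rewrite mulrBr -{2}vE !Ha_nat -!lrM -E -E' -!f_nat vE subrr //.
have [|g [gn gv _]] := @glued_function k Y (van u (@F0 k))
   (fun A B h y => van_pull Fok (f := h) (y := y)) (@quotient_chart) _ cov compat.
  by move=> R r c [[[]]].
have gn' (A B : alg) (h : {lrmorphism A -> B}) (p : Y A) : g B (pull h p) = h (g A p).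
  exact: gn.
have fE (A : alg) (p : Y A) : f A p = Ha A p * g A p.
  apply/eqP; rewrite -subr_eq0; apply/eqP; move: A p (tr A p).
  apply: (chart_check Fok (Good := fun R r => exists c, quotient_chart r c)
    (z := fun A p => f A p - Ha A p * g A p)) => //.
  - by move=> R r [c [[[]]]].
  - exact: quotient_cover.
  - by move=> A B h p _; rewrite f_nat Ha_nat gn' lrB lrM.
  - move=> R A r h [c qc] _; have [_ _ E] := qc.
    by rewrite (gv _ _ _ _ _ qc) // f_nat Ha_nat E lrM subrr.
exists g; split=> // A x e1 e2 p _ px h01; have ux := borel_units px h01.
have uH := torus_char_unit lamH ux; apply: (mulrI uH).
rewrite mulrA [X in _ = X * _]mulrC torus_charB //.
apply/eqP; rewrite -subr_eq0; apply/eqP; move: A p x e1 e2 (tr A p) px h01 {ux uH}.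
suff H (A : alg) (p : Y A) x e1 e2 : van u (@F0 k) p -> parab x -> (true -> x o0 o1 = 0) ->
  torus_char lamH x * g A (ac x e1 e2 p) - torus_char lam x * g A p = 0 by move=> *; apply: H.
move: A p x e1 e2; apply: (universal_reduction (bor := true) Fok
    (Good := fun R r => exists c, quotient_chart r c)
    (z := fun A p x e1 e2 => torus_char lamH x * g A (ac x e1 e2 p) - torus_char lam x * g A p)) => //.
- by move=> R r [c [[cr dR] _ _]]; split=> //; apply/prime_F0.
- exact: quotient_cover.
- move=> A B h p x e1 e2 _ px h01; have ux := borel_units px (h01 isT).
  by rewrite lrB !lrM -!torus_char_map // -!gn' ac_pull.
- move=> R r T m x e1 e2 [c [_ nH _]] fgT dT mI px h01 _.
  have nHT : Ha T (pull m r) <> 0 by rewrite Ha_nat => /mI/VI_F0.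
  apply/eqP; rewrite subr_eq0; apply/eqP; apply: (domain_mulI dT nHT).
  transitivity (f T (ac x e1 e2 (pull m r))).
    by rewrite fE Ha_semi ?h01 // mulrA [_ * torus_char _ _]mulrC.
  by rewrite f_semi ?h01 // fE mulrCA.
Qed.

End Quotient.

(** The cell of w_0 s_alpha1 lies in the closed set [M02 = 0], hence so does its reduced closure,
    which is the zero scheme of [Ha]. *)
Lemma hasse_zero (k : closedFieldType) (q : nat) (lam : 'rV[int]_3)
    (Ha : forall A : comUnitAlgType k, GL3_space k q A -> A) : (0 < q)%N ->
  partial_hasse_alpha1 lam Ha -> forall (A : comUnitAlgType k) (g : GL3_space k q A),
  Ha A g = 0 -> M02 (val (g : GL3 A)) = 0.
Proof.
move=> q0 [_ H] A g /H.
apply: (@reduced_sub_closed k (GL3_space k q) (fun A (g : GL3_functor k A) => M02 (val (g : GL3 A)) = 0)).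
- move=> B x; exists (fun a => a = M02 (val (x : GL3 B))) => C h.
  rewrite val_pull_GL3 M02_map; split=> [E a ->//|E]; exact: E.
- by move=> K y _; exact: cell_w0s1.
Qed.

Theorem theorem4p3p2
  (Fq : finFieldType) (k : closedFieldType) (iota : {rmorphism Fq -> k})
  (k_algebraic : forall c : k, algebraicOver iota c)
  (S : kfunctor k) (S_scheme : is_scheme S)
  (zeta : stack_map #|Fq| S)
  (zeta_smooth : stack_map_smooth zeta)
  (zeta_surj : stack_map_surjective_on_components zeta)
  (FlagS : flag_space zeta)
  (FlagS_pc : pseudo_complete_length1 FlagS)
  (Ha1 : forall A : comUnitAlgType k, GL3_space k #|Fq| A -> A)
  (Ha1_hasse :
     partial_hasse_alpha1 (weight (#|Fq|%:Z + 1) 1 #|Fq|%:Z) Ha1)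
  (a1 a2 a3 : int) (a13 : 0 < a1 - a3)
  (f : forall A : comUnitAlgType k, tors zeta A -> A)
  (f_section : Vflag_section (weight a1 a2 a3) f) :
  exists g : forall A : comUnitAlgType k, tors zeta A -> A,
    Vflag_section
      (weight a1 a2 a3 - weight (#|Fq|%:Z + 1) 1 #|Fq|%:Z) g /\
    forall (A : comUnitAlgType k) (p : tors zeta A),
      f A p = Ha1 A (tors_map zeta A p) * g A p.
Proof.
have q1 := card_finNzRing_gt1 Fq; have qD := frobenius_additive iota.
have qk := card_zero iota; have u_act := tors_map_act (s := zeta).
have [u_smooth u_lfp] := zeta_smooth; have [f_nat f_act] := f_section.
have [[Ha_nat Ha_act] _] := Ha1_hasse.
have [||||||g [gn gs gE]] := @quotient_exists k #|Fq| q1 qD (tors zeta) (tors_map zeta)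
  u_smooth u_lfp f
  (fun A p => Ha1 A (tors_map zeta A p)) (weight a1 a2 a3) (weight (#|Fq|%:Z + 1) 1 #|Fq|%:Z).
- exact: f_nat.
- by move=> A x e1 e2 p _ px h01; apply: f_act; apply: (ac_zipE' q1 qD).
- by move=> A B h p; rewrite kfun_nat Ha_nat.
- move=> A x e1 e2 p _ px h01; rewrite /ac u_act; last exact: (ac_zipE q1 qD).
  by apply: Ha_act; apply: (ac_zipE' q1 qD).
- by move=> A p; exact: (hasse_zero (ltnW q1) Ha1_hasse).
- move=> y; exact: (vanishing_on_D q1 qD qk zeta_smooth zeta_surj FlagS_pc a13 f_section).
exists g; split=> //; split=> // A x y p z.
have [px h01 [e1 [e2 ->]]] := zipE'_ac q1 qD (tors zeta) z.
exact: gs.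
Qed.
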